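(* The function ${}^{\times}\mathcal{G}_{\omega}(\mathbf x,\mathbf y)$ evaluated at $\mathbf{x}=\mathbf{y}$ is $Q$-Schur positive, and \[ {}^{\times}\mathcal{G}_{\omega}(\mathbf{x},\mathbf{x})=\sum_{\rho\subseteq\mu,\ \lambda} H_{\omega}^{\rho}\,K_{\rho}^{\mu}\,F_{\mu}^{\lambda}\,Q_{\lambda}(\mathbf{x}). \]
   Context: Write $i^{\circ}$ for a circled letter $i$. A hook Hecke factorization of $\omega$ is a sequence of infinitely many factors (almost all empty), each a set of circled letters from $\{1^{\circ},2^{\circ},\dots\}$ written strictly decreasing followed by a multiset of uncircled letters written weakly increasing, such that erasing circles and parentheses gives a Hecke word for $\omega$ (word in operators $\bar s_i$ — swap $i,i+1$ if $i$ is left of $i+1$, else nothing — which applied right to left to the identity gives $\omega$). Its $x$-weight ($y$-weight) counts uncircled (circled) letters in each factor, and ${}^{\times}\mathcal{G}_\omega(\mathbf x,\mathbf y)=\sum_{\mathfrak f}\mathbf x^{\mathrm{xwt}(\mathfrak f)}\mathbf y^{\mathrm{ywt}(\mathfrak f)}$ over all hook Hecke factorizations. $Q_\lambda(\mathbf x)$ is the Schur $Q$-function. $H_\omega^\rho$: number of Hecke tableaux for $\omega$ of shape $\rho$ (fillings by letters $\bar s_i$ strictly increasing in rows and columns whose row reading word, rows left to right and bottom to top, is a Hecke word for $\omega$). $K_\rho^\mu$: number of over flagged tableaux of shape $\mu/\rho$, i.e. (when $\mu,\rho$ have equal numbers of rows; otherwise zero) fillings of $\mu/\rho$ with each box in row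 $i$ containing an element of $\{1,\dots,\rho_i\}$, rows weakly decreasing left to right, columns strictly decreasing top to bottom. Primed tableau of shape $\mu$ (alphabet $1'<1<2'<2<\cdots$): one letter per box, weakly increasing along rows and columns, each $i$ at most once per column, each $i'$ at most once per row; $x$-weight counts $i$'s, $y$-weight counts $i'$'s. Such $T$ has the $i$-starting property if, reading boxes left to right within rows from the bottom row to the top row, the first box containing $i$ or $i'$ contains $i$ (or if there is none). $T$ has the $i$-lattice property if the following tally process never ''breaks'': (a) read boxes right to left within rows from the top row to the bottom row, adding an upper tally for each $i$ and a lower tally for each $i-1$; failure if ever upper tallies exceed lower tallies, or if they are equal while reading an $i'$; (b) then, keeping the tallies, read boxes left to right within rows from the bottom row to the top row, adding an upper tally for each $i'$ and a lower tally for each $(i-1)'$; failure if ever upper exceed lower, or if equal while reading an $i-1$. $F_\mu^\lambda$ is the number of primed tableaux $T$ of shape $\mu$ having the $i$-starting and $i$-lattice properties for all $i$ and whose $x$-weight plus $y$-weight equals $\lambda$. *)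

(* Defs.v *)
From HB Require Import structures.
From mathcomp Require Import all_boot all_order all_algebra all_fingroup.
From mathcomp Require Import finmap.
From mathcomp Require Import all_classical.

Set Implicit Arguments.
Unset Strict Implicit.
Unset Printing Implicit Defensive.

Import Order.TTheory GRing.Theory Num.Theory.

Local Open Scope nat_scope.
Local Open Scope classical_set_scope.

(* Cardinality of a finite set; every set counted below is finite (fset_set
   sends an infinite set to the empty one). *)
Definition ncard (T : choiceType) (A : set T) : nat := #|` fset_set A|.

(* [m i] is the exponent of the variable x_(i+1). *)
Definition monom := {fsfun nat -> nat with 0}.

(* A series is its family of coefficients. *)
Definition series := monom -> int.
Definition series2 := monom -> monom -> int.

Definition eval_diag (S : series2) : series := fun m =>
  (\sum_(p \in [set p : monom * monom | forall i, p.1 i + p.2 i = m i])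
     S p.1 p.2)%R.

(* S is the sum of the possibly infinite family c_t F_t (t in A): for each
   monomial only finitely many terms contribute to the coefficient. *)
Definition formal_sum (I : choiceType) (A : set I) (c : I -> int)
    (F : I -> series) (S : series) : Prop :=
  forall m, finite_set [set t | A t /\ (c t * F t m != 0)%R] /\
            S m = (\sum_(t \in A) c t * F t m)%R.

Definition is_part (la : seq nat) : bool := sorted geq la && (0 \notin la).
Definition is_strict_part (la : seq nat) : bool :=
  sorted gtn la && (0 \notin la).

Definition part_sub (rho mu : seq nat) : Prop :=
  forall i, nth 0 rho i <= nth 0 mu i.

(* A filling is its list of rows from top to bottom (English convention).
   Row r occupies the columns off r, off r + 1, ...: off = 0 for a straight
   shape, off r = r for a shifted shape, off r = rho_r for a skew shape mu/rho. *)
Definition column (A : Type) (off : nat -> nat) (T : seq (seq A)) (c : nat) :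
    seq A :=
  pmap (fun r => if off r <= c then onth (nth [::] T r) (c - off r) else None)
       (iota 0 (size T)).

(* Rows left to right, from the bottom row to the top row. *)
Definition reading_up (A : Type) (T : seq (seq A)) : seq A := flatten (rev T).

(* Rows right to left, from the top row to the bottom row. *)
Definition reading_down (A : Type) (T : seq (seq A)) : seq A :=
  flatten (map rev T).

Definition one_line n (w : 'S_n) : seq nat := [seq (w i : nat).+1 | i <- enum 'I_n].

Definition swap_letters (i x : nat) : nat :=
  if x == i then i.+1 else if x == i.+1 then i else x.

Definition hecke_op (i : nat) (s : seq nat) : seq nat :=
  if index i s < index i.+1 s then map (swap_letters i) s else s.

(* The operators available on S_n are those with index 1, ..., n-1. *)
Definition hecke_word n (w : 'S_n) (u : seq nat) : bool :=
  all (fun i => 0 < i < n) u && (foldr hecke_op (iota 1 n) u == one_line w).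

(* A factor is (circled letters, uncircled letters), each part as written. *)
Definition hook_factor := (seq nat * seq nat)%type.

Definition is_hook_factor (h : hook_factor) : bool :=
  sorted gtn h.1 && sorted leq h.2.

Definition factorization := {fsfun nat -> hook_factor with ([::], [::])}.

(* Empty factors, i.e. those outside the support, contribute no letter. *)
Definition erase (f : factorization) : seq nat :=
  flatten [seq (f i).1 ++ (f i).2 | i <- sort leq (enum_fset (finsupp f))].

Definition hook_hecke n (w : 'S_n) (f : factorization) : Prop :=
  (forall i, is_hook_factor (f i)) /\ hecke_word w (erase f).

Definition hook_gen n (w : 'S_n) : series2 := fun a b =>
  Posz (ncard [set f : factorization |
    [/\ hook_hecke w f,
        forall i, size (f i).2 = a i
      & forall i, size (f i).1 = b i]]).

Definition hecke_tableau n (w : 'S_n) (rho : seq nat) (T : seq (seq nat)) :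
    Prop :=
  [/\ shape T = rho,
      all (sorted ltn) T,
      forall c, sorted ltn (column (fun=> 0) T c)
    & hecke_word w (reading_up T)].

Definition Hcoef n (w : 'S_n) (rho : seq nat) : nat :=
  ncard [set T | hecke_tableau w rho T].

Definition over_flagged (rho mu : seq nat) (T : seq (seq nat)) : Prop :=
  [/\ shape T = [seq nth 0 mu r - nth 0 rho r | r <- iota 0 (size mu)],
      forall r x, x \in nth [::] T r -> 1 <= x <= nth 0 rho r,
      all (sorted geq) T
    & forall c, sorted gtn (column (nth 0 rho) T c)].

Definition Kcoef (rho mu : seq nat) : nat :=
  if size rho == size mu then ncard [set T | over_flagged rho mu T] else 0.

(* (i, false) is the letter i and (i, true) is the letter i'. *)
Definition pletter := (nat * bool)%type.

Definition pletter_le (a b : pletter) : bool :=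
  (a.1 < b.1) || (a.1 == b.1) && (b.2 ==> a.2).

Definition primed_tableau (off : nat -> nat) (mu : seq nat)
    (T : seq (seq pletter)) : Prop :=
  [/\ shape T = mu,
      all (all (fun a => 0 < a.1)) T,
      all (sorted pletter_le) T /\ (forall c, sorted pletter_le (column off T c)),
      forall c i, count_mem (i, false) (column off T c) <= 1
    & forall r i, count_mem (i, true) (nth [::] T r) <= 1].

Definition xwt (T : seq (seq pletter)) (i : nat) : nat :=
  count_mem (i, false) (flatten T).
Definition ywt (T : seq (seq pletter)) (i : nat) : nat :=
  count_mem (i, true) (flatten T).

Definition starting (i : nat) (T : seq (seq pletter)) : bool :=
  if [seq a <- reading_up T | a.1 == i] is a :: _ then ~~ a.2 else true.

(* Tallies are pairs (upper, lower); None means that the process broke. *)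
Definition tally_down (i : nat) (st : option (nat * nat)) (a : pletter) :
    option (nat * nat) :=
  if st is Some (u, l) then
    let u1 := u + (a == (i, false)) in
    let l1 := l + (a == (i.-1, false)) in
    if (l1 < u1) || (u == l) && (a == (i, true)) then None else Some (u1, l1)
  else None.

Definition tally_up (i : nat) (st : option (nat * nat)) (a : pletter) :
    option (nat * nat) :=
  if st is Some (u, l) then
    let u1 := u + (a == (i, true)) in
    let l1 := l + (a == (i.-1, true)) in
    if (l1 < u1) || (u == l) && (a == (i.-1, false)) then None else Some (u1, l1)
  else None.

Definition lattice (i : nat) (T : seq (seq pletter)) : bool :=
  isSome (foldl (tally_up i)
            (foldl (tally_down i) (Some (0, 0)) (reading_down T))
            (reading_up T)).

(* The lattice property compares i with i-1, hence is imposed for i >= 2. *)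
Definition Fcoef (mu la : seq nat) : nat :=
  ncard [set T | [/\ primed_tableau (fun=> 0) mu T,
                     forall i, 1 <= i -> starting i T,
                     forall i, 2 <= i -> lattice i T
                   & forall i, xwt T i.+1 + ywt T i.+1 = nth 0 la i]].

(* Generating function of the marked shifted tableaux of shape la (marks
   are allowed on the main diagonal), for la a strict partition. *)
Definition schurQ (la : seq nat) : series := fun m =>
  Posz (ncard [set T | primed_tableau id la T /\
                       forall i, xwt T i.+1 + ywt T i.+1 = m i]).

Definition Q_Schur_positive (S : series) : Prop :=
  exists c : seq nat -> int,
    (forall la, is_strict_part la -> 0 <= c la)%R /\
    formal_sum [set la | is_strict_part la] c schurQ S.

(* Main.v *)
From HB Require Import structures.
Require Import Defs.
From mathcomp Require Import all_boot all_order all_algebra all_fingroup.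
From mathcomp Require Import finmap.
From mathcomp Require Import all_classical.
From mathcomp Require Import zify.
Set Implicit Arguments.
Unset Strict Implicit.
Unset Printing Implicit Defensive.
Import Order.TTheory GRing.Theory Num.Theory.
Local Open Scope nat_scope.

(** Let [u] be generators of the 0-Hecke ring, realised by the matrices [hmx] of the Hecke
    operators, and let [hL] and [eL] be the complete and elementary elements: sums of products of
    [u] along weakly increasing and strictly decreasing words. At x = y only the size m_i of each
    hook factor matters, so the coefficient of x^m is one matrix entry of the product of the
    elements q_{m_i}, where q_m is the sum over a of e_a h_{m-a} ([eval_diag_count], [prod_facs]).
    The letters do not commute but the h_r do ([hL_comm]), and the e_a are polynomials in them
    because the alternating sum of the h_{r-a} e_a vanishes ([hook_alt]). Everything therefore takes
    place in a commutative ring, the bicommutant of the h_r, where Jacobi-Trudi determinants s_mu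
    make sense. The Pieri rules give the product of the q_{m_i} as a sum of N(m, mu) s_mu, where
    N(m, mu) counts arrays of hook factors whose word is a lattice word of content mu ([prod_qq]).

    Two independent facts finish the proof.

    First, s_mu is the sum over rho of K_rho^mu times the sum of the reading words of the increasing
    tableaux of shape rho. In the expanded determinant every row collapses, by idempotence, to its
    support. The arrays of supports that are not column strict contribute terms symmetric in two
    adjacent rows of the determinant, hence nothing ([phase_one]). The scalars attached to the
    remaining tableaux antisymmetrise to the number of chains of horizontal strips from rho to mu
    with bounded rows ([altn_cnum]), that is to over flagged tableaux ([NK_Kcoef]).

    Second, N(m, mu) is the sum over la of F_mu^la times the coefficient of x^m in Q_la
    ([VA_identity]). A row insertion on hook words is a bijection between words and pairs formed by
    a tableau with hook rows and a recording word that builds up strict partitions. It follows Knuth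
    relations, so it keeps lattice words and contents ([insw_read]); it exchanges the valleys of the
    word with those of the recording word, so it keeps the division into hook factors
    ([ins_valley]). Each nonempty hook word has two splittings on either side. Recording words with
    split hook blocks are marked shifted tableaux ([schurQ_VA]). The insertion tableaux with lattice
    reading word of content mu become the tableaux counted by F when row k is read as the list of
    rows occupied by the letter k + 1 ([FA_Fcoef]): the relation between consecutive rows is the
    lattice property, and the choice of one of the two splittings is the starting property.

    All coefficients are cardinalities, and homogeneity leaves finitely many terms for each monomial
    and for each la, whence positivity. *)

(** * Cardinalities of finite sets *)

Lemma ncard_seq (T : choiceType) (A : set T) (s : seq T) :
  uniq s -> (forall x, A x <-> x \in s) -> ncard A = size s.
Proof.
move=> us sA; have -> : A = [set` s]%classic.
  by apply/predeqP => x /=; rewrite sA.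
rewrite /ncard.
have -> : fset_set [set` s]%classic = seq_fset tt s.
  by apply/fsetP => x; rewrite in_fset_set ?seq_fsetE //; apply/idP/idP; rewrite inE.
by rewrite size_seq_fset undup_id.
Qed.

Lemma finite_seqP (T : choiceType) (A : set T) (s : seq T) :
  (forall x, A x -> x \in s) -> exists t, uniq t /\ (forall x, A x <-> x \in t).
Proof.
move=> sA; exists (undup [seq x <- s | `[< A x >]]); split; first exact: undup_uniq.
move=> x; rewrite mem_undup mem_filter; split => [Ax|/andP[/asboolP//]].
by rewrite sA // andbT; apply/asboolP.
Qed.

(** Counting by a bijection. The list [s] only certifies that [A] is finite, since [ncard] of an
    infinite set is 0. *)
Lemma ncard_rel (T U : choiceType) (A : set T) (B : set U) (f : T -> U) (s : seq T) :
  (forall x, A x -> x \in s) ->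
  (forall x, A x -> B (f x)) ->
  (forall x y, A x -> A y -> f x = f y -> x = y) ->
  (forall y, B y -> exists2 x, A x & f x = y) ->
  ncard A = ncard B.
Proof.
move=> sA fB fi fs; have [t [ut tA]] := finite_seqP sA.
rewrite (ncard_seq ut tA) (@ncard_seq _ B (map f t)) ?size_map //.
  by rewrite map_inj_in_uniq // => x y /tA Ax /tA Ay; apply: fi.
move=> y; split => [/fs[x Ax <-]|/mapP[x /tA Ax ->]]; last exact: fB.
by apply: map_f; apply/tA.
Qed.

Lemma ncard_sum (T J : choiceType) (A : set T) (k : T -> J) (s : seq T) (js : seq J) :
  (forall x, A x -> x \in s) -> uniq js -> (forall x, A x -> k x \in js) ->
  ncard A = \sum_(j <- js) ncard [set x | A x /\ k x = j]%classic.
Proof.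
move=> sA ujs kA; have [t [ut tA]] := finite_seqP sA.
rewrite (ncard_seq ut tA).
transitivity (\sum_(j <- js) count (fun x => k x == j) t).
  have kt x : x \in t -> k x \in js by move/tA; apply: kA.
  elim: t kt {ut tA} => [|x t IH] kt /=; first by rewrite big1.
  rewrite big_split /= -IH; last by move=> y yt; apply: kt; rewrite inE yt orbT.
  rewrite (eq_bigr (fun j => if k x == j then 1 else 0)) => [|j _]; last by case: eqP. rewrite -big_mkcond /=.
  rewrite (eq_bigl (fun j => j == k x)) => [|j]; last by rewrite eq_sym.
  rewrite -big_filter (_ : [seq _ <- _ | _] = [:: k x]) ?big_seq1 //.
  by rewrite filter_pred1_uniq // kt // inE eqxx.
apply: eq_bigr => j _; rewrite -size_filter.
rewrite (@ncard_seq _ _ [seq x <- t | k x == j]) ?filter_uniq // => x.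
rewrite mem_filter /=; split => [[/tA -> ->]|/andP[/eqP <- /tA]]; by rewrite ?eqxx.
Qed.

Lemma ncard_prod (T U : choiceType) (A : set T) (B : set U) (s : seq T) (t : seq U) :
  (forall x, A x -> x \in s) -> (forall x, B x -> x \in t) ->
  ncard [set p : T * U | A p.1 /\ B p.2]%classic = ncard A * ncard B.
Proof.
move=> /finite_seqP[s' [us sA]] /finite_seqP[t' [ut tB]].
rewrite (ncard_seq us sA) (ncard_seq ut tB).
rewrite (@ncard_seq _ _ [seq (x, y) | x <- s', y <- t']) ?size_allpairs //.
  by apply: allpairs_uniq => // -[a b] [c d] _ _ /= [-> ->].
move=> [a b] /=; split => [[/sA Aa /tB Bb]|]; first exact: allpairs_f.
by case/allpairsP => -[c d] /= [/sA Ac /tB Bd [-> ->]].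
Qed.

Lemma ncard_le0 (T : choiceType) (A : set T) : (forall x, ~ A x) -> ncard A = 0.
Proof. by move=> nA; rewrite (@ncard_seq _ A [::]) // => x; split => // /nA. Qed.

(** * Words over an increasing alphabet, and compositions *)

Fixpoint incw (L : seq nat) : nat -> seq (seq nat) :=
  if L is x :: L' then
    fix f r := if r is r'.+1 then map (cons x) (f r') ++ incw L' r else [:: [::]]
  else fun r => if r is 0 then [:: [::]] else [::].

Fixpoint decw (L : seq nat) (r : nat) : seq (seq nat) :=
  match r, L with
  | 0, _ => [:: [::]]
  | _, [::] => [::]
  | r'.+1, x :: L' => decw L' r ++ map (rcons^~ x) (decw L' r')
  end.

Fixpoint subs (L : seq nat) : seq (seq nat) :=
  if L is x :: L' then subs L' ++ map (cons x) (subs L') else [:: [::]].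

(** The number of compositions of [m] into [k] positive parts; equivalently, of weakly increasing
    words of length [m] with a given support of size [k]. *)
Fixpoint cp (m k : nat) : nat :=
  match m, k with
  | 0, _ => k == 0
  | _, 0 => 0
  | m'.+1, k'.+1 => cp m' k + cp m' k'
  end.

Lemma cpSS m k : cp m.+1 k.+1 = cp m k.+1 + cp m k.
Proof. by []. Qed.

(** A composition is cut after its first [k] parts, [p] being their sum. *)
Lemma cp_conv m k j : cp m (k + j) = \sum_(p < m.+1) cp p k * cp (m - p) j.
Proof.
elim: m k => [|m IH] [|k].
- by rewrite big_ord1 /= mul1n.
- by rewrite big_ord1.
- rewrite big_ord_recl big1 ?addn0 ?subn0 /= ?mul1n //.
- rewrite addSn cpSS -addSn !IH -big_split big_ord_recl mul0n add0n.
  by apply: eq_bigr => i _; rewrite /= mulnDl.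
Qed.

Lemma incw0 L : incw L 0 = [:: [::]]. Proof. by case: L. Qed.
Lemma decw0 L : decw L 0 = [:: [::]]. Proof. by case: L. Qed.
Lemma incwS x L r : incw (x :: L) r.+1 = map (cons x) (incw (x :: L) r) ++ incw L r.+1.
Proof. by []. Qed.
Lemma decwS x L r : decw (x :: L) r.+1 = decw L r.+1 ++ map (rcons^~ x) (decw L r).
Proof. by []. Qed.

(** * Alternating sums over split hook words *)

Section HookAlternation.
Variable R : pzRingType.
Local Open Scope ring_scope.

(** The two alphabets are kept apart so that a letter can be removed from one of them at a time. *)
Definition altUV (I J : seq nat) (r : nat) (phi : seq nat -> R) : R :=
  \sum_(a < r.+1) (-1) ^+ a *
    \sum_(U <- incw I (r - a)) \sum_(V <- decw J a) phi (U ++ V).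

Lemma altUV_incS x L J r phi :
  altUV (x :: L) J r.+1 phi = altUV (x :: L) J r (phi \o cons x) + altUV L J r.+1 phi.
Proof.
rewrite /altUV big_ord_recr [in X in _ = _ + X]big_ord_recr /= subnn incw0 addrA; congr (_ + _).
rewrite -big_split; apply: eq_bigr => a _ /=; rewrite -mulrDr; congr (_ * _).
by rewrite subSn ?incwS ?big_cat ?big_map // -ltnS.
Qed.

Lemma altUV_decS I x L r phi :
  altUV I (x :: L) r.+1 phi = altUV I L r.+1 phi - altUV I L r (phi \o rcons^~ x).
Proof.
rewrite /altUV big_ord_recl [in X in _ = X - _]big_ord_recl /= !decw0 -addrA; congr (_ + _).
rewrite -sumrB; apply: eq_bigr => a _; rewrite /bump /= add1n subSS exprS mulN1r !mulNr -opprD.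
congr (- _); rewrite -mulrDr; congr (_ * _); rewrite -big_split; apply: eq_bigr => U _ /=.
rewrite big_cat big_map /=; congr (_ + _); apply: eq_bigr => V _.
by rewrite rcons_cat.
Qed.

Lemma altUV0 I J phi : altUV I J 0 phi = phi [::].
Proof. by rewrite /altUV big_ord1 mul1r incw0 decw0 !big_seq1. Qed.

(* A nonempty word that is weakly increasing and then strictly decreasing has exactly two
   such factorizations: its peak can be moved across the cut. *)
Lemma hook_alt L r phi : altUV L L r phi = if r is 0 then phi [::] else 0.
Proof.
elim: L r phi => [|x L IH] [|s] phi; rewrite ?altUV0 //.
  by rewrite /altUV big1 // => -[[|a] ? _] /=; rewrite ?subn0 ?big_nil ?mulr0 //
    big1 ?mulr0 // => U _; rewrite big_nil.
(* Once [x] is available on the increasing side only, the sum reduces to the single word made of [t]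
   letters [x]. *)
have key t psi : altUV (x :: L) L t psi = psi (nseq t x).
  elim: t psi => [|t IHt] psi; first by rewrite altUV0.
  by rewrite altUV_incS IHt IH addr0.
by rewrite altUV_decS !key /= -cats1 -(nseqD s 1) addn1 subrr.
Qed.

End HookAlternation.

(** * Commuting complete elements in the 0-Hecke ring *)

Lemma zmod_shuffle (V : zmodType) (a b c d e g : V) :
  (a + b + (c + d) = a + e + (c + g + (- e - g) + (b + d)))%R.
Proof.
rewrite [(c + g + _)%R]addrACA subrr addr0 -!addrA; congr (_ + _)%R.
by rewrite [RHS]addrCA addNKr [LHS]addrCA.
Qed.

Section HeckeRing.
Variables (A : pzRingType) (u : nat -> A).
Local Open Scope ring_scope.
Hypothesis uu : forall i, u i * u i = u i.
Hypothesis ufar : forall i j, (i.+1 < j)%N -> u i * u j = u j * u i.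
Hypothesis ubraid : forall i, u i * u i.+1 * u i = u i.+1 * u i * u i.+1.

Definition Wd (v : seq nat) : A := \prod_(x <- v) u x.
Definition eL L a : A := \sum_(v <- decw L a) Wd v.
Definition hL L m : A := \sum_(v <- incw L m) Wd v.
(** Elementary sums of increasing products of [j - 2] distinct letters; with this shift the
    recursion [ez_cons] holds for every [j]. *)
Definition ez L j : A := \sum_(v <- subs L | (size v).+2 == j) Wd v.

Lemma Wd_cat v w : Wd (v ++ w) = Wd v * Wd w.
Proof. exact: big_cat. Qed.
Lemma Wd_cons x v : Wd (x :: v) = u x * Wd v.
Proof. exact: big_cons. Qed.

Lemma ez_cons x L j : ez (x :: L) j.+1 = ez L j.+1 + u x * ez L j.
Proof.
rewrite /ez big_cat big_map /= mulr_sumr; congr (_ + _).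
by apply: eq_bigr => v _; rewrite Wd_cons.
Qed.

Lemma ez0 L : ez L 0 = 0.
Proof. by rewrite /ez big1_seq // => v /andP[]. Qed.

Lemma ez_nil j : ez [::] j = (j == 2)%:R.
Proof. by rewrite /ez big_mkcond big_seq1 /= eq_sym; case: eqP => // _; rewrite /Wd big_nil. Qed.

Lemma Wd_far x v : all (fun y => (x.+1 < y)%N) v -> u x * Wd v = Wd v * u x.
Proof.
elim: v => [|y v IH] /=; first by rewrite /Wd big_nil mulr1 mul1r.
by case/andP => xy /IH E; rewrite Wd_cons mulrA ufar // -mulrA E mulrA.
Qed.

Lemma subs_sub (L v : seq nat) : v \in subs L -> subseq v L.
Proof.
elim: L v => [|x L IH] v /=; first by rewrite inE => /eqP->.
rewrite mem_cat => /orP[/IH vL|/mapP[w /IH wL ->]]; last by rewrite /= eqxx.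
exact: subseq_trans vL (subseq_cons L x).
Qed.

Lemma ez_far x b k j : (x.+1 < b)%N -> u x * ez (iota b k) j = ez (iota b k) j * u x.
Proof.
move=> xb; rewrite /ez mulr_sumr mulr_suml big_seq_cond [RHS]big_seq_cond.
apply: eq_bigr => v /andP[/subs_sub /mem_subseq vL _]; apply: Wd_far.
by apply/allP => y /vL; rewrite mem_iota => /andP[+ _]; apply: leq_trans.
Qed.

(** Moving [u b] across [F j.+1], together with the term [u b * F j * u b], leaves a correction
    whose left factor does not depend on [j]. This uniformity is what makes the products in
    [ez_comm] symmetric. *)
Lemma ez_swap b k j (F := ez (iota b.+1 k.+1)) :
  F j.+1 * u b + u b * F j * u b =
  u b * F j.+1 + (u b - u b * u b.+1 + u b.+1 * u b) * F j.
Proof.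
have far i := @ez_far b b.+2 k i (ltnSn _).
rewrite /F /= ez_cons; case: j => [|j]; rewrite ?ez0 ?mulr0 ?mul0r ?addr0.
  by rewrite far.
rewrite ez_cons; set G2 := ez _ j.+2; set G1 := ez _ j.+1; set G0 := ez _ j.
set x := u b; set y := u b.+1.
have xy : x * y * x = y * x * y by exact: ubraid.
rewrite !(mulrDl, mulrDr, mulNr, mulrA).
rewrite -[y * G1 * x]mulrA -[x * G1 * x]mulrA -[_ * G0 * x]mulrA -!far -/x.
rewrite !mulrA uu -[x * y * y]mulrA uu xy; exact: zmod_shuffle.
Qed.

Lemma ez_comm b k i j : ez (iota b k) i * ez (iota b k) j = ez (iota b k) j * ez (iota b k) i.
Proof.
elim: k b i j => [|k IH] b [|i] [|j]; rewrite ?ez0 ?mulr0 ?mul0r // ?ez_nil; try exact: commr_nat.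
rewrite [iota b _]/= !ez_cons; set F := ez (iota b.+1 k); set x := u b.
(* For an empty remaining interval there is no neighbour [u b.+1] and the correction of [ez_swap] is
   just [u b]. *)
pose c := if k is _.+1 then x - x * u b.+1 + u b.+1 * x else x.
have sw p : F p.+1 * x + x * F p * x = x * F p.+1 + c * F p.
  rewrite /F /c; case: k {IH F c} => [|k]; last by rewrite ez_swap.
  by rewrite /= !ez_nil !mulr_natl !mulr_natr mulrnAl /x uu.
(* In this form each of the three groups is symmetric in [p] and [q] by the induction hypothesis. *)
have key p q : (F p.+1 + x * F p) * (F q.+1 + x * F q) =
    F p.+1 * F q.+1 + (x * F p * F q.+1 + x * F p.+1 * F q) + c * F p * F q.
  rewrite mulrDl !mulrDr !mulrA -!addrA; congr (_ + _).
  rewrite [LHS]addrCA; congr (_ + _); by rewrite -!(mulrDl _ _ (F q)) sw.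
rewrite !key (IH _ i.+1) -!mulrA (IH _ i j); congr (_ + _ + _).
by rewrite (IH _ i j.+1) (IH _ i.+1 j) addrC.
Qed.

Lemma hL_subs_head x L :
  (forall m, hL L m = \sum_(v <- subs L) Wd v *+ cp m (size v)) ->
  forall m, hL (x :: L) m = \sum_(v <- subs (x :: L)) Wd v *+ cp m (size v) /\
    u x * hL (x :: L) m = \sum_(v <- subs L) u x * Wd v *+ cp m.+1 (size v).+1.
Proof.
move=> HL; have step m : hL (x :: L) m = \sum_(v <- subs (x :: L)) Wd v *+ cp m (size v) ->
    u x * hL (x :: L) m = \sum_(v <- subs L) u x * Wd v *+ cp m.+1 (size v).+1.
  move=> ->; rewrite big_cat big_map /= mulrDr !mulr_sumr -big_split; apply: eq_bigr => v _ /=.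
  by rewrite Wd_cons -!mulrnAr !mulrA uu -mulrDr -mulrnDr addnC.
elim=> [|m [IH1 IH2]]; last first.
  split; last apply: step; (rewrite /hL incwS big_cat big_map /=;
    rewrite -[X in _ + X]/(hL L m.+1) HL addrC big_cat big_map /=; congr (_ + _);
    under eq_bigr do rewrite Wd_cons; rewrite -mulr_sumr IH2;
    by apply: eq_bigr => v _; rewrite Wd_cons).
have E : hL (x :: L) 0 = \sum_(v <- subs (x :: L)) Wd v *+ cp 0 (size v).
  transitivity (hL L 0); first by rewrite /hL !incw0.
  by rewrite HL big_cat big_map /= [X in _ = _ + X]big1 ?addr0.
by split => //; apply: step.
Qed.

(** By idempotence the product along a weakly increasing word equals the product along its support,
    and [cp m k] words of length [m] share a given support of size [k]. *)
Lemma hL_subs L m : hL L m = \sum_(v <- subs L) Wd v *+ cp m (size v).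
Proof.
elim: L m => [|x L IH] m; last by case: (hL_subs_head x IH m).
by rewrite big_seq1 /hL; case: m => [|m] /=; rewrite ?big_seq1 ?big_nil.
Qed.

Lemma mul_hL_head x L m :
  u x * hL (x :: L) m = \sum_(v <- subs L) u x * Wd v *+ cp m.+1 (size v).+1.
Proof. by case: (hL_subs_head x (hL_subs L) m). Qed.

Lemma hL_ez L m : hL L m = \sum_(j < (size L).+3) ez L j *+ cp m (j - 2).
Proof.
rewrite hL_subs; under [RHS]eq_bigr do rewrite -sumrMnl.
rewrite (exchange_big_dep xpredT) //= [LHS]big_seq [RHS]big_seq; apply: eq_bigr => v /subs_sub /size_subseq vL.
have lv : ((size v).+2 < (size L).+3)%N by [].
rewrite (big_pred1 (Ordinal lv)) /= ?subn2 // => i; by rewrite eq_sym.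
Qed.

Lemma hL_comm b k i j : hL (iota b k) i * hL (iota b k) j = hL (iota b k) j * hL (iota b k) i.
Proof.
rewrite !hL_ez !mulr_suml; under [LHS]eq_bigr do rewrite mulr_sumr.
under [RHS]eq_bigr do rewrite mulr_sumr.
rewrite exchange_big; apply: eq_bigr => p _; apply: eq_bigr => q _.
by rewrite !mulrnAl !mulrnAr ez_comm mulrnAC.
Qed.

Lemma he_alt L r : \sum_(a < r.+1) (-1) ^+ a * (hL L (r - a) * eL L a) = (r == 0)%:R.
Proof.
transitivity (altUV L L r Wd); last first.
  by rewrite hook_alt; case: r => [|r] //=; rewrite /Wd big_nil.
apply: eq_bigr => a _; congr (_ * _); rewrite mulr_suml; apply: eq_bigr => U _.
by rewrite mulr_sumr; apply: eq_bigr => V _; rewrite Wd_cat.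
Qed.

End HeckeRing.

(** * Membership and uniqueness in the lists of words *)

Lemma mem_incw L r U : path.sorted ltn L ->
  (U \in incw L r) = [&& size U == r, sorted leq U & all [in L] U].
Proof.
elim: L r U => [|x L IH] r U.
  by case: r U => [|r] [|y U] _ //=; rewrite ?inE ?andbF.
move=> xL; have sL := path_sorted xL.
have gx y : y \in L -> x < y by move=> yL; apply: (allP (order_path_min ltn_trans xL)).
elim: r U => [|r IHr] U; first by rewrite incw0 inE; case: U.
rewrite incwS mem_cat IH //; case: U => [|y U].
  by rewrite orbF; apply/negbTE/mapP => -[].
have -> : (y :: U \in map (cons x) (incw (x :: L) r)) = (y == x) && (U \in incw (x :: L) r).
  apply/mapP/andP => [[V Vi [-> ->]]|[/eqP -> Ui]]; [by rewrite eqxx | by exists U].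
rewrite IHr /= eqSS; case: (size U == r) => //=; last by rewrite andbF.
rewrite (path_sortedE leq_trans) inE; case: (sorted leq U) => /=; last by rewrite !andbF.
rewrite !andbT; case: eqP => [->|yx] /=.
  rewrite (_ : x \in L = false) ?andbF ?orbF; last by apply/negP => /gx; rewrite ltnn.
  case: (boolP (all _ U)) => [aU|]; rewrite ?andbF ?andbT //; symmetry; apply/allP => z /(allP aU).
  by rewrite inE => /orP[/eqP->//|/gx /ltnW].
case yL: (y \in L); rewrite ?andbF //= ; case: (boolP (all (leq y) U)) => //= aU.
apply: eq_in_all => z /(allP aU) yz; rewrite inE; case: eqP => // E.
by have := gx _ yL; rewrite -E ltnNge yz.
Qed.

Lemma mem_decw L r U : path.sorted ltn L ->
  (U \in decw L r) = [&& size U == r, sorted gtn U & all [in L] U].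
Proof.
elim: L r U => [|x L IH] r U.
  by case: r U => [|r] [|y U] _ //=; rewrite ?inE ?andbF.
case: r => [|r] xL; first by rewrite decw0 inE; case: U.
have sL := path_sorted xL.
have gx y : y \in L -> x < y by move=> yL; apply: (allP (order_path_min ltn_trans xL)).
rewrite decwS mem_cat IH //; case/lastP: U => [|U y].
  by rewrite orFb; apply/negbTE/mapP => -[[]].
have -> : (rcons U y \in map (rcons^~ x) (decw L r)) = (y == x) && (U \in decw L r).
  apply/mapP/andP => [[V Vi /rcons_inj[-> ->]]|[/eqP -> Ui]]; [by rewrite eqxx | by exists U].
rewrite IH // size_rcons eqSS; case: (size U == r) => //=; last by rewrite andbF.
have -> : sorted gtn (rcons U y) = all (fun z => y < z) U && sorted gtn U.
  by rewrite -rev_sorted rev_rcons /= (path_sortedE ltn_trans) all_rev rev_sorted.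
rewrite !all_rcons; case: (sorted gtn U) => /=; last by rewrite !andbF.
rewrite !andbT inE; case: eqP => [->|yx] /=.
  rewrite (_ : x \in L = false) ?andbF ?orFb; last by apply/negP => /gx; rewrite ltnn.
  apply/idP/andP => [aU|[a1 a2]].
    by split; apply/allP => z /(allP aU); [apply: gx | rewrite inE => ->; rewrite orbT].
  by apply/allP => z zU; have := allP a2 z zU; rewrite inE; case: eqP => // E; have := allP a1 z zU; rewrite E ltnn.
rewrite orbF; case yL: (y \in L); rewrite ?andbF //=; case: (boolP (all _ U)) => //= aU.
apply: eq_in_all => z /(allP aU) yz; rewrite inE; case: eqP => // E.
by have := gx _ yL; rewrite -E ltnNge (ltnW yz).
Qed.

Lemma mem_subs L U : path.sorted ltn L -> (U \in subs L) = sorted ltn U && all [in L] U.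
Proof.
elim: L U => [|x L IH] U; first by case: U => [|y U] _ //=; rewrite ?inE ?andbF.
move=> xL; have sL := path_sorted xL.
have gx y : y \in L -> x < y by move=> yL; apply: (allP (order_path_min ltn_trans xL)).
rewrite /= mem_cat IH //; case: U => [|y U]; first by [].
have -> : (y :: U \in map (cons x) (subs L)) = (y == x) && (U \in subs L).
  apply/mapP/andP => [[V Vi [-> ->]]|[/eqP -> Ui]]; [by rewrite eqxx | by exists U].
rewrite IH //= (path_sortedE ltn_trans) inE; case: (sorted ltn U) => /=; last by rewrite !andbF.
rewrite !andbT; case: eqP => [->|yx] /=.
  rewrite (_ : x \in L = false) ?andbF ?orFb; last by apply/negP => /gx; rewrite ltnn.
  apply/idP/andP => [aU|[a1 a2]].
    by split; apply/allP => z /(allP aU); [apply: gx | rewrite inE => ->; rewrite orbT].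
  by apply/allP => z zU; have := allP a2 z zU; rewrite inE; case: eqP => // E; have := allP a1 z zU; rewrite E ltnn.
rewrite orbF; case yL: (y \in L); rewrite ?andbF //=; case: (boolP (all _ U)) => //= aU.
apply: eq_in_all => z /(allP aU) yz; rewrite inE; case: eqP => // E.
by have := gx _ yL; rewrite -E ltnNge (ltnW yz).
Qed.

Lemma notin_incw L r x U : path.sorted ltn (x :: L) -> U \in incw L r -> x \notin U.
Proof.
move=> xL; rewrite mem_incw ?(path_sorted xL) // => /and3P[_ _ /allP aU].
by apply/negP => /aU xin; have := allP (order_path_min ltn_trans xL) x xin; rewrite /= ltnn.
Qed.

Lemma uniq_incw L r : path.sorted ltn L -> uniq (incw L r).
Proof.
elim: L r => [|x L IH] r; first by case: r.
move=> xL; have sL := path_sorted xL; elim: r => [|r IHr]; first by rewrite incw0.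
rewrite incwS cat_uniq map_inj_uniq ?IHr ?IH // => [|? ? []//]; rewrite andbT.
apply/hasPn => U /(notin_incw xL) xU; apply/mapP => -[V _ E].
by rewrite E inE eqxx in xU.
Qed.

Lemma uniq_decw L r : path.sorted ltn L -> uniq (decw L r).
Proof.
elim: L r => [|x L IH] [|r] // xL; have sL := path_sorted xL.
rewrite decwS cat_uniq map_inj_uniq ?IH // => [|? ? /rcons_inj[]//]; rewrite andbT.
apply/hasPn => U /mapP[V _ ->]; rewrite mem_decw //= all_rcons; apply/negP => /and3P[_ _ /andP[xin _]].
by have := allP (order_path_min ltn_trans xL) x xin; rewrite /= ltnn.
Qed.

Lemma uniq_subs L : path.sorted ltn L -> uniq (subs L).
Proof.
elim: L => [|x L IH] // xL; have sL := path_sorted xL.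
rewrite /= cat_uniq map_inj_uniq ?IH // => [|? ? []//]; rewrite andbT.
apply/hasPn => U /mapP[V _ ->]; rewrite mem_subs //=; apply/negP => /andP[_ /andP[xin _]].
by have := allP (order_path_min ltn_trans xL) x xin; rewrite /= ltnn.
Qed.

(** * Lattice words *)

Lemma gtn_trans : transitive gtn.
Proof. by move=> y x z /= xy yz; apply: ltn_trans xy. Qed.

(* The word is read from right to left, the letter x adding a box to row x; with o = 0
   (resp. 1) it must build up partitions (resp. strict partitions). *)
Fixpoint okw (o : nat) (w : seq nat) : bool :=
  if w is x :: w' then
    okw o w' && ((x == 0) || (count_mem x w' + 1 + o <= count_mem x.-1 w'))
  else true.

(** A weakly increasing word adds a horizontal strip: its letters are read from the largest down, so
    row [i] has received all its boxes before row [i.-1] starts to grow. *)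
Lemma okw_cat_inc o U w : sorted leq U ->
  okw o (U ++ w) = okw o w &&
    all (fun i => (i == 0) || (count_mem i (U ++ w) + o <= count_mem i.-1 w)) U.
Proof.
elim: U => [|x U IH] /=; first by rewrite andbT.
rewrite (path_sortedE leq_trans) => /andP[/allP xU sU]; rewrite (IH sU) -!andbA; congr (_ && _).
have c0 : 0 < x -> count_mem x.-1 U = 0.
  move=> x0; apply/count_memPn/negP => /xU; lia.
rewrite eqxx [RHS]andbC; apply/andP/andP => -[h1 h2]; split.
- apply/allP => i iU; have := allP h1 i iU; have /= := xU i iU; case: eqP => //= i0 xi.
  case: (eqVneq x i) => [E|]; rewrite ?add0n //; rewrite -{i}E in i0 xi iU *.
  move: h2; rewrite !count_cat; have x0 : 0 < x by lia.
  by rewrite c0 // -[x == 0]negbK -lt0n x0 /=; lia.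
- by move: h2; rewrite !count_cat; case: (posnP x) => [->//|x0]; rewrite c0 //; lia.
- apply/allP => i iU; have := allP h1 i iU; case: eqP => //= i0.
  by apply: leq_trans; rewrite leq_add2r leq_addl.
- by move: h2; rewrite !count_cat; case: (posnP x) => [->//|x0]; rewrite c0 //; lia.
Qed.

(** A strictly decreasing word adds a vertical strip: its letters are read from the smallest up, so
    row [i] is compared with the row above after that row has grown. *)
Lemma okw_cat_dec o V w : sorted gtn V ->
  okw o (V ++ w) = okw o w &&
    all (fun i => (i == 0) || (count_mem i (V ++ w) + o <= count_mem i.-1 (V ++ w))) V.
Proof.
elim: V => [|x V IH] /=; first by rewrite andbT.
rewrite (path_sortedE gtn_trans) => /andP[/allP xV sV]; rewrite (IH sV) -!andbA; congr (_ && _).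
rewrite eqxx [RHS]andbC; apply/andP/andP => -[h1 h2]; split.
- apply/allP => i iV; have := allP h1 i iV; have /= := xV i iV; case: eqP => //= i0 xi.
  by rewrite gtn_eqF // gtn_eqF ?(leq_ltn_trans (leq_pred i)).
- by move: h2; case: (posnP x) => [->//|x0] /=; case: eqP => //= _; lia.
- apply/allP => i iV; have := allP h1 i iV; have /= := xV i iV; case: eqP => //= i0 xi.
  by rewrite gtn_eqF // gtn_eqF ?(leq_ltn_trans (leq_pred i)).
- by move: h2; case: (posnP x) => [->//|x0] /=; case: eqP => //= ; lia.
Qed.

Lemma okw_catr o U w : okw o (U ++ w) -> okw o w.
Proof. by elim: U => //= x U IH /andP[/IH]. Qed.

Lemma okw0_count w i : okw 0 w -> count_mem i.+1 w <= count_mem i w.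
Proof.
elim: w => //= x w IH /andP[/IH h]; case: (eqVneq x i.+1) => [->|xi] /= H; last by lia.
by rewrite [i.+1 == i]gtn_eqF //; lia.
Qed.

Lemma okw0_small w : okw 0 w -> all (fun x => x < size w) w.
Proof.
move=> ok; apply/allP => x xw.
have h j : j <= x -> j \in w.
  move=> jx; rewrite -has_pred1 has_count; have: 0 < count_mem x w by rewrite -has_count has_pred1.
  elim: x jx {xw} => [|x IH]; first by rewrite leqn0 => /eqP->.
  rewrite leq_eqVlt ltnS => /orP[/eqP->//|/IH h /leq_trans hx]; apply: h; apply: hx; exact: okw0_count.
rewrite -[x.+1](size_iota 0); apply: uniq_leq_size; first exact: iota_uniq.
by move=> j; rewrite mem_iota add0n ltnS; apply: h.
Qed.

Definition wofc (t : nat) (c : nat -> nat) : seq nat := flatten [seq nseq (c i) i | i <- iota 0 t].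

Lemma wofcS t c : wofc t.+1 c = wofc t c ++ nseq (c t) t.
Proof. by rewrite /wofc -addn1 iotaD map_cat flatten_cat /= cats0. Qed.

Lemma all_wofc t c : all (fun i => i < t) (wofc t c).
Proof.
elim: t => // t IH; rewrite wofcS all_cat all_nseq ltnSn orbT andbT.
by apply: sub_all IH => i /ltnW.
Qed.

Lemma count_wofc t c i : count_mem i (wofc t c) = if i < t then c i else 0.
Proof.
elim: t => // t IH; rewrite wofcS count_cat IH count_nseq /= ltnS.
by case: ltngtP => [|//|->]; rewrite /= ?mul0n ?mul1n ?addn0 //; case: ltngtP.
Qed.

Lemma sorted_wofc t c : sorted leq (wofc t c).
Proof.
elim: t => // t IH; rewrite wofcS.
rewrite sorted_pairwise; last exact: leq_trans.
rewrite pairwise_cat -!sorted_pairwise; try exact: leq_trans.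
rewrite IH /= ; apply/andP; split.
  apply/allrelP => x y /(allP (all_wofc t c)) xt /nseqP[-> _]; exact: ltnW.
by elim: (c t) => //= -[|m] //=; rewrite leqnn.
Qed.

Lemma wofcK t U : sorted leq U -> all (fun i => i < t) U -> wofc t (fun i => count_mem i U) = U.
Proof.
move=> sU aU; apply: (sorted_eq leq_trans anti_leq) => //; first exact: sorted_wofc.
apply/allP => i _ /=; rewrite count_wofc; case: ltnP => // ti; rewrite eq_sym; apply/eqP.
by apply/count_memPn/negP => /(allP aU); rewrite ltnNge ti.
Qed.

Lemma sum_count t U : all (fun i => i < t) U -> \sum_(i < t) count_mem (i : nat) U = size U.
Proof.
elim: U => [|x U IH] /=; first by rewrite big1.
case/andP => xt /IH <-; rewrite big_split /= (bigD1 (Ordinal xt)) //= eqxx big1 // => i.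
by move=> ne; case: eqP => // E; case/eqP: ne; apply: val_inj.
Qed.

Lemma sorted_iota b k : path.sorted ltn (iota b k).
Proof. by elim: k b => //= k IH b; case: k IH => //= k IH; rewrite ltnSn; apply: IH. Qed.

Lemma all_iota0 t U : all [in iota 0 t] U = all (fun i => i < t) U.
Proof. by apply: eq_all => i; rewrite mem_iota. Qed.

(** * Sign-reversing involutions and antisymmetrisation *)

(** Fixed points of [tau] are allowed: reindexing shows that the sum is its own opposite, and there
    is no 2-torsion. *)
Lemma inv_sum0 (V : zmodType) (T : finType) (P : pred T) (F : T -> V) (tau : T -> T) :
  (forall x : V, x + x = 0 -> x = 0)%R -> involutive tau ->
  (forall x, P (tau x) = P x) -> (forall x, P x -> F (tau x) = - F x)%R ->
  (\sum_(x | P x) F x = 0)%R.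
Proof.
move=> tf tauK Pt Ft; apply: tf; rewrite {1}(reindex_inj (inv_inj tauK)) /=.
by rewrite (eq_bigl _ _ Pt) (eq_bigr _ Ft) sumrN addNr.
Qed.

Section Altn.
Variables (C : pzRingType) (l' : nat).
Notation l := l'.+1.
Local Open Scope ring_scope.
Hypothesis tf : forall x : C, x + x = 0 -> x = 0.

(** Applied to a product over the rows this is a determinant. *)
Definition altn (f : ('I_l -> nat) -> C) (b : 'I_l -> nat) : C :=
  \sum_(s : 'S_l) (-1) ^+ s * f (b \o s).

Lemma altn_perm f b (t : 'S_l) : altn f (b \o t) = (-1) ^+ t * altn f b.
Proof.
rewrite /altn (reindex_inj (mulIg t^-1%g)) mulr_sumr; apply: eq_bigr => s _ /=.
rewrite odd_permM odd_permV addbC signr_addb -mulrA; congr (_ * (_ * f _)).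
by apply/funext => x /=; rewrite permM permKV.
Qed.

Lemma altn_sym0 f (t : 'S_l) b : odd_perm t -> (forall c, f (c \o t) = f c) -> altn f b = 0.
Proof.
move=> ot ft; apply: tf; rewrite {1}/altn (reindex_inj (mulgI t)) -big_split big1 // => s _ /=.
rewrite odd_permM ot /= (_ : b \o _ = (b \o s) \o t) ?ft; last by apply/funext => x /=; rewrite permM.
by rewrite signrN mulNr addNr.
Qed.

Lemma altnD f g b : altn (fun c => f c + g c) b = altn f b + altn g b.
Proof. by rewrite /altn -big_split; apply: eq_bigr => s _; rewrite mulrDr. Qed.

Lemma altn_swap f b i j : i != j -> altn f (b \o tperm i j) = - altn f b.
Proof. by move=> ij; rewrite altn_perm odd_tperm ij mulN1r. Qed.

Section Strip.
Variables (M : nat) (F : ('I_l -> nat) -> C).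
Variable t : nat.
Hypothesis Fswap : forall b (i j : 'I_l), i != j -> (i < t)%N -> (j < t)%N -> F (b \o tperm i j) = - F b.
Local Notation vec := {ffun 'I_l -> 'I_M}.
Definition nv (g : vec) : 'I_l -> nat := fun i => g i.

Definition domr (t : nat) (b : 'I_l -> nat) (g : vec) : bool :=
  [forall i : 'I_l, if (i < t)%N then (b i <= g i)%N else g i == b i :> nat].

Lemma sum_perm (c : 'I_l -> nat) (s : 'S_l) : (\sum_i c (s i) = \sum_i c i)%N.
Proof. by rewrite [RHS](reindex_inj (@perm_inj _ s)). Qed.

(* If row i+1 violates the strip condition then both rows i and i+1 range over the
   values at least b_i, so exchanging them cancels the violating terms. *)
Lemma strip_cancel b N : (t <= l)%N -> (forall i j : 'I_l, (i <= j)%N -> (b j <= b i)%N) ->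
  \sum_(g : vec | domr t b g && (\sum_i g i == N)%N) F (nv g) =
  \sum_(g : vec | [&& domr t b g, (\sum_i g i == N)%N &
     [forall i : 'I_l, forall j : 'I_l, (j == i.+1 :> nat) && (j < t)%N ==> (g j < b i)%N]]) F (nv g).
Proof.
move=> tl bmono.
pose P k (g : vec) := [forall i : 'I_l, forall j : 'I_l,
   [&& (k <= i)%N, j == i.+1 :> nat & (j < t)%N] ==> (g j < b i)%N].
(* The conditions are imposed one pair of rows at a time from the last pair upwards, so that
   exchanging the next two rows does not disturb those already imposed. *)
suff H k : \sum_(g : vec | domr t b g && (\sum_i g i == N)%N) F (nv g) =
   \sum_(g : vec | [&& domr t b g, (\sum_i g i == N)%N & P (t - k)%N g]) F (nv g).
  rewrite (H t) subnn; apply: eq_bigl => g; congr [&& _, _ & _].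
elim: k => [|k IH].
  apply: eq_bigl => g; rewrite (_ : P _ g = true) ?andbT // subn0.
  by apply/forallP => i; apply/forallP => j; apply/implyP => /and3P[]; lia.
rewrite {}IH; case: (ltnP k t) => kt; last first.
  by rewrite (_ : t - k.+1 = t - k)%N //; lia.
set p := (t - k.+1)%N; have -> : (t - k = p.+1)%N by rewrite /p; lia.
have pt : (p < t)%N by rewrite /p; lia.
have [p1t|p1t] := ltnP p.+1 t; last first.
  apply: eq_bigl => g; congr [&& _, _ & _]; rewrite /P; apply: eq_forallb => i; apply: eq_forallb => j.
  by congr (_ ==> _); lia.
have pl : (p < l)%N by apply: leq_trans tl.
have p1l : (p.+1 < l)%N by apply: leq_trans tl.
pose i0 := Ordinal pl; pose i1 := Ordinal p1l.
pose tau (g : vec) : vec := [ffun i => g (tperm i0 i1 i)].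
have tauK : involutive tau by move=> g; apply/ffunP => i; rewrite !ffunE tpermK.
rewrite (bigID (fun g : vec => g i1 < b i0)%N) /= [X in _ + X](@inv_sum0 _ _ _ _ tau) ?addr0.
- apply: eq_bigl => g; rewrite -!andbA; congr [&& _, _ & _].
  apply/andP/forallP => [[/forallP h h1] i|h]; last first.
    split; last by have /forallP/(_ i1)/implyP := h i0; apply; rewrite /= leqnn eqxx.
    apply/forallP => i; apply/forallP => j; apply/implyP => /and3P[h1 h2 h3].
    by have /forallP/(_ j)/implyP := h i; apply; rewrite h2 h3 ltnW.
  apply/forallP => j; apply/implyP => /and3P[h2 /eqP h3 h4].
  have [E|E] := eqVneq (i : nat) p.
    have -> : j = i1 by apply: val_inj; rewrite /= h3 E.
    by have -> : i = i0 by exact: val_inj.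
  have /forallP/(_ j)/implyP := h i; apply; rewrite h3 eqxx -{1}h3 h4 ltn_neqAle eq_sym E h2 //.
- exact: tf.
- exact: tauK.
- pose Q g := [&& domr t b g, (\sum_i g i == N)%N & P p.+1 g] && ~~ (g i1 < b i0)%N.
  have QQ g : Q g -> Q (tau g).
    rewrite /Q -!andbA -leqNgt => /and4P[/forallP dg sg /forallP Pg h].
    have g0 : (b i0 <= g i0)%N by have := dg i0; rewrite /= pt.
    apply/and4P; split.
    - apply/forallP => i; rewrite ffunE; case: tpermP => [->|->|_ _]; last exact: dg.
        by rewrite /= pt.
      by rewrite /= p1t; apply: leq_trans (bmono i0 i1 _) g0; rewrite /= leqnSn.
    - by rewrite -(eqP sg) -[X in _ == X](sum_perm _ (tperm i0 i1)); under eq_bigr do rewrite ffunE.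
    - apply/forallP => i; apply/forallP => j; apply/implyP => /and3P[h2 /eqP h3 h4].
      have e0 : i0 != j by apply/eqP => /(congr1 val) /=; lia.
      have e1 : i1 != j by apply/eqP => /(congr1 val) /=; lia.
      rewrite ffunE tpermD //.
      by have /forallP/(_ j)/implyP := Pg i; apply; rewrite h2 h3 eqxx -h3.
    - by rewrite -leqNgt ffunE tpermR.
  suff QE g : Q (tau g) = Q g by exact: QE.
  by apply/idP/idP => [Qt|]; [rewrite -[g]tauK; apply: QQ | apply: QQ].
- move=> g _; rewrite -(@Fswap _ i0 i1 _ pt p1t); last by apply/eqP => /(congr1 val) /=; lia.
  by congr (F _); apply/funext => i; rewrite /nv ffunE.
Qed.

End Strip.
End Altn.

(** * The Pieri rule for Jacobi-Trudi determinants *)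

Section Alternant.
Variables (C : comPzRingType) (l' : nat).
Notation l := l'.+1.
Local Open Scope ring_scope.
Hypothesis tf : forall x : C, x + x = 0 -> x = 0.
Section Pieri.
Variable h : nat -> C.
Hypothesis h0 : h 0 = 1.

Definition hh (x d : nat) : C := if (d <= x)%N then h (x - d) else 0.
Lemma hhS x d : hh x.+1 d.+1 = hh x d.
Proof. by rewrite /hh ltnS subSS. Qed.

Definition mono (b : 'I_l -> nat) : C := \prod_(i < l) hh (b i) (l' - i).
(** For b_i = mu_i + l' - i this is the Jacobi-Trudi determinant of the Schur function s_mu in the
    elements [h]. *)
Definition jt (b : 'I_l -> nat) : C := altn mono b.

Variable M : nat.
Local Notation vec := {ffun 'I_l -> 'I_M}.

Definition frz (j r : nat) (b : 'I_l -> nat) (g : vec) : bool :=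
  [forall i : 'I_l, if (i < j)%N then g i == b i :> nat else (b i <= g i)%N]
  && (\sum_i g i == \sum_i b i + r)%N.

Definition fsum j r (b : 'I_l -> nat) : C := \sum_(g : vec | frz j r b g) mono (nv g).

(** The terms in which row [j] really grows form a function symmetric in the entries of rows [j] and
    [j.+1], so antisymmetrisation kills them and row [j] may be frozen. *)
Lemma fsum_step j r b (i0 i1 : 'I_l) : i0 = j :> nat -> i1 = j.+1 :> nat ->
  (\sum_i b i + r < M)%N -> altn (fsum j r) b = altn (fsum j.+1 r) b.
Proof.
move=> e0 e1 bM.
pose B := (\sum_i b i)%N.
have n01 : i0 != i1 by apply/eqP => /(congr1 val) /=; lia.
(* The total of [c] is part of the condition so that the entries of [tau g] stay below [M]. *)
pose P c (g : vec) := frz j r c g && (c i0 < g i0)%N && (\sum_i c i == B)%N.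
pose S c := \sum_(g : vec | P c g) mono (nv g).
pose fs (c : 'I_l -> nat) := if (\sum_i c i == B)%N then fsum j.+1 r c else 0.
have E1 c : (\sum_i c i)%N = B -> fsum j r c = fs c + S c.
  move=> cB; rewrite /fs cB eqxx /fsum (bigID (fun g : vec => c i0 < g i0)%N) /= addrC; congr (_ + _).
    apply: eq_bigl => g; rewrite /frz -andbA [X in _ && X]andbC andbA; congr (_ && _).
    apply/andP/forallP => [[/forallP h1 h2] i|h1].
      have := h1 i; rewrite ltnS; case: (ltngtP i j) => //= E.
      have -> : i = i0 by apply: val_inj => /=; lia.
      by move: h2; rewrite -leqNgt eqn_leq => -> ->.
    split; last by have := h1 i0; rewrite e0 ltnSn => /eqP->; rewrite ltnn.
    apply/forallP => i; have := h1 i; rewrite ltnS; case: (ltngtP i j) => //= _.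
    by move=> /eqP->.
  by apply: eq_bigl => g; rewrite /P cB eqxx andbT.
have main : altn S b = 0.
  apply: (altn_sym0 tf (t := tperm i0 i1)) => [|c]; first by rewrite odd_tperm.
  (* Since the index shifts of the two rows differ by one, exchanging the entries with this
     correction leaves [mono] unchanged, while the bounds [c i0] and [c i1] are exchanged. *)
  pose tau (g : vec) : vec := [ffun i => if i == i0 then insubd (g i) (g i1).+1
     else if i == i1 then insubd (g i) (g i0).-1 else g i].
  have sumE (f : 'I_l -> nat) : (\sum_i f i = f i0 + (f i1 + \sum_(i | (i != i0) && (i != i1)) f i))%N.
    by rewrite (bigD1 i0) //= (bigD1 i1) //= eq_sym.
  have t0 c' g : P c' g -> (tau g i0 = (g i1).+1 :> nat) * (tau g i1 = (g i0).-1 :> nat) *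
     (forall i, i != i0 -> i != i1 -> tau g i = g i).
    move=> /andP[/andP[/andP[_ /eqP sg] h2] /eqP h3]; split; last first.
      by move=> i /negbTE i0n /negbTE i1n; rewrite ffunE i0n i1n.
    rewrite !ffunE !eqxx [i1 == i0]eq_sym (negbTE n01) !val_insubd.
    move: sg; rewrite h3 sumE => sg.
    by rewrite !ifT //; have := ltn_ord (g i0); lia.
  have PP c' g : P c' g -> P (c' \o tperm i0 i1) (tau g) /\ tau (tau g) = g.
    move=> Pg; have [[T0 T1] T2] := t0 _ _ Pg.
    have Pt : P (c' \o tperm i0 i1) (tau g).
      move: Pg => /andP[/andP[/andP[/forallP h1 h2] h3] h4].
      rewrite /P /frz (sum_perm c') h4 andbT -andbA /= tpermL T0; apply/and3P; split.
      - apply/forallP => i; case: tpermP => [->|->|/eqP ne0 /eqP ne1].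
        + by rewrite T0 e0 ltnn /=; have := h1 i1; rewrite e1 ltnNge leqnSn /=; lia.
        + by rewrite T1 e1 [(_ < j)%N]ltnNge leqnSn /=; lia.
        + by rewrite T2.
      - rewrite sumE T0 T1; move: h2; rewrite sumE.
        rewrite [X in (_ + (_ + X) == _)%N -> _](eq_bigr (fun i => tau g i : nat)).
          by move: h3; case: (nat_of_ord (g i0)) => // a _ /eqP <-; rewrite /= !addSn addnCA.
        by move=> i /andP[ne0 ne1]; rewrite T2.
      - by have := h1 i1; rewrite e1 ltnNge leqnSn /=; lia.
    split => //; have [[T0' T1'] T2'] := t0 _ _ Pt.
    apply/ffunP => i; apply: val_inj => /=.
    have [->|ne0] := eqVneq i i0; first by rewrite T0' T1; move: Pg => /andP[/andP[_ ?] _]; lia.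
    have [->|ne1] := eqVneq i i1; first by rewrite T1' T0.
    by rewrite T2' // T2.
  rewrite /S (reindex_onto tau tau) => [|g /PP[_ //]].
  apply: eq_big => [g|g /andP[]].
    apply/andP/idP => [[/PP[+ _]] /eqP E|/PP[-> ->]//].
    rewrite E (_ : (c \o tperm i0 i1) \o tperm i0 i1 = c) //.
    by apply/funext => i /=; rewrite tpermK.
  move=> Pt /eqP E; have Pg : P c g.
    have [+ _] := PP _ _ Pt; rewrite E (_ : (c \o tperm i0 i1) \o tperm i0 i1 = c) //.
    by apply/funext => i /=; rewrite tpermK.
  have [[T0 T1] T2] := t0 _ _ Pg.
  rewrite /mono (bigD1 i0) //= (bigD1 i1) 1?eq_sym //= [RHS](bigD1 i0) //= [X in _ = _ * X](bigD1 i1) 1?eq_sym //=.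
  rewrite /nv T0 T1 !mulrA; congr (_ * _); last first.
    by apply: eq_bigr => i /andP[ne0 ne1]; rewrite T2.
  move: Pg => /andP[/andP[_ g0] _].
  have k : (l' - i0 = (l' - i1).+1)%N.
    by have := ltn_ord i1; move: (nat_of_ord i0) (nat_of_ord i1) e0 e1 => a0 a1 -> ->; lia.
  by rewrite mulrC k hhS -(ltn_predK g0) hhS.
transitivity (altn (fun c => fs c + S c) b).
  by apply: eq_bigr => s _; rewrite E1 //= sum_perm.
rewrite altnD main addr0; apply: eq_bigr => s _.
by rewrite /fs /= (sum_perm b) eqxx.
Qed.

Lemma jt_sum b r : (\sum_i b i + r < M)%N ->
  \sum_(g : vec | domr l b g && (\sum_i g i == \sum_i b i + r)%N) jt (nv g) = altn (fsum 0 r) b.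
Proof.
move=> bM; rewrite /jt /altn exchange_big; apply: eq_bigr => s _ /=.
rewrite -mulr_sumr; congr (_ * _).
pose tau (s : 'S_l) (g : vec) : vec := [ffun i => g (s i)].
have tauK (t : 'S_l) : cancel (tau t) (tau t^-1%g).
  by move=> g; apply/ffunP => i; rewrite !ffunE permKV.
have tinj : injective (tau s^-1%g) by apply: can_inj (tauK _).
rewrite [LHS](reindex_inj tinj) /fsum; apply: eq_big => g; last first.
  by move=> _; congr mono; apply/funext => i; rewrite /nv /= ffunE permK.
rewrite /frz (sum_perm b) -[X in (_ && (X == _)) = _](sum_perm _ s); congr (_ && _); last first.
  by congr (_ == _)%N; apply: eq_bigr => i _; rewrite ffunE permK.
apply/forallP/forallP => H i.
  by have := H (s i); rewrite ltn_ord ffunE permK.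
by have := H (s^-1%g i); rewrite ltn_ord /= permKV ffunE.
Qed.

(** With all rows but the last frozen, the whole growth sits in the last factor. That row being
    empty, only the permutations fixing it contribute, and for these the last factor is [h r]. *)
Lemma jt_hmul b r : b ord_max = 0 -> (\sum_i b i + r < M)%N ->
  \sum_(g : vec | domr l b g && (\sum_i g i == \sum_i b i + r)%N) jt (nv g) = h r * jt b.
Proof.
move=> b0 bM; rewrite jt_sum //.
have step k : (k <= l')%N -> altn (fsum 0 r) b = altn (fsum k r) b.
  elim: k => // k IH kl; rewrite IH ?(ltnW kl) //.
  have k1 : (k < l)%N by apply: leq_trans kl _; apply: leqnSn.
  exact: (@fsum_step k r b (Ordinal k1) (Ordinal (kl : (k.+1 < l)%N))).
rewrite (step l') // /jt mulr_sumr; apply: eq_bigr => s _.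
rewrite mulrCA; congr (_ * _).
have fE (c : 'I_l -> nat) : (\sum_i c i + r < M)%N ->
    fsum l' r c = (\prod_(i < l') hh (c (widen_ord (leqnSn l') i)) (l' - i)) * h (c ord_max + r).
  move=> cM; have M0 : (0 < M)%N by apply: leq_ltn_trans cM.
  pose v i := if i == ord_max then (c ord_max + r)%N else c i.
  have vM i : (v i < M)%N.
    apply: leq_ltn_trans cM; rewrite /v; case: eqP => [_|_].
      by rewrite leq_add2r (bigD1 ord_max) //= leq_addr.
    by rewrite (bigD1 i) //= -addnA leq_addr.
  pose g0 : vec := [ffun i => Ordinal (vM i)].
  have nw (i : 'I_l') : (widen_ord (leqnSn l') i == ord_max) = false.
    by apply/negP => /eqP /(congr1 val) /= E; have := ltn_ord i; rewrite E ltnn.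
  rewrite /fsum (big_pred1 g0) => [|g].
    rewrite /mono big_ord_recr /= /nv ffunE /= /v eqxx subnn /hh leq0n subn0; congr (_ * _).
    by apply: eq_bigr => i _; rewrite ffunE /= /v nw.
  apply/andP/eqP => [[/forallP H sg]|->].
    have Hw (i : 'I_l') : g (widen_ord (leqnSn l') i) = c (widen_ord (leqnSn l') i) :> nat.
      by have := H (widen_ord (leqnSn l') i); rewrite /= ltn_ord => /eqP.
    apply/ffunP => i; apply: val_inj; rewrite /= ffunE /= /v.
    case: eqP => [->|ni].
      move: sg; rewrite !big_ord_recr /= (eq_bigr _ (fun i _ => Hw i)).
      by rewrite -addnA eqn_add2l => /eqP.
    have il : (i < l')%N by rewrite ltn_neqAle -ltnS ltn_ord andbT; apply/eqP => E; apply: ni; apply: val_inj.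
    by have := H i; rewrite il => /eqP.
  split; last first.
    rewrite !big_ord_recr /= ffunE /= /v eqxx addnA; apply/eqP; congr (_ + _ + _)%N.
    by apply: eq_bigr => i _; rewrite ffunE /= /v nw.
  apply/forallP => i; rewrite ffunE /= /v; case: (eqVneq i ord_max) => [->|_].
    by rewrite /= ltnn leq_addr.
  by case: ifP.
rewrite fE ?sum_perm //= /mono big_ord_recr /= subnn /hh leq0n subn0.
(* If [s] moves the last row, an earlier factor receives the entry 0 with a positive shift and
   vanishes. *)
have [E|E] := eqVneq (s ord_max) ord_max; first by rewrite E b0 h0 add0n mulr1 mulrC.
suff Z : \prod_(i < l') hh (b (s (widen_ord (leqnSn l') i))) (l' - i) = 0.
  by rewrite /hh in Z; rewrite Z !mul0r mulr0.
have si : s (s^-1%g ord_max) = ord_max by rewrite permKV.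
have il : (s^-1%g ord_max < l')%N.
  rewrite ltn_neqAle -ltnS ltn_ord andbT; apply/eqP => F; case/eqP: E.
  by rewrite -{2}si; congr (s _); apply: val_inj; rewrite /= F.
rewrite (bigD1 (Ordinal il)) //= (_ : widen_ord _ _ = s^-1%g ord_max) ?si; last exact: val_inj.
by rewrite b0 /hh leqn0 subn_eq0 leqNgt il mul0r.
Qed.

(* Rows sorted increasingly are the same thing as vectors of multiplicities. *)
Lemma sum_incw (F : ('I_l -> nat) -> C) t b r : (t <= l)%N -> (\sum_i b i + r < M)%N ->
  \sum_(U <- incw (iota 0 t) r) F (fun i => (b i + count_mem (i : nat) U)%N) =
  \sum_(g : vec | domr t b g && (\sum_i g i == \sum_i b i + r)%N) F (nv g).
Proof.
move=> tl bM; have M0 : (0 < M)%N by apply: leq_ltn_trans bM.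
pose phi (U : seq nat) : vec := [ffun i => insubd (Ordinal M0) (b i + count_mem (i : nat) U)%N].
have inE U : U \in incw (iota 0 t) r -> [/\ size U = r, sorted leq U & all (fun i => i < t)%N U].
  by rewrite mem_incw ?sorted_iota // all_iota0 => /and3P[/eqP].
have phiE U i : U \in incw (iota 0 t) r -> phi U i = (b i + count_mem (i : nat) U)%N :> nat.
  case/inE => sU _ _; rewrite ffunE val_insubd ifT //; apply: leq_ltn_trans bM.
  by apply: leq_add; rewrite -?sU ?count_size // (bigD1 i) //= leq_addr.
rewrite big_seq_cond [LHS](eq_bigr (fun U => F (nv (phi U)))); last first.
  by move=> U; rewrite andbT => Ui; congr F; apply/funext => i; rewrite /nv phiE.
rewrite -big_seq_cond -(big_map phi predT (fun g => F (nv g))) -[RHS]big_filter.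
apply: perm_big; apply: uniq_perm.
- rewrite map_inj_in_uniq ?uniq_incw ?sorted_iota // => U V Ui Vi E.
  have [sU oU aU] := inE _ Ui; have [sV oV aV] := inE _ Vi.
  rewrite -(wofcK oU aU) -(wofcK oV aV); congr wofc; apply/funext => i.
  have [ti|it] := leqP t i.
    have z W : all (fun i => i < t)%N W -> count_mem i W = 0%N.
      by move=> aW; apply/count_memPn/negP => /(allP aW); rewrite ltnNge ti.
    by rewrite !z.
  have il : (i < l)%N by apply: leq_trans tl.
  by have := congr1 (fun g : vec => g (Ordinal il) : nat) E; rewrite !phiE //= => /addnI.
- by rewrite filter_uniq // /index_enum -enumT enum_uniq.
move=> g; rewrite mem_filter mem_index_enum andbT; apply/mapP/andP => [[U Ui ->]|[/forallP d /eqP sg]].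
  have [sU oU aU] := inE _ Ui; split.
    apply/forallP => i; rewrite phiE //; case: ifP => it; first exact: leq_addr.
    rewrite (count_memPn _) ?addn0 //; apply/negP => /(allP aU).
    by rewrite it.
  under eq_bigr do rewrite phiE //.
  rewrite big_split /= sum_count ?sU //; apply: sub_all aU => i it; exact: leq_trans it tl.
pose c i := if insub i is Some j then (g j - b j)%N else 0.
have cE (i : 'I_l) : c i = (g i - b i)%N by rewrite /c valK.
have dle i : (b i <= g i)%N by have := d i; case: ifP => // _ /eqP->.
have cw (i : 'I_l) : count_mem (i : nat) (wofc t c) = (g i - b i)%N.
  rewrite count_wofc; case: ifP => it; first exact: cE.
  by have := d i; rewrite it => /eqP->; rewrite subnn.
have Ui : wofc t c \in incw (iota 0 t) r.
  rewrite mem_incw ?sorted_iota // all_iota0 all_wofc sorted_wofc !andbT.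
  rewrite -(@sum_count l); last by apply: sub_all (all_wofc t c) => i it; apply: leq_trans it tl.
  rewrite (eq_bigr _ (fun i _ => cw i)) sumnB ?sg ?addKn // => i _; exact: dle.
exists (wofc t c) => //; apply/ffunP => i; apply: val_inj.
by rewrite /= phiE // cw subnKC.
Qed.

End Pieri.
End Alternant.

(** * Pieri rules in terms of lattice words *)

Definition hooks (L : seq nat) (m : nat) : seq (seq nat * seq nat) :=
  flatten [seq [seq (U, V) | U <- incw L (m - a), V <- decw L a] | a <- iota 0 m.+1].

Fixpoint arrs (L : seq nat) (ms : seq nat) : seq (seq (seq nat * seq nat)) :=
  if ms is m :: ms' then [seq x :: X | x <- hooks L m, X <- arrs L ms'] else [:: [::]].

Definition wd (X : seq (seq nat * seq nat)) : seq nat := flatten [seq x.1 ++ x.2 | x <- X].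

Section PieriWords.
Variables (C : comPzRingType) (h e : nat -> C) (l' : nat).
Notation l := l'.+1.
Local Open Scope ring_scope.
Hypothesis tf : forall x : C, x + x = 0 -> x = 0.
Hypothesis h0 : h 0 = 1.
Hypothesis he : forall r, \sum_(a < r.+1) (-1) ^+ a * (h (r - a) * e a) = (r == 0)%:R.

(** The content of [w] plus the staircase, so that for a lattice word [Dw w] is the Schur function
    of its content. *)
Definition bw (w : seq nat) (i : 'I_l) : nat := (count_mem (i : nat) w + (l' - i))%N.
Definition Dw (w : seq nat) : C := jt h (bw w).

Lemma bw_cat U w : bw (U ++ w) = fun i => (bw w i + count_mem (i : nat) U)%N.
Proof. by apply/funext => i; rewrite /bw count_cat; lia. Qed.

Lemma okw0_bw U w : okw 0 w -> sorted leq U -> all (fun i => i < l)%N U ->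
  okw 0 (U ++ w) = [forall i : 'I_l, forall j : 'I_l,
    (j == i.+1 :> nat) && (j < l)%N ==> (bw (U ++ w) j < bw w i)%N].
Proof.
move=> okw sU aU; rewrite okw_cat_inc // okw /=; apply/allP/forallP => H.
  move=> i; apply/forallP => j; apply/implyP => /andP[/eqP ji jl].
  have ilt : (i < l')%N by rewrite -ltnS -ji.
  rewrite /bw ji; suff : (count_mem i.+1 (U ++ w) <= count_mem (i : nat) w)%N by lia.
  case: (boolP (i.+1 \in U)) => iU; first by have := H _ iU; rewrite /= addn0.
  by rewrite count_cat (count_memPn iU) okw0_count.
move=> [|i] iU //=; rewrite addn0; have il := allP aU _ iU.
have /forallP/(_ (Ordinal il)) := H (Ordinal (ltnW il)).
by rewrite /= eqxx il /bw /=; move: il; rewrite ltnS; lia.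
Qed.

(** [jt_hmul] yields a sum over all growths of size [r], [strip_cancel] discards those that are not
    horizontal strips, and [sum_incw] codes the others by weakly increasing words. *)
Lemma hPieri w r : okw 0 w -> (size w + r < l)%N ->
  \sum_(U <- incw (iota 0 l) r | okw 0 (U ++ w)) Dw (U ++ w) = h r * Dw w.
Proof.
move=> okw szw; have aw := okw0_small okw.
pose M := (\sum_i bw w i + r).+1.
have bM : (\sum_i bw w i + r < M)%N by [].
pose Q (c : 'I_l -> nat) := [forall i : 'I_l, forall j : 'I_l,
    (j == i.+1 :> nat) && (j < l)%N ==> (c j < bw w i)%N].
transitivity (\sum_(U <- incw (iota 0 l) r)
   (fun c => if Q c then jt h c else 0) (fun i => (bw w i + count_mem (i : nat) U)%N)).
  rewrite big_mkcond big_seq [RHS]big_seq; apply: eq_bigr => U.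
  rewrite mem_incw ?sorted_iota // all_iota0 => /and3P[_ sU aU].
  by rewrite okw0_bw // /Dw bw_cat.
rewrite (sum_incw (fun c => if Q c then jt h c else 0) (leqnn l) bM) -big_mkcondr /=.
(* There are more rows than boxes, so the last row is empty. *)
have bmax : bw w ord_max = 0%N.
  rewrite /bw /= subnn addn0; apply/count_memPn/negP => /(allP aw) /=; lia.
rewrite -(jt_hmul tf h0 bmax bM) (@strip_cancel _ _ tf _ (jt h) l) //.
- by apply: eq_bigl => g; rewrite -andbA.
- by move=> b i j ij _ _; rewrite /jt altn_swap.
move=> i j ij; rewrite /bw; apply: leq_add; last by lia.
move: ij; case: i j => i il [j jl] /= {il jl}; elim: j => [|j IH]; first by rewrite leqn0 => /eqP->.
by rewrite leq_eqVlt ltnS => /orP[/eqP->//|/IH]; apply: leq_trans; apply: okw0_count.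
Qed.

(** The cancellation [hook_alt] over words, combined with [hPieri], gives the left-hand sides the
    recursion by which [he] determines the [e] from the [h]; no determinant is manipulated. *)
Lemma ePieri w r : okw 0 w -> (size w + r < l)%N ->
  \sum_(V <- decw (iota 0 l) r | okw 0 (V ++ w)) Dw (V ++ w) = e r * Dw w.
Proof.
move=> okww; elim/ltn_ind: r => r IH szw.
pose Y a := \sum_(V <- decw (iota 0 l) a | okw 0 (V ++ w)) Dw (V ++ w).
have alt0 : \sum_(a < r.+1) (-1) ^+ a * (h (r - a) * Y a) = (r == 0)%:R * Dw w.
  pose phi u := if okw 0 (u ++ w) then Dw (u ++ w) else 0.
  transitivity (altUV (iota 0 l) (iota 0 l) r phi); last first.
    by rewrite hook_alt; case: (r) => [|s]; rewrite /phi /= ?okww ?mul1r ?mul0r.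
  apply: eq_bigr => a _; congr (_ * _); rewrite exchange_big /= mulr_sumr big_mkcond.
  rewrite big_seq [RHS]big_seq; apply: eq_bigr => V.
  rewrite mem_decw ?sorted_iota // => /and3P[/eqP sV _ _].
  case: ifP => [ok|nok]; last first.
    by rewrite big1 // => U _; rewrite /phi -catA; case: ifP => // /okw_catr; rewrite nok.
  rewrite -hPieri // ?size_cat ?sV; last by have := ltn_ord a; lia.
  by rewrite big_mkcond; apply: eq_bigr => U _; rewrite /phi -catA.
have E : \sum_(a < r) (-1) ^+ a * (h (r - a) * Y a) =
    (\sum_(a < r) (-1) ^+ a * (h (r - a) * e a)) * Dw w.
  rewrite mulr_suml; apply: eq_bigr => a _; rewrite /Y IH ?ltn_ord // -?mulrA //.
  by have := ltn_ord a; lia.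
have := alt0; rewrite -he !big_ord_recr /= mulrDl E => /addrI.
rewrite subnn h0 !mul1r -mulrA => /(congr1 (fun x => (-1) ^+ r * x)).
by rewrite !mulrA -!exprD addnn -signr_odd odd_double !mul1r.
Qed.

Lemma Dw_nil : Dw [::] = 1.
Proof.
rewrite /Dw /jt /altn (bigD1 1%g) //= odd_perm1 mul1r [X in _ + X]big1 => [|s s1].
  rewrite addr0 /mono big1 // => i _.
  by rewrite /= perm1 /bw /hh /= add0n leqnn subnn.
suff [i Hi] : exists i : 'I_l, (i < s i)%N.
  rewrite /mono (bigD1 i) //= {1}/hh /bw add0n.
  by rewrite leqNgt ltn_sub2l ?mul0r ?mulr0 // (leq_trans Hi) // -ltnS.
apply/existsP; apply: contraR s1 => /existsPn H.
have H' (i : 'I_l) : (s i <= i)%N by rewrite leqNgt H.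
apply/eqP/permP => i; rewrite perm1; apply: val_inj.
have sumeq : (\sum_(i < l) s i = \sum_(i < l) i)%N.
  by rewrite (sum_perm (fun i : 'I_l => i : nat)).
apply/eqP; rewrite eqn_leq H' /= leqNgt; apply/negP => lt.
have : (\sum_(i < l) s i < \sum_(i < l) i)%N.
  rewrite (bigD1 i) //= [X in (_ < X)%N](bigD1 i) //= -addSn leq_add //.
  by apply: leq_sum => j _; apply: H'.
by rewrite sumeq ltnn.
Qed.

(** The analogue of the one-row Schur Q-function q_m, whose generating series is the product of
    those of [e] and [h]. *)
Definition qq m := \sum_(a < m.+1) e a * h (m - a).

Lemma big_hooks m (F : seq nat * seq nat -> C) :
  \sum_(x <- hooks (iota 0 l) m) F x =
  \sum_(a < m.+1) \sum_(U <- incw (iota 0 l) (m - a)) \sum_(V <- decw (iota 0 l) a) F (U, V).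
Proof.
rewrite /hooks big_flatten big_map -(big_mkord xpredT (fun a => \sum_(U <- incw (iota 0 l) (m - a)) \sum_(V <- decw (iota 0 l) a) F (U, V))).
by rewrite /index_iota subn0; apply: eq_bigr => a _; rewrite big_allpairs.
Qed.

Lemma qPieri w m : okw 0 w -> (size w + m < l)%N ->
  \sum_(x <- hooks (iota 0 l) m | okw 0 ((x.1 ++ x.2) ++ w)) Dw ((x.1 ++ x.2) ++ w) = qq m * Dw w.
Proof.
move=> okww szw; rewrite big_mkcond big_hooks mulr_suml; apply: eq_bigr => a _.
rewrite -mulrA mulrCA -ePieri //; last by have := ltn_ord a; lia.
rewrite [LHS]exchange_big mulr_sumr [RHS]big_mkcond [LHS]big_seq [RHS]big_seq; apply: eq_bigr => V. 
rewrite mem_decw ?sorted_iota // => /and3P[/eqP sV _ _]; case: ifP => [ok|nok].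
  rewrite -hPieri // ?size_cat ?sV; last by have := ltn_ord a; lia.
  by rewrite [RHS]big_mkcond; apply: eq_bigr => U _; rewrite -catA.
by rewrite big1 // => U _; rewrite -catA; case: ifP => // /okw_catr; rewrite nok.
Qed.

Lemma size_hooks m x : x \in hooks (iota 0 l) m -> size (x.1 ++ x.2) = m.
Proof.
move/flatten_mapP => [a]; rewrite mem_iota add0n ltnS => am /allpairsP[p [Ui Vi ->]].
move: Ui Vi; rewrite mem_incw ?mem_decw ?sorted_iota // => /and3P[/eqP sU _ _] /and3P[/eqP sV _ _].
by rewrite size_cat /= sU sV subnK.
Qed.

Lemma size_arrs ms X : X \in arrs (iota 0 l) ms -> size (wd X) = sumn ms.
Proof.
elim: ms X => [|m ms IH] X; first by rewrite inE => /eqP->.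
case/allpairsP => -[x X'] /= [/size_hooks xm /IH XE ->].
by rewrite /wd /= size_cat xm -XE.
Qed.

(** Iterated Pieri rule starting from the empty word: the number of terms with a given content mu is
    the coefficient of s_mu in the product. *)
Lemma prod_qq ms : (sumn ms < l)%N ->
  \sum_(X <- arrs (iota 0 l) ms | okw 0 (wd X)) Dw (wd X) = \prod_(m <- ms) qq m.
Proof.
elim: ms => [|m ms IH] sl; first by rewrite big_nil big_mkcond big_seq1 /= Dw_nil.
rewrite big_cons -IH; last by apply: leq_ltn_trans sl; rewrite /= leq_addl.
rewrite [LHS]big_mkcond.
have -> : arrs (iota 0 l) (m :: ms) = [seq x :: X | x <- hooks (iota 0 l) m, X <- arrs (iota 0 l) ms] by [].
rewrite big_allpairs_dep [LHS]exchange_big mulr_sumr [RHS]big_mkcond [LHS]big_seq [RHS]big_seq.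
apply: eq_bigr => X /size_arrs sX; case: ifP => [ok|nok]; last first.
  by rewrite big1 // => x _; case: ifP => // /okw_catr; rewrite -/(wd X) nok.
rewrite -qPieri // ?sX 1?addnC; last by move: sl; rewrite /=.
by rewrite [RHS]big_mkcond.
Qed.

End PieriWords.

(** * The noncommutative Jacobi-Trudi determinant expanded over tableaux *)

Fixpoint lsts (T : Type) (S : seq T) (k : nat) : seq (seq T) :=
  if k is k'.+1 then [seq x :: s | x <- S, s <- lsts S k'] else [:: [::]].

Lemma size_lsts (T : eqType) (S : seq T) k s : s \in lsts S k -> size s = k.
Proof.
elim: k s => [|k IH] s; first by rewrite inE => /eqP->.
by case/allpairsP => -[x s'] /= [_ /IH <- ->].
Qed.

Lemma mem_lsts (T : eqType) (S : seq T) k s : (s \in lsts S k) = (size s == k) && all [in S] s.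
Proof.
elim: k s => [|k IH] [|x s] //.
  by apply/negbTE/negP => /allpairsP[[y t] [_ _]].
rewrite /= eqSS; apply/allpairsP/idP => [[[y t] /= [yS tS [-> ->]]]|/andP[sk /andP[xS aS]]].
  by move: tS; rewrite IH yS.
by exists (x, s); rewrite IH sk aS.
Qed.

Lemma uniq_lsts (T : eqType) (S : seq T) k : uniq S -> uniq (lsts S k).
Proof.
by move=> uS; elim: k => //= k IH; apply: allpairs_uniq => // -[a b] [c d] _ _ /= [-> ->].
Qed.

Lemma lstsS (T : Type) (S : seq T) k : lsts S k.+1 = [seq x :: s | x <- S, s <- lsts S k].
Proof. by []. Qed.

Lemma big_lsts_cat (V : nmodType) (T : Type) (S : seq T) i j (F : seq T -> V) :
  (\sum_(s <- lsts S (i + j)) F s = \sum_(a <- lsts S i) \sum_(b <- lsts S j) F (a ++ b))%R.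
Proof.
elim: i F => [|i IH] F; first by rewrite big_seq1.
rewrite addSn /= !big_allpairs_dep; apply: eq_bigr => x _.
by rewrite IH.
Qed.

Lemma big_subs_cat (V : nmodType) L1 L2 (F : seq nat -> V) :
  (\sum_(s <- subs (L1 ++ L2)) F s = \sum_(a <- subs L1) \sum_(b <- subs L2) F (a ++ b))%R.
Proof.
elim: L1 F => [|x L IH] F; first by rewrite big_seq1.
rewrite /= !big_cat !big_map /= !IH; congr (_ + _)%R.
Qed.

(* Rows are listed from top to bottom; a violation at the letter b in rows i, i+1. *)
Definition vio (A : seq (seq nat)) (i b : nat) : bool :=
  [&& b \in nth [::] A i.+1 &
      count (ltn^~ b) (nth [::] A i) <= count (ltn^~ b) (nth [::] A i.+1)].

Definition goodA (A : seq (seq nat)) : bool :=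
  all (fun i => all (fun b => ~~ vio A i b) (nth [::] A i.+1)) (iota 0 (size A).-1).

(** The number of weakly increasing words of length [x - d] with a given support of size [k], with
    the convention of [hh] for [x < d]. *)
Definition cpd (d x k : nat) : nat := if d <= x then cp (x - d) k else 0.

Lemma cpd_conv d x k j : cpd d x (k + j) = \sum_(p < x.+1) cp p k * cpd (d + p) x j.
Proof.
rewrite /cpd; case: leqP => dx; last first.
  by rewrite big1 // => p _; rewrite leqNgt (leq_trans dx) ?leq_addr //= muln0.
rewrite cp_conv -(big_mkord xpredT (fun p => cp p k * cp (x - d - p) j)).
rewrite -(big_mkord xpredT (fun p => cp p k * (if d + p <= x then cp (x - (d + p)) j else 0))).
rewrite (@big_cat_nat _ _ _ (x - d).+1 0 x.+1) //=; last by rewrite ltnS leq_subr.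
rewrite [X in _ = _ + X]big1_seq ?addn0; last first.
  by move=> p; rewrite mem_index_iota => /andP[_ /andP[h _]]; rewrite ifN ?muln0 //; lia.
rewrite [LHS]big_seq_cond [RHS]big_seq_cond; apply: eq_bigr => p.
rewrite mem_index_iota andbT => /andP[_ h]; rewrite ifT; last by lia.
by rewrite subnDA.
Qed.

Arguments lsts : simpl never.

Section PhaseOne.
Variables (A : pzRingType) (u : nat -> A).
Local Open Scope ring_scope.
Hypothesis uu : forall i, u i * u i = u i.
Hypothesis ufar : forall i j, (i.+1 < j)%N -> u i * u j = u j * u i.
Hypothesis ubraid : forall i, u i * u i.+1 * u i = u i.+1 * u i * u i.+1.

Lemma Wd_far2 v w : (forall x y, x \in v -> y \in w -> (x.+1 < y)%N) ->
  Wd u v * Wd u w = Wd u w * Wd u v.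
Proof.
elim: v => [|x v IH] H; first by rewrite /Wd big_nil mul1r mulr1.
rewrite Wd_cons -mulrA IH => [|y z yv zw]; last by apply: H; rewrite ?inE ?yv ?orbT.
rewrite !mulrA Wd_far //; apply/allP => y yw; apply: H => //; exact: mem_head.
Qed.

(* The generating element of a pair of rows whose tails from the violating letter b on are
   free: exchanging the two tails and the two prefix multiplicities is a symmetry. *)
Lemma fiber_sym (b k d c : nat) (x y : nat) :
  let f x y := \sum_(X <- subs (iota b k.+1)) \sum_(B <- subs (iota b.+1 k))
    (u b * Wd u B * Wd u X) *+ (cpd d.+1 x (c + size X) * cpd d y (c.+1 + size B)) in
  f x y = f y x.
Proof.
pose hd d (x p : nat) : A := if (d + p <= x)%N then hL u (iota b k.+1) (x - (d + p)) else 0.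
have hdC d1 d2 x1 x2 p1 p2 : hd d1 x1 p1 * hd d2 x2 p2 = hd d2 x2 p2 * hd d1 x1 p1.
  by rewrite /hd; case: ifP; case: ifP; rewrite ?mul0r ?mulr0 // => _ _; apply: hL_comm.
(* The tails sum to two complete elements over the same interval. The row containing [b] absorbs one
   repetition of that letter, which brings both elements to the same shift [d.+1]; they commute by
   [hL_comm]. *)
have E x' y' : \sum_(X <- subs (iota b k.+1)) \sum_(B <- subs (iota b.+1 k))
    (u b * Wd u B * Wd u X) *+ (cpd d.+1 x' (c + size X) * cpd d y' (c.+1 + size B)) =
    \sum_(p < x'.+1) \sum_(q < y'.+1)
      (u b * hd d.+1 y' q * hd d.+1 x' p) *+ (cp p c * cp q c).
  transitivity (\sum_(X <- subs (iota b k.+1)) \sum_(B <- subs (iota b.+1 k))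
     \sum_(p < x'.+1) \sum_(q < y'.+1)
       (u b * (Wd u B *+ cpd (d + q) y' (size B).+1) * (Wd u X *+ cpd (d.+1 + p) x' (size X)))
          *+ (cp p c * cp q c)).
    apply: eq_bigr => X _; apply: eq_bigr => B _.
    rewrite addSnnS !cpd_conv big_distrl -sumrMnr; apply: eq_bigr => p _ /=.
    rewrite big_distrr -sumrMnr; apply: eq_bigr => q _ /=.
    rewrite mulrnAr mulrnAr mulrnAl -!mulrnA; congr (_ *+ _); lia.
  transitivity (\sum_(X <- subs (iota b k.+1)) \sum_(p < x'.+1) \sum_(B <- subs (iota b.+1 k))
     \sum_(q < y'.+1)
       (u b * (Wd u B *+ cpd (d + q) y' (size B).+1) * (Wd u X *+ cpd (d.+1 + p) x' (size X)))
          *+ (cp p c * cp q c)).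
    by apply: eq_bigr => X _; rewrite exchange_big.
  rewrite exchange_big; apply: eq_bigr => p _.
  transitivity (\sum_(X <- subs (iota b k.+1)) \sum_(q < y'.+1) \sum_(B <- subs (iota b.+1 k))
       (u b * (Wd u B *+ cpd (d + q) y' (size B).+1) * (Wd u X *+ cpd (d.+1 + p) x' (size X)))
          *+ (cp p c * cp q c)).
    by apply: eq_bigr => X _; rewrite exchange_big.
  rewrite exchange_big; apply: eq_bigr => q _.
  under eq_bigr do rewrite sumrMnl -mulr_suml -mulr_sumr.
  rewrite sumrMnl -mulr_sumr; congr (_ *+ _); congr (_ * _).
    rewrite /hd; case: ifP => dq; last first.
      rewrite big1 ?mulr0 // => B _; rewrite /cpd; case: ifP => // h.
      by rewrite (_ : y' - (d + q) = 0)%N ?mulr0n //; lia.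
    rewrite (mul_hL_head uu) mulr_sumr; apply: eq_bigr => B _.
    rewrite /cpd ifT; last by lia.
    by rewrite mulrnAr (_ : (y' - (d + q)) = (y' - (d.+1 + q)).+1)%N //; lia.
  rewrite /hd; case: ifP => dp; last first.
    by rewrite big1 // => X _; rewrite /cpd dp.
  by rewrite (hL_subs uu); apply: eq_bigr => X _; rewrite /cpd dp.
move=> f; rewrite /f !E exchange_big; apply: eq_bigr => q _; apply: eq_bigr => p _.
by rewrite -!mulrA hdC mulnC.
Qed.

Variable l' : nat.
Notation l := l'.+1.
Variables (b0 N : nat).
Notation L := (iota b0 N).

(** The number of ways to blow up each support in [R] to a weakly increasing word of the length that
    row [i] of the determinant requires. *)
Fixpoint co (c : nat -> nat) (i : nat) (R : seq (seq nat)) : nat :=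
  if R is a :: R' then (cpd (l' - i) (c i) (size a) * co c i.+1 R')%N else 1%N.

Lemma co_cat c i R S : co c i (R ++ S) = (co c i R * co c (i + size R) S)%N.
Proof.
elim: R i => [|a R IH] i /=; first by rewrite mul1n addn0.
by rewrite IH addSnnS mulnA.
Qed.

Lemma eq_co c c' i R : (forall j, (i <= j < i + size R)%N -> c j = c' j) -> co c i R = co c' i R.
Proof.
elim: R i => //= a R IH i H; rewrite H ?IH //; last by lia.
by move=> j hj; apply: H; lia.
Qed.

Definition hA (x d : nat) : A := if (d <= x)%N then hL u L (x - d) else 0.

Lemma sum_lsts_co c k i :
  \sum_(R <- lsts (subs L) k) Wd u (flatten (rev R)) *+ co c i R =
  \prod_(j <- rev (iota i k)) hA (c j) (l' - j).
Proof.
elim: k i => [|k IH] i; first by rewrite big_seq1 big_nil /Wd big_nil.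
have -> : \prod_(j <- rev (iota i k.+1)) hA (c j) (l' - j) =
    (\sum_(R <- lsts (subs L) k) Wd u (flatten (rev R)) *+ co c i.+1 R) * hA (c i) (l' - i).
  by rewrite IH [iota _ _]/= rev_cons -cats1 big_cat big_seq1.
rewrite lstsS big_allpairs_dep exchange_big mulr_suml.
apply: eq_bigr => R _ /=.
rewrite -[in RHS](mulr1 (hA _ _)) /hA; case: ifP => h; last first.
  by rewrite mul0r mulr0 big1 // => a _; rewrite /cpd h.
rewrite mulr1 (hL_subs uu) mulr_sumr; apply: eq_bigr => a _.
rewrite rev_cons flatten_rcons Wd_cat /cpd h mulrnAr mulrnAl -mulrnA mulnC //.
Qed.

(** Singles out one violation of a bad array: the smallest violating letter, and for it the lowest
    pair of rows. *)
Definition isel (R : seq (seq nat)) (i b : nat) : bool :=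
  [&& vio R i b, all (fun c => all (fun j => ~~ vio R j c) (iota 0 l')) (iota 0 b)
   & all (fun j => ~~ vio R j b) (iota i.+1 (l' - i.+1))].

Lemma isel_eq (R S : seq (seq nat)) (i b : nat) :
  (forall j c, (c <= b)%N -> count (ltn^~ c) (nth [::] R j) = count (ltn^~ c) (nth [::] S j)) ->
  (forall j c, (c < b)%N -> (c \in nth [::] R j) = (c \in nth [::] S j)) ->
  (forall j, (i < j)%N -> (b \in nth [::] R j) = (b \in nth [::] S j)) ->
  isel R i b = isel S i b.
Proof.
move=> H1 H2 H3; rewrite /isel /vio; congr [&& [&& _ & _], _ & _].
- by rewrite H3.
- by rewrite !H1.
- apply: eq_in_all => c; rewrite mem_iota add0n => cb; apply: eq_in_all => j _.
  by rewrite H2 // !H1 // ltnW.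
- apply: eq_in_all => j; rewrite mem_iota => /andP[ij _].
  have ij1 : (i < j.+1)%N by exact: ltnW.
  by rewrite (H3 _ ij1) !H1.
Qed.

Lemma isel_ex (R : seq (seq nat)) : size R = l -> all [in subs L] R -> ~~ goodA R ->
  exists i b, [/\ isel R i b, (i < l')%N & b \in L].
Proof.
move=> sR aR; rewrite /goodA sR /= => /allPn[i]; rewrite mem_iota add0n => il /allPn[b bi].
rewrite negbK => vb.
have ex1 : exists b, has (fun j => vio R j b) (iota 0 l').
  by exists b; apply/hasP; exists i; rewrite ?mem_iota.
case: (ex_minnP ex1) => c hc cmin.
have ex2 : exists j, (j < l')%N && vio R j c.
  by case/hasP: hc => j; rewrite mem_iota => jl vj; exists j; rewrite vj andbT.
have bd j : (j < l')%N && vio R j c -> (j <= l')%N by case/andP => /ltnW.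
case: (ex_maxnP ex2 bd) => j /andP[jl vj] jmax.
exists j, c; split => //; last first.
  case/andP: (vj) => cj _; have /allP aR' := aR.
  have : nth [::] R j.+1 \in subs L by apply: aR'; rewrite mem_nth // sR ltnS.
  by rewrite mem_subs ?sorted_iota // => /andP[_ /allP]; apply.
rewrite /isel vj /=; apply/andP; split.
  apply/allP => d; rewrite mem_iota => /andP[_ dc]; apply/allP => k kl; apply/negP => vk.
  have : (c <= d)%N by apply: cmin; apply/hasP; exists k.
  by rewrite leqNgt dc.
apply/allP => k; rewrite mem_iota => /andP[jk kl]; apply/negP => vk.
have : (k <= j)%N by apply: jmax; rewrite vk andbT; lia.
by rewrite leqNgt jk.
Qed.

Lemma isel_uniq (R : seq (seq nat)) i b j c : (i < l')%N -> (j < l')%N ->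
  isel R i b -> isel R j c -> i = j /\ b = c.
Proof.
move=> il jl /and3P[v1 /allP a1 /allP m1] /and3P[v2 /allP a2 /allP m2].
have bc : b = c.
  case: (ltngtP b c) => // h.
    by have := a2 b; rewrite mem_iota => /(_ h) /allP /(_ i); rewrite mem_iota v1 => /(_ il).
  by have := a1 c; rewrite mem_iota => /(_ h) /allP /(_ j); rewrite mem_iota v2 => /(_ jl).
split=> //; subst c; case: (ltngtP i j) => // h.
  by have := m1 j; rewrite mem_iota v2 => H; have := H ltac:(lia).
by have := m2 i; rewrite mem_iota v1 => H; have := H ltac:(lia).
Qed.

Lemma isel_bad (R : seq (seq nat)) i b : size R = l -> (i < l')%N -> isel R i b -> ~~ goodA R.
Proof.
move=> sR il /and3P[vi _ _]; apply/allPn; exists i; first by rewrite sR mem_iota.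
by apply/allPn; exists b; rewrite ?negbK //; case/andP: vi.
Qed.

Lemma sum_bad (F : seq (seq nat) -> A) :
  \sum_(R <- lsts (subs L) l | ~~ goodA R) F R =
  \sum_(i <- iota 0 l') \sum_(b <- L) \sum_(R <- lsts (subs L) l | isel R i b) F R.
Proof.
under [RHS]eq_bigr do (under eq_bigr do rewrite big_mkcond; rewrite exchange_big /=).
rewrite exchange_big big_mkcond big_seq [RHS]big_seq; apply: eq_bigr => R.
rewrite mem_lsts => /andP[/eqP sR aR]; case: ifP => [bad|ok]; last first.
  rewrite big1_seq // => i /andP[_]; rewrite mem_iota add0n => il; rewrite big1 // => b _; case: ifP => // h.
  by rewrite (isel_bad sR il h) in ok.
have [i [b [sel il bL]]] := isel_ex sR aR bad.
rewrite (bigD1_seq i) ?mem_iota ?iota_uniq //= (bigD1_seq b) ?iota_uniq //= sel.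
rewrite big1_seq ?addr0 => [|c /andP[cb _]]; last first.
  by case: ifP => // /(isel_uniq il il sel)[_ E]; rewrite E eqxx in cb.
rewrite big1_seq ?addr0 // => j /andP[ji]; rewrite mem_iota add0n => jl.
rewrite big1 // => c _; case: ifP => // /(isel_uniq il jl sel)[E _].
by rewrite E eqxx in ji.
Qed.

Lemma count_take b k v : v \in subs (iota b k) -> forall c, (c <= b)%N -> count (ltn^~ c) v = 0%N.
Proof.
rewrite mem_subs ?sorted_iota // => /andP[_ /allP vL] c cb; apply/eqP; rewrite -leqn0 leqNgt -has_count.
by apply/hasPn => y /vL; rewrite mem_iota => /andP[h _]; rewrite -leqNgt (leq_trans cb).
Qed.

Lemma count_low b k v : v \in subs (iota b k) -> count (ltn^~ (b + k)%N) v = size v.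
Proof.
rewrite mem_subs ?sorted_iota // => /andP[_ /allP vL]; apply/eqP; rewrite -all_count.
by apply/allP => y /vL; rewrite mem_iota => /andP[].
Qed.

Definition nats (c : 'I_l -> nat) (k : nat) : nat := if insub k is Some i then c i else 0%N.

Lemma natsE c (i : 'I_l) : nats c i = c i.
Proof. by rewrite /nats valK. Qed.

Definition Tbad i b (c : 'I_l -> nat) : A :=
  \sum_(R <- lsts (subs L) l | isel R i b) Wd u (flatten (rev R)) *+ co (nats c) 0 R.

(** The selection of [b] in rows [i], [i.+1] does not look at the letters of the two rows from [b]
    on, apart from [b] itself in the lower row. The tails are therefore free in each fibre. *)
Lemma isel_prefix (P : seq (seq nat)) (a1 X b1 B : seq nat) (Q : seq (seq nat)) (i k1 k2 : nat) :
  let b := (b0 + k1)%N in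
  size P = i -> X \in subs (iota b k2.+1) -> B \in subs (iota b.+1 k2) ->
  isel (P ++ (a1 ++ X) :: (b1 ++ b :: B) :: Q) i b = isel (P ++ a1 :: (b1 ++ [:: b]) :: Q) i b.
Proof.
move=> b sP Xi Bi.
have Bc c : (c <= b)%N -> count (ltn^~ c) B = 0%N.
  by move=> cb; apply: (count_take Bi); apply: leqW.
have Xge y : y \in X -> (b <= y)%N.
  by move: Xi; rewrite mem_subs ?sorted_iota // => /andP[_ /allP H] /H; rewrite mem_iota => /andP[].
have Bge y : y \in B -> (b < y)%N.
  by move: Bi; rewrite mem_subs ?sorted_iota // => /andP[_ /allP H] /H; rewrite mem_iota => /andP[].
apply: isel_eq => [j c cb|j c cb|j ij]; rewrite !nth_cat; case: ltnP => // ji;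
  case E: (j - size P)%N => [|[|m]] //=.
- by rewrite count_cat (count_take Xi) ?addn0.
- by rewrite !count_cat /= Bc.
- by rewrite mem_cat orbC; case: (boolP (c \in X)) => // /Xge; rewrite leqNgt cb.
- rewrite !mem_cat !inE; congr (_ || _); case: eqP => //= _.
  by apply/negP => /Bge; lia.
- by lia.
- by rewrite !mem_cat !inE eqxx orbT.
Qed.

(* In the selected fibre the letters of the upper row below b are smaller than b - 1, hence
   commute with the tail of the lower row. *)
Lemma isel_comm (P : seq (seq nat)) (a1 b1 : seq nat) (Q : seq (seq nat)) (i k1 : nat) :
  let b := (b0 + k1)%N in
  (i < l')%N -> size P = i -> a1 \in subs (iota b0 k1) -> b1 \in subs (iota b0 k1) ->
  isel (P ++ a1 :: (b1 ++ [:: b]) :: Q) i b ->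
  size a1 = size b1 /\ forall y, y \in a1 -> (y.+1 < b)%N.
Proof.
move=> b il sP ai bi; have ca := count_low ai; have cb := count_low bi; rewrite -/b in ca cb.
have n0 : nth [::] (P ++ a1 :: (b1 ++ [:: b]) :: Q) i = a1 by rewrite nth_cat sP ltnn subnn.
have n1 : nth [::] (P ++ a1 :: (b1 ++ [:: b]) :: Q) i.+1 = b1 ++ [:: b].
  by rewrite nth_cat sP ltnNge leqnSn /= subSnn.
move=> /and3P[/andP[_]]; rewrite n0 n1 count_cat /= ltnn addn0 ca cb => ab /allP none _.
have gd c : (c < b)%N -> c \in b1 -> (count (ltn^~ c) b1 < count (ltn^~ c) a1)%N.
  move=> cltb cb1; have := none c; rewrite mem_iota => /(_ cltb) /allP /(_ i); rewrite mem_iota => /(_ il).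
  rewrite /vio n0 n1 mem_cat cb1 /= -ltnNge count_cat /=.
  by rewrite [(b < c)%N]ltnNge (ltnW cltb) !addn0.
case/lastP: b1 => [|b1 m] in bi cb n0 n1 ab none gd *.
  by move: ab; rewrite leqn0 => /nilP->.
move: bi; rewrite mem_subs ?sorted_iota // => /andP[sb /allP bL].
have mb : (m < b)%N by have := bL m; rewrite mem_rcons mem_head mem_iota => /(_ isT) /andP[].
have := gd m mb; rewrite mem_rcons mem_head => /(_ isT).
have -> : count (ltn^~ m) (rcons b1 m) = size b1.
  rewrite -cats1 count_cat /= ltnn !addn0; apply/eqP; rewrite -all_count.
  by move: sb; rewrite -rev_sorted rev_rcons /= (path_sortedE gtn_trans) all_rev => /andP[].
move=> H1; have H2 := count_size (ltn^~ m) a1.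
rewrite addn0 in ab.
have E : size a1 = size (rcons b1 m).
  by apply/eqP; rewrite eqn_leq ab size_rcons (leq_trans H1 H2).
split=> // y ya; suff : (y < m)%N by move/leq_ltn_trans; apply.
have : count (ltn^~ m) a1 == size a1 by rewrite eqn_leq H2 E size_rcons H1.
by rewrite -all_count => /allP; apply.
Qed.

Definition fib (b k d s x y : nat) : A :=
  \sum_(X <- subs (iota b k.+1)) \sum_(B <- subs (iota b.+1 k))
    (u b * Wd u B * Wd u X) *+ (cpd d.+1 x (s + size X) * cpd d y (s.+1 + size B)).

(** The bad terms are grouped by the data unaffected by the exchange, namely the other rows and the
    prefixes below [b]. The entries [c i0] and [c i1] then occur in the factor [fib] only. *)
Lemma TbadE i k1 k2 j (c : 'I_l -> nat) (i0 i1 : 'I_l) : let b := (b0 + k1)%N in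
  i0 = i :> nat -> i1 = i.+1 :> nat -> N = (k1 + k2.+1)%N -> l = (i + j.+2)%N ->
  Tbad i b c = \sum_(P <- lsts (subs L) i) \sum_(a1 <- subs (iota b0 k1))
    \sum_(b1 <- subs (iota b0 k1)) \sum_(Q <- lsts (subs L) j)
     if isel (P ++ a1 :: (b1 ++ [:: b]) :: Q) i b then
       (Wd u (flatten (rev Q)) * Wd u b1 * Wd u a1 *
        fib b k2 (l' - i.+1) (size a1) (c i0) (c i1) * Wd u (flatten (rev P)))
       *+ (co (nats c) 0 P * co (nats c) i.+2 Q)
     else 0.
Proof.
move=> b e0 e1 NE lE; rewrite /Tbad big_mkcond lE big_lsts_cat big_seq [RHS]big_seq.
have il : (i < l')%N by move: lE; lia.
have LE : L = iota b0 k1 ++ b :: iota b.+1 k2 by rewrite NE iotaD.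
apply: eq_bigr => P Pi; have sP := size_lsts Pi.
rewrite 2!lstsS big_allpairs_dep.
under eq_bigr do rewrite big_allpairs_dep.
rewrite LE big_subs_cat -LE big_seq [RHS]big_seq; apply: eq_bigr => a1 ai.
transitivity (\sum_(X <- subs (b :: iota b.+1 k2)) \sum_(b1 <- subs (iota b0 k1))
  \sum_(b2 <- subs (b :: iota b.+1 k2)) \sum_(Q <- lsts (subs L) j)
   (if isel (P ++ (a1 ++ X) :: (b1 ++ b2) :: Q) i b then
     Wd u (flatten (rev (P ++ (a1 ++ X) :: (b1 ++ b2) :: Q))) *+
      co (nats c) 0 (P ++ (a1 ++ X) :: (b1 ++ b2) :: Q) else 0)).
  by apply: eq_bigr => X _; rewrite LE big_subs_cat -LE.
rewrite exchange_big big_seq [RHS]big_seq; apply: eq_bigr => b1 bi.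
under eq_bigr do rewrite exchange_big.
rewrite exchange_big; apply: eq_bigr => Q _.
case: ifP => sel; last first.
  rewrite big1_seq // => X /andP[_ Xi]; rewrite big_cat big_map /= !big1_seq ?addr0 //.
    by move=> B /andP[_ Bi]; rewrite (isel_prefix _ _ _ sP Xi Bi) sel.
  move=> B /andP[_ Bi]; case: ifP => // /and3P[/andP[+ _] _ _].
  rewrite nth_cat sP ltnNge leqnSn /= subSnn /= mem_cat => /orP[bb|bb].
    by move: bi; rewrite mem_subs ?sorted_iota // => /andP[_ /allP/(_ _ bb)]; rewrite mem_iota /b ltnn andbF.
  by move: Bi; rewrite mem_subs ?sorted_iota // => /andP[_ /allP/(_ _ bb)]; rewrite mem_iota ltnn.
have [sz cm] := isel_comm il sP ai bi sel.
rewrite /fib mulr_sumr mulr_suml -sumrMnl big_seq [RHS]big_seq; apply: eq_bigr => X Xi.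
rewrite mulr_sumr mulr_suml -sumrMnl big_cat big_map /= [X in X + _]big1_seq ?add0r; last first.
  move=> B /andP[_ Bi]; case: ifP => // /and3P[/andP[+ _] _ _].
  rewrite nth_cat sP ltnNge leqnSn /= subSnn /= mem_cat => /orP[bb|bb].
    by move: bi; rewrite mem_subs ?sorted_iota // => /andP[_ /allP/(_ _ bb)]; rewrite mem_iota /b ltnn andbF.
  by move: Bi; rewrite mem_subs ?sorted_iota // => /andP[_ /allP/(_ _ bb)]; rewrite mem_iota ltnn.
rewrite big_seq [RHS]big_seq; apply: eq_bigr => B Bi.
rewrite (isel_prefix _ _ _ sP Xi Bi) sel.
(* By [isel_comm] the prefix of the upper row commutes past the tail of the lower row, which brings
   the two tails together. *)
have far : Wd u a1 * Wd u (b :: B) = Wd u (b :: B) * Wd u a1.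
  apply: Wd_far2 => x y xa; rewrite inE => /orP[/eqP->|yB]; first exact: cm.
  move: Bi; rewrite mem_subs ?sorted_iota // => /andP[_ /allP/(_ _ yB)].
  by rewrite mem_iota => /andP[h _]; have := cm _ xa; lia.
have -> : Wd u (flatten (rev (P ++ (a1 ++ X) :: (b1 ++ b :: B) :: Q))) =
  Wd u (flatten (rev Q)) * Wd u b1 * Wd u a1 * (u b * Wd u B * Wd u X) * Wd u (flatten (rev P)).
  rewrite rev_cat !rev_cons flatten_cat !flatten_rcons !Wd_cat -Wd_cons !mulrA.
  by congr (_ * _ * _); rewrite -!mulrA far.
rewrite mulrnAr mulrnAl -mulrnA; congr (_ *+ _).
rewrite co_cat /= add0n sP -e0 natsE e0 -e1 natsE e1 !size_cat /= sz.
rewrite (_ : (l' - i)%N = (l' - i.+1).+1); last by lia.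
rewrite addnS addSn; lia.
Qed.

Lemma Tbad_swap i b (c : 'I_l -> nat) (i0 i1 : 'I_l) :
  i0 = i :> nat -> i1 = i.+1 :> nat -> b \in L ->
  Tbad i b (c \o tperm i0 i1) = Tbad i b c.
Proof.
move=> e0 e1; rewrite mem_iota => /andP[b0b bN].
have il : (i < l')%N by rewrite -e1; have := ltn_ord i1; rewrite ltnS e1.
have -> : b = (b0 + (b - b0))%N by lia.
have NE : N = (b - b0 + (N - (b - b0)).-1.+1)%N by lia.
have lE : l = (i + (l' - i.+1).+2)%N by lia.
rewrite !(@TbadE _ _ _ _ _ i0 i1 e0 e1 NE lE) /= tpermL tpermR.
have tl j : j != i -> j != i.+1 -> nats (c \o tperm i0 i1) j = nats c j.
  move=> ji ji1; rewrite /nats; case: insubP => // k _ kj /=; rewrite tpermD //.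
    by apply/eqP => E; move: ji; rewrite -kj -E /= e0 eqxx.
  by apply/eqP => E; move: ji1; rewrite -kj -E /= e1 eqxx.
rewrite big_seq [RHS]big_seq; apply: eq_bigr => P Pi; have sP := size_lsts Pi.
apply: eq_bigr => a1 _; apply: eq_bigr => b1 _.
rewrite big_seq [RHS]big_seq; apply: eq_bigr => Q Qi; case: ifP => // _.
congr (_ *+ _); first by congr (_ * _ * _); rewrite /fib; apply: fiber_sym.
by congr (_ * _)%N; apply: eq_co => j; rewrite ?sP => hj; apply: tl; apply/eqP => E; move: hj; rewrite E; lia.
Qed.

(** For each selected violation the bad terms are invariant under exchanging two adjacent entries of
    [c], hence vanish after antisymmetrisation. *)
Lemma phase_one (tf : forall x : A, x + x = 0 -> x = 0) (c : 'I_l -> nat) :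
  altn (fun c => \prod_(j <- rev (iota 0 l)) hA (nats c j) (l' - j)) c =
  altn (fun c => \sum_(R <- lsts (subs L) l | goodA R) Wd u (flatten (rev R)) *+ co (nats c) 0 R) c.
Proof.
transitivity (altn (fun c =>
   (\sum_(R <- lsts (subs L) l | goodA R) Wd u (flatten (rev R)) *+ co (nats c) 0 R) +
   \sum_(i <- iota 0 l') \sum_(b <- L) Tbad i b c) c).
  by congr altn; apply/funext => c'; rewrite -sum_lsts_co (bigID goodA) /= sum_bad.
rewrite altnD [X in _ + X](_ : _ = 0) ?addr0 // /altn.
under eq_bigr do rewrite mulr_sumr; rewrite exchange_big big1_seq // => i /andP[_].
rewrite mem_iota add0n => il.
under eq_bigr do rewrite mulr_sumr; rewrite exchange_big big1_seq // => b /andP[_ bL].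
have il1 : (i < l)%N by apply: ltnW.
pose i0 : 'I_l := Ordinal il1; pose i1 : 'I_l := Ordinal (il : (i.+1 < l)%N).
apply: (altn_sym0 tf (f := Tbad i b) (t := tperm i0 i1)).
  by rewrite odd_tperm; apply/eqP => /(congr1 val) /= /n_Sn.
by move=> c'; apply: Tbad_swap.
Qed.

End PhaseOne.

(** * The Hecke operators satisfy the 0-Hecke relations, and become matrices *)

Lemma swap_lettersK i : involutive (swap_letters i).
Proof. by move=> x; rewrite /swap_letters; do !case: eqP => //; lia. Qed.

Lemma index_swap i x s : index x (map (swap_letters i) s) = index (swap_letters i x) s.
Proof. by rewrite -{1}[x](swap_lettersK i) index_map //; apply: inv_inj (swap_lettersK i). Qed.

Lemma swapE i x : swap_letters i x = if x == i then i.+1 else if x == i.+1 then i else x.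
Proof. by []. Qed.

Lemma hecke_op_idem i s : hecke_op i (hecke_op i s) = hecke_op i s.
Proof.
rewrite {2 3}/hecke_op; case: ifP => h; rewrite /hecke_op ?h // !index_swap !swapE eqxx.
by rewrite gtn_eqF // eqxx; case: ifP => //; lia.
Qed.

Lemma hecke_op_far i j s : i.+1 < j -> hecke_op i (hecke_op j s) = hecke_op j (hecke_op i s).
Proof.
move=> ij; rewrite /hecke_op.
have E k x : swap_letters k x = x \/ x = k \/ x = k.+1.
  by rewrite swapE; do !case: eqP; auto.
have [Ei Ei1] : swap_letters j i = i /\ swap_letters j i.+1 = i.+1.
  by split; rewrite swapE; do !case: eqP => //; lia.
have [Ej Ej1] : swap_letters i j = j /\ swap_letters i j.+1 = j.+1.
  by split; rewrite swapE; do !case: eqP => //; lia.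
case hj: (index j s < _); case hi: (index i s < _);
  rewrite ?index_swap ?Ei ?Ei1 ?Ej ?Ej1 ?hi ?hj //.
rewrite -!map_comp; apply: eq_map => x /=; rewrite !swapE.
by do !case: eqP => //; lia.
Qed.

Lemma hecke_op_braid i s :
  hecke_op i (hecke_op i.+1 (hecke_op i s)) = hecke_op i.+1 (hecke_op i (hecke_op i.+1 s)).
Proof.
have [E1 [E2 E3]] : [/\ swap_letters i i = i.+1, swap_letters i i.+1 = i & swap_letters i i.+2 = i.+2].
  by split; rewrite swapE; do !case: eqP => //; lia.
have [F1 [F2 F3]] : [/\ swap_letters i.+1 i = i, swap_letters i.+1 i.+1 = i.+2 & swap_letters i.+1 i.+2 = i.+1].
  by split; rewrite swapE; do !case: eqP => //; lia.
have EF := (E1, E2, E3, F1, F2, F3).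
have brd x : swap_letters i (swap_letters i.+1 (swap_letters i x)) =
             swap_letters i.+1 (swap_letters i (swap_letters i.+1 x)).
  by rewrite !swapE; do !case: eqP => //; lia.
rewrite /hecke_op.
case h1: (index i s < index i.+1 s); case h2: (index i.+1 s < index i.+2 s);
case h3: (index i s < index i.+2 s);
 rewrite ?index_swap ?EF ?h1 ?h2 ?h3 ?index_swap ?EF ?h1 ?h2 ?h3
  ?index_swap ?EF ?h1 ?h2 ?h3 //; try lia.
all: rewrite -?map_comp.
- by apply: eq_map => x /=; apply: brd.
- by case: ifP => //; lia.
- by case: ifP => //; lia.
Qed.

Section HeckeMatrix.
Variable n : nat.
Local Notation St := (n.-tuple 'I_n.+1).
Local Open Scope ring_scope.

(** Maps are turned into permutation-like matrices so that words in the operators can be added. *)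
Definition fmx (T : finType) (f : T -> T) : 'M[int]_#|T| :=
  \matrix_(s, t) (enum_val s == f (enum_val t))%:R.

Lemma fmxM (T : finType) (f g : T -> T) : fmx f *m fmx g = fmx (f \o g).
Proof.
apply/matrixP => s t; rewrite !mxE (bigD1 (enum_rank (g (enum_val t)))) //= !mxE enum_rankK eqxx mulr1.
rewrite big1 ?addr0 // => r; rewrite !mxE => rt.
case: eqP => _; rewrite ?mul0r // mul1r; case: eqP => // E.
by rewrite -E enum_valK eqxx in rt.
Qed.

Lemma eq_fmx (T : finType) (f g : T -> T) : f =1 g -> fmx f = fmx g.
Proof. by move=> fg; apply/matrixP => s t; rewrite !mxE fg. Qed.

Lemma fmx_id (T : finType) : fmx (@id T) = 1%:M.
Proof. by apply/matrixP => s t; rewrite !mxE (inj_eq enum_val_inj). Qed.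

(** An index outside 1, ..., n - 1 acts as the identity, so that the relations hold for all natural
    indices. *)
Definition hst (i : nat) (t : St) : St :=
  if (0 < i < n)%N && (index i (map val t) < index i.+1 (map val t))%N
  then map_tuple (fun x : 'I_n.+1 => inord (swap_letters i x) : 'I_n.+1) t else t.

Lemma hstE i (t : St) : (0 < i < n)%N -> map val (hst i t) = hecke_op i (map val t).
Proof.
move=> hi; rewrite /hst /hecke_op hi /=; case: ifP => // _.
rewrite -!map_comp; apply: eq_map => x /=; rewrite inordK // ltnS swapE.
by have := ltn_ord x; move: hi; do !case: eqP => //; lia.
Qed.

Lemma hst_out i (t : St) : ~~ (0 < i < n)%N -> hst i t = t.
Proof. by rewrite /hst => /negbTE->. Qed.

Definition hmx (i : nat) : 'M[int]_#|{: St}| := fmx (hst i).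

Lemma tuple_val_inj (s t : St) : map val s = map val t -> s = t.
Proof. by move=> E; apply: val_inj; apply: inj_map val_inj _ _ E. Qed.

Lemma hmx_idem i : hmx i * hmx i = hmx i.
Proof.
rewrite /hmx [LHS]fmxM; apply: eq_fmx => t /=; case hi: (0 < i < n)%N; last by rewrite !hst_out ?hi.
by apply: tuple_val_inj; rewrite !hstE // hecke_op_idem.
Qed.

Lemma hmx_far i j : (i.+1 < j)%N -> hmx i * hmx j = hmx j * hmx i.
Proof.
move=> ij; rewrite /hmx [LHS]fmxM [RHS]fmxM; apply: eq_fmx => t /=.
case hi: (0 < i < n)%N; last by rewrite !(@hst_out i) ?hi.
case hj: (0 < j < n)%N; last by rewrite !(@hst_out j) ?hj.
by apply: tuple_val_inj; rewrite !hstE // hecke_op_far.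
Qed.

Lemma hmx_braid i : hmx i * hmx i.+1 * hmx i = hmx i.+1 * hmx i * hmx i.+1.
Proof.
rewrite /hmx; do ![rewrite [fmx _ * _]fmxM]; apply: eq_fmx => t /=.
case hi: (0 < i < n)%N; case hj: (0 < i.+1 < n)%N; try by move: hi hj; lia.
- by apply: tuple_val_inj; rewrite !hstE // hecke_op_braid.
- rewrite !(@hst_out i.+1) ?hj //.
  by apply: tuple_val_inj; rewrite !hstE // hecke_op_idem.
- rewrite !(@hst_out i) ?hi //.
  by apply: tuple_val_inj; rewrite !hstE // hecke_op_idem.
- by rewrite !(@hst_out i) ?(@hst_out i.+1) ?hi ?hj.
Qed.

Lemma iota_St : exists t : St, map val t = iota 1 n.
Proof.
exists (map_tuple (fun i : 'I_n => inord i.+1 : 'I_n.+1) (ord_tuple n)).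
rewrite -[map val _]/(map val (map _ (val (ord_tuple n)))) val_ord_tuple -map_comp; apply: (@eq_from_nth _ 0); rewrite size_map ?size_iota size_enum_ord // => i hi.
by rewrite (nth_map (Ordinal hi)) ?size_enum_ord //= inordK ?ltnS nth_enum_ord ?nth_iota.
Qed.

Lemma one_line_St (w : 'S_n) : exists t : St, map val t = one_line w.
Proof.
exists (map_tuple (fun i : 'I_n => inord (w i).+1 : 'I_n.+1) (ord_tuple n)).
by rewrite -[map val _]/(map val (map _ (val (ord_tuple n)))) val_ord_tuple -map_comp; apply: eq_map => i /=; rewrite inordK // ltnS.
Qed.

Lemma hmx_word v s t : all (fun i => (0 < i < n)%N) v ->
  Wd hmx v (enum_rank s) (enum_rank t) = (map val s == foldr hecke_op (map val t) v)%:R.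
Proof.
move=> va; have -> : Wd hmx v = fmx (foldr (fun i f => hst i \o f) id v).
  elim: v {va} => [|i v IH]; rewrite /Wd ?big_nil ?fmx_id // big_cons -fmxM.
  by rewrite -IH.
rewrite mxE !enum_rankK; congr (nat_of_bool _)%:R.
have -> : foldr hecke_op (map val t) v = map val (foldr (fun i f => hst i \o f) id v t).
  elim: v va => [|i v IH] //= /andP[hi /IH ->]; by rewrite hstE.
by rewrite (inj_eq (@tuple_val_inj)).
Qed.

End HeckeMatrix.

(** * A commutative ring containing the complete elements *)

Section Bicommutant.
Variables (A : pzRingType) (h : nat -> A).
Hypothesis hC : forall i j, (h i * h j = h j * h i)%R.
Local Open Scope ring_scope.

(** Elements commuting with everything that commutes with all [h r]. As the [h r] commute with each
    other, they belong to this subring and it is commutative. *)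
Definition bicom : {pred A} :=
  [pred x | `[< forall y, (forall r, y * h r = h r * y) -> y * x = x * y >]].

Lemma bicom_closed : subring_closed bicom.
Proof.
split => [|x z /asboolP hx /asboolP hz|x z /asboolP hx /asboolP hz]; apply/asboolP => y hy.
- by rewrite mulr1 mul1r.
- by rewrite mulrBr mulrBl hx ?hz.
- by rewrite mulrA hx // -mulrA hz // mulrA.
Qed.

HB.instance Definition _ := GRing.isSubringClosed.Build A bicom bicom_closed.

Record bicomT (hc : forall i j, h i * h j = h j * h i) :=
  Bicom {bival : A; _ : bival \in bicom}.

Local Notation C := (bicomT hC).
HB.instance Definition _ := [isSub for @bival hC].
HB.instance Definition _ := [Choice of C by <:].
HB.instance Definition _ := GRing.SubChoice_isSubPzRing.Build A (mem bicom) C bicom_closed.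

Lemma bicom_mulC : commutative (@GRing.mul C).
Proof.
move=> x y; apply: val_inj; rewrite !rmorphM /=.
have /asboolP := valP y; apply=> r.
have /asboolP /(_ (h r)) H := valP x.
by rewrite H.
Qed.

HB.instance Definition _ := GRing.PzRing_hasCommutativeMul.Build C bicom_mulC.

Lemma mem_bicom r : h r \in bicom.
Proof. by apply/asboolP => y. Qed.

Definition bic r : C := Bicom hC (mem_bicom r).

End Bicommutant.

(** * Hook words and their two splittings *)

(** The length of the longest weakly increasing prefix. *)
Fixpoint upl (v : seq nat) : nat :=
  if v is x :: v' then (if v' is y :: _ then (if x <= y then (upl v').+1 else 1) else 1) else 0.
Definition up v := take (upl v) v.
Definition dn v := drop (upl v) v.
Definition hook v := sorted gtn (dn v).

Lemma up_dn v : up v ++ dn v = v. Proof. exact: cat_take_drop. Qed.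

Lemma up_cons x y v : up (x :: y :: v) = if x <= y then x :: up (y :: v) else [:: x].
Proof. by rewrite /up /=; case: ifP. Qed.
Lemma dn_cons x y v : dn (x :: y :: v) = if x <= y then dn (y :: v) else y :: v.
Proof. by rewrite /dn /=; case: ifP. Qed.

Lemma sorted_up v : sorted leq (up v).
Proof.
elim: v => [|x [|y v] IH] //; rewrite up_cons; case: ifP => // xy.
move: IH; case E: (up (y :: v)) => [|z s] //= ->; rewrite andbT.
have : head 0 (up (y :: v)) = y by case: (v) => [|w t]; rewrite ?up_cons //; case: ifP.
by rewrite E /= => ->.
Qed.

Lemma head_dn v d D : dn v = d :: D -> exists2 U, up v = rcons U (last 0 (up v)) & d < last 0 (up v).
Proof.
elim: v => [|x [|y v] IH] //; rewrite up_cons dn_cons; case: ifP => xy.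
  move=> /IH[U E ld]; exists (x :: U).
    by rewrite E /= last_rcons -E.
  by rewrite /= E last_rcons; move: ld; rewrite E last_rcons; case: (up _).
by case=> <- _; exists [::] => //=; rewrite ltnNge xy.
Qed.

Lemma up_dnE U D : sorted leq U -> (if D is d :: _ then (U != [::]) && (d < last 0 U) else true) ->
  up (U ++ D) = U /\ dn (U ++ D) = D.
Proof.
elim: U => [|x U IH]; first by case: D.
case: U IH => [|y U] IH.
  clear IH.
  case: D => [|d D] //= _ dx; rewrite up_cons dn_cons leqNgt dx //.
move=> /= /andP[xy sU] hD; rewrite up_cons dn_cons xy.
have [|E1 E2] := IH sU; first by case: (D) hD.
by split; [congr (_ :: _); exact: E1 | exact: E2].
Qed.

(** The cut of a hook word can only lie just after its peak, where [up] puts it, or just before. *)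
Lemma split_cases U D : sorted leq U -> sorted gtn D ->
  (up (U ++ D) = U /\ dn (U ++ D) = D) \/
  exists M D0, [/\ D = M :: D0, up (U ++ D) = rcons U M, dn (U ++ D) = D0, all (leq^~ M) U & all (ltn^~ M) D0].
Proof.
move=> sU; case: D => [|M D0] sD; first by left; apply: up_dnE.
have [h|h] := boolP ((U != [::]) && (M < last 0 U)); first by left; apply: up_dnE.
right; exists M, D0; rewrite -cat_rcons.
have aU : all (leq^~ M) U.
  case/lastP: U sU h => [|U m] sU //; rewrite last_rcons.
  have -> : rcons U m != [::] by case: (U).
  rewrite /= -leqNgt => mM; rewrite all_rcons mM /=; move: sU.
  rewrite -[rcons U m]revK rev_sorted rev_rcons /= (path_sortedE (rev_trans leq_trans)) all_rev => /andP[h _].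
  by apply: sub_all h => u /= um; apply: leq_trans mM.
have aD : all (ltn^~ M) D0 by move: sD; rewrite /= (path_sortedE gtn_trans) => /andP[].
have sM : sorted leq (rcons U M).
  rewrite -[rcons U M]revK rev_sorted rev_rcons /= (path_sortedE (rev_trans leq_trans)) all_rev rev_sorted sU andbT //.
have [|-> ->] := up_dnE sM (D := D0); last by [].
case: (D0) aD => // d D' /= /andP[dM _]; rewrite last_rcons dM andbT.
by case: (U).
Qed.

Lemma hook_cat U D : sorted leq U -> sorted gtn D -> hook (U ++ D).
Proof.
move=> sU sD; rewrite /hook; case: (split_cases sU sD) => [[_ ->]//|[M [D0 [E _ -> _ _]]]].
by move: sD; rewrite E; apply: path_sorted.
Qed.

(** * The lattice condition on consecutive rows and its behaviour under insertion *)

Section Good.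
Implicit Types U D : seq nat.

Definition cle r U := count (leq^~ r) U.
Definition clt r U := count (ltn^~ r) U.
Definition cge r U := count (leq r) U.
Definition cgt r U := count (ltn r) U.

Lemma cle_cat r U V : cle r (U ++ V) = cle r U + cle r V. Proof. exact: count_cat. Qed.
Lemma clt_cat r U V : clt r (U ++ V) = clt r U + clt r V. Proof. exact: count_cat. Qed.
Lemma cge_cat r U V : cge r (U ++ V) = cge r U + cge r V. Proof. exact: count_cat. Qed.
Lemma cgt_cat r U V : cgt r (U ++ V) = cgt r U + cgt r V. Proof. exact: count_cat. Qed.
Lemma cle_cons r a V : cle r (a :: V) = (a <= r) + cle r V. Proof. by []. Qed.
Lemma clt_cons r a V : clt r (a :: V) = (a < r) + clt r V. Proof. by []. Qed.
Lemma cge_cons r a V : cge r (a :: V) = (r <= a) + cge r V. Proof. by []. Qed.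
Lemma cgt_cons r a V : cgt r (a :: V) = (r < a) + cgt r V. Proof. by []. Qed.
Lemma cle_nil r : cle r [::] = 0. Proof. by []. Qed.
Lemma clt_nil r : clt r [::] = 0. Proof. by []. Qed.
Lemma cge_nil r : cge r [::] = 0. Proof. by []. Qed.
Lemma cgt_nil r : cgt r [::] = 0. Proof. by []. Qed.
Definition cE := (size_cat, cle_cat, clt_cat, cge_cat, cgt_cat, cle_cons, clt_cons, cge_cons, cgt_cons,
  cle_nil, clt_nil, cge_nil, cgt_nil).
Lemma cle_size r U : cle r U <= size U. Proof. exact: count_size. Qed.
Lemma clt_size r U : clt r U <= size U. Proof. exact: count_size. Qed.

(* Stembridge's lattice condition for two consecutive letters of a primed tableau, where
   U, D list the rows of its unprimed and primed occurrences. *)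
Definition G (U1 D1 U2 D2 : seq nat) : Prop :=
  [/\ forall r, cle r U2 <= clt r U1,
      forall d, d \in D2 -> cle d U2 < clt d U1,
      forall r, size U2 + cge r D2 <= size U1 + cge r D1
    & forall a, a \in U1 -> size U2 + cgt a D2 < size U1 + cge a D1].

Lemma c_le_all m r U : all (leq^~ m) U -> m <= r -> cle r U = size U.
Proof. by move=> aU mr; apply/eqP; rewrite -all_count; apply: sub_all aU => a /= /leq_trans; apply. Qed.
Lemma c_lt_all m r U : all (leq^~ m) U -> m < r -> clt r U = size U.
Proof. by move=> aU mr; apply/eqP; rewrite -all_count; apply: sub_all aU => a /= /leq_ltn_trans; apply. Qed.
Lemma c_le_none m r U : all (leq m) U -> r < m -> cle r U = 0.
Proof.
move=> /allP aU mr; apply/eqP; rewrite -leqn0 leqNgt -has_count; apply/hasPn => a /aU /= h.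
by rewrite -ltnNge (leq_trans mr).
Qed.
Lemma c_lt_none m r U : all (leq m) U -> r <= m -> clt r U = 0.
Proof.
move=> /allP aU mr; apply/eqP; rewrite -leqn0 leqNgt -has_count; apply/hasPn => a /aU /= h.
by rewrite -leqNgt (leq_trans mr).
Qed.
Lemma c_ge_all m r D : all (leq m) D -> r <= m -> cge r D = size D.
Proof. by move=> aU mr; apply/eqP; rewrite -all_count; apply: sub_all aU => a /=; apply: leq_trans. Qed.
Lemma c_gt_all m r D : all (leq m) D -> r < m -> cgt r D = size D.
Proof. by move=> aU mr; apply/eqP; rewrite -all_count; apply: sub_all aU => a /=; apply: leq_trans. Qed.
Lemma c_ge_none m r D : all (leq^~ m) D -> m < r -> cge r D = 0.
Proof.
move=> /allP aU mr; apply/eqP; rewrite -leqn0 leqNgt -has_count; apply/hasPn => a /aU /= h.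
by rewrite -ltnNge (leq_ltn_trans h).
Qed.
Lemma c_gt_none m r D : all (leq^~ m) D -> m <= r -> cgt r D = 0.
Proof.
move=> /allP aU mr; apply/eqP; rewrite -leqn0 leqNgt -has_count; apply/hasPn => a /aU /= h.
by rewrite -leqNgt (leq_trans h).
Qed.
Lemma c_le_mono r s U : r <= s -> cle r U <= cle s U.
Proof. by move=> rs; apply: sub_count => a /= /leq_trans; apply. Qed.
Lemma c_lt_mono r s U : r <= s -> clt r U <= clt s U.
Proof. by move=> rs; apply: sub_count => a /= /leq_trans; apply. Qed.
Lemma c_ge_mono r s D : r <= s -> cge s D <= cge r D.
Proof. by move=> rs; apply: sub_count => a /=; apply: leq_trans. Qed.
Lemma c_gt_mono r s D : r <= s -> cgt s D <= cgt r D.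
Proof. by move=> rs; apply: sub_count => a /=; apply: leq_ltn_trans. Qed.
Lemma c_gt_ge r s D : r < s -> cge s D <= cgt r D.
Proof. by move=> rs; apply: sub_count => a /=; apply: leq_trans. Qed.
Lemma c_ge_gt r D : cge r.+1 D = cgt r D.
Proof. by []. Qed.

(** Together with [flip_up]: a peak may be counted as primed or unprimed without affecting [G].
    Hence [G] is a property of the two rows as words ([goodE]), and each proof may choose the
    convenient splitting. *)
Lemma flip_low U1 D1 U2 M D2 : all (leq^~ M) U2 -> all (ltn^~ M) D2 ->
  G U1 D1 (rcons U2 M) D2 <-> G U1 D1 U2 (M :: D2).
Proof.
move=> aU aD; rewrite -cats1.
have aD' : all (leq^~ M) D2 by apply: sub_all aD => d /ltnW.
split => -[g1 g2 g3 g4]; split.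
- by move=> r; have := g1 r; rewrite !cE; lia.
- move=> d; rewrite inE => /orP[/eqP->|dD]; last by have := g2 d dD; rewrite !cE; lia.
  by have := g1 M; rewrite !cE leqnn; lia.
- by move=> r; have := g3 r; rewrite !cE /=; lia.
- by move=> a aU1; have := g4 a aU1; rewrite !cE /=; lia.
- move=> r; have := g1 r; rewrite !cE addn0; case: (leqP M r) => Mr; last by lia.
  have := g2 M (mem_head _ _); rewrite !(c_le_all aU) // => h.
  by have := c_lt_mono U1 Mr; lia.
- move=> d dD; have dM : d < M := allP aD d dD.
  by have := g2 d; rewrite inE dD orbT !cE [M <= d]leqNgt dM => /(_ isT); lia.
- move=> r; have := g3 r; rewrite !cE /=; case: (leqP r M) => rM; first by lia.
  rewrite (c_ge_none aD' rM).
  have h := g2 M (mem_head _ _); rewrite (c_le_all aU) // in h.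
  by have := clt_size M U1; lia.
- move=> a aU1; have := g4 a aU1; rewrite !cE /=; case: (leqP M a) => aM; last by lia.
  rewrite (c_gt_none aD' aM).
  have h := g2 M (mem_head _ _); rewrite (c_le_all aU) // in h.
  suff : clt M U1 < size U1 by lia.
  rewrite ltn_neqAle clt_size andbT -all_count; apply/allPn; exists a => //=.
  by rewrite -leqNgt.
Qed.

Lemma flip_up U1 M D1 U2 D2 : all (leq^~ M) U1 -> all (ltn^~ M) D1 ->
  G (rcons U1 M) D1 U2 D2 <-> G U1 (M :: D1) U2 D2.
Proof.
move=> aU aD; rewrite -cats1.
have aD' : all (leq^~ M) D1 by apply: sub_all aD => d /ltnW.
split => -[g1 g2 g3 g4].
  have h4 : size U2 + cgt M D2 <= size U1.
    have := g4 M; rewrite mem_cat inE eqxx orbT !cE /= => /(_ isT).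
    have -> : cge M D1 = 0; last by lia.
    apply/eqP; rewrite -leqn0 leqNgt -has_count; apply/hasPn => d /(allP aD) /=.
    by rewrite ltnNge.
  split.
  - move=> r; have := g1 r; rewrite !cE; case: (ltnP M r) => Mr; last by lia.
    by rewrite (c_lt_all aU Mr); have := cle_size r U2; lia.
  - move=> d dD; have := g2 d dD; rewrite !cE; case: (ltnP M d) => Md; last by lia.
    rewrite (c_lt_all aU Md); have := cle_size d U2.
    have : 0 < cgt M D2 by rewrite -has_count; apply/hasP; exists d.
    by lia.
  - move=> r; have := g3 r; rewrite !cE /=; case: (leqP r M) => rM; first by lia.
    by rewrite (c_ge_none aD' rM); have := c_gt_ge D2 rM; lia.
  - move=> a aU1; have := g4 a; rewrite mem_cat aU1 !cE /= => /(_ isT).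
    by have := allP aU a aU1 => /= ->; lia.
have h3 := g3 M.+1; rewrite !cE ltnn (c_ge_none aD' (ltnSn M)) in h3.
split.
- by move=> r; have := g1 r; rewrite !cE; lia.
- by move=> d dD; have := g2 d dD; rewrite !cE; lia.
- by move=> r; have := g3 r; rewrite !cE /=; lia.
- move=> a; rewrite mem_cat inE => /orP[aU1|/eqP->]; rewrite !cE /=; last first.
    by rewrite c_ge_gt in h3; lia.
  by have := g4 a aU1; rewrite !cE (allP aU a aU1); lia.
Qed.

Definition good W1 W2 := G (up W1) (dn W1) (up W2) (dn W2).

Lemma goodE U1 D1 U2 D2 : sorted leq U1 -> sorted gtn D1 -> sorted leq U2 -> sorted gtn D2 ->
  good (U1 ++ D1) (U2 ++ D2) <-> G U1 D1 U2 D2.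
Proof.
move=> s1 t1 s2 t2; rewrite /good.
case: (split_cases s1 t1) => [[-> ->]|[M [D0 [E -> -> h1 h2]]]];
case: (split_cases s2 t2) => [[-> ->]|[M2 [D3 [E2 -> -> h3 h4]]]]; rewrite ?E ?E2 //.
- exact: flip_low.
- exact: flip_up.
- by rewrite flip_low // flip_up.
Qed.

Local Ltac bcase := repeat match goal with
  | |- context [nat_of_bool (leq ?a ?b)] => let h := fresh "hb" in case: (leqP a b) => h; try (exfalso; lia)
  end.

(* Inserting x into the first row (z leaves U1, y moves from D1 to U1, x enters D1) and z
   into the second. *)
Lemma fwd_bump Ua1 z Ua2 Da1 y Da2 x Ub1 z' Ub2 Db1 y' Db2 :
  all (leq^~ y) Ua1 -> y < z -> all (leq z) Ua2 -> y <= x ->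
  all (leq^~ y') Ub1 -> y' < z' -> all (leq z') Ub2 -> all (leq z.+1) Db1 -> y' <= z -> all (ltn^~ y') Db2 ->
  G (Ua1 ++ z :: Ua2) (Da1 ++ y :: Da2) (Ub1 ++ z' :: Ub2) (Db1 ++ y' :: Db2) ->
  G (Ua1 ++ y :: Ua2) (Da1 ++ x :: Da2) (Ub1 ++ y' :: Ub2) (Db1 ++ z :: Db2).
Proof.
move=> h1 h2 h3 h5 k1 k2 k3 k4 k5 k6 [g1 g2 g3 g4].
have k6' : all (leq^~ y') Db2 by apply: sub_all k6 => d /ltnW.
have G4 := g4 z ltac:(by rewrite mem_cat mem_head orbT).
have G2 := g2 y' ltac:(by rewrite mem_cat mem_head orbT).
rewrite !cE /= (c_gt_none k6' k5) (c_gt_all k4 (ltnSn z)) in G4.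
rewrite !cE (c_le_all k1 (leqnn y')) (c_le_none k3 k2) in G2.
have m1 r := @c_lt_mono y' r Ua1; have m2 r := @c_lt_mono y' r Ua2.
split.
- move=> r; have := g1 r; have := m1 r; have := m2 r; rewrite !cE.
  case: (leqP y' r) => yr; last by clear -yr h2 k2; bcase; lia.
  case: (ltnP r z') => rz; last by clear -yr rz h2; bcase; lia.
  rewrite (c_le_all k1 yr) (c_le_none k3 rz).
  by clear -G2 yr rz h2 k2; bcase; lia.
- move=> d; rewrite mem_cat inE => /orP[dD|/orP[/eqP->|dD]].
  + have zd : z < d := allP k4 d dD.
    have := g2 d; rewrite mem_cat dD => /(_ isT); rewrite !cE.
    have := @c_lt_mono z d Ua1; have := @c_lt_mono z d Ua2; have := m1 z; have := m2 z.
    case: (ltnP d z') => dz; last by clear -zd dz h2; bcase; lia.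
    have yd : y' <= d by lia.
    rewrite (c_le_all k1 yd) (c_le_none k3 dz).
    rewrite (c_lt_none h3 (leqnn z)).
    by clear -G2 zd dz h2 k5 yd; bcase; lia.
  + have := g1 z; have := m1 z; have := m2 z; rewrite !cE.
    case: (ltnP z z') => dz; last by clear -dz h2 k5; bcase; lia.
    rewrite (c_le_all k1 k5) (c_le_none k3 dz).
    by clear -G2 dz h2 k5; bcase; lia.
  + have dy : d < y' := allP k6 d dD.
    have := g2 d; rewrite mem_cat inE dD !orbT => /(_ isT); rewrite !cE.
    by clear -dy h2 k2 k5; bcase; lia.
- move=> r; have := g3 r; have := @c_ge_mono r z Da1; have := @c_ge_mono r z Da2; rewrite !cE /=.
  case: (leqP r z) => rz; last by clear -rz k5 h5 h2; bcase; lia.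
  case: (ltnP y' r) => yr; last by clear -yr rz k5 h5 h2; bcase; lia.
  rewrite (c_ge_all k4 (leqW rz)) (c_ge_none k6' yr).
  by clear -G4 yr rz k5 h5 h2; bcase; lia.
- move=> a; rewrite mem_cat inE => /orP[aU|/orP[/eqP->|aU]].
  + have ay : a <= y := allP h1 a aU.
    have := g4 a; rewrite mem_cat aU => /(_ isT); rewrite !cE /=.
    have := @c_ge_mono a z Da1; have := @c_ge_mono a z Da2.
    case: (ltnP a y') => ya; first by clear -ay ya k5 h5 h2; bcase; lia.
    rewrite (c_gt_none k6' ya) (c_gt_all k4 (_ : a < z.+1)); last by lia.
    by clear -G4 ay ya k5 h5 h2; bcase; lia.
  + have := g3 y.+1; rewrite !cE /= !c_ge_gt.
    have := @c_ge_mono y z Da1; have := @c_ge_mono y z Da2.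
    have := @c_gt_ge y.-1 y Da1; have := @c_ge_mono y y.+1 Da1; have := @c_ge_mono y y.+1 Da2.
    rewrite !c_ge_gt.
    case: (ltnP y y') => ya; first by clear -ya k5 h5 h2; bcase; lia.
    rewrite (c_gt_none k6' ya) (c_gt_all k4 (_ : y < z.+1)); last by lia.
    by clear -G4 ya k5 h5 h2; bcase; lia.
  + have za : z <= a := allP h3 a aU.
    have := g4 a; rewrite mem_cat inE aU !orbT => /(_ isT); rewrite !cE /=.
    by clear -za k5 h5 h2; bcase; lia.
Qed.

(** As [fwd_bump], with [z] appended to the second row instead of bumping in it. *)
Lemma fwd_app Ua1 z Ua2 Da1 y Da2 x Ub Db :
  all (leq^~ y) Ua1 -> y < z -> all (leq z) Ua2 -> y <= x -> all (leq z.+1) Db ->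
  G (Ua1 ++ z :: Ua2) (Da1 ++ y :: Da2) Ub Db ->
  G (Ua1 ++ y :: Ua2) (Da1 ++ x :: Da2) Ub (Db ++ [:: z]).
Proof.
move=> h1 h2 h3 h5 k4 [g1 g2 g3 g4].
have G4 := g4 z ltac:(by rewrite mem_cat mem_head orbT).
rewrite !cE /= (c_gt_all k4 (ltnSn z)) in G4.
split.
- by move=> r; have := g1 r; rewrite !cE; clear -h2; bcase; lia.
- move=> d; rewrite mem_cat inE => /orP[dD|/eqP->].
  + have zd : z < d := allP k4 d dD.
    by have := g2 d dD; rewrite !cE; clear -h2 zd; bcase; lia.
  + by have := g1 z; rewrite !cE; clear -h2; bcase; lia.
- move=> r; have := g3 r; have := @c_ge_mono r z Da1; have := @c_ge_mono r z Da2; rewrite !cE /=.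
  case: (leqP r z) => rz; last by clear -rz h5 h2; bcase; lia.
  rewrite (c_ge_all k4 (leqW rz)); by clear -G4 rz h5 h2; bcase; lia.
- move=> a; rewrite mem_cat inE => /orP[aU|/orP[/eqP->|aU]].
  + have ay : a <= y := allP h1 a aU.
    have := @c_ge_mono a z Da1; have := @c_ge_mono a z Da2; rewrite !cE /=.
    rewrite (c_gt_all k4 (_ : a < z.+1)); last by lia.
    by clear -G4 ay h5 h2; bcase; lia.
  + have := @c_ge_mono y z Da1; have := @c_ge_mono y z Da2; rewrite !cE /=.
    rewrite (c_gt_all k4 (_ : y < z.+1)); last by lia.
    by clear -G4 h5 h2; bcase; lia.
  + have za : z <= a := allP h3 a aU.
    have := g4 a; rewrite mem_cat inE aU !orbT => /(_ isT); rewrite !cE /=.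
    by clear -za h5 h2; bcase; lia.
Qed.

(* Reverse insertion: z' enters U2 and pushes y' into D2, which releases z; then z enters U1
   and pushes y into D1, which releases x. *)
Lemma bwd_bump Ua1 z Ua2 Da1 y Da2 x Ub1 z' Ub2 Db1 y' Db2 :
  all (leq^~ y) Ua1 -> y < z -> all (leq z) Ua2 -> all (leq x) Da1 -> y <= x -> all (ltn^~ y) Da2 ->
  all (leq^~ y') Ub1 -> y' < z' -> all (leq z.+1) Db1 -> y' <= z -> all (ltn^~ y') Db2 ->
  G (Ua1 ++ y :: Ua2) (Da1 ++ x :: Da2) (Ub1 ++ y' :: Ub2) (Db1 ++ z :: Db2) ->
  G (Ua1 ++ z :: Ua2) (Da1 ++ y :: Da2) (Ub1 ++ z' :: Ub2) (Db1 ++ y' :: Db2).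
Proof.
move=> h1 h2 h3 h4 h5 h6 k1 k2 k4 k5 k6 [g1 g2 g3 g4].
have k6' : all (leq^~ y') Db2 by apply: sub_all k6 => d /ltnW.
have h6' : all (leq^~ y) Da2 by apply: sub_all h6 => d /ltnW.
have G4 := g4 y ltac:(by rewrite mem_cat mem_head orbT).
have G2 := g2 z ltac:(by rewrite mem_cat mem_head orbT).
have sD2 : cge y Da2 = 0.
  apply/eqP; rewrite -leqn0 leqNgt -has_count; apply/hasPn => d /(allP h6) /=; by rewrite ltnNge.
rewrite !cE /= (c_ge_all h4 h5) sD2 in G4.
rewrite !cE (c_lt_all h1 h2) (c_lt_none h3 (leqnn z)) in G2.
split.
- move=> r; have := g1 r; have := @c_le_mono r z Ub1; have := @c_le_mono r z Ub2; rewrite !cE.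
  case: (ltnP y r) => yr; last by clear -yr h2 k2; bcase; lia.
  case: (leqP r z) => rz; last by clear -yr rz h2 k2; bcase; lia.
  rewrite (c_lt_all h1 yr) (c_lt_none h3 rz).
  by clear -G2 yr rz h2 k2 k5; bcase; lia.
- move=> d; rewrite mem_cat inE => /orP[dD|/orP[/eqP->|dD]].
  + have zd : z < d := allP k4 d dD.
    have := g2 d; rewrite mem_cat dD => /(_ isT); rewrite !cE.
    by clear -zd h2 k2 k5; bcase; lia.
  + have := g1 y'; have := @c_le_mono y' z Ub1; have := @c_le_mono y' z Ub2; rewrite !cE.
    case: (ltnP y y') => yr; last by clear -yr h2 k2 k5; bcase; lia.
    rewrite (c_lt_all h1 yr) (c_lt_none h3 k5).
    by clear -G2 yr h2 k2 k5; bcase; lia.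
  + have dy : d < y' := allP k6 d dD.
    have := g2 d; rewrite mem_cat inE dD !orbT => /(_ isT); rewrite !cE.
    have := @c_le_mono d z Ub1; have := @c_le_mono d z Ub2.
    case: (ltnP y d) => yr; last by clear -yr dy h2 k2 k5; bcase; lia.
    rewrite (c_lt_all h1 yr) (c_lt_none h3 (_ : d <= z)); last by lia.
    by clear -G2 yr dy h2 k2 k5; bcase; lia.
- move=> r; have := g3 r; rewrite !cE /=.
  case: (ltnP y r) => yr; last by clear -yr h2 h5 k5; bcase; lia.
  case: (leqP r x) => rx; last by clear -yr rx h2 h5 k5; bcase; lia.
  rewrite (c_ge_all h4 rx) (c_ge_none h6' yr).
  have := @c_gt_ge y r Db1; have := @c_gt_ge y r Db2.
  by clear -G4 yr rx h2 h5 k5; bcase; lia.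
- move=> a; rewrite mem_cat inE => /orP[aU|/orP[/eqP->|aU]].
  + have ay : a <= y := allP h1 a aU.
    have := g4 a; rewrite mem_cat aU => /(_ isT); rewrite !cE /=.
    by clear -ay h2 h5 k5; bcase; lia.
  + have := g3 z; rewrite !cE /=.
    have := @c_gt_ge y z Db1; have := @c_gt_ge y z Db2.
    rewrite (c_ge_all k4 (leqnSn z)) (c_gt_all k4 (ltnSn z)).
    have zz : cge z Db2 = 0.
      apply/eqP; rewrite -leqn0 leqNgt -has_count; apply/hasPn => d /(allP k6) /= dy.
      by rewrite -ltnNge (leq_trans dy).
    rewrite zz (c_gt_none k6' k5).
    case: (leqP z x) => zx; last by clear -zx h2 h5 k5; bcase; lia.
    rewrite (c_ge_all h4 zx) (c_ge_none h6' h2).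
    by clear -G4 zx h2 h5 k5; bcase; lia.
  + have za : z <= a := allP h3 a aU.
    have := g4 a; rewrite mem_cat inE aU !orbT => /(_ isT); rewrite !cE /=.
    have := @c_gt_ge y z Db1; have := @c_gt_ge y z Db2.
    case: (leqP a x) => zx; last by clear -za zx h2 h5 k5; bcase; lia.
    rewrite (c_ge_all h4 zx) (c_ge_none h6' (leq_trans h2 za)).
    have := @c_gt_mono y a Db1; have := @c_gt_mono y a Db2.
    by clear -G4 za zx h2 h5 k5; bcase; lia.
Qed.

(** As [bwd_bump], with [z] taken from the end of the second row. *)
Lemma bwd_app Ua1 z Ua2 Da1 y Da2 x Ub Db :
  all (leq^~ y) Ua1 -> y < z -> all (leq z) Ua2 -> all (leq x) Da1 -> y <= x -> all (ltn^~ y) Da2 ->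
  all (leq z.+1) Db ->
  G (Ua1 ++ y :: Ua2) (Da1 ++ x :: Da2) Ub (Db ++ [:: z]) ->
  G (Ua1 ++ z :: Ua2) (Da1 ++ y :: Da2) Ub Db.
Proof.
move=> h1 h2 h3 h4 h5 h6 k4 [g1 g2 g3 g4].
have h6' : all (leq^~ y) Da2 by apply: sub_all h6 => d /ltnW.
have G4 := g4 y ltac:(by rewrite mem_cat mem_head orbT).
have G2 := g2 z ltac:(by rewrite mem_cat mem_head orbT).
have sD2 : cge y Da2 = 0.
  apply/eqP; rewrite -leqn0 leqNgt -has_count; apply/hasPn => d /(allP h6) /=; by rewrite ltnNge.
have yz1 : y < z.+1 by lia.
rewrite !cE /= (c_ge_all h4 h5) sD2 (c_gt_all k4 yz1) in G4.
rewrite !cE (c_lt_all h1 h2) (c_lt_none h3 (leqnn z)) in G2.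
split.
- move=> r; have := g1 r; have := @c_le_mono r z Ub; rewrite !cE.
  case: (ltnP y r) => yr; last by clear -yr h2; bcase; lia.
  case: (leqP r z) => rz; last by clear -yr rz h2; bcase; lia.
  rewrite (c_lt_all h1 yr) (c_lt_none h3 rz).
  by clear -G2 yr rz h2; bcase; lia.
- move=> d dD; have zd : z < d := allP k4 d dD.
  have := g2 d; rewrite mem_cat dD => /(_ isT); rewrite !cE.
  by clear -zd h2; bcase; lia.
- move=> r; have := g3 r; rewrite !cE /=.
  case: (ltnP y r) => yr; last by clear -yr h2 h5; bcase; lia.
  case: (leqP r x) => rx; last by clear -yr rx h2 h5; bcase; lia.
  rewrite (c_ge_all h4 rx) (c_ge_none h6' yr).
  have : cge r Db <= size Db by apply: count_size.
  by clear -G4 yr rx h2 h5; bcase; lia.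
- move=> a; rewrite mem_cat inE => /orP[aU|/orP[/eqP->|aU]].
  + have ay : a <= y := allP h1 a aU.
    have := g4 a; rewrite mem_cat aU => /(_ isT); rewrite !cE /=.
    by clear -ay h2 h5; bcase; lia.
  + have := g3 z; rewrite !cE /=.
    rewrite (c_ge_all k4 (leqnSn z)) (c_gt_all k4 (ltnSn z)).
    case: (leqP z x) => zx; last by clear -zx h2 h5; bcase; lia.
    rewrite (c_ge_all h4 zx) (c_ge_none h6' h2).
    by clear -G4 zx h2 h5; bcase; lia.
  + have za : z <= a := allP h3 a aU.
    have := g4 a; rewrite mem_cat inE aU !orbT => /(_ isT); rewrite !cE /=.
    case: (leqP a x) => zx; last by clear -za zx h2 h5; bcase; lia.
    rewrite (c_ge_all h4 zx) (c_ge_none h6' (leq_trans h2 za)).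
    have : cgt a Db <= size Db by apply: count_size.
    by clear -G4 za zx h2 h5; bcase; lia.
Qed.

End Good.

(** * Row insertion into a hook word and its inverse *)

(** Two-stage bumping, as for decomposition tableaux: [x] replaces a letter [y] of the decreasing
    part, and [y] replaces the outgoing letter of the increasing part. If appending [x] keeps a hook
    word, the insertion stops there. *)
Definition rowins (W : seq nat) (x : nat) : option nat * seq nat :=
  if hook (rcons W x) then (None, rcons W x) else
  let q := find (leq^~ x) (dn W) in let y := nth 0 (dn W) q in
  let p := find (ltn y) (up W) in
  (Some (nth 0 (up W) p), set_nth 0 (up W) p y ++ set_nth 0 (dn W) q x).

(* z is the leftmost entry of the increasing part exceeding y, and y the leftmost entry of the
   decreasing part not exceeding x. *)
Definition bump (W : seq nat) (x z : nat) (W' : seq nat) : Prop :=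
  exists U1 U2 D1 D2 y,
   [/\ up W = U1 ++ z :: U2, dn W = D1 ++ y :: D2, W' = (U1 ++ y :: U2) ++ (D1 ++ x :: D2)
     & [/\ all (leq^~ y) U1, y < z, all (leq x.+1) D1 & y <= x]].

Lemma find_split (T : eqType) (x0 : T) (a : pred T) (s : seq T) : has a s ->
  exists s1 s2, [/\ s = s1 ++ nth x0 s (find a s) :: s2, all (predC a) s1, a (nth x0 s (find a s))
    & forall y, set_nth x0 s (find a s) y = s1 ++ y :: s2].
Proof.
move=> h; exists (take (find a s) s), (drop (find a s).+1 s).
have fs : find a s < size s by rewrite -has_find.
split.
- by rewrite -drop_nth // cat_take_drop.
- apply/allP => y yt; rewrite /= -(nth_index x0 yt).
  have iy : index y (take (find a s) s) < find a s.
    by move: yt; rewrite -index_mem size_take fs.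
  by rewrite nth_take // before_find.
- exact: nth_find.
- by move=> y; rewrite set_nthE fs.
Qed.

Lemma hook_rcons W x : hook W ->
  hook (rcons W x) = if dn W is d :: D then x < last 0 (dn W) else true.
Proof.
move=> hW; case E: (dn W) => [|d D].
  rewrite -{1}(up_dn W) E cats0 -cats1; exact: hook_cat (sorted_up W) _.
have [U eU ld] := head_dn E.
have [|_ e] := up_dnE (sorted_up W) (D := rcons (d :: D) x).
  by rewrite /= ld andbT eU; case: (U).
rewrite /hook -{1}(up_dn W) E rcons_cat e.
have : sorted gtn (dn W) by exact: hW.
by rewrite E /= rcons_path => ->.
Qed.

Lemma sorted_cat_gtn D1 y D2 : sorted gtn (D1 ++ y :: D2) ->
  [/\ sorted gtn D1, sorted gtn D2, all (ltn y) D1, all (ltn^~ y) D2 & allrel gtn D1 D2].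
Proof.
rewrite !(sorted_pairwise gtn_trans) pairwise_cat /= => /and3P[h1 h2 /andP[h3 h4]]; split=> //.
- by apply/allP => a aD; have /allrelP := h1; apply; rewrite ?mem_head.
- by apply/allrelP => a b aD bD; have /allrelP := h1; apply; rewrite ?inE ?bD ?orbT.
Qed.

Lemma sorted_cat_leq U1 z U2 : sorted leq (U1 ++ z :: U2) ->
  [/\ sorted leq U1, sorted leq U2, all (leq^~ z) U1, all (leq z) U2 & allrel leq U1 U2].
Proof.
rewrite !(sorted_pairwise leq_trans) pairwise_cat /= => /and3P[h1 h2 /andP[h3 h4]]; split=> //.
- by apply/allP => a aD; have /allrelP := h1; apply; rewrite ?mem_head.
- by apply/allrelP => a b aD bD; have /allrelP := h1; apply; rewrite ?inE ?bD ?orbT.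
Qed.

Lemma sorted_gtn_mk D1 y D2 : sorted gtn D1 -> sorted gtn D2 -> all (ltn y) D1 -> all (ltn^~ y) D2 ->
  sorted gtn (D1 ++ y :: D2).
Proof.
rewrite !(sorted_pairwise gtn_trans) pairwise_cat /= => -> -> h1 h2; rewrite h2 !andbT.
apply/allrelP => a b aD; rewrite inE => /orP[/eqP->|bD]; first exact: (allP h1).
by apply: ltn_trans (allP h1 a aD); apply: (allP h2).
Qed.

Lemma sorted_leq_mk U1 z U2 : sorted leq U1 -> sorted leq U2 -> all (leq^~ z) U1 -> all (leq z) U2 ->
  sorted leq (U1 ++ z :: U2).
Proof.
rewrite !(sorted_pairwise leq_trans) pairwise_cat /= => -> -> h1 h2; rewrite h2 !andbT.
apply/allrelP => a b aD; rewrite inE => /orP[/eqP->|bD]; first exact: (allP h1).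
by apply: leq_trans (allP h1 a aD) _; apply: (allP h2).
Qed.

Lemma rowinsP W x : hook W -> ~~ hook (rcons W x) ->
  exists z W', rowins W x = (Some z, W') /\ bump W x z W'.
Proof.
move=> hW nh; rewrite /rowins (negbTE nh).
move: nh; rewrite hook_rcons //; case E: (dn W) => [|d D] // nlt.
have hq : has (leq^~ x) (dn W).
  apply/hasP; exists (last 0 (dn W)); rewrite ?E /= ?mem_last // leqNgt; exact: nlt.
have [D1 [D2 [eD aD yx sD]]] := find_split 0 hq.
have [U eU ld] := head_dn E.
set y := nth 0 (dn W) (find (leq^~ x) (dn W)) in eD yx *.
have yd : y <= d.
  have : sorted gtn (dn W) by exact: hW.
  rewrite E /= (path_sortedE gtn_trans) => /andP[/allP ad _].
  have : y \in d :: D by rewrite -E eD mem_cat mem_head orbT.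
  by rewrite inE => /orP[/eqP->//|/ad /ltnW].
have hp : has (ltn y) (up W).
  apply/hasP; exists (last 0 (up W)); last by rewrite /= (leq_ltn_trans yd).
  by rewrite {2}eU mem_rcons mem_head.
have [U1 [U2 [eU' aU yz sU]]] := find_split 0 hp.
rewrite -E; exists (nth 0 (up W) (find (ltn y) (up W))), ((U1 ++ y :: U2) ++ (D1 ++ x :: D2)).
split; first by rewrite -/y sU sD.
exists U1, U2, D1, D2, y; split=> //; split=> //.
- by apply: sub_all aU => a /=; rewrite -leqNgt.
- by apply: sub_all aD => a /=; rewrite -ltnNge.
Qed.

(* Everything about a bump, with both splittings of the row into parts. *)
Lemma bump_facts W x z W' : hook W -> bump W x z W' ->
  exists U1 U2 D1 D2 y,
   [/\ up W = U1 ++ z :: U2, dn W = D1 ++ y :: D2, W' = (U1 ++ y :: U2) ++ (D1 ++ x :: D2)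
     & [/\ [/\ all (leq^~ y) U1, y < z, all (leq z) U2 & sorted leq (U1 ++ y :: U2)],
           [/\ all (leq x.+1) D1, y <= x, all (ltn^~ y) D2 & sorted gtn (D1 ++ x :: D2)]
         & sorted leq (U1 ++ z :: U2) /\ sorted gtn (D1 ++ y :: D2)]].
Proof.
move=> hW [U1 [U2 [D1 [D2 [y [eU eD -> [h1 h2 h3 h4]]]]]]].
exists U1, U2, D1, D2, y; split=> //.
have sU := sorted_up W; have sD : sorted gtn (dn W) := hW; rewrite eU in sU; rewrite eD in sD.
have [u1 u2 u3 u4 u5] := sorted_cat_leq sU; have [d1 d2 d3 d4 d5] := sorted_cat_gtn sD.
split=> //; split=> //.
  by apply: sorted_leq_mk => //; apply: sub_all u4 => a /= /(leq_trans (ltnW h2)).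
apply: sorted_gtn_mk => //; apply: sub_all d4 => a /= /leq_trans; apply; exact: h4.
Qed.

Lemma bump_size W x z W' : bump W x z W' -> size W' = size W.
Proof.
move=> [U1 [U2 [D1 [D2 [y [eU eD -> _]]]]]].
by rewrite -[in RHS](up_dn W) eU eD !size_cat.
Qed.

Lemma good_fwd_bump Wa x z Wa' Wb z' Wb' : hook Wa -> hook Wb ->
  bump Wa x z Wa' -> bump Wb z z' Wb' -> good Wa Wb -> good Wa' Wb'.
Proof.
move=> ha hb /(bump_facts ha)[U1 [U2 [D1 [D2 [y [e1 e2 -> [[a1 a2 a3 a4] [b1 b2 b3 b4] [c1 c2]]]]]]]].
move=> /(bump_facts hb)[V1 [V2 [E1 [E2 [w [f1 f2 -> [[p1 p2 p3 p4] [q1 q2 q3 q4] [r1 r2]]]]]]]].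
rewrite {1}/good e1 e2 f1 f2 => g; apply/goodE => //.
exact: (fwd_bump a1 a2 a3 b2 p1 p2 p3 q1 q2 q3 g).
Qed.

Lemma good_bwd_bump Wa x z Wa' Wb z' Wb' : hook Wa -> hook Wb ->
  bump Wa x z Wa' -> bump Wb z z' Wb' -> good Wa' Wb' -> good Wa Wb.
Proof.
move=> ha hb /(bump_facts ha)[U1 [U2 [D1 [D2 [y [e1 e2 -> [[a1 a2 a3 a4] [b1 b2 b3 b4] [c1 c2]]]]]]]].
move=> /(bump_facts hb)[V1 [V2 [E1 [E2 [w [f1 f2 -> [[p1 p2 p3 p4] [q1 q2 q3 q4] [r1 r2]]]]]]]].
move=> /goodE g; rewrite /good e1 e2 f1 f2.
have b1' : all (leq x) D1 by apply: sub_all b1 => d /ltnW.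
exact: (bwd_bump a1 a2 a3 b1' b2 b3 p1 p2 q1 q2 q3 (g a4 b4 p4 q4)).
Qed.

Lemma gtn_last_all z d D : sorted gtn (d :: D) -> z < last d D -> all (leq z.+1) (d :: D).
Proof.
elim: D d => [|e D IH] d; first by move=> _ /= ->.
move=> /= /andP[ed sD] zl; have := IH e sD zl => /= /andP[ze ->].
by rewrite ze (ltn_trans ze ed).
Qed.

Lemma hook_rcons_split W z : hook W -> hook (rcons W z) ->
  exists U D, [/\ W = U ++ D, sorted leq U, sorted gtn D & all (leq z.+1) D].
Proof.
move=> hW; rewrite hook_rcons //; case E: (dn W) => [|d D] zl.
  by exists W, [::]; split => //; rewrite ?cats0 // -(up_dn W) E cats0 sorted_up.
exists (up W), (dn W); rewrite up_dn; split=> //; first exact: sorted_up.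
have : sorted gtn (dn W) := hW; rewrite E => sD; exact: gtn_last_all.
Qed.

Lemma good_fwd_app Wa x z Wa' Wb : hook Wa -> hook Wb ->
  bump Wa x z Wa' -> hook (rcons Wb z) -> good Wa Wb -> good Wa' (rcons Wb z).
Proof.
move=> ha hb /(bump_facts ha)[U1 [U2 [D1 [D2 [y [e1 e2 -> [[a1 a2 a3 a4] [b1 b2 b3 b4] [c1 c2]]]]]]]] hz.
have [U [D [eW sU sD aD]]] := hook_rcons_split hb hz.
have sDz : sorted gtn (D ++ [:: z]) by apply: sorted_gtn_mk.
have -> : rcons Wb z = U ++ (D ++ [:: z]) by rewrite eW -cats1 catA.
rewrite -{1}(up_dn Wa) e1 e2 eW => /goodE g; apply/goodE => //.
exact: (fwd_app a1 a2 a3 b2 aD (g c1 c2 sU sD)).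
Qed.

Lemma good_bwd_app Wa x z Wa' Wb : hook Wa -> hook Wb ->
  bump Wa x z Wa' -> hook (rcons Wb z) -> good Wa' (rcons Wb z) -> good Wa Wb.
Proof.
move=> ha hb /(bump_facts ha)[U1 [U2 [D1 [D2 [y [e1 e2 -> [[a1 a2 a3 a4] [b1 b2 b3 b4] [c1 c2]]]]]]]] hz.
have [U [D [eW sU sD aD]]] := hook_rcons_split hb hz.
have sDz : sorted gtn (D ++ [:: z]) by apply: sorted_gtn_mk.
have b1' : all (leq x) D1 by apply: sub_all b1 => d /ltnW.
have -> : rcons Wb z = U ++ (D ++ [:: z]) by rewrite eW -cats1 catA.
move=> /goodE g; rewrite -(up_dn Wa) e1 e2 eW; apply/goodE => //.
exact: (bwd_app a1 a2 a3 b1' b2 b3 aD (g a4 b4 sU sDz)).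
Qed.

Lemma good_nil Wa : Wa <> [::] -> good Wa [::].
Proof.
move=> W0; rewrite /good /up /dn /=; split=> // a aU; rewrite !cE.
by case: (upl Wa) aU => [|k]; case: (Wa) W0.
Qed.

Lemma good_new Wa x z Wa' : hook Wa -> bump Wa x z Wa' -> good Wa' [:: z].
Proof.
move=> ha hb; apply: (@good_fwd_app Wa x z Wa' [::]) => //; apply: good_nil => E.
by case: hb => U1 [U2 [D1 [D2 [y [eU _ _ _]]]]]; move: eU; rewrite E; case: U1.
Qed.

Lemma good_app_top Wa x Wb : hook Wa -> hook Wb -> hook (rcons Wa x) -> good Wa Wb -> good (rcons Wa x) Wb.
Proof.
move=> ha hb hx; have [U [D [-> sU sD aD]]] := hook_rcons_split ha hx.
have sDz : sorted gtn (D ++ [:: x]) by apply: sorted_gtn_mk.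
have sb : sorted gtn (dn Wb) := hb.
rewrite -(up_dn Wb) -cats1 -catA => /goodE g; apply/goodE => //; first exact: sorted_up.
have [g1 g2 g3 g4] := g sU sD (sorted_up _) sb; split=> //.
- by move=> r; have := g3 r; rewrite !cE; lia.
- by move=> a aU; have := g4 a aU; rewrite !cE; lia.
Qed.

(** The fourth condition of [G] at the least letter of [up Wa] bounds the whole size of [Wb]: by the
    second condition every letter of [dn Wb] exceeds it. *)
Lemma good_size Wa Wb : hook Wb -> Wa <> [::] -> good Wa Wb -> size Wb < size Wa.
Proof.
move=> hb W0 [g1 g2 g3 g4]; rewrite -(up_dn Wa) -(up_dn Wb) !size_cat.
have [m mU am] : exists2 m, m \in up Wa & all (leq m) (up Wa).
  have := sorted_up Wa; case E: (up Wa) => [|m U] => [|sU].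
    by case: W0; case: (Wa) E => // a [|b V] //; rewrite up_cons; case: ifP.
  exists m; rewrite ?mem_head //= leqnn /=; exact: order_path_min leq_trans sU.
have := g4 m mU; rewrite (@c_gt_all m.+1 m (dn Wb)) //.
  by move=> h; apply: leq_trans h _; rewrite leq_add2l count_size.
apply/allP => d dD; have := g2 d dD; rewrite ltnNge => h; rewrite ltnNge; apply: contra h => dm.
by rewrite (c_lt_none am dm).
Qed.

(** The inequality of sizes says that the shape stays strict after the removal; it replaces the box
    lost in the last two conditions of [G]. *)
Lemma good_unapp W x Wb : hook (rcons W x) -> hook Wb -> W <> [::] -> size Wb < size W ->
  good (rcons W x) Wb -> good W Wb.
Proof.
move=> hx hb W0 sz.
have [U [D [eW sU sD]]] : exists U D, [/\ W = U ++ D, sorted leq U & sorted gtn (rcons D x)].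
  case/lastP E: (dn (rcons W x)) => [|D m].
    have := up_dn (rcons W x); rewrite E cats0 => e; have := sorted_up (rcons W x); rewrite e => s.
    exists W, [::]; rewrite cats0; split=> //; apply: subseq_sorted s; first exact: leq_trans.
    exact: subseq_rcons.
  have := up_dn (rcons W x); rewrite E -rcons_cat => /rcons_inj[e1 e2].
  exists (up (rcons W x)), D; rewrite e1 -e2 -E; split=> //; exact: sorted_up.
have sb : sorted gtn (dn Wb) := hb.
have [sD0 aD] : sorted gtn D /\ all (ltn x) D.
  move: sD; rewrite -cats1 => /sorted_cat_gtn[? _ ? _ _]; by split.
rewrite eW -cats1 -catA cats1 -(up_dn Wb) => /goodE g; apply/goodE => //; first exact: sorted_up.
have szW : size W = size U + size D by rewrite eW size_cat.
have szb : size Wb = size (up Wb) + size (dn Wb) by rewrite -size_cat up_dn.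
have [g1 g2 g3 g4] := g sU sD (sorted_up _) sb; split=> //.
- move=> r; have := g3 r; rewrite -cats1 !cE addn0; case: (leqP r x) => rx; last by lia.
  rewrite (c_ge_all (_ : all (leq r) D)) //; last by apply: sub_all aD => d /= /ltnW; apply: leq_trans.
  by have : cge r (dn Wb) <= size (dn Wb) := count_size _ _; lia.
- move=> a aU; have := g4 a aU; rewrite -cats1 !cE addn0; case: (leqP a x) => rx; last by lia.
  rewrite (c_ge_all (_ : all (leq a) D)) //; last by apply: sub_all aD => d /= /ltnW; apply: leq_trans.
  by have : cgt a (dn Wb) <= size (dn Wb) := count_size _ _; lia.
Qed.

Lemma last_split (T : eqType) (a : pred T) s : has a s ->
  exists s1 y s2, [/\ s = s1 ++ y :: s2, a y & all (predC a) s2].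
Proof.
elim/last_ind: s => // s x IH; rewrite has_rcons; case ax: (a x) => /=.
  by move=> _; exists s, x, [::]; rewrite cats1.
by case/IH => s1 [y [s2 [-> ay h]]]; exists s1, y, (rcons s2 x); rewrite rcons_cat all_rcons /= ax.
Qed.

Lemma last_split_uniq (T : eqType) (a : pred T) s1 y s2 t1 z t2 : s1 ++ y :: s2 = t1 ++ z :: t2 ->
  a y -> a z -> all (predC a) s2 -> all (predC a) t2 -> [/\ s1 = t1, y = z & s2 = t2].
Proof.
elim: s1 t1 => [|b s1 IH] [|c t1] /=.
- by case=> -> ->.
- by case=> -> ->; rewrite all_cat /= => _ az /and3P[_]; rewrite az.
- by case=> -> <-; rewrite all_cat /= => ay _ _ /and3P[_]; rewrite ay.
- by case=> -> e ay az h1 h2; have [-> -> ->] := IH _ e ay az h1 h2.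
Qed.

Lemma peakD W : hook W -> W <> [::] -> exists U M D,
  [/\ up W = rcons U M, dn W = D, sorted leq U, sorted gtn (M :: D) & all (leq^~ M) U].
Proof.
move=> hW W0; have := sorted_up W; case/lastP E: (up W) => [|U M].
  by case: W0; case: (W) E => // a [|b V] //; rewrite up_cons; case: ifP.
rewrite -cats1 => /sorted_cat_leq[sU _ aU _ _].
exists U, M, (dn W); split=> //; first by rewrite cats1.
have : sorted gtn (dn W) := hW.
case F: (dn W) => [|d D] //= ->; have [_ _] := head_dn F.
by rewrite E last_rcons => ->.
Qed.

Lemma bump_mk U1 z U2 D1 y D2 x : sorted leq (U1 ++ z :: U2) -> sorted gtn (D1 ++ y :: D2) ->
  all (leq^~ y) U1 -> y < z -> all (leq x.+1) D1 -> y <= x ->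
  bump ((U1 ++ z :: U2) ++ (D1 ++ y :: D2)) x z ((U1 ++ y :: U2) ++ (D1 ++ x :: D2)).
Proof.
move=> sU sD a1 yz b1 yx; case: (split_cases sU sD) => [[e1 e2]|[M [D0 [E e1 e2 hU hD]]]].
  by exists U1, U2, D1, D2, y.
case: D1 E b1 sD e1 e2 => [|d D1] /= [E1 E2] b1 sD e1 e2.
  by have := hU; rewrite all_cat /= -E1 leqNgt yz andbF.
subst M; have /andP[b2 b3] := b1.
exists U1, (rcons U2 d), D1, D2, y; rewrite e1 e2 -E2 rcons_cat; split=> //.
by rewrite -[in RHS]rcons_cons -rcons_cat cat_rcons.
Qed.

Lemma set_nth_mid (s t : seq nat) a b : set_nth 0 (s ++ a :: t) (size s) b = s ++ b :: t.
Proof. by elim: s => //= c s ->. Qed.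

Lemma bump_rowins W x z W' : hook W -> bump W x z W' -> ~~ hook (rcons W x) /\ rowins W x = (Some z, W').
Proof.
move=> hW hb; have [U1 [U2 [D1 [D2 [y [e1 e2 eW' [[a1 a2 a3 a4] [b1 b2 b3 b4] [c1 c2]]]]]]]] := bump_facts hW hb.
have nh : ~~ hook (rcons W x).
  rewrite hook_rcons // e2; case E: (D1 ++ y :: D2) => [|d D]; first by case: (D1) E.
  rewrite -E -leqNgt last_cat /=; apply: leq_trans b2.
  case/lastP: D2 b3 {e2 E eW' b4 c2} => [|D2 m] //=; rewrite all_rcons last_rcons => /andP[/ltnW //].
split=> //; rewrite /rowins (negbTE nh) e1 e2.
have f1 : find (leq^~ x) (D1 ++ y :: D2) = size D1.
  rewrite find_cat ifF /= ?b2 ?addn0 //; apply/negP => /hasP[d dD /= dx].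
  by have := allP b1 d dD; rewrite /= ltnNge dx.
have f2 : find (ltn y) (U1 ++ z :: U2) = size U1.
  rewrite find_cat ifF /= ?a2 ?addn0 //; apply/negP => /hasP[d dD /= dx].
  by have := allP a1 d dD; rewrite /= leqNgt dx.
have g1 : nth 0 (D1 ++ y :: D2) (size D1) = y by rewrite nth_cat ltnn subnn.
have g2 : nth 0 (U1 ++ z :: U2) (size U1) = z by rewrite nth_cat ltnn subnn.
rewrite !f1 g1 f2 g2 eW'; congr (_, _ ++ _).
  exact: set_nth_mid.
exact: set_nth_mid.
Qed.

(* Splitting a row so that its peak belongs to the decreasing part makes the reverse bump
   canonical. *)
Lemma bump_peak W x z W' : hook W -> bump W x z W' -> exists U1 y U2 D1 D2,
  [/\ take (upl W').-1 W' = U1 ++ y :: U2, drop (upl W').-1 W' = D1 ++ x :: D2,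
      W = (U1 ++ z :: U2) ++ (D1 ++ y :: D2), all (leq z) U2 & [/\ y < z, all (leq y) D1, y <= x & all (ltn^~ y) D2]].
Proof.
move=> hW hb; have [U1 [U2 [D1 [D2 [y [e1 e2 eW' [[a1 a2 a3 a4] [b1 b2 b3 b4] [c1 c2]]]]]]]] := bump_facts hW hb.
have b1' : all (leq y) D1 by apply: sub_all b1 => d /ltnW; apply: leq_trans.
have su V : size (up V) = upl V.
  rewrite size_takel //; elim: V => [|p [|q V] IH] //; rewrite /upl -/upl; case: ifP => // _; exact: IH.
have kk V U D : V = U ++ D -> size U = (upl V).-1 -> take (upl V).-1 V = U /\ drop (upl V).-1 V = D.
  by move=> E s; rewrite -s E take_size_cat ?drop_size_cat.
case: (split_cases a4 b4) => [[f1 f2]|[M [D0 [E f1 f2 hU hD]]]]; last first.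
  have [|k1 k2] := kk W' (U1 ++ y :: U2) (D1 ++ x :: D2) eW'.
    by rewrite -su eW' f1 size_rcons.
  by exists U1, y, U2, D1, D2; split=> //; rewrite -(up_dn W) e1 e2.
case/lastP: U2 => [|U2 M] in e1 a3 a4 eW' f1 f2 c1 *.
  have [d [D E]] : exists d D, D1 ++ x :: D2 = d :: D.
    by case: (D1) => [|d D]; [exists x, D2|exists d, (D ++ x :: D2)].
  have [_ _] := head_dn (etrans f2 E); rewrite f1 last_cat /= => dy.
  have : y <= d by case: (D1) E b1' => [|d' D1'] /= [<- _] // /andP[].
  by rewrite leqNgt dy.
have E1 : W' = (U1 ++ y :: U2) ++ ((M :: D1) ++ x :: D2) by rewrite eW' -rcons_cons -rcons_cat cat_rcons.
have [|k1 k2] := kk _ _ _ E1.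
  by rewrite -su eW' f1 !size_cat /= size_rcons; lia.
move: a3; rewrite all_rcons => /andP[zM a3].
exists U1, y, U2, (M :: D1), D2; split=> //.
  by rewrite -(up_dn W) e1 e2 -rcons_cons -rcons_cat cat_rcons.
by split=> //=; rewrite b1' (ltnW (leq_trans a2 zM)).
Qed.

Lemma bump_inj W x V x' z W' : hook W -> hook V -> bump W x z W' -> bump V x' z W' -> W = V /\ x = x'.
Proof.
move=> hW hV /(bump_peak hW)[U1 [y [U2 [D1 [D2 [e1 e2 -> a [b1 b2 b3 b4]]]]]]].
move=> /(bump_peak hV)[V1 [w [V2 [E1 [E2 [f1 f2 -> c [d1 d2 d3 d4]]]]]]].
have nn (T : seq nat) (q : nat) : all (leq q) T -> all (predC (ltn^~ q)) T by apply: sub_all => t /=; rewrite -leqNgt.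
have [-> ey ->] := last_split_uniq (etrans (esym e1) f1) b1 d1 (nn _ _ a) (nn _ _ c).
rewrite -ey in d2 d3 d4 *.
have nn' (T : seq nat) (q : nat) : all (ltn^~ q) T -> all (predC (leq q)) T by apply: sub_all => t /=; rewrite -ltnNge.
by have [-> -> ->] := last_split_uniq (etrans (esym e2) f2) b3 d3 (nn' _ _ b4) (nn' _ _ d4).
Qed.

(** Reverse bumping with the peak of [W'] counted as decreasing. The second condition of [G] at [z]
    supplies a letter [y < z] in the increasing part, and the peak guarantees a letter [x >= y] in
    the decreasing one; the last such letters are taken. *)
Lemma bump_exists W' Wb z U D : hook W' -> W' <> [::] -> Wb = U ++ D -> sorted leq U -> sorted gtn D -> z \in D ->
  good W' Wb -> exists W x, hook W /\ bump W x z W'.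
Proof.
move=> hW W0 -> sU sD zD; have [U' [M [D' [e1 e2 s1 s2 aM]]]] := peakD hW W0.
rewrite -(up_dn W') e1 e2 cat_rcons => /goodE g; have [_ g2 _ _] := g s1 s2 sU sD.
have : has (ltn^~ z) U' by rewrite has_count; apply: leq_ltn_trans (g2 z zD).
case/last_split => U1 [y [U2 [eU yz aU2]]].
have : has (leq y) (M :: D') by rewrite /= (allP aM) // eU mem_cat mem_head orbT.
case/last_split => D1 [x [D2 [eD yx aD2]]].
rewrite eU eD in s1 s2 *.
have [p1 p2 p3 p4 _] := sorted_cat_leq s1; have [q1 q2 q3 q4 _] := sorted_cat_gtn s2.
have aU2' : all (leq z) U2 by apply: sub_all aU2 => a /=; rewrite -leqNgt.
have aD2' : all (ltn^~ y) D2 by apply: sub_all aD2 => a /=; rewrite -ltnNge.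
have sz : sorted leq (U1 ++ z :: U2).
  by apply: sorted_leq_mk => //; apply: sub_all p3 => a /= /leq_trans; apply; exact: ltnW.
have sy : sorted gtn (D1 ++ y :: D2).
  by apply: sorted_gtn_mk => //; apply: sub_all q3 => a /=; apply: leq_ltn_trans.
exists ((U1 ++ z :: U2) ++ (D1 ++ y :: D2)), x; split; first exact: hook_cat.
exact: bump_mk.
Qed.

Lemma bump_hook0 W x z W' : hook W -> bump W x z W' -> hook W' /\ W' <> [::].
Proof.
move=> hW /(bump_facts hW)[U1 [U2 [D1 [D2 [y [e1 e2 -> [[a1 a2 a3 a4] [b1 b2 b3 b4] _]]]]]]].
by split; [exact: hook_cat | case: U1 {e1 a1 a4}].
Qed.

(** The three cases locate the new peak: still in the old increasing part, at the inserted [x], or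
    at the head of the old decreasing part. The cut moves to the right in the last two. *)
Lemma bump_after W x z W' : hook W -> bump W x z W' -> exists U1 U2 D1 D2 y,
  [/\ up W = U1 ++ z :: U2, dn W = D1 ++ y :: D2, all (leq^~ y) U1, all (leq z) U2 &
  [/\ all (leq x.+1) D1, all (ltn^~ y) D2, y < z, y <= x &
  [\/ [/\ up W' = U1 ++ y :: U2, dn W' = D1 ++ x :: D2, U2 <> [::] & size (up W) = size (up W')],
      [/\ D1 = [::], up W' = rcons (U1 ++ y :: U2) x, dn W' = D2, size (up W) < size (up W') & all (leq^~ x) U2]
    | exists d D, [/\ D1 = d :: D, U2 = [::], up W' = rcons (U1 ++ [:: y]) d, dn W' = D ++ x :: D2 & size (up W) < size (up W') /\ d < z]]]].
Proof.
move=> hW hb; have [U1 [U2 [D1 [D2 [y [e1 e2 eW' [[a1 a2 a3 a4] [b1 b2 b3 b4] [c1 c2]]]]]]]] := bump_facts hW hb.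
exists U1, U2, D1, D2, y; split=> //; split=> //; rewrite eW'.
case: (split_cases a4 b4) => [[f1 f2]|[M [D0 [E f1 f2 hU hD]]]].
  apply: Or31; rewrite f1 f2 e1 !size_cat; split=> // U20.
  have [d [D E]] : exists d D, D1 ++ x :: D2 = d :: D.
    by case: (D1) => [|d D]; [exists x, D2|exists d, (D ++ x :: D2)].
  have [_ _] := head_dn (etrans f2 E); rewrite f1 U20 last_cat /= => dy.
  have : y <= d by case: (D1) E b1 => [|d' D1'] /= [<- _] // /andP[/ltnW h _]; apply: leq_trans h.
  by rewrite leqNgt dy.
case: D1 E => [|d D1] [-> <-] in e2 b1 b4 c2 eW' f1 f2 hD hU *.
  apply: Or32; rewrite f1 f2 e1 size_rcons !size_cat /= ltnSn; split=> //.
  by move: hU; rewrite all_cat /= => /and3P[].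
apply: Or33; exists M, D1; have dz : M < last 0 (up W) by have [_ _] := head_dn e2.
case/lastP: U2 => [|U2 m] in e1 a3 a4 c1 eW' f1 f2 hU dz *; last first.
  move: dz; rewrite e1 last_cat /= last_rcons => mM.
  by exfalso; move: hU; rewrite all_cat /= all_rcons /= [m <= M]leqNgt mM !andbF.
move: dz; rewrite e1 last_cat /= => dz.
by rewrite f1 f2 size_rcons !size_cat /= ltnSn.
Qed.

Lemma bump_min W x z W' : hook W -> bump W x z W' -> exists y : nat, [/\ y \in dn W, y <= x, y < z, z \in up W &
  (forall d : nat, d \in dn W -> d <= x -> d <= y) /\ (forall a : nat, a \in up W -> y < a -> z <= a)].
Proof.
move=> hW hb; have [U1 [U2 [D1 [D2 [y [e1 e2 eW' [[a1 a2 a3 a4] [b1 b2 b3 b4] [c1 c2]]]]]]]] := bump_facts hW hb.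
exists y; rewrite e1 e2 !mem_cat !mem_head !orbT; split=> //; split.
- move=> d; rewrite mem_cat inE => /orP[/(allP b1) /= h|/orP[/eqP->//|/(allP b3) /ltnW //]].
  by rewrite leqNgt h.
- move=> a; rewrite mem_cat inE => /orP[/(allP a1) /= h|/orP[/eqP->//|/(allP a3) //]].
  by rewrite ltnNge h.
Qed.

(** * Two successive bumps in the same row *)

(** Whether the cut moves to the right. For weakly increasing inputs the outputs increase weakly if
    it did not move at the first bump and decrease strictly if it did, in which case it moves again;
    for strictly decreasing inputs the outputs decrease and the second bump does not move it. *)
Definition nrm (W W' : seq nat) := size (up W) < size (up W').

Section TwoBumps.
Variables (W W' W'' : seq nat) (x z x' z' : nat).
Hypotheses (hW : hook W) (b1 : bump W x z W') (b2 : bump W' x' z' W'').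
Let hW' : hook W'. Proof. by have [] := bump_hook0 hW b1. Qed.

Lemma bump_le : x <= x' -> ~~ nrm W W' -> z <= z'.
Proof.
move=> xx; have [U1 [U2 [D1 [D2 [y [e1 e2 p1 p2 [p3 p4 p5 p6 H]]]]]]] := bump_after hW b1.
have [y' [yd yx yz zu [m1 m2]]] := bump_min hW' b2; rewrite /nrm.
case: H => [[f1 f2 _ f3]|[_ _ _ ->] //|[d [D [_ _ _ _ [-> _]]]] //]; move=> _.
have xy : x <= y' by apply: m1; rewrite // f2 mem_cat mem_head orbT.
move: zu; rewrite f1 mem_cat inE => /orP[/(allP p1) /= h|/orP[/eqP h|/(allP p2) //]]; exfalso; lia.
Qed.

Lemma bump_ge_nrm : x <= x' -> nrm W W' -> z' < z.
Proof.
move=> xx; have [U1 [U2 [D1 [D2 [y [e1 e2 p1 p2 [p3 p4 p5 p6 H]]]]]]] := bump_after hW b1.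
have [y' [yd yx yz zu [m1 m2]]] := bump_min hW' b2; rewrite /nrm.
case: H => [[_ _ _ ->]|[_ f1 f2 _ _]|[d [D [_ _ f1 f2 [_ dz]]]]]; first by rewrite ltnn.
  move=> _; apply: leq_ltn_trans p5; apply: m2; first by rewrite f1 mem_rcons inE mem_cat mem_head !orbT.
  by move: yd; rewrite f2 => /(allP p4).
move=> _; move: zu; rewrite f1 mem_rcons inE mem_cat inE => /orP[/eqP->//|/orP[/(allP p1) /= h|/eqP->//]].
exact: leq_ltn_trans h p5.
Qed.

Lemma bump_nrm_nrm : x <= x' -> nrm W W' -> nrm W' W''.
Proof.
move=> xx; have [U1 [U2 [D1 [D2 [y [e1 e2 p1 p2 [p3 p4 p5 p6 H]]]]]]] := bump_after hW b1.
have [y' [yd yx yz zu [m1 m2]]] := bump_min hW' b2.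
have [V1 [V2 [E1 [E2 [w [f1 f2 q1 q2 [q3 q4 q5 q6 H2]]]]]]] := bump_after hW' b2.
rewrite /nrm; case: H2 => [[g1 g2 g3 g4]|[_ _ _ -> _] //|[d [D [_ _ _ _ [-> _]]]] //].
case: H => [[_ _ _ ->]|[h1 h2 h3 _ h4]|[d [D [_ _ h1 h2 [_ dz]]]]]; first by rewrite ltnn.
  move=> _; exfalso; move: (bump_hook0 hW' b2) => [hW'' _].
  case: E1 f2 q3 g2 => [|e E1] f2 q3 g2; last first.
    have : e \in D2 by rewrite -h3 f2 mem_head.
    by move=> /(allP p4) /= ey; move/andP: q3 => [/= q3 _]; clear -xx p6 ey q3; lia.
  have [_ _] := head_dn g2; rewrite g1.
  case/lastP: V2 g3 {q2 g1 g2 g4} f1 => // V2 m _; rewrite h2 -rcons_cons -rcons_cat => /rcons_inj[_ <-].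
  by rewrite last_cat /= last_rcons; clear -q6 xx; lia.
move=> _; exfalso; case/lastP: V2 g3 f1 q2 {g1} => // V2 m _; rewrite h1 -rcons_cons -rcons_cat.
move=> /rcons_inj[e <-]; rewrite all_rcons => /andP[zd _].
have xw : x <= w.
  have : x \in dn W' by rewrite h2 mem_cat mem_head orbT.
  rewrite f2 mem_cat inE => /orP[/(allP q3) /=|/orP[/eqP<-//|/(allP q4) /= /ltnW //]]; lia.
have : z' \in U1 ++ [:: y] by rewrite e mem_cat mem_head orbT.
by rewrite mem_cat inE => /orP[/(allP p1) /= hh|/eqP hh]; clear -hh xw q5 p6; lia.
Qed.

Lemma bump_gt : x' < x -> z' < z /\ ~~ nrm W' W''.
Proof.
move=> xx; have [U1 [U2 [D1 [D2 [y [e1 e2 p1 p2 [p3 p4 p5 p6 H]]]]]]] := bump_after hW b1.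
have [y' [yd yx yz zu [m1 m2]]] := bump_min hW' b2.
have yy (d : nat) : d \in dn W' -> d <= x' -> d < y.
  move=> dW dx; have : [\/ d \in D1, d = x | d \in D2].
    case: H dW => [[_ -> _ _]|[_ _ -> _ _]|[f [D [-> _ _ -> _]]]]; rewrite ?mem_cat ?inE.
    - by case/orP => [h|/orP[/eqP h|h]]; [apply: Or31|apply: Or32|apply: Or33].
    - by move=> h; apply: Or33.
    - by case/orP => [h|/orP[/eqP h|h]]; [apply: Or31; rewrite h orbT|apply: Or32|apply: Or33].
  by case=> [/(allP p3) /= h|h|/(allP p4) //]; clear -h dx xx; lia.
have yup : y \in up W'.
  case: H => [[-> _ _ _]|[_ -> _ _ _]|[f [D [_ _ -> _ _]]]]; rewrite ?mem_rcons ?inE ?mem_cat ?mem_head ?orbT //.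
have zy : z' <= y by apply: m2 => //; apply: yy.
split; first exact: leq_ltn_trans zy p5.
have [V1 [V2 [E1 [E2 [w [f1 f2 q1 q2 [q3 q4 q5 q6 H2]]]]]]] := bump_after hW' b2.
have wy : w < y by apply: yy; rewrite // f2 mem_cat mem_head orbT.
rewrite /nrm; case: H2 => [[_ _ _ ->]|[g1 g2 g3 _ g4]|[d [D [g1 g2 g3 g4 _]]]]; first by rewrite ltnn.
  exfalso; case: H => [[h1 h2 h3 _]|[h1 h2 h3 _ h4]|[d [D [h1 h2 h3 h4 [_ dz]]]]].
  - move: h2; rewrite f2 g1 /=; case: (D1) p3 => [|d D] /= pp; case=> E _; first by clear -E q6 xx; lia.
    by case/andP: pp => pp _; clear -pp E q6 xx; lia.
  - case/lastP: V2 f1 g4 {q2 g2} => [|V2 m]; rewrite h2.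
      rewrite cats1 => /rcons_inj[E _] _; have : y \in V1 by rewrite -E mem_cat mem_head orbT.
      by move/(allP q1) => /= hh; clear -hh wy; lia.
    by rewrite -rcons_cons -rcons_cat all_rcons => /rcons_inj[_ <-] /andP[hh _]; clear -hh xx; lia.
  - move: h4; rewrite f2 g1 /=; move: p3; rewrite h1 /= => /andP[_].
    by case: (D) => [|e D'] /=; [move=> _ [E _]; clear -E q6 xx | move=> /andP[ee _] [E _]; clear -ee E q6 xx]; lia.
exfalso; rewrite g2 cats1 in f1.
case: H => [[h1 h2 h3 _]|[h1 h2 h3 _ h4]|[d' [D' [h1 h2 h3 h4 [_ dz]]]]].
- case/lastP: U2 h3 h1 p2 {e1} => // U2 m _; rewrite f1 -rcons_cons -rcons_cat => /rcons_inj[E1' E2'].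
  by rewrite all_rcons -E2' => /andP[hh _]; clear -hh p5 zy; lia.
- move: h2; rewrite f1 => /rcons_inj[E _]; have : y \in V1 by rewrite E mem_cat mem_head orbT.
  by move/(allP q1) => /= hh; clear -hh wy; lia.
- move: h3; rewrite f1 => /rcons_inj[E _]; have : y \in V1 by rewrite E mem_cat mem_head orbT.
  by move/(allP q1) => /= hh; clear -hh wy; lia.
Qed.
End TwoBumps.

(** * Knuth relations and lattice words *)

(* Knuth congruence as far as it matters here. *)
Definition keq (u v : seq nat) : Prop :=
  perm_eq u v /\ forall p s, okw 0 (p ++ u ++ s) = okw 0 (p ++ v ++ s).

Lemma keq_refl u : keq u u. Proof. by split. Qed.
Lemma keq_sym u v : keq u v -> keq v u.
Proof. by case=> h1 h2; split=> [|p s]; rewrite ?h2 // perm_sym. Qed.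
Lemma keq_trans u v w : keq u v -> keq v w -> keq u w.
Proof. by move=> [h1 h2] [k1 k2]; split=> [|p s]; [apply: perm_trans h1 k1|rewrite h2 k2]. Qed.
Lemma keq_cat p s u v : keq u v -> keq (p ++ u ++ s) (p ++ v ++ s).
Proof.
move=> [h1 h2]; split=> [|q t]; first by rewrite perm_cat2l perm_cat2r.
have := h2 (q ++ p) (s ++ t); by rewrite !catA.
Qed.

(** A prefix sees what follows only through letter counts and the lattice property, so contexts on
    the left need not be checked. *)
Lemma keqP (u v : seq nat) : perm_eq u v -> (forall s, okw 0 (u ++ s) = okw 0 (v ++ s)) -> keq u v.
Proof.
move=> h1 h2; split=> // p s; elim: p => [|a p IH] /=; first exact: h2.
by rewrite IH !count_cat !(seq.permP h1).
Qed.

(** One of the two Knuth relations, the other being [keq2]. The exchanged letters [x] and [z] can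
    interfere only when [z = x.+1], and the third letter then settles the comparison. *)
Lemma keq1 x y z : x < y -> y <= z -> keq [:: y; z; x] [:: y; x; z].
Proof.
move=> xy yz; apply: keqP => [|s].
  by apply/seq.permP => a /=; lia.
rewrite /= -!andbA; congr (_ && _); case: (eqVneq z x.+1) => [zx|zx].
  have -> : y = x.+1 by lia.
  rewrite zx /= eqxx (ltn_eqF (ltnSn x)) (gtn_eqF (ltnSn x)) (@gtn_eqF x.-1 x.+1); last by lia.
  move: (count_mem x.-1 s) (count_mem x s) (count_mem x.+1 s) => a b c; lia.
have -> : (x == z.-1) = false by lia.
have -> : (x == z) = false by lia.
have -> : (z == x) = false by lia.
have -> : (z == x.-1) = false by lia.
rewrite !add0n andbCA; congr (_ && (_ && _)).
by rewrite addnCA [in X in _ || (_ <= X)]addnCA.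
Qed.

Lemma keq2 x y z : x <= y -> y < z -> keq [:: x; z; y] [:: z; x; y].
Proof.
move=> xy yz; apply: keqP => [|s].
  by apply/seq.permP => a /=; lia.
rewrite /= -!andbA; case os: (okw 0 s) => //; rewrite !andTb; have os' := okw0_count x os; case: (eqVneq z x.+1) => [zx|zx].
  have -> : y = x by lia.
  rewrite zx /= eqxx (ltn_eqF (ltnSn x)) (gtn_eqF (ltnSn x)) (@gtn_eqF x.-1 x.+1); last by lia.
  have -> : (x == x.-1) = (x == 0) by lia.
  move: (count_mem x.-1 s) (count_mem x s) (count_mem x.+1 s) os' => a b c; lia.
have -> : (x == z.-1) = false by lia.
have -> : (x == z) = false by lia.
have -> : (z == x) = false by lia.
have -> : (z == x.-1) = false by lia.
have e0 : nat_of_bool false = 0 by [].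
by rewrite !e0 !add0n; congr (_ && _); rewrite andbC.
Qed.

Lemma keq_cons a u v : keq u v -> keq (a :: u) (a :: v).
Proof. by move=> /(keq_cat [:: a] [::]); rewrite !cats0. Qed.
Lemma keq_catl p u v : keq u v -> keq (p ++ u) (p ++ v).
Proof. by move=> /(keq_cat p [::]); rewrite !cats0. Qed.
Lemma keq_catr s u v : keq u v -> keq (u ++ s) (v ++ s).
Proof. exact: (keq_cat [::] s). Qed.

Lemma keq_dec_in x D y : sorted gtn (y :: D) -> y <= x -> keq ((y :: D) ++ [:: x]) (y :: x :: D).
Proof.
elim: D y => [|d D IH] q; first by move=> _ _; exact: keq_refl.
move=> /= /andP[dq sD] qx; have h := IH d sD (leq_trans (ltnW dq) qx).
apply: keq_trans (keq_cons q h) _.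
exact: (keq_catr D (keq_sym (keq1 dq qx))).
Qed.

Lemma keq_dec_out y D e T : sorted gtn (D ++ e :: T) -> y <= e -> keq (D ++ y :: e :: T) (y :: D ++ e :: T).
Proof.
elim: D => [|d D IH]; first by move=> _ _; exact: keq_refl.
move=> sD ye; have sD' : sorted gtn (D ++ e :: T) := path_sorted sD.
apply: keq_trans (keq_cons d (IH sD' ye)) _.
case: D sD {IH} sD' => [|f D] /= /andP[fd _] sD'; first exact: (keq_catr T (keq_sym (keq2 ye fd))).
have yf : y <= f.
  have := order_path_min gtn_trans sD'; rewrite all_cat /= => /and3P[_ /= ef _]; lia.
exact: (keq_catr (D ++ e :: T) (keq_sym (keq2 yf fd))).
Qed.

Lemma keq_inc_in y U z : sorted leq (z :: U) -> y < z -> keq ((z :: U) ++ [:: y]) (z :: y :: U).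
Proof.
elim: U z => [|u U IH] z; first by move=> _ _; exact: keq_refl.
move=> /= /andP[zu sU] yz; have h := IH u sU (leq_trans yz zu).
apply: keq_trans (keq_cons z h) _; exact: (keq_catr U (keq1 yz zu)).
Qed.

Lemma keq_inc_out z U y T : sorted leq (U ++ [:: y]) -> y < z -> keq (U ++ z :: y :: T) (z :: U ++ y :: T).
Proof.
elim: U => [|u U IH]; first by move=> _ _; exact: keq_refl.
move=> sU yz; have sU' : sorted leq (U ++ [:: y]) := path_sorted sU.
apply: keq_trans (keq_cons u (IH sU' yz)) _.
case: U sU {IH} sU' => [|v U] /= /andP[uv _] sU'; first exact: (keq_catr T (keq2 uv yz)).
have vz : v < z.
  by have := order_path_min leq_trans sU'; rewrite all_cat /= => /and3P[_ /= ef _]; lia.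
exact: (keq_catr (U ++ y :: T) (keq2 uv vz)).
Qed.

(** By Knuth moves [x] travels left through the decreasing part and sends [y] to its front; then [y]
    travels through the increasing part and sends out [z]. *)
Lemma bump_keq W x z W' : hook W -> bump W x z W' -> keq (rcons W x) (z :: W').
Proof.
move=> hW /(bump_facts hW)[U1 [U2 [D1 [D2 [y [e1 e2 -> [[a1 a2 a3 a4] [b1 b2 b3 b4] [c1 c2]]]]]]]].
have sD : sorted gtn (y :: D2) by apply: subseq_sorted c2; [exact: gtn_trans|exact: suffix_subseq].
have sU : sorted leq (z :: U2) by apply: subseq_sorted c1; [exact: leq_trans|exact: suffix_subseq].
have sU1 : sorted leq (U1 ++ [:: y]).
  by apply: subseq_sorted a4; [exact: leq_trans|rewrite cats1 -cat_rcons; exact: prefix_subseq].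
have k1 := keq_trans (keq_catl D1 (keq_dec_in sD b2)) (keq_dec_out b4 b2).
have k2 := keq_trans (keq_catl U1 (keq_inc_in sU a2)) (keq_inc_out U2 sU1 a2).
rewrite -{1}(up_dn W) e1 e2 -cats1.
have := keq_catl (U1 ++ z :: U2) k1; rewrite -!catA /= => h; apply: keq_trans h _.
by have := keq_catr (D1 ++ x :: D2) k2; rewrite -!catA /= -!catA.
Qed.

(** * Insertion of words as a bijection *)

(* The first component is the tableau, the second the row receiving a new box; a bottom row is
   created when the insertion reaches the empty tableau. *)
Fixpoint ins (R : seq (seq nat)) (x : nat) : seq (seq nat) * nat :=
  if R is W :: R' then
    match rowins W x with
    | (None, W') => (W' :: R', 0)
    | (Some z, W') => (W' :: (ins R' z).1, (ins R' z).2.+1)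
    end
  else ([:: [:: x]], 0).

Fixpoint goodR (R : seq (seq nat)) : Prop :=
  if R is W :: R' then
    [/\ hook W, W <> [::], goodR R' & if R' is W2 :: _ then good W W2 else True]
  else True.

Lemma ins_cons_app W R x : hook (rcons W x) -> ins (W :: R) x = (rcons W x :: R, 0).
Proof. by move=> h; rewrite /= /rowins h. Qed.

Lemma ins_cons_bump W R x z W' : hook W -> bump W x z W' -> ins (W :: R) x = (W' :: (ins R z).1, (ins R z).2.+1).
Proof. by move=> hW /(bump_rowins hW)[_ e]; rewrite /= e. Qed.

Lemma row_cases W x : hook W -> hook (rcons W x) \/ ~~ hook (rcons W x) /\ exists z W', bump W x z W'.
Proof.
move=> hW; have [h|nh] := boolP (hook (rcons W x)); [by left|right; split=> //].
by have [z [W' [_ b]]] := rowinsP hW nh; exists z, W'.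
Qed.

Lemma rcons_neq0 (T : Type) (s : seq T) x : rcons s x <> [::]. Proof. by case: s. Qed.

Lemma ins_good_bump W R x z W' : goodR (W :: R) -> bump W x z W' -> goodR (W' :: (ins R z).1).
Proof.
elim: R W x z W' => [|W2 R IH] W x z W' [hW W0 gR gW] b; have [hW' W0'] := bump_hook0 hW b.
  by split=> //=; exact: good_new b.
have [hW2 W20 gR2 _] := gR.
case: (row_cases z hW2) => [h|[_ [z' [W2' b']]]].
  rewrite ins_cons_app //; split=> //; last exact: good_fwd_app b h gW.
  split=> //; first exact: rcons_neq0.
  by case: (R) gR => // W3 R3 [_ _ [hW3 _ _ _] g]; apply: good_app_top.
rewrite (ins_cons_bump _ hW2 b'); split=> //; first exact: IH gR b'.
exact: good_fwd_bump b b' gW.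
Qed.

Lemma ins_good R x : goodR R -> goodR (ins R x).1.
Proof.
case: R => [|W R] gR; first by [].
have [hW W0 gR' gW] := gR.
case: (row_cases x hW) => [h|[_ [z [W' b]]]]; last first.
  by rewrite (ins_cons_bump _ hW b); exact: ins_good_bump gR b.
rewrite ins_cons_app //; split=> //; first exact: rcons_neq0.
by case: (R) gR' gW => // W3 R3 [hW3 _ _ _] g; apply: good_app_top.
Qed.

Lemma ins_shape R x j : all hook R ->
  nth 0 (shape (ins R x).1) j = nth 0 (shape R) j + (j == (ins R x).2).
Proof.
elim: R x j => [|W R IH] x j; first by case: j => [|[|j]].
move=> /andP[hW hR]; case: (row_cases x hW) => [h|[_ [z [W' b]]]].
  by rewrite ins_cons_app //; case: j => [|j] /=; rewrite ?size_rcons ?addn0 ?addn1.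
rewrite (ins_cons_bump _ hW b); case: j => [|j] /=; first by rewrite (bump_size b) addn0.
exact: IH.
Qed.

Lemma goodR_hook R : goodR R -> all hook R.
Proof. by elim: R => //= W R IH [-> _ /IH ->]. Qed.

Lemma ins_read R x : all hook R -> keq (rcons (reading_up R) x) (reading_up (ins R x).1).
Proof.
elim: R x => [|W R IH] x; first by move=> _; exact: keq_refl.
move=> /andP[hW hR]; case: (row_cases x hW) => [h|[_ [z [W' b]]]].
  rewrite ins_cons_app // /reading_up !rev_cons !flatten_rcons rcons_cat; exact: keq_refl.
rewrite (ins_cons_bump _ hW b) /reading_up !rev_cons !flatten_rcons rcons_cat.
apply: keq_trans (keq_catl _ (bump_keq hW b)) _.
by rewrite -cat_rcons; apply: keq_catr; apply: IH.
Qed.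

Lemma goodR_size R j : goodR R -> nth 0 (shape R) j.+1 = 0 \/ nth 0 (shape R) j.+1 < nth 0 (shape R) j.
Proof.
elim: R j => [|W R IH] j; first by left; case: j.
case=> hW W0 gR; case: R IH gR => [|W2 R] IH gR gW; first by left; case: j.
case: j => [|j]; last exact: IH.
by right; have [hW2 _ _ _] := gR; exact: good_size gW.
Qed.

Lemma goodR_size0 R j : goodR R -> (j < size R) = (0 < nth 0 (shape R) j).
Proof.
elim: R j => [|W R IH] j; first by case: j.
by case=> hW W0 gR _; case: j => [|j]; rewrite /= ?ltnS ?IH //; case: (W) W0.
Qed.

(** After an insertion the inserted letter is visible in a decreasing part of the first row; this is
    the letter from which the row above can be reverse bumped. *)
Lemma ins_head R x W R' i : goodR R -> ins R x = (W :: R', i) ->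
  exists U D, [/\ W = U ++ D, sorted leq U, sorted gtn D & x \in D].
Proof.
case: R => [|V R] /=; first by move=> _ [<- _ _]; exists [::], [:: x]; rewrite mem_head.
case=> hV V0 gR _; rewrite -/(ins (V :: R) x); case: (row_cases x hV) => [h|[_ [z [V' b]]]].
  rewrite ins_cons_app // => -[<- _ _]; have [U [D [-> sU sD aD]]] := hook_rcons_split hV h.
  exists U, (rcons D x); rewrite rcons_cat mem_rcons mem_head; split=> //.
  by rewrite -cats1; apply: sorted_gtn_mk.
rewrite (ins_cons_bump _ hV b) => -[<- _ _].
have [U1 [U2 [D1 [D2 [y [e1 e2 -> [[a1 a2 a3 a4] [b1 b2 b3 b4] [c1 c2]]]]]]]] := bump_facts hV b.
by exists (U1 ++ y :: U2), (D1 ++ x :: D2); rewrite mem_cat mem_head orbT.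
Qed.

Lemma hook_belast W x : hook (rcons W x) -> hook W.
Proof.
move=> h; case/lastP E: (dn (rcons W x)) => [|D m].
  have := up_dn (rcons W x); rewrite E cats0 => e; have := sorted_up (rcons W x); rewrite e => s.
  rewrite -(cats0 W); apply: hook_cat => //; apply: subseq_sorted s; first exact: leq_trans.
  exact: subseq_rcons.
have := up_dn (rcons W x); rewrite E -rcons_cat => /rcons_inj[e1 e2].
rewrite -e1; apply: hook_cat; first exact: sorted_up.
have : sorted gtn (dn (rcons W x)) := h; rewrite E => s.
by apply: subseq_sorted s; [exact: gtn_trans|exact: subseq_rcons].
Qed.

(** The condition on the next part says that a box can be removed from row [i] leaving a strict
    partition. Reverse bumping then proceeds from row [i] up to the first row. *)
Lemma ins_surj R' i : goodR R' -> i < size R' ->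
  nth 0 (shape R') i.+1 = 0 \/ (nth 0 (shape R') i.+1).+1 < nth 0 (shape R') i ->
  exists R x, goodR R /\ ins R x = (R', i).
Proof.
elim: R' i => [|W' R' IH] i // [hW' W0' gR' gW'].
case: i => [_|i]; last first.
  rewrite ltnS => ilt c; have [R [z [gR eR]]] := IH i gR' ilt c.
  case: R' eR {IH} gR' gW' ilt c => [|W2' R2'] // eR gR' gW' _ _.
  have [U [D [eW2 sU sD zD]]] := ins_head gR eR.
  have [W [x [hW b]]] := bump_exists hW' W0' eW2 sU sD zD gW'.
  exists (W :: R), x; split; last by rewrite (ins_cons_bump _ hW b) eR.
  split=> //; first by move=> E; have := bump_size b; rewrite E; case: (W') W0'.
  case: R gR eR => [|W2 R] // [hW2 W20 gR g2].
  case: (row_cases z hW2) => [h|[_ [z' [W2'' b']]]].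
    by rewrite ins_cons_app // => -[e _ _]; apply: good_bwd_app b h _ => //; rewrite e.
  by rewrite (ins_cons_bump _ hW2 b') => -[e _ _]; apply: good_bwd_bump b b' _ => //; rewrite e.
case/lastP: W' hW' W0' gW' => [|W x] // hW' _ gW' c.
case: W hW' gW' c => [|a W] hW' gW' c.
  exists [::], x; split=> //; case: R' gR' {IH gW'} c => [|W2 R2] //= [hW2 W20 _ _].
  by case: (W2) W20 => //= b s _ []//; lia.
exists ((a :: W) :: R'), x; split; last by rewrite ins_cons_app.
split=> //; first exact: hook_belast hW'.
case: R' gR' gW' {IH} c => [|W2 R2] //= [hW2 W20 _ _] gW' c; apply: good_unapp hW' hW2 _ _ gW' => //.
by case: c; rewrite ?size_rcons /=; [case: (W2) W20|lia].
Qed.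

Lemma ins_inj R S x y : goodR R -> goodR S -> ins R x = ins S y -> R = S /\ x = y.
Proof.
elim: R S x y => [|W R IH] [|V S] x y.
- by move=> _ _ [->].
- move=> _ [hV V0 gS _]; case: (row_cases y hV) => [h|[_ [z [V' b]]]].
    by rewrite ins_cons_app // => -[]; case: (V) V0 => // a [|].
  by rewrite (ins_cons_bump _ hV b).
- move=> [hV V0 gS _] _; case: (row_cases x hV) => [h|[_ [z [V' b]]]].
    by rewrite ins_cons_app // => -[]; case: (W) V0 => // a [|].
  by rewrite (ins_cons_bump _ hV b).
move=> [hW W0 gR _] [hV V0 gS _]; case: (row_cases x hW) => [h|[_ [z [W' b]]]];
case: (row_cases y hV) => [h2|[_ [z2 [V' b2]]]];
rewrite ?(ins_cons_app _ h) ?(ins_cons_app _ h2) ?(ins_cons_bump _ hW b) ?(ins_cons_bump _ hV b2) //.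
  by case=> /rcons_inj[-> ->] ->.
case=> e e1 e2; have [-> ez] : R = S /\ z = z2 by apply: IH => //; rewrite [LHS]surjective_pairing [RHS]surjective_pairing e1 e2.
by rewrite -e -ez in b2; have [-> ->] := bump_inj hW hV b b2.
Qed.

(** The second component is the recording word: the rows that receive the successive boxes. Read
    backwards from the empty tableau it builds up strict partitions ([insw_okw]), so it is a
    standard shifted tableau. *)
Fixpoint insw (R : seq (seq nat)) (v : seq nat) : seq (seq nat) * seq nat :=
  if v is x :: v' then ((insw (ins R x).1 v').1, (ins R x).2 :: (insw (ins R x).1 v').2) else (R, [::]).

Lemma insw_cat R u v : insw R (u ++ v) =
  ((insw (insw R u).1 v).1, (insw R u).2 ++ (insw (insw R u).1 v).2).
Proof.
elim: u R => [|x u IH] R /=; first by rewrite -surjective_pairing.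
by rewrite IH.
Qed.

Lemma insw_good R v : goodR R -> goodR (insw R v).1.
Proof. by elim: v R => //= x v IH R /(ins_good x) /IH. Qed.

Lemma size_insw R v : size (insw R v).2 = size v.
Proof. by elim: v R => //= x v IH R; rewrite IH. Qed.

Lemma insw_read R v : goodR R -> keq (reading_up R ++ v) (reading_up (insw R v).1).
Proof.
elim: v R => [|x v IH] R gR /=; first by rewrite cats0; exact: keq_refl.
rewrite -cat_rcons; apply: keq_trans (IH _ (ins_good x gR)); apply: keq_catr; apply: ins_read.
exact: goodR_hook.
Qed.

Lemma insw_shape v j : nth 0 (shape (insw [::] v).1) j = count_mem j (insw [::] v).2.
Proof.
elim/last_ind: v => [|v x IH]; first by case: j.
rewrite -cats1 insw_cat; set R := (insw [::] v).1; have gR : goodR R by apply: (@insw_good [::] v I).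
have -> : insw R [:: x] = ((ins R x).1, [:: (ins R x).2]) by [].
by rewrite [(_, _).1]/= [(_, _).2]/= count_cat -IH (ins_shape _ _ (goodR_hook gR)) /= addn0 [_ == j]eq_sym.
Qed.

Lemma insw_okw v : okw 1 (rev (insw [::] v).2).
Proof.
elim/last_ind: v => [|v x IH] //.
rewrite -cats1 insw_cat rev_cat /= IH /=; set R := (insw _ v).1; set i := (ins R x).2.
have gR : goodR R by apply: insw_good.
rewrite !count_rev -!insw_shape -/R; case: (posnP i) => //= i0.
case: (goodR_size i.-1 (ins_good x gR)); rewrite prednK // !ins_shape ?goodR_hook // -/i eqxx; first by lia.
by rewrite [_ == i]ltn_eqF ?prednK //; lia.
Qed.

Lemma insw_inj u v : insw [::] u = insw [::] v -> u = v.
Proof.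
elim/last_ind: u v => [|u x IH] v e.
  by have := size_insw [::] v; rewrite -e; case: v {e}.
case/lastP: v e => [|v y] e; first by have := size_insw [::] (rcons u x); rewrite e size_rcons.
move: e; rewrite -!cats1 !insw_cat /= !cats1 => -[e1 /rcons_inj[e2 e3]].
have [e4 ->] : (insw [::] u).1 = (insw [::] v).1 /\ x = y.
  apply: (ins_inj (@insw_good [::] u I) (@insw_good [::] v I)).
  by rewrite [LHS]surjective_pairing [RHS]surjective_pairing e1 e3.
by rewrite (IH v) // [LHS]surjective_pairing [RHS]surjective_pairing e2 e4.
Qed.

Lemma insw_surj R r : goodR R -> okw 1 (rev r) -> (forall j, nth 0 (shape R) j = count_mem j r) ->
  exists v, insw [::] v = (R, r).
Proof.
elim/last_ind: r R => [|r i IH] R gR.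
  move=> _ c; exists [::]; case: R gR c => // W R [_ W0 _ _] /(_ 0).
  by case: (W) W0.
rewrite rev_rcons /= => /andP[ok c] sh.
have sh' j : nth 0 (shape R) j = count_mem j r + (i == j) by rewrite sh -cats1 count_cat /= addn0.
have dec j : count_mem j.+1 r = 0 \/ count_mem j.+1 r < count_mem j r.
  clear -ok; elim/last_ind: r ok => [|r i IH]; first by left.
  rewrite rev_rcons -cats1 !count_cat /= !count_rev => /andP[/IH {}IH h].
  case: (eqVneq i j.+1) h => [->|ij] h; first by rewrite [j.+1 == j]gtn_eqF //=; move: h => /=; lia.
  clear h; have -> : count_mem j.+1 r + (false + 0) = count_mem j.+1 r by exact: addn0.
  by case: IH => IH; [left|right; exact: leq_trans IH (leq_addr _ _)].
have [||R0 [x [gR0 e]]] := @ins_surj R i gR.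
- by rewrite goodR_size0 // sh' eqxx addn1.
- have s1 : nth 0 (shape R) i.+1 = count_mem i.+1 r by rewrite sh' ltn_eqF //; exact: addn0.
  have s2 : nth 0 (shape R) i = (count_mem i r).+1 by rewrite sh' eqxx addn1.
  by rewrite s1 s2; case: (dec i); [left|right].
have [v ev] : exists v, insw [::] v = (R0, r).
  apply: IH => // j; have := ins_shape x j (goodR_hook gR0); rewrite e /= sh' [i == j]eq_sym.
  by move/addIn.
by exists (rcons v x); rewrite -cats1 insw_cat ev /= e /= cats1.
Qed.

(** * Valleys, and their exchange by insertion *)

(** Hook words characterised by a forbidden pattern [x > y <= z] on consecutive letters
    ([hook_nov]), a local form that can be followed through insertion one triple at a time. *)
Fixpoint nov (v : seq nat) : bool :=
  if v is x :: v' then (if v' is y :: z :: _ then ~~ ((y < x) && (y <= z)) else true) && nov v' else true.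

Lemma nov_sorted x v : nov (x :: v) -> (if v is y :: _ then y < x else true) -> sorted gtn (x :: v).
Proof.
elim: v x => [|y v IH] x //; case: v IH => [|z v] IH; first by move=> _ /= ->.
rewrite -[nov _]/(~~ ((y < x) && (y <= z)) && nov (y :: z :: v)) => /andP[h h2] yx.
rewrite -[sorted _ _]/((y < x) && sorted gtn (y :: z :: v)) yx; apply: IH => //.
by move: h; rewrite yx /= ltnNge.
Qed.

Lemma sorted_nov v : sorted gtn v -> nov v.
Proof.
elim: v => // x [|y [|z v]] IH // /andP[xy s]; rewrite -[nov _]/(~~ ((y < x) && (y <= z)) && nov (y :: z :: v)).
have IHs := IH s; have zy : z < y by case/andP: s.
by rewrite IHs andbT [y <= z]leqNgt zy andbF.
Qed.

Lemma hook_nov v : hook v = nov v.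
Proof.
elim: v => // x [|y v] IH; first by [].
rewrite /hook dn_cons; case: leqP => xy.
  by rewrite -/(hook (y :: v)) IH; case: v {IH} => [|z v] //; rewrite [nov (x :: _)]/= ltnNge xy.
apply/idP/idP => [s|h].
  by apply: (@sorted_nov (x :: y :: v)); rewrite /= xy.
by have := nov_sorted h xy => /= /andP[].
Qed.

Lemma nov_cat3 s a b c : nov (s ++ [:: a; b; c]) = nov (s ++ [:: a; b]) && ~~ ((b < a) && (b <= c)).
Proof.
elim: s => [|x s IH]; first by rewrite /= !andbT.
case: s IH => [|y s] IH; first by rewrite /= !andbT; case: (~~ _); rewrite ?andbF.
rewrite -[nov ((x :: y :: s) ++ [:: a; b; c])]/((if s ++ [:: a; b; c] is z :: _ then ~~ ((y < x) && (y <= z)) else true) && nov ((y :: s) ++ [:: a; b; c])).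
rewrite -[nov ((x :: y :: s) ++ [:: a; b])]/((if s ++ [:: a; b] is z :: _ then ~~ ((y < x) && (y <= z)) else true) && nov ((y :: s) ++ [:: a; b])).
by rewrite IH; case: (s) => [|z t]; rewrite andbA.
Qed.

(** The same condition for the reversed word ([novrE]), as needed for recording words. *)
Fixpoint novr (v : seq nat) : bool :=
  if v is x :: v' then (if v' is y :: z :: _ then ~~ ((y <= x) && (y < z)) else true) && novr v' else true.

Lemma novrE v : novr v = nov (rev v).
Proof.
elim: v => // x [|y [|z v]] IH //.
rewrite -[novr _]/(~~ ((y <= x) && (y < z)) && novr (y :: z :: v)) IH !rev_cons -!cats1 -!catA /=.
by rewrite nov_cat3 andbC [(y <= x) && _]andbC.
Qed.

Lemma last_dn W : dn W <> [::] -> last 0 (dn W) = last 0 W.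
Proof. by move=> D0; rewrite -[in RHS](up_dn W) last_cat; case: (dn W) D0. Qed.

Lemma app_iff W x : hook W -> hook (rcons W x) <-> dn W = [::] \/ x < last 0 W.
Proof.
move=> hW; rewrite hook_rcons //; case E: (dn W) => [|d D].
  by split=> // _; left.
rewrite -E last_dn ?E //; split=> [|[]//]; by right.
Qed.

Lemma app_dn W x : hook W -> hook (rcons W x) -> dn (rcons W x) = [::] ->
  dn W = [::] /\ (W = [::] \/ last 0 W <= x).
Proof.
move=> hW hx E; have := sorted_up (rcons W x); have := up_dn (rcons W x); rewrite E cats0 => -> s.
have sW : sorted leq W by apply: subseq_sorted s; [exact: leq_trans|exact: subseq_rcons].
have [|_] := up_dnE sW (D := [::]) => //; rewrite cats0 => ->; split=> //.
case: W s {hW hx E sW} => [|a W]; first by left.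
by rewrite /= rcons_path => /andP[_ h]; right.
Qed.

Lemma app_dn0 W x : hook W -> dn W = [::] -> W = [::] \/ last 0 W <= x -> dn (rcons W x) = [::].
Proof.
move=> hW E c; have s := sorted_up W; have := up_dn W; rewrite E cats0 => e; rewrite e in s.
have sW : sorted leq (rcons W x).
  case: W s c {hW E e} => [|a W] // s [//|c]; by rewrite /= rcons_path c andbT.
by have [|_] := up_dnE sW (D := [::]) => //; rewrite cats0 => ->.
Qed.

Lemma bump_last W x z W' : hook W -> bump W x z W' -> last 0 W' <= x /\ (dn W' = [::] -> last 0 W' = x /\ nrm W W').
Proof.
move=> hW b.
have [U1 [U2 [D1 [D2 [y [e1 e2 eW' [[a1 a2 a3 a4] [b1 b2 b3 b4] [c1 c2]]]]]]]] := bump_facts hW b; split.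
  rewrite eW' last_cat; have -> : last (last 0 (U1 ++ y :: U2)) (D1 ++ x :: D2) = last x D2 by rewrite last_cat.
  case/lastP: D2 {e2 b4 c2 eW'} b3 => [|D2 m] //; rewrite all_rcons last_rcons => /andP[/= my _]; lia.
have [V1 [V2 [E1 [E2 [w [f1 f2 q1 q2 [q3 q4 q5 q6 H2]]]]]]] := bump_after hW b.
case: H2 => [[_ -> _ _]|[_ g2 g3 g4 _]|[d [D [_ _ _ -> _]]]] E; try by case: (E1) E; case: (D) E.
- by case: (E1) E.
- by split=> //; rewrite -(up_dn W') E cats0 g2 last_rcons.
- by case: (D) E.
Qed.

Lemma valley_app3 W x1 x2 x3 : hook W -> hook (rcons W x1) -> hook (rcons (rcons W x1) x2) ->
  hook (rcons (rcons (rcons W x1) x2) x3) <-> ~ (x2 < x1 /\ x2 <= x3).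
Proof.
move=> hW h1 h2; rewrite (app_iff _ h2) last_rcons; split.
  move=> c [lt le]; case: c => [c|]; last by lia.
  by have [c1 [c2|]] := app_dn h1 h2 c; [have := rcons_neq0 c2|rewrite last_rcons; lia].
move=> nv; have [le|lt] := leqP x2 x3; last by right.
left; have le1 : x1 <= x2 by lia.
apply: app_dn0 => //; last by right; rewrite last_rcons.
by move: (h2); rewrite (app_iff _ h1) last_rcons => -[//|]; lia.
Qed.

Lemma valley_bump W x1 z W' x2 x3 : hook W -> bump W x1 z W' -> hook (rcons W' x2) ->
  hook (rcons (rcons W' x2) x3) <-> ~ (x2 < x1 /\ x2 <= x3).
Proof.
move=> hW b h2; have [hW' W0] := bump_hook0 hW b; have [l1 l2] := bump_last hW b.
rewrite (app_iff _ h2) last_rcons; split.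
  move=> c [lt le]; case: c => [c|]; last by lia.
  by have [/l2[l3 _] [//|]] := app_dn hW' h2 c; lia.
move=> nv; have [le|lt] := leqP x2 x3; last by right.
left; have le1 : x1 <= x2 by lia.
by move: (h2); rewrite (app_iff _ hW') => -[c|]; [apply: app_dn0 => //; right; lia|lia].
Qed.

(* Insertion exchanges the two kinds of valleys; checked row by row, according to which of the
   three insertions stop at the row. *)
Lemma ins_valley R x1 x2 x3 : goodR R ->
  ((x2 < x1) && (x2 <= x3)) =
  (((ins (ins R x1).1 x2).2 <= (ins R x1).2) &&
   ((ins (ins R x1).1 x2).2 < (ins (ins (ins R x1).1 x2).1 x3).2)).
Proof.
have vb (p q r : nat) : (q < p) && (q <= r) = false <-> ~ (q < p /\ q <= r).
  by split=> [/negbT/negP h [h1 h2]|h]; [apply: h; rewrite h1|apply/negP => /andP].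
(* The case where the first letter is appended to the top row; in the remaining case the outputs of
   that row are compared and the induction hypothesis applies to the rows below. *)
have base W R0 a b x : hook W -> hook (rcons W a) -> ((b < a) && (b <= x)) =
  (((ins (rcons W a :: R0) b).2 <= 0) &&
   ((ins (rcons W a :: R0) b).2 < (ins (ins (rcons W a :: R0) b).1 x).2)).
  move=> hW h1; case: (row_cases b h1) => [h2|[h2 [z2 [W2 b2]]]].
    rewrite (ins_cons_app _ h2) [(_, _).1]/= [(_, _).2]/=; case: (row_cases x h2) => [h3|[h3 [z3 [W3 b3]]]].
      by rewrite (ins_cons_app _ h3) /=; apply/vb; apply/(valley_app3 x hW h1 h2).
    rewrite (ins_cons_bump _ h2 b3) /=; apply/negbNE; apply: contra h3 => /negbTE /vb nv.
    by apply/(valley_app3 x hW h1 h2).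
  rewrite (ins_cons_bump _ h1 b2) /= /=; apply/vb => -[lt _].
  by move/negP: h2; apply; apply/(app_iff _ h1); rewrite last_rcons; right.
elim: R x1 x2 x3 => [|W R IH] x1 x2 x3.
  by move=> _; apply: (base [::] [::] x1 x2 x3).
case=> hW W0 gR gW; case: (row_cases x1 hW) => [h1|[h1 [z1 [W1 b1]]]].
  by rewrite (ins_cons_app _ h1); apply: base.
rewrite (ins_cons_bump _ hW b1) [(_, _).1]/= [(_, _).2]/=; have [hW1 W10] := bump_hook0 hW b1.
case: (row_cases x2 hW1) => [h2|[h2 [z2 [W2 b2]]]].
  rewrite (ins_cons_app _ h2) [(_, _).1]/= [(_, _).2]/=; case: (row_cases x3 h2) => [h3|[h3 [z3 [W3 b3]]]].
    by rewrite (ins_cons_app _ h3) /=; apply/vb; apply/(valley_bump x3 hW b1 h2).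
  rewrite (ins_cons_bump _ h2 b3) /=; apply/negbNE; apply: contra h3 => /negbTE /vb nv.
  by apply/(valley_bump x3 hW b1 h2).
rewrite (ins_cons_bump _ hW1 b2) [(_, _).1]/= [(_, _).2]/=; have [hW2 W20] := bump_hook0 hW1 b2.
case: (row_cases x3 hW2) => [h3|[h3 [z3 [W3 b3]]]].
  rewrite (ins_cons_app _ h3) /= ltn0 andbF; apply/vb => -[lt le].
  move: h3; rewrite (app_iff _ hW2); have [l1 l2] := bump_last hW1 b2.
  case=> [/l2[_ n2]|]; last by lia.
  by have [_] := bump_gt hW b1 b2 lt; rewrite n2.
rewrite (ins_cons_bump _ hW2 b3) [(_, _).2]/= !ltnS -IH //.
case: (ltnP x2 x1) => lt.
  have [-> n2] := bump_gt hW b1 b2 lt; rewrite /=.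
  case: (leqP x2 x3) => le; first by rewrite (bump_le hW1 b2 b3 le n2).
  by have [h _] := bump_gt hW1 b2 b3 le; rewrite leqNgt h.
rewrite /=; have [n1|n1] := boolP (nrm W W1); last by rewrite ltnNge (bump_le hW b1 b2 lt n1).
have n2 := bump_nrm_nrm hW b1 b2 lt n1.
symmetry; apply/negbTE; rewrite negb_and -ltnNge; apply/orP; right.
case: (leqP x2 x3) => le; first by rewrite -ltnNge; apply: (bump_ge_nrm hW1 b2 b3 le n2).
by have [h _] := bump_gt hW1 b2 b3 le; rewrite -ltnNge.
Qed.

Lemma insw_novr R v : goodR R -> novr (insw R v).2 = nov v.
Proof.
elim: v R => // x [|y [|z v]] IH R gR //.
have := IH _ (ins_good x gR) => e.
rewrite -[nov (x :: _)]/(~~ ((y < x) && (y <= z)) && nov (y :: z :: v)) -e (ins_valley x y z gR).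
by [].
Qed.

(** * Lattice words with hook blocks counted by insertion *)

Lemma okw_weak o v : okw o v -> okw 0 v.
Proof.
elim: v => //= x v IH /andP[/IH -> /=]; case: (x == 0) => //=; lia.
Qed.

Definition wset (o : nat) (ms mu : seq nat) : set (seq nat) :=
  [set v | [/\ size v = sumn ms, all nov (reshape ms v), okw o v & forall j, count_mem j v = nth 0 mu j]]%classic.

Definition FA (mu la : seq nat) : set (seq (seq nat)) :=
  [set R | [/\ goodR R, shape R = la, okw 0 (reading_up R) & forall j, count_mem j (reading_up R) = nth 0 mu j]]%classic.

Lemma uniq_flat (S T : eqType) (k : T -> S) (s : seq S) (F : S -> seq T) : uniq s ->
  (forall a, a \in s -> uniq (F a)) -> (forall a x, a \in s -> x \in F a -> k x = a) ->
  uniq (flatten (map F s)).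
Proof.
elim: s => //= a s IH /andP[aS us] uF kF; rewrite cat_uniq uF ?mem_head // IH //=; last first.
- by move=> b x bs; apply: kF; rewrite inE bs orbT.
- by move=> b bs; apply: uF; rewrite inE bs orbT.
rewrite andbT; apply/hasPn => x /flatten_mapP[b bs xb]; apply/negP => xa.
have e1 := kF a x (mem_head _ _) xa; have e2 : k x = b by apply: kF; rewrite // inE bs orbT.
by rewrite -e1 e2 bs in aS.
Qed.

Definition box (N : nat) : seq (seq nat) := flatten [seq lsts (iota 0 N.+1) k | k <- iota 0 N.+1].

Lemma mem_box N la : (la \in box N) = (size la <= N) && all (leq^~ N) la.
Proof.
apply/flatten_mapP/andP => [[k]|[h1 h2]].
  rewrite mem_iota mem_lsts => /andP[_ kN] /andP[/eqP -> h]; split=> //.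
  by rewrite all_iota0 in h; apply: sub_all h => x.
by exists (size la); rewrite ?mem_iota // mem_lsts eqxx all_iota0.
Qed.

Lemma uniq_box N : uniq (box N).
Proof.
apply: (@uniq_flat _ _ (fun s : seq nat => size s)); rewrite ?iota_uniq // => k.
  by move=> _; rewrite uniq_lsts ?iota_uniq.
by move=> x _ /size_lsts.
Qed.

Lemma part_box la : 0 \notin la -> la \in box (sumn la).
Proof.
move=> h; rewrite mem_box; elim: la h => //= a la IH; rewrite inE negb_or eq_sym -lt0n => /andP[a0 /IH /andP[h1 h2]].
rewrite leq_addr /= -add1n leq_add //=; apply: sub_all h2 => x /= /leq_trans; apply; exact: leq_addl.
Qed.

Definition lams N := [seq la <- box N | is_strict_part la].

Lemma goodR_strict R : goodR R -> is_strict_part (shape R).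
Proof.
elim: R => // W R IH [hW W0 gR gW]; have /andP[s n0] := IH gR.
rewrite /is_strict_part /= inE negb_or n0 andbT; apply/andP; split; last by case: (W) W0.
by case: R s gW gR {IH n0} => //= W2 R -> gW [hW2 _ _ _]; rewrite andbT; exact: good_size gW.
Qed.

Lemma size_reading (T : Type) (R : seq (seq T)) : size (reading_up R) = sumn (shape R).
Proof. by rewrite /reading_up size_flatten /shape map_rev sumn_rev. Qed.

Lemma insw_novr_blocks ms R v : goodR R -> size v = sumn ms ->
  all novr (reshape ms (insw R v).2) = all nov (reshape ms v).
Proof.
elim: ms R v => //= m ms IH R v gR sv.
have mv : m <= size v by rewrite sv leq_addr.
rewrite -{1 2}(cat_take_drop m v) insw_cat /=.
have st : size (insw R (take m v)).2 = m by rewrite size_insw size_takel.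
rewrite take_size_cat // drop_size_cat // insw_novr // IH //; first exact: insw_good.
by rewrite size_drop sv addKn.
Qed.

Lemma novr_rev_blocks ms r : size r = sumn ms -> all nov (reshape (rev ms) (rev r)) = all novr (reshape ms r).
Proof.
move=> sr; have e : r = flatten (reshape ms r) by rewrite reshapeKr // sr.
rewrite {1}e rev_flatten; set ss := reshape ms r.
have -> : rev ms = shape (rev (map rev ss)).
  rewrite /shape map_rev -map_comp (eq_map (g := size)) => [|x /=]; last by rewrite size_rev.
  by rewrite -/(shape ss) reshapeKl // sr.
by rewrite -map_rev flattenK map_rev all_rev all_map; apply: eq_all => x /=; rewrite novrE.
Qed.

Lemma wset_fin o ms mu v : wset o ms mu v -> v \in lsts (iota 0 (sumn ms)) (sumn ms).
Proof.
case=> sv _ /okw_weak ok _; rewrite mem_lsts sv eqxx all_iota0 -sv; exact: okw0_small.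
Qed.

Lemma FA_fin mu la R : FA mu la R -> R \in map (reshape la) (lsts (iota 0 (sumn la)) (sumn la)).
Proof.
case=> _ sh ok _; apply/mapP; exists (flatten R); last by rewrite -sh flattenK.
rewrite mem_lsts size_flatten sh eqxx all_iota0 /=.
have := okw0_small ok; rewrite size_reading sh; congr (is_true _); apply: eq_all_r => x.
by apply/flattenP/flattenP => -[s sR xs]; exists s; rewrite // mem_rev in sR *.
Qed.

(** Insertion sends [v] to a pair: the tableau inherits content and lattice property from [v]
    ([insw_read]), the recording word inherits the hook blocks ([insw_novr_blocks]) and is read
    backwards, hence [rev ms]. *)
Lemma word_identity ms mu :
  ncard (wset 0 ms mu) = \sum_(la <- lams (sumn ms)) ncard (FA mu la) * ncard (wset 1 (rev ms) la).
Proof.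
rewrite (@ncard_sum _ _ (wset 0 ms mu) (fun v => shape (insw [::] v).1) _ (lams (sumn ms)) (@wset_fin 0 ms mu)).
- rewrite big_seq [RHS]big_seq; apply: eq_bigr => la lam.
  (* The recording words themselves, before reversal. *)
  pose B := [set r : seq nat | [/\ size r = sumn ms, all novr (reshape ms r), okw 1 (rev r)
    & forall j, count_mem j r = nth 0 la j]]%classic.
  have finB r : B r -> r \in lsts (iota 0 (sumn ms)) (sumn ms).
    case=> sv _ /okw_weak /okw0_small ok _; rewrite mem_lsts sv eqxx all_iota0 -sv.
    by rewrite all_rev size_rev in ok.
  have -> : ncard (wset 1 (rev ms) la) = ncard B.
    symmetry; apply: (ncard_rel (f := rev) finB).
    - move=> r [h1 h2 h3 h4]; split=> //; first by rewrite size_rev sumn_rev.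
        by rewrite novr_rev_blocks.
      by move=> j; rewrite count_rev.
    - by move=> r s _ _ /(can_inj revK).
    - move=> s [h1 h2 h3 h4]; exists (rev s); last exact: revK.
      split; rewrite ?revK ?size_rev //; first by rewrite h1 sumn_rev.
        by rewrite -novr_rev_blocks ?revK // size_rev h1 sumn_rev.
      by move=> j; rewrite count_rev.
  rewrite -(ncard_prod (@FA_fin mu la) finB).
  apply: (ncard_rel (f := insw [::]) (s := lsts (iota 0 (sumn ms)) (sumn ms))).
  - by move=> v [/wset_fin].
  - move=> v [[h1 h2 h3 h4] sh]; have gR := @insw_good [::] v I.
    have [pe ok] := @insw_read [::] v I; split; split=> //=.
    + by have := ok [::] [::]; rewrite !cats0 /= => <-.
    + by move=> j; rewrite -(seq.permP pe) /= h4.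
    + by rewrite size_insw.
    + by rewrite insw_novr_blocks.
    + exact: insw_okw.
    + by move=> j; rewrite -insw_shape sh.
  - by move=> u v _ _; exact: insw_inj.
  - move=> [R r] [[g1 g2 g3 g4] [b1 b2 b3 b4]] /=.
    have [v ev] := insw_surj g1 b3 (fun j => etrans (congr1 (fun s => nth 0 s j) g2) (esym (b4 j))).
    have [pe ok] := @insw_read [::] v I; rewrite ev /= in pe ok.
    exists v => //; split; last by rewrite ev.
    have sv : size v = sumn ms by rewrite -(size_insw [::]) ev.
    split=> //; first by rewrite -(@insw_novr_blocks ms [::]) // ev.
      by have := ok [::] [::]; rewrite !cats0 /= => ->.
    by move=> j; rewrite (seq.permP pe).
- by rewrite filter_uniq // uniq_box.
- move=> v [sv _ _ _]; rewrite mem_filter; have gR := @insw_good [::] v I.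
  have st := goodR_strict gR; rewrite st /=.
  have [pe _] := @insw_read [::] v I.
  have <- : sumn (shape (insw [::] v).1) = sumn ms by rewrite -size_reading -(perm_size pe).
  by apply: part_box; case/andP: st.
Qed.

(** * Split hook blocks and their multiplicities *)

Lemma upl_size v : size (up v) = upl v.
Proof.
rewrite size_takel //; elim: v => [|p [|q V] IH] //; rewrite /upl -/upl; case: ifP => // _; exact: IH.
Qed.

Lemma mem_hooks l m x : (x \in hooks (iota 0 l) m) =
  [&& size (x.1 ++ x.2) == m, sorted leq x.1, sorted gtn x.2 & all (fun i => i < l) (x.1 ++ x.2)].
Proof.
case: x => U V /=; rewrite size_cat all_cat; apply/flatten_mapP/idP => [[a]|].
  rewrite mem_iota add0n ltnS => am /allpairsP[[U' V'] /= [Ui Vi [-> ->]]].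
  move: Ui Vi; rewrite mem_incw ?mem_decw ?sorted_iota // !all_iota0 => /and3P[/eqP -> -> ->] /and3P[/eqP -> -> ->].
  by rewrite subnK // eqxx.
case/and5P => /eqP s h1 h2 h3 h4; exists (size V); first by rewrite mem_iota add0n ltnS -s leq_addl.
apply/allpairsP; exists (U, V); rewrite mem_incw ?mem_decw ?sorted_iota // !all_iota0 h1 h2 h3 h4 eqxx -s addnK eqxx.
by split.
Qed.

Lemma uniq_hooks l m : uniq (hooks (iota 0 l) m).
Proof.
apply: (@uniq_flat _ _ (fun x : seq nat * seq nat => size x.2)); rewrite ?iota_uniq // => a.
  by move=> _; apply: allpairs_uniq; rewrite ?uniq_incw ?uniq_decw ?sorted_iota // => -[? ?] [? ?].
move=> x _ /allpairsP[p [_ Vi ->]]; move: Vi; rewrite mem_decw ?sorted_iota // => /and3P[/eqP].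
by [].
Qed.

Lemma mem_arrs l ms X : (X \in arrs (iota 0 l) ms) =
  (size X == size ms) && all (fun p => p.1 \in hooks (iota 0 l) p.2) (zip X ms).
Proof.
elim: ms X => [|m ms IH] [|x X] //.
  by apply/negbTE/negP => /allpairsP[[y t] [_ _]].
rewrite -[arrs _ (m :: ms)]/([seq x :: X | x <- hooks (iota 0 l) m, X <- arrs (iota 0 l) ms]) /= eqSS.
apply/allpairsP/idP => [[[y t] /= [yS tS [-> ->]]]|/and3P[sk xS aS]].
  by move: tS; rewrite IH yS.
by exists (x, X); rewrite IH sk aS.
Qed.

Lemma uniq_arrs l ms : uniq (arrs (iota 0 l) ms).
Proof.
elim: ms => // m ms IH; apply: allpairs_uniq; rewrite ?uniq_hooks // => -[? ?] [? ?] _ _ /= [-> ->] //.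
Qed.

(** Every nonempty hook word is cut once after and once before its peak. *)
Lemma perm_hooks l m : 0 < m -> perm_eq (hooks (iota 0 l) m)
  ([seq (up v, dn v) | v <- lsts (iota 0 l) m & nov v] ++
   [seq (take (upl v).-1 v, drop (upl v).-1 v) | v <- lsts (iota 0 l) m & nov v]).
Proof.
move=> m0; have uL : uniq [seq v <- lsts (iota 0 l) m | nov v] by rewrite filter_uniq // uniq_lsts // iota_uniq.
have inj1 : injective (fun v => (up v, dn v)) by move=> u v [e1 e2]; rewrite -(up_dn u) -(up_dn v) e1 e2.
have inj2 : injective (fun v => (take (upl v).-1 v, drop (upl v).-1 v)).
  by move=> u v [e1 e2]; rewrite -(cat_take_drop (upl u).-1 u) -(cat_take_drop (upl v).-1 v) e1 e2.
have mL v : v \in [seq v <- lsts (iota 0 l) m | nov v] = [&& hook v, size v == m & all (fun i => i < l) v].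
  by rewrite mem_filter mem_lsts all_iota0 hook_nov.
have n0 (v : seq nat) : size v == m -> v <> [::] by move=> /eqP sv E; rewrite E in sv; rewrite -sv in m0.
have flipE U M v : up v = rcons U M -> take (upl v).-1 v = U /\ drop (upl v).-1 v = M :: dn v.
  move=> e; rewrite -upl_size e size_rcons /=.
  by split; rewrite -{1}(up_dn v) e cat_rcons ?take_size_cat ?drop_size_cat.
apply: uniq_perm; first exact: uniq_hooks.
  rewrite cat_uniq !map_inj_uniq // uL /= andbT; apply/hasPn => x /mapP[v]; rewrite mL => /and3P[hv sv av] ->.
  apply/mapP => -[w]; rewrite mL => /and3P[hw sw aw] [e1 e2].
  have vw : v = w by rewrite -(cat_take_drop (upl v).-1 v) e1 e2 up_dn.
  rewrite -vw in e1; have [U [M [D [f1 _ _ _ _]]]] := peakD hv (n0 _ sv).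
  have [f2 _] := flipE _ _ _ f1; move: e1; rewrite f2 f1 => /(congr1 size); rewrite size_rcons; lia.
move=> x; rewrite mem_hooks mem_cat; apply/idP/orP.
  case: x => U V /= /and4P[s h1 h2 h3].
  have hk := hook_cat h1 h2; case: (split_cases h1 h2) => [[e1 e2]|[M [D0 [E e1 e2 _ _]]]].
    by left; apply/mapP; exists (U ++ V); rewrite ?mL ?hk ?s ?h3 // e1 e2.
  right; apply/mapP; exists (U ++ V); rewrite ?mL ?hk ?s ?h3 //.
  by have [-> ->] := flipE _ _ _ e1; rewrite e2 E.
case=> /mapP[v]; rewrite mL => /and3P[hv sv av] -> /=.
  by rewrite up_dn sv av sorted_up andbT.
rewrite cat_take_drop sv av andbT; have [U [M [D [f1 f2 f3 f4 _]]]] := peakD hv (n0 _ sv).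
by have [-> ->] := flipE _ _ _ f1; rewrite f3 f2 f4.
Qed.

Lemma sum_hooks l m (F : seq nat -> nat) :
  \sum_(x <- hooks (iota 0 l) m) F (x.1 ++ x.2) =
  2 ^ (0 < m) * \sum_(v <- lsts (iota 0 l) m | nov v) F v.
Proof.
case: m => [|m].
  rewrite /hooks /= incw0 decw0 /= !big_cons !big_nil /= mul1n.
  by rewrite !addn0.
rewrite (perm_big _ (perm_hooks l (ltn0Sn m))) /= big_cat !big_map expn1 mul2n -addnn !big_filter.
by congr (_ + _); apply: eq_bigr => v _; rewrite /= ?up_dn ?cat_take_drop.
Qed.

Lemma sum_lsts_cat (S : seq nat) i j (F : seq nat -> nat) :
  \sum_(s <- lsts S (i + j)) F s = \sum_(a <- lsts S i) \sum_(b <- lsts S j) F (a ++ b).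
Proof.
elim: i F => [|i IH] F; first by rewrite big_seq1.
by rewrite addSn !lstsS !big_allpairs_dep; apply: eq_bigr => x _; rewrite IH.
Qed.

(** Every nonempty block contributes a factor 2, the choice of its cut. *)
Lemma mark_count l ms (P : pred (seq nat)) :
  count (fun X => P (wd X)) (arrs (iota 0 l) ms) =
  2 ^ (count (leq 1) ms) * count (fun v => all nov (reshape ms v) && P v) (lsts (iota 0 l) (sumn ms)).
Proof.
have cE (T : Type) (p : pred T) s : count p s = \sum_(x <- s) (p x : nat).
  by elim: s => [|x s IH]; rewrite ?big_nil ?big_cons //= IH.
elim: ms P => [|m ms IH] P; first by rewrite /= mul1n.
rewrite cE -[arrs _ (m :: ms)]/([seq x :: X | x <- hooks (iota 0 l) m, X <- arrs (iota 0 l) ms]).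
rewrite big_allpairs_dep [sumn (m :: ms)]/= [count (leq 1) (m :: ms)]/= [X in _ = _ * X]cE sum_lsts_cat.
under eq_bigr => x _.
  have -> : \sum_(X <- arrs (iota 0 l) ms) (P (wd (x :: X)) : nat) =
      count (fun X => P ((x.1 ++ x.2) ++ wd X)) (arrs (iota 0 l) ms) by rewrite cE.
  rewrite (IH (fun w => P ((x.1 ++ x.2) ++ w))).
  over.
rewrite (sum_hooks l m (fun v => 2 ^ count (leq 1) ms *
  count (fun w => all nov (reshape ms w) && P (v ++ w)) (lsts (iota 0 l) (sumn ms)))).
rewrite -big_distrr /= mulnA -expnD; congr (_ * _).
rewrite big_mkcond big_seq [RHS]big_seq; apply: eq_bigr => v /size_lsts sv.
rewrite cE; case: ifP => nv; last first.
  by rewrite big1 // => w _; rewrite take_size_cat // nv.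
by apply: eq_bigr => w _; rewrite take_size_cat // drop_size_cat // nv.
Qed.

(** For [o = 0] the coefficient of s_mu in the product of the q_m ([prod_qq]), for [o = 1] a
    coefficient of the Schur Q-function of [mu] ([schurQ_VA]). *)
Definition VA l o ms mu : nat :=
  count (fun X => okw o (wd X) && `[< forall j, count_mem j (wd X) = nth 0 mu j >]) (arrs (iota 0 l) ms).

Lemma VA_wset l o ms mu : sumn ms <= l -> VA l o ms mu = 2 ^ (count (leq 1) ms) * ncard (wset o ms mu).
Proof.
move=> sl; rewrite /VA (mark_count l ms (fun v => okw o v && `[< forall j, count_mem j v = nth 0 mu j >])).
congr (_ * _); rewrite -size_filter; symmetry; apply: ncard_seq.
  by rewrite filter_uniq // uniq_lsts // iota_uniq.
move=> v; rewrite mem_filter mem_lsts all_iota0; split.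
  case=> sv h1 h2 h3; rewrite h1 h2 sv eqxx /=; apply/andP; split; first by apply/asboolP.
  by have := okw0_small (okw_weak h2); apply: sub_all => i; rewrite sv => h; apply: leq_trans h sl.
by case/andP => /and3P[h1 h2 /asboolP h3] /andP[/eqP sv _].
Qed.

(** The expansion of the supersymmetric Schur function of [mu] into Schur Q-functions, read off at
    one monomial. The factors 2 agree on both sides because the blocks have the same lengths. *)
Lemma VA_identity l ms mu : sumn ms <= l ->
  VA l 0 ms mu = \sum_(la <- lams (sumn ms)) ncard (FA mu la) * VA l 1 (rev ms) la.
Proof.
move=> sl; rewrite VA_wset // word_identity big_distrr /=; apply: eq_bigr => la _.
by rewrite VA_wset ?sumn_rev // count_rev mulnCA.
Qed.

(** * Primed tableaux coded letter by letter *)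

(* The alphabet 1' < 1 < 2' < 2 < ... coded by integers; pltR is the relation allowed between
   vertically adjacent boxes. *)
Definition pcode (a : pletter) : nat := a.1.*2 + ~~ a.2.
Definition pltR (a b : pletter) : bool := if b.2 then pcode a <= pcode b else pcode a < pcode b.

Lemma pletter_leE a b : pletter_le a b = (pcode a <= pcode b).
Proof.
case: a b => i [] [j []]; rewrite /pletter_le /pcode /=; case: ltngtP => //= h;
  rewrite ?h /= -?muln2; apply/esym; lia.
Qed.

Lemma pcode_inj : injective pcode.
Proof. move=> [i []] [j []]; rewrite /pcode /= -!muln2 => e; congr (_, _); lia. Qed.

Lemma ple_trans : transitive pletter_le.
Proof. by move=> y x z; rewrite !pletter_leE; apply: leq_trans. Qed.
Lemma ple_anti : antisymmetric pletter_le.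
Proof. by move=> x y; rewrite !pletter_leE => /anti_leq /pcode_inj. Qed.
Lemma pltR_trans : transitive pltR.
Proof.
move=> y x z; rewrite /pltR; case: y.2; case: z.2 => h1 h2; lia.
Qed.
Lemma pltR_le a b : pltR a b -> pletter_le a b.
Proof. by rewrite /pltR pletter_leE; case: b.2 => // /ltnW. Qed.

Lemma column_pltR s : (sorted pletter_le s /\ forall i, count_mem (i, false) s <= 1) <-> sorted pltR s.
Proof.
rewrite (sorted_pairwise ple_trans) (sorted_pairwise pltR_trans).
elim: s => [|x s IH]; first by split=> // _; split.
rewrite /=; split.
  case=> /andP[a p] c; apply/andP; split; last first.
    by apply/IH; split=> // i; apply: leq_trans (c i); exact: leq_addl.
  apply/allP => y ys; have := allP a y ys; rewrite pletter_leE /pltR.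
  case y2: y.2 => //; rewrite leq_eqVlt => /orP[/eqP /pcode_inj E|//]; exfalso.
  have := c y.1; have e : (y.1, false) = y by rewrite -y2; case: (y).
  rewrite e E eqxx; have : 0 < count_mem y s by rewrite -has_count has_pred1.
  by case: (count_mem y s).
case/andP => a /IH[p c]; split.
  by rewrite p andbT; apply: sub_all a => y; exact: pltR_le.
move=> i; case: eqP => [E|_]; last by rewrite add0n.
suff -> : count_mem (i, false) s = 0 by [].
by apply/count_memPn/negP => /(allP a); rewrite E /pltR /= ltnn.
Qed.

(** The second hypothesis says that the boxes of a column are contiguous, so comparing neighbours
    suffices. *)
Lemma sorted_pmap_iota (A : Type) (Rr : rel A) (f : nat -> option A) h : transitive Rr ->
  (forall i j, i < j -> j < h -> isSome (f i) -> isSome (f j) -> isSome (f j.-1)) ->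
  (sorted Rr (pmap f (iota 0 h)) <->
   forall r a b, r.+1 < h -> f r = Some a -> f r.+1 = Some b -> Rr a b).
Proof.
move=> tr ct; rewrite (sorted_pairwise tr).
have pw b k : pairwise Rr (pmap f (iota b k)) <->
    forall i j x y, b <= i -> i < j -> j < b + k -> f i = Some x -> f j = Some y -> Rr x y.
  elim: k b => [|k IH] b; first by split=> // _ i j x y; lia.
  rewrite [iota _ _]/= /=; case fb: (f b) => [z|]; last first.
    rewrite /= IH; split=> H i j x y h1 h2 h3 fi fj; last by apply: (H i j) => //; lia.
    have bi : b != i by apply/eqP => E; rewrite -E fb in fi.
    by apply: (H i j) => //; lia.
  rewrite /=; split.
    case/andP => a /IH H i j x y h1 h2 h3 fi fj; case: (eqVneq b i) => [E|bi].
      move: fi; rewrite -E fb => -[<-].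
      have : forall k b, all (Rr z) (pmap f (iota b k)) -> b <= j -> j < b + k -> Rr z y.
        elim=> [|k' IH'] b' /=; first by lia.
        case: (eqVneq b' j) => [->|bj]; first by rewrite fj /= => /andP[].
        by case: (f b') => [w|] /= => [/andP[_]|] aa g1 g2; apply: IH' aa _ _; lia.
      by move/(_ k b.+1 a); apply; lia.
    by apply: (H i j) => //; lia.
  move=> H; apply/andP; split; last by apply/IH => i j x y h1 h2 h3; apply: H => //; lia.
  have : forall k' b', b < b' -> b' + k' <= b + k.+1 -> all (Rr z) (pmap f (iota b' k')).
    elim=> [|k' IH'] b' //= h1 h2; have hh : all (Rr z) (pmap f (iota b'.+1 k')) by apply: IH'; lia.
    by case fb': (f b') => [w|] //=; rewrite hh andbT; apply: (H b b') => //; lia.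
  by apply; lia.
rewrite pw; split=> H.
  by move=> r a b rh fr fr1; apply: (H r r.+1).
move=> i j x y _ ij; rewrite add0n => jh fi; elim: j ij jh y => // j IH ij jh y fj.
move: ij; rewrite ltnS leq_eqVlt => /orP[/eqP E|ij]; first by apply: (H j); rewrite -?E // E.
have := ct i j.+1 (ltnW ij) jh; rewrite fi fj /= => /(_ isT isT); case fj': (f j) => [w|] // _.
by apply: (tr w); [apply: IH => //; exact: ltnW | exact: (H j)].
Qed.

Lemma sorted_count_nth (P : pred pletter) s x0 i : sorted pletter_le s -> (forall x y, pletter_le x y -> P y -> P x) ->
  i < size s -> P (nth x0 s i) = (i < count P s).
Proof.
move=> ss dP; elim: s i ss => // x s IH i ss; have sx := order_path_min ple_trans ss.
have ss' := path_sorted ss; case: i => [_|i] /=; last first.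
  rewrite ltnS => il; rewrite IH //; case Px: (P x) => //=.
  have -> : count P s = 0; last by [].
  by apply/eqP; rewrite -leqn0 leqNgt -has_count; apply/hasPn => y /(allP sx) xy; apply/negP => /(dP _ _ xy); rewrite Px.
case Px: (P x) => //=; symmetry; apply/negbTE; rewrite -leqNgt leqn0.
by rewrite -leqn0 leqNgt -has_count; apply/hasPn => y /(allP sx) xy; apply/negP => /(dP _ _ xy); rewrite Px.
Qed.

Lemma onthP (T : Type) (x0 : T) s i a : onth s i = Some a <-> i < size s /\ nth x0 s i = a.
Proof.
elim: s i => [|x s IH] [|i] /=; try by split=> // -[].
- by split=> [[->]|[_ ->]].
- by rewrite IH ltnS.
Qed.

Lemma onth_isSome (T : Type) (s : seq T) i : isSome (onth s i) = (i < size s).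
Proof. by elim: s i => [|x s IH] [|i] //=; rewrite IH. Qed.

(* Vertical adjacency of two sorted rows starting in columns p and q, in terms of counts. *)
Lemma adj_count s t p q : sorted pletter_le s -> sorted pletter_le t -> q + size t <= p + size s ->
  (forall c a b, p <= c -> q <= c -> onth s (c - p) = Some a -> onth t (c - q) = Some b -> pltR a b) <->
  (forall a, a \in t -> q + count (pletter_le^~ a) t <= p + count (pltR^~ a) s).
Proof.
move=> ss st sz; pose x0 : pletter := (0, false).
have d1 a x y : pletter_le x y -> pletter_le y a -> pletter_le x a by apply: ple_trans.
have d2 a x y : pletter_le x y -> pltR y a -> pltR x a.
  by rewrite pletter_leE /pltR; case: a.2 => h1 h2; lia.
split=> H.
  move=> a at'; have ci : 0 < count (pletter_le^~ a) t.
    by rewrite -has_count; apply/hasP; exists a => //; rewrite pletter_leE.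
  set j := (count (pletter_le^~ a) t).-1.
  have jt : j < count (pletter_le^~ a) t by rewrite /j prednK.
  have js : j < size t by apply: leq_trans jt (count_size _ _).
  have ja : nth x0 t j = a.
    apply: ple_anti; rewrite (sorted_count_nth x0 st (d1 a) js) jt /=.
    have ia : index a t < count (pletter_le^~ a) t.
      by rewrite -(sorted_count_nth x0 st (d1 a)) ?index_mem // nth_index // pletter_leE.
    rewrite -[a in pletter_le a _](nth_index x0 at').
    have ij : index a t <= j by rewrite /j; lia.
    by apply: (sorted_leq_nth ple_trans _ x0 st) => //; rewrite ?inE ?index_mem // => x; rewrite pletter_leE.
  case: (ltnP (q + j) p) => qp; first by rewrite /j in qp *; lia.
  have cs : q + j - p < size s by lia.
  have := H (q + j) (nth x0 s (q + j - p)) a qp (leq_addr _ _).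
  have -> : onth s (q + j - p) = Some (nth x0 s (q + j - p)) by apply/(onthP x0).
  have -> : onth t (q + j - q) = Some a by apply/(onthP x0); rewrite addKn.
  move=> /(_ erefl erefl); rewrite (sorted_count_nth x0 ss (d2 a) cs) /j; lia.
move=> c a b pc qc /(onthP x0)[i1 ea] /(onthP x0)[i2 eb].
have bt : b \in t by rewrite -eb mem_nth.
have := H b bt; have : c - q < count (pletter_le^~ b) t.
  by rewrite -(sorted_count_nth x0 st (d1 b)) // eb pletter_leE.
move=> h1 h2; rewrite -ea (sorted_count_nth x0 ss (d2 b) i1); lia.
Qed.

Notation hookf := (seq nat * seq nat)%type.
Notation nthX X k := (nth ([::] : seq nat, [::] : seq nat) X k).

(* X lists, letter by letter, the rows of the unprimed and of the primed occurrences. *)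
Definition rowX (X : seq hookf) (r : nat) : seq pletter :=
  flatten [seq nseq (count_mem r (nthX X k).2) (k.+1, true) ++ nseq (count_mem r (nthX X k).1) (k.+1, false)
    | k <- iota 0 (size X)].

Definition okX (X : seq hookf) : bool := all (fun x => sorted leq x.1 && sorted gtn x.2) X.

Lemma rowX_rcons X x r : rowX (rcons X x) r = rowX X r ++
  (nseq (count_mem r x.2) ((size X).+1, true) ++ nseq (count_mem r x.1) ((size X).+1, false)).
Proof.
rewrite /rowX size_rcons -addn1 iotaD map_cat flatten_cat /= cats0 nth_rcons ltnn eqxx; congr (flatten _ ++ _).
  by apply/eq_in_map => k; rewrite mem_iota add0n /= => kX; rewrite nth_rcons kX.
by rewrite add0n addn1.
Qed.

Lemma rowX_letters X r a : a \in rowX X r -> 0 < a.1 <= size X.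
Proof.
elim/last_ind: X => [|X x IH] //; rewrite rowX_rcons !mem_cat size_rcons => /or3P[/IH|/nseqP[-> _]|/nseqP[-> _]] //=.
by case/andP => -> /leqW.
Qed.

Lemma sorted_rowX X r : sorted pletter_le (rowX X r).
Proof.
elim/last_ind: X => [|X x IH] //; rewrite rowX_rcons !(sorted_pairwise ple_trans) !pairwise_cat.
rewrite -!(sorted_pairwise ple_trans) IH.
have ns n (a : pletter) : sorted pletter_le (nseq n a).
  by case: n => //; elim=> //= n ->; rewrite pletter_leE leqnn.
rewrite !ns !andbT /=; apply/andP; split; apply/allrelP => a b; last first.
  by move=> /nseqP[-> _] /nseqP[-> _]; rewrite pletter_leE leq_add2l.
move=> /rowX_letters /andP[_ h] bb; rewrite /pletter_le.
by have -> : b.1 = (size X).+1; [move: bb; rewrite mem_cat => /orP[] /nseqP[-> _] | rewrite ltnS h].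
Qed.

Lemma wd_rcons X x : wd (rev (rcons X x)) = x.1 ++ x.2 ++ wd (rev X).
Proof. by rewrite rev_rcons /wd /= catA. Qed.

Lemma size_rowX X r : size (rowX X r) = count_mem r (wd (rev X)).
Proof.
elim/last_ind: X => [|X x IH] //; rewrite rowX_rcons wd_rcons !size_cat !count_cat IH !size_nseq; lia.
Qed.

Lemma count_rowX X r i b : count_mem (i.+1, b) (rowX X r) =
  count_mem r (if b then (nthX X i).2 else (nthX X i).1).
Proof.
elim/last_ind: X => [|X x IH]; first by rewrite nth_nil; case: b.
rewrite rowX_rcons !count_cat IH !count_nseq nth_rcons /=.
have sz : ((size X).+1 == i.+1) = (i == size X) by rewrite eqSS eq_sym.
rewrite -![(_, _) == (i.+1, b)]/(((size X).+1 == i.+1) && _) sz.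
case: ltngtP => h; rewrite /= ?mul0n ?addn0 //; first by rewrite nth_default ?(ltnW h) //; case: b.
rewrite h nth_default //; clear IH; case: b => /=; rewrite ?mul1n ?mul0n ?addn0 //.
Qed.

(** Each letter adds the vertical strip of its primed boxes and then the horizontal strip of its
    unprimed ones ([okw_cat_dec], [okw_cat_inc]). The inequality for [a] is the strip condition at
    the stage of [a], with [w0] standing for the inner shape. *)
Lemma okw_rows o w0 X : okX X -> okw o (wd (rev X) ++ w0) <->
  okw o w0 /\ forall r a, a \in rowX X r.+1 ->
    (count_mem r.+1 w0 + o) + count (pletter_le^~ a) (rowX X r.+1) <=
    count_mem r w0 + count (pltR^~ a) (rowX X r).
Proof.
elim/last_ind: X => [|X [U V] IH]; first by split=> [|[]].
rewrite /okX all_rcons => /andP[/andP[/= sU sV] /IH {}IH].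
rewrite wd_rcons /= -!catA (okw_cat_inc o _ sU) (okw_cat_dec o _ sV) -!andbA.
set w := wd (rev X) ++ w0 in IH *; set N := (size X).+1.
have cw r : count_mem r w = size (rowX X r) + count_mem r w0 by rewrite count_cat size_rowX.
have cV r : count_mem r (V ++ w) = count_mem r V + (size (rowX X r) + count_mem r w0) by rewrite -cw -count_cat.
have cU r : count_mem r (U ++ V ++ w) = count_mem r U + (count_mem r V + (size (rowX X r) + count_mem r w0)).
  by rewrite -cV -count_cat.
have old (P : pred pletter) r : (forall c, ~~ P (N, c)) ->
    count P (rowX (rcons X (U, V)) r) = count P (rowX X r).
  by move=> nP; rewrite rowX_rcons !count_cat !count_nseq !(negbTE (nP _)) !mul0n !addn0.
have new (P : pred pletter) r : (forall a, a.1 <= size X -> P a) ->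
    count P (rowX (rcons X (U, V)) r) = size (rowX X r) + P (N, true) * count_mem r V + P (N, false) * count_mem r U.
  move=> aP; rewrite rowX_rcons !count_cat !count_nseq addnA; congr (_ + _ + _).
  by apply/eqP; rewrite -all_count; apply/allP => a /rowX_letters /andP[_ /aP].
have eV r : count (pletter_le^~ (N, true)) (rowX (rcons X (U, V)) r) = size (rowX X r) + count_mem r V.
  rewrite new => [|a ha]; last by rewrite /pletter_le ltnS ha.
  by rewrite !pletter_leE leqnn /pcode /= addn0 addn1 ltnn mul1n mul0n addn0.
have eV' r : count (pltR^~ (N, true)) (rowX (rcons X (U, V)) r) = size (rowX X r) + count_mem r V.
  rewrite new => [|a ha]; last by rewrite /pltR /pcode /= -!muln2; case: a.2 => /=; rewrite /N; lia.
  by rewrite /pltR leqnn /pcode /= addn0 addn1 ltnn mul1n mul0n addn0.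
have eU r : count (pletter_le^~ (N, false)) (rowX (rcons X (U, V)) r) = size (rowX X r) + count_mem r V + count_mem r U.
  rewrite new => [|a ha]; last by rewrite /pletter_le ltnS ha.
  by rewrite !pletter_leE leqnn /pcode /= addn0 addn1 leqnSn !mul1n.
have eU' r : count (pltR^~ (N, false)) (rowX (rcons X (U, V)) r) = size (rowX X r) + count_mem r V.
  rewrite new => [|a ha]; last by rewrite /pltR /pcode /= -!muln2; case: a.2 => /=; rewrite /N; lia.
  by rewrite /pltR ltnn /pcode /= addn0 addn1 ltnSn mul1n mul0n addn0.
have memN r b : (N, b) \in rowX (rcons X (U, V)) r = (r \in if b then V else U).
  rewrite -!has_pred1 !has_count count_rowX nth_rcons ltnn eqxx; by case: b.
have oldE r a : a \in rowX X r.+1 ->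
    (count (pletter_le^~ a) (rowX (rcons X (U, V)) r.+1) = count (pletter_le^~ a) (rowX X r.+1)) *
    (count (pltR^~ a) (rowX (rcons X (U, V)) r) = count (pltR^~ a) (rowX X r)).
  move=> /rowX_letters /andP[_ h]; split; apply: old => c.
    by rewrite pletter_leE /pcode /= -!muln2 /N; case: a h => i [] /= h; case: c => /=; lia.
  by rewrite /pltR /pcode /= -!muln2 /N; case: a h => i [] /= h; case: c => /=; lia.
split.
  case/and3P => /IH[ok0 H] /allP hV /allP hU; split=> // r a ra.
  have : [|| a \in rowX X r.+1, a \in nseq (count_mem r.+1 V) (N, true) | a \in nseq (count_mem r.+1 U) (N, false)].
    by move: ra; rewrite rowX_rcons !mem_cat.
  clear ra; case/or3P => [ar|/nseqP[-> c0]|/nseqP[-> c0]].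
  - by rewrite !(oldE r a ar); exact: H.
  - have rV : r.+1 \in V by rewrite -has_pred1 has_count.
    have := hV _ rV; rewrite eV eV' !cV /=; lia.
  - have rU : r.+1 \in U by rewrite -has_pred1 has_count.
    have := hU _ rU; rewrite eU eU' !cU !cV /=; lia.
case=> ok0 H; apply/and3P; split.
- apply/IH; split=> // r a ar; have := H r a; rewrite !(oldE r a ar); apply.
  by rewrite rowX_rcons mem_cat ar.
- apply/allP => -[|r] rV //; have := H r (N, true); rewrite memN rV eV eV' !cV /= => /(_ isT); lia.
- apply/allP => -[|r] rU //; have := H r (N, false); rewrite memN rU eU eU' !cU !cV /= => /(_ isT); lia.
Qed.

Definition tabX (h : nat) (X : seq hookf) : seq (seq pletter) := [seq rowX X r | r <- iota 0 h].

Lemma nth_tabX h X r : nth [::] (tabX h X) r = if r < h then rowX X r else [::].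
Proof.
case: ltnP => rh; first by rewrite (nth_map 0) ?size_iota // nth_iota.
by rewrite nth_default // size_map size_iota.
Qed.

(** The condition on [off] makes columns contiguous; it covers shifted shapes, where [off]
    increases, as well as skew shapes, where it decreases. *)
Lemma tabX_columns h X off o w0 : okX X -> all (fun i => i < h) (wd (rev X)) -> okw o w0 ->
  (forall r, r < h -> off r = count_mem r w0 + o * r) ->
  (forall i j k, i <= j -> j <= k -> k < h -> off j <= maxn (off i) (off k)) ->
  (forall r, r.+1 < h -> off r.+1 + size (rowX X r.+1) <= off r + size (rowX X r)) ->
  (forall c, sorted pltR (column off (tabX h X) c)) <-> okw o (wd (rev X) ++ w0).
Proof.
move=> oX lX ok0 offE mono ends; rewrite okw_rows //.
pose f c r := if off r <= c then onth (rowX X r) (c - off r) else None.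
have colE c : column off (tabX h X) c = pmap (f c) (iota 0 h).
  rewrite /column size_map size_iota; apply: eq_in_pmap => r; rewrite mem_iota add0n /= => rh.
  by rewrite nth_tabX rh.
have fS c r : isSome (f c r) = (off r <= c) && (c - off r < size (rowX X r)).
  by rewrite /f; case: ifP => // _; rewrite onth_isSome.
have ends2 i j : i <= j -> j < h -> off j + size (rowX X j) <= off i + size (rowX X i).
  elim: j => [|j IH]; first by rewrite leqn0 => /eqP->.
  rewrite leq_eqVlt => /orP[/eqP->//|ij] jh; apply: leq_trans (ends j jh) (IH _ (ltnW jh)).
  by [].
have ct c i j : i < j -> j < h -> isSome (f c i) -> isSome (f c j) -> isSome (f c j.-1).
  rewrite !fS => ij jh /andP[a1 a2] /andP[b1 b2].
  have := mono i j.-1 j ltac:(lia) (leq_pred _) jh; have := ends2 j.-1 j (leq_pred _) jh.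
  by rewrite maxnE; lia.
split=> [H|[_ H] c].
  split=> // r a ar; case: (ltnP r.+1 h) => rh; last first.
    have : 0 < size (rowX X r.+1) by case: (rowX _ _) ar.
    by rewrite size_rowX -has_count has_pred1 => /(allP lX) /=; rewrite ltnNge rh.
  have /(adj_count (sorted_rowX _ _) (sorted_rowX _ _) (ends r rh)) : forall c a b, off r <= c -> off r.+1 <= c ->
     onth (rowX X r) (c - off r) = Some a -> onth (rowX X r.+1) (c - off r.+1) = Some b -> pltR a b.
    move=> c x y h1 h2 e1 e2; have := H c; rewrite colE => /(sorted_pmap_iota pltR_trans (ct c)) /(_ r x y rh).
    by rewrite /f h1 h2; apply.
  move=> /(_ a ar); rewrite (offE r.+1 rh) (offE r (ltnW rh)) mulnS; lia.
rewrite colE; apply/(sorted_pmap_iota pltR_trans (ct c)) => r x y rh.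
rewrite /f; case: ifP => // h1; case: ifP => // h2 e1 e2.
have [_ HH] := adj_count (sorted_rowX X r) (sorted_rowX X r.+1) (ends r rh).
apply: (HH _ c x y) => // a ar; have := H r a ar.
rewrite (offE r.+1 rh) (offE r (ltnW rh)) mulnS; lia.
Qed.

(** Inverse of [tabX] on tableaux with letters at most [N] ([tabX_toX]). *)
Definition toX (h N : nat) (T : seq (seq pletter)) : seq hookf :=
  [seq (wofc h (fun r => count_mem (k.+1, false) (nth [::] T r)),
        rev [seq r <- iota 0 h | (k.+1, true) \in nth [::] T r]) | k <- iota 0 N].

Lemma toX_ok h N T : okX (toX h N T).
Proof.
apply/allP => x /mapP[k _ ->] /=; rewrite sorted_wofc rev_sorted; apply: sorted_filter; first exact: ltn_trans.
exact: sorted_iota.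
Qed.

Lemma toX_letters h N T x : x \in toX h N T -> all (fun i => i < h) (x.1 ++ x.2).
Proof.
case/mapP => k _ -> /=; rewrite all_cat all_wofc all_rev /=; apply/allP => r.
by rewrite mem_filter mem_iota => /andP[_].
Qed.

Lemma tabX_toX h N T : size T = h -> all (all (fun a : pletter => 0 < a.1)) T -> all (sorted pletter_le) T ->
  (forall r i, count_mem (i, true) (nth [::] T r) <= 1) -> (forall r a, a \in nth [::] T r -> a.1 <= N) ->
  tabX h (toX h N T) = T.
Proof.
move=> sT pos so c1 le; apply: (@eq_from_nth _ [::]); first by rewrite size_map size_iota.
move=> r; rewrite size_map size_iota => rh; rewrite nth_tabX rh.
have rT : nth [::] T r \in T by rewrite mem_nth // sT.
apply: (sorted_eq ple_trans ple_anti (sorted_rowX _ _) (allP so _ rT)).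
apply/allP => -[i b] _ /=; apply/eqP.
have sX : size (toX h N T) = N by rewrite size_map size_iota.
case: i => [|i].
  have -> : count_mem (0, b) (nth [::] T r) = 0 by apply/count_memPn/negP => /(allP (allP pos _ rT)).
  by apply/count_memPn/negP => /rowX_letters.
rewrite count_rowX; case: (ltnP i N) => iN; last first.
  have -> : count_mem (i.+1, b) (nth [::] T r) = 0.
    by apply/count_memPn/negP => /le /=; rewrite ltnNge iN.
  by rewrite nth_default ?sX //; case: (b).
rewrite (nth_map 0) ?size_iota // nth_iota // add0n; case: b => /=; last by rewrite count_wofc rh.
rewrite count_rev count_uniq_mem ?filter_uniq ?iota_uniq // mem_filter mem_iota rh andbT.
by have := c1 r i.+1; rewrite -has_pred1 has_count; case: (count_mem _ _) => [|[|]].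
Qed.

Lemma tabX_inj h X Y : okX X -> okX Y -> all (fun i => i < h) (wd (rev X)) -> all (fun i => i < h) (wd (rev Y)) ->
  size X = size Y -> tabX h X = tabX h Y -> X = Y.
Proof.
move=> oX oY lX lY s e; apply: (@eq_from_nth _ ([::], [::])) => // k kX.
have inw (Z : seq hookf) : k < size Z -> all (fun i => i < h) (wd (rev Z)) ->
    all (fun i => i < h) (nthX Z k).1 && all (fun i => i < h) (nthX Z k).2.
  move=> kZ aZ; rewrite -all_cat; apply/allP => x xk; apply: (allP aZ); apply/flattenP.
  by exists ((nthX Z k).1 ++ (nthX Z k).2) => //; apply/mapP; exists (nthX Z k) => //; rewrite mem_rev mem_nth.
have /andP[a1 a2] := inw X kX lX; have /andP[b1 b2] := inw Y (eq_ind _ (fun n => k < n) kX _ s) lY.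
have /andP[c1 c2] := allP oX _ (mem_nth ([::], [::]) kX).
have /andP[d1 d2] := allP oY _ (mem_nth ([::], [::]) (eq_ind _ (fun n => k < n) kX _ s)).
have cc b r : r < h -> count_mem r (if b then (nthX X k).2 else (nthX X k).1) =
    count_mem r (if b then (nthX Y k).2 else (nthX Y k).1).
  move=> rh; rewrite -!count_rowX; have := congr1 (fun T => nth [::] T r) e.
  by rewrite !nth_tabX rh => ->.
have pe (b : bool) : perm_eq (if b then (nthX X k).2 else (nthX X k).1) (if b then (nthX Y k).2 else (nthX Y k).1).
  apply/allP => r; rewrite mem_cat /= => hr; apply/eqP; apply: cc.
  by case: b hr => /orP[] hr; [apply: (allP a2)|apply: (allP b2)|apply: (allP a1)|apply: (allP b1)].
rewrite [LHS]surjective_pairing [RHS]surjective_pairing; congr (_, _).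
  exact: (sorted_eq leq_trans anti_leq c1 d1 (pe false)).
apply: (sorted_eq gtn_trans _ c2 d2 (pe true)) => x y /andP[/= h1 h2]; clear -h1 h2; lia.
Qed.

Lemma nth_parts (la mu : seq nat) : 0 \notin la -> 0 \notin mu -> (forall i, nth 0 la i = nth 0 mu i) -> la = mu.
Proof.
have sz (s : seq nat) i : 0 \notin s -> (i < size s) = (0 < nth 0 s i).
  move=> s0; case: ltnP => h; last by rewrite nth_default.
  by symmetry; rewrite lt0n; apply: contraNneq s0 => <-; apply: mem_nth.
move=> h1 h2 e; apply: (@eq_from_nth _ 0); last by move=> i _; exact: e.
apply/eqP; rewrite eqn_leq; apply/andP; split; rewrite leqNgt; apply/negP => h.
  by have := h; rewrite sz // e -sz // ltnn.
by have := h; rewrite sz // -e -sz // ltnn.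
Qed.

Lemma content_letters w mu : (forall r, count_mem r w = nth 0 mu r) -> all (fun i => i < size mu) w.
Proof.
move=> c; apply/allP => x xw; rewrite ltnNge; apply/negP => h.
by have := c x; rewrite (nth_default _ h) => /count_memPn; rewrite xw.
Qed.

Lemma part_letters p X k : all p (wd (rev X)) -> all p (nthX X k).1 && all p (nthX X k).2.
Proof.
move=> aX; case: (ltnP k (size X)) => kX; last by rewrite nth_default.
rewrite -all_cat; apply/allP => x xk; apply: (allP aX); apply/flattenP.
by exists ((nthX X k).1 ++ (nthX X k).2) => //; apply/mapP; exists (nthX X k) => //; rewrite mem_rev mem_nth.
Qed.

Lemma count_tabX h X i b : all (fun i => i < h) (wd (rev X)) ->
  count_mem (i.+1, b) (flatten (tabX h X)) = size (if b then (nthX X i).2 else (nthX X i).1).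
Proof.
move=> /(part_letters i)/andP[a1 a2]; rewrite count_flatten sumnE /tabX !big_map.
have -> : iota 0 h = index_iota 0 h by rewrite /index_iota subn0.
rewrite big_mkord; under eq_bigr do rewrite count_rowX.
by apply: sum_count; case: b.
Qed.

Lemma nth_okX X k : okX X -> sorted leq (nthX X k).1 && sorted gtn (nthX X k).2.
Proof.
move=> oX; case: (ltnP k (size X)) => kX; last by rewrite nth_default.
exact: (allP oX _ (mem_nth _ kX)).
Qed.

Lemma tabX_primed o mu X : okX X -> (forall r, count_mem r (wd (rev X)) = nth 0 mu r) ->
  (forall r, r.+1 < size mu -> o + nth 0 mu r.+1 <= nth 0 mu r) ->
  okw o (wd (rev X)) <-> primed_tableau (fun r => o * r) mu (tabX (size mu) X).
Proof.
move=> oX cX ends; set h := size mu; have lX := content_letters cX.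
have szr r : size (rowX X r) = nth 0 mu r by rewrite size_rowX cX.
have [|||c1 c2] := @tabX_columns h X (fun r => o * r) o [::] oX lX isT.
- by move=> r _.
- by move=> i j k ij jk _; rewrite leq_max [_ <= o * k]leq_mul // orbT.
- by move=> r rh; rewrite !szr mulnS; have := ends r rh; lia.
rewrite cats0 in c1 c2; split=> [ok|[_ _ [_ col] col1 _]]; last first.
  by apply: c1 => c; apply/column_pltR; split=> // i; exact: col1.
split.
- apply: (@eq_from_nth _ 0); first by rewrite !size_map size_iota.
  move=> r; rewrite !size_map size_iota => rh.
  by rewrite (nth_map [::]) ?size_map ?size_iota // nth_tabX rh szr.
- by apply/allP => s /mapP[r _ ->]; apply/allP => a /rowX_letters /andP[].
- split; first by apply/allP => s /mapP[r _ ->]; exact: sorted_rowX.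
  by move=> c; have /column_pltR[] := c2 ok c.
- by move=> c i; have /column_pltR[_] := c2 ok c; apply.
- move=> r i; rewrite nth_tabX; case: ifP => // _; case: i => [|i].
    by rewrite (count_memPn _) //; apply/negP => /rowX_letters.
  rewrite count_rowX; have /andP[_ s2] := nth_okX i oX.
  by rewrite count_uniq_mem ?leq_b1 //; apply: sorted_uniq s2 => // [|x /=]; [exact: gtn_trans|rewrite ltnn].
Qed.

Lemma toX_primed off mu N T : primed_tableau off mu T -> (forall r a, a \in nth [::] T r -> a.1 <= N) ->
  tabX (size mu) (toX (size mu) N T) = T /\
  forall r, count_mem r (wd (rev (toX (size mu) N T))) = nth 0 mu r.
Proof.
move=> [sh pos [rows _] _ c1] le; have sT : size T = size mu by rewrite -sh size_map.
have e : tabX (size mu) (toX (size mu) N T) = T by apply: tabX_toX.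
split=> // r; rewrite -size_rowX; case: (ltnP r (size mu)) => rh.
  by have := congr1 (fun S => size (nth [::] S r)) e; rewrite nth_tabX rh => ->; rewrite -sh (nth_map [::]) ?sT.
rewrite nth_default // size_rowX; apply/count_memPn/negP.
case/flatten_mapP => x; rewrite mem_rev => /toX_letters /allP a /a; by rewrite ltnNge rh.
Qed.

(** * Coefficients of Schur Q-functions *)

Lemma tableau_letters T N (m : nat -> nat) : all (all (fun a : pletter => 0 < a.1)) T ->
  (forall i, xwt T i.+1 + ywt T i.+1 = m i) -> (forall i, N <= i -> m i = 0) ->
  forall r a, a \in nth [::] T r -> a.1 <= N.
Proof.
move=> pos wt mN r [i b] ar; have rT : r < size T.
  by rewrite ltnNge; apply/negP => h; rewrite nth_default in ar.
have := allP (allP pos _ (mem_nth [::] rT)) _ ar; case: i ar => // i ar _ /=.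
rewrite ltnNge; apply/negP => /mN m0; have e0 := wt i; rewrite m0 in e0.
have e : count_mem (i.+1, b) (flatten T) <= count_mem (i.+1, false) (flatten T) + count_mem (i.+1, true) (flatten T).
  by case: (b); rewrite ?leq_addr ?leq_addl.
have : 0 < count_mem (i.+1, b) (flatten T).
  by rewrite -has_count has_pred1; apply/flattenP; exists (nth [::] T r) => //; exact: mem_nth.
by rewrite ltnNge => /negP; apply; exact: leq_trans e (eq_leq e0).
Qed.

(** A marked shifted tableau is built up letter by letter, each letter contributing one split hook
    word. Lattice words grow on the left, so the letter 1 gives the last factor and the exponents
    appear reversed. *)
Lemma schurQ_VA l N la (m : monom) : is_strict_part la -> size la <= l -> (forall i, N <= i -> m i = 0) ->
  schurQ la m = Posz (VA l 1 (rev [seq m i | i <- iota 0 N]) la).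
Proof.
move=> /andP[sla la0] sl mN; congr Posz; set ms := [seq m i | i <- iota 0 N]; set h := size la.
pose A := [set X : seq hookf | [/\ X \in arrs (iota 0 l) (rev ms), okw 1 (wd X)
   & forall j, count_mem j (wd X) = nth 0 la j]]%classic.
have offE : id = (fun r => 1 * r) by apply/funext => r; rewrite mul1n.
have ends r : r.+1 < size la -> 1 + nth 0 la r.+1 <= nth 0 la r.
  by move=> rh; apply: (sortedP 0 sla).
have szX X : X \in arrs (iota 0 l) (rev ms) -> size X = N.
  by rewrite mem_arrs => /andP[/eqP -> _]; rewrite size_rev size_map size_iota.
have hkX X k : X \in arrs (iota 0 l) (rev ms) -> k < N ->
    [&& size ((nthX (rev X) k).1 ++ (nthX (rev X) k).2) == m k, sorted leq (nthX (rev X) k).1 & sorted gtn (nthX (rev X) k).2].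
  move=> Xi kN; have sX := szX X Xi; move: Xi; rewrite mem_arrs => /andP[/eqP s /allP H].
  have := H (nthX (rev X) k, m k); rewrite mem_hooks => H'.
  have /H'/and4P[-> -> -> _] // : (nthX (rev X) k, m k) \in zip X (rev ms).
  have sm : size (rev X) = size ms by rewrite size_rev sX size_map size_iota.
  have -> : zip X (rev ms) = rev (zip (rev X) ms) by rewrite rev_zip ?revK.
  rewrite mem_rev; have <- : nth (([::], [::]), 0) (zip (rev X) ms) k = (nthX (rev X) k, m k).
    by rewrite nth_zip //; congr (_, _); rewrite (nth_map 0) ?size_iota // nth_iota.
  by apply: mem_nth; rewrite size_zip sm minnn size_map size_iota.
have okXX X : X \in arrs (iota 0 l) (rev ms) -> okX (rev X).
  move=> Xi; apply/allP => x /(nthP ([::], [::]))[k]; rewrite size_rev (szX X Xi) => kN <-.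
  by have /and3P[_ -> ->] := hkX X k Xi kN.
have -> : VA l 1 (rev ms) la = ncard A.
  rewrite /VA -size_filter; symmetry; apply: ncard_seq; first by rewrite filter_uniq ?uniq_arrs.
  move=> X; rewrite mem_filter; split; first by case=> -> -> c; rewrite andbT; apply/asboolP.
  by case/andP => /andP[h1 /asboolP h2] h3; split.
symmetry; apply: (ncard_rel (f := fun X => tabX h (rev X)) (s := arrs (iota 0 l) (rev ms))).
- by move=> X [].
- move=> X [Xi ok c]; have cX : forall r, count_mem r (wd (rev (rev X))) = nth 0 la r by rewrite revK.
  split; first by rewrite offE; apply/(tabX_primed (okXX X Xi) cX ends); rewrite revK.
  move=> i; rewrite /xwt /ywt !count_tabX ?(content_letters cX) //.
  case: (ltnP i N) => iN.
    by have /and3P[/eqP <- _ _] := hkX X i Xi iN; rewrite size_cat.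
  by rewrite nth_default ?size_rev ?(szX X Xi) // mN.
- move=> X Y [Xi _ cX] [Yi _ cY] e; apply: (can_inj revK).
  apply: (tabX_inj (okXX X Xi) (okXX Y Yi) _ _ _ e); rewrite ?revK ?size_rev ?(szX X Xi) ?(szX Y Yi) //.
    exact: content_letters cX.
  exact: content_letters cY.
- move=> T [pT wt]; have le := tableau_letters (let: And5 _ p _ _ _ := pT in p) wt mN.
  have [eT cT] := toX_primed pT le; set X := toX h N T in eT cT *.
  have lX := content_letters cT.
  exists (rev X); last by rewrite revK.
  split=> //; last first.
    by apply/(tabX_primed (toX_ok h N T) cT ends); rewrite -/X eT -offE.
  rewrite mem_arrs !size_rev !size_map !size_iota eqxx /=.
  rewrite -rev_zip ?size_map ?size_iota // all_rev; apply/allP => p /(nthP (([::], [::]), 0))[k].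
  rewrite size_zip !size_map !size_iota minnn => kN <-; rewrite nth_zip ?size_map ?size_iota //.
  rewrite mem_hooks /=; have /andP[-> ->] := nth_okX k (toX_ok h N T).
  rewrite -/X [nth 0 ms k](nth_map 0) ?size_iota // nth_iota // -wt /xwt /ywt -eT !count_tabX // size_cat eqxx /=.
  have /andP[a1 a2] := part_letters k lX.
  by rewrite all_cat; apply/andP; split; [apply: sub_all a1|apply: sub_all a2] => x /leq_trans; apply.
Qed.

(** * The tally process and the lattice condition *)

Section Tally.
Variables (h k : nat) (X : seq hookf).
Let U' := (nthX X k).1.
Let V' := (nthX X k).2.
Let U := (nthX X k.+1).1.
Let V := (nthX X k.+1).2.

Lemma sorted_blocks (s : seq (nat * pletter)) : sorted pletter_le (map snd s) ->
  sorted pletter_le (flatten [seq nseq p.1 p.2 | p <- s]).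
Proof.
rewrite !(sorted_pairwise ple_trans); elim: s => //= p s IH /andP[ap /IH ps].
rewrite pairwise_cat ps andbT; apply/andP; split.
  apply/allrelP => a b /nseqP[-> _] /flatten_mapP[q qs /nseqP[-> _]].
  by apply: (allP ap); apply: map_f.
by elim: (p.1) => //= n ->; rewrite andbT; apply/allP => a /nseqP[-> _]; rewrite pletter_leE.
Qed.

Lemma filter_rowX r : [seq a <- rowX X r | (a.1 == k.+1) || (a.1 == k.+2)] =
  nseq (count_mem r V') (k.+1, true) ++ nseq (count_mem r U') (k.+1, false) ++
  nseq (count_mem r V) (k.+2, true) ++ nseq (count_mem r U) (k.+2, false).
Proof.
have -> : nseq (count_mem r V') (k.+1, true) ++ nseq (count_mem r U') (k.+1, false) ++
  nseq (count_mem r V) (k.+2, true) ++ nseq (count_mem r U) (k.+2, false) =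
  flatten [seq nseq p.1 p.2 | p <- [:: (count_mem r V', (k.+1, true)); (count_mem r U', (k.+1, false));
     (count_mem r V, (k.+2, true)); (count_mem r U, (k.+2, false))]] by rewrite /= cats0.
apply: (sorted_eq ple_trans ple_anti).
- by apply: sorted_filter (sorted_rowX _ _); exact: ple_trans.
- by apply: sorted_blocks; rewrite /= !pletter_leE /pcode /= -!muln2; apply/and4P; split => //; lia.
apply/allP => -[i b] _; apply/eqP.
rewrite /= cats0 !count_cat !count_nseq count_filter.
case: (boolP ((i == k.+1) || (i == k.+2))) => [ik|]; last first.
  rewrite negb_or => /andP[n1 n2]; rewrite (eq_count (a2 := pred0)) ?count_pred0; last first.
    move=> [j c] /=; rewrite xpair_eqE; case: eqP => //= ->.
    by rewrite (negbTE n1) (negbTE n2) andbF.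
  by rewrite /= !xpair_eqE ![_ == i]eq_sym (negbTE n1) (negbTE n2) !mul0n.
rewrite (eq_count (a2 := pred1 (i, b))); last first.
  move=> [j c] /=; rewrite xpair_eqE; case: eqP => //= ->; by rewrite ik andbT.
case/orP: ik => /eqP ->; rewrite count_rowX /= !xpair_eqE eqxx.
  by rewrite (gtn_eqF (ltnSn k.+1)) /= !mul0n !addn0; case: b; rewrite /= ?mul1n ?mul0n ?addn0.
by rewrite (ltn_eqF (ltnSn k.+1)) /= !mul0n !add0n; case: b; rewrite /= ?mul1n ?mul0n ?addn0.
Qed.

Notation td := (tally_down k.+2).
Notation tu := (tally_up k.+2).

Lemma td_step u l a : td (Some (u, l)) a =
  if a.1 == k.+2 then (if a.2 then (if (l < u) || (u == l) then None else Some (u, l))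
                       else if l < u.+1 then None else Some (u.+1, l))
  else if (a.1 == k.+1) && ~~ a.2 then (if l.+1 < u then None else Some (u, l.+1))
  else if l < u then None else Some (u, l).
Proof.
case: a => i b; rewrite /tally_down !xpair_eqE [k.+2.-1]/=; case: (eqVneq i k.+2) => [->|n2].
  by rewrite (gtn_eqF (ltnSn k.+1)); case: b; rewrite /= ?addn0 ?addn1 ?andbT ?andbF ?orbF.
by case: (i == k.+1); case: b; rewrite /= ?addn0 ?addn1 ?andbT ?andbF ?orbF.
Qed.

Lemma tu_step u l a : tu (Some (u, l)) a =
  if a.1 == k.+2 then (if a.2 then (if l < u.+1 then None else Some (u.+1, l))
                       else if l < u then None else Some (u, l))
  else if a.1 == k.+1 then
     (if a.2 then (if l.+1 < u then None else Some (u, l.+1))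
      else if (l < u) || (u == l) then None else Some (u, l))
  else if l < u then None else Some (u, l).
Proof.
case: a => i b; rewrite /tally_up !xpair_eqE [k.+2.-1]/=; case: (eqVneq i k.+2) => [->|n2].
  by rewrite (gtn_eqF (ltnSn k.+1)); case: b; rewrite /= ?addn0 ?addn1 ?andbT ?andbF ?orbF.
by case: (i == k.+1); case: b; rewrite /= ?addn0 ?addn1 ?andbT ?andbF ?orbF.
Qed.

Lemma td_none s : foldl td None s = None. Proof. by elim: s. Qed.
Lemma tu_none s : foldl tu None s = None. Proof. by elim: s. Qed.

Lemma td_filter u l s : u <= l -> foldl td (Some (u, l)) s =
  foldl td (Some (u, l)) [seq a <- s | (a.1 == k.+1) || (a.1 == k.+2)].
Proof.
elim: s u l => //= a s IH u l ul; rewrite -/(td (Some (u, l)) a); case: ifP => [_|/negbT].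
  rewrite [RHS]/= -/(td (Some (u, l)) a).
  case E: (td (Some (u, l)) a) => [[u1 l1]|]; last by rewrite !td_none.
  apply: IH; move: E; rewrite /tally_down; case: ifP => // /negbT; rewrite negb_or -leqNgt => /andP[h1 _] [<- <-]; exact: h1.
by rewrite negb_or => /andP[n1 n2]; rewrite td_step (negbTE n1) (negbTE n2) /= ltnNge ul /= IH.
Qed.

Lemma tu_filter u l s : u <= l -> foldl tu (Some (u, l)) s =
  foldl tu (Some (u, l)) [seq a <- s | (a.1 == k.+1) || (a.1 == k.+2)].
Proof.
elim: s u l => //= a s IH u l ul; rewrite -/(tu (Some (u, l)) a); case: ifP => [_|/negbT].
  rewrite [RHS]/= -/(tu (Some (u, l)) a).
  case E: (tu (Some (u, l)) a) => [[u1 l1]|]; last by rewrite !tu_none.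
  apply: IH; move: E; rewrite /tally_up; case: ifP => // /negbT; rewrite negb_or -leqNgt => /andP[h1 _] [<- <-]; exact: h1.
by rewrite negb_or => /andP[n1 n2]; rewrite tu_step (negbTE n1) (negbTE n2) /= ltnNge ul /= IH.
Qed.

Lemma td_row u l r : u <= l -> foldl td (Some (u, l)) (rev (rowX X r)) =
  if (u + count_mem r U <= l) && ((count_mem r V == 0) || (u + count_mem r U < l))
  then Some (u + count_mem r U, l + count_mem r U') else None.
Proof.
move=> ul; rewrite td_filter // filter_rev filter_rowX !rev_cat !rev_nseq -!catA !foldl_cat.
have d1 n : foldl td (Some (u, l)) (nseq n (k.+2, false)) = if u + n <= l then Some (u + n, l) else None.
  elim: n u ul => [|n IH] u0 ul0; first by rewrite addn0 ul0.
  rewrite [foldl _ _ _]/= -/(td (Some (u0, l)) (k.+2, false)) td_step /= eqxx.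
  case: ltnP => h1; first by rewrite td_none; case: leqP => //; lia.
  by rewrite IH // addSnnS.
rewrite d1; case: ifP => h1; last by rewrite !td_none.
set u1 := u + _ in h1 *.
have d2 n : foldl td (Some (u1, l)) (nseq n (k.+2, true)) = if (n == 0) || (u1 < l) then Some (u1, l) else None.
  elim: n => [|n IH] //; rewrite [foldl _ _ _]/= -/(td (Some (u1, l)) (k.+2, true)) td_step /= eqxx.
  by case: ltngtP h1 => //= hh _; [rewrite IH hh orbT|rewrite td_none].
rewrite d2; case: ifP => h2; last by rewrite !td_none.
have d3 n l1 : u1 <= l1 -> foldl td (Some (u1, l1)) (nseq n (k.+1, false)) = Some (u1, l1 + n).
  elim: n l1 => [|n IH] l1 hh; first by rewrite addn0.
  rewrite [foldl _ _ _]/= -/(td (Some (u1, l1)) (k.+1, false)) td_step /= eqxx (ltn_eqF (ltnSn _)) /=.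
  by rewrite ifF ?IH ?addSnnS //; lia.
rewrite d3 //; elim: (count_mem r V') => //= n IH.
by rewrite -/(td (Some (u1, l + count_mem r U')) (k.+1, true)) td_step /= (ltn_eqF (ltnSn _)) andbF ifF //; lia.
Qed.

Lemma tu_row u l r : u <= l -> foldl tu (Some (u, l)) (rowX X r) =
  if ((count_mem r U' == 0) || (u < l + count_mem r V')) && (u + count_mem r V <= l + count_mem r V')
  then Some (u + count_mem r V, l + count_mem r V') else None.
Proof.
move=> ul; rewrite tu_filter // filter_rowX !foldl_cat.
have d3 n l1 : u <= l1 -> foldl tu (Some (u, l1)) (nseq n (k.+1, true)) = Some (u, l1 + n).
  elim: n l1 => [|n IH] l1 hh; first by rewrite addn0.
  rewrite [foldl _ _ _]/= -/(tu (Some (u, l1)) (k.+1, true)) tu_step /= eqxx (ltn_eqF (ltnSn _)) /=.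
  by rewrite ifF ?IH ?addSnnS //; lia.
rewrite d3 //; set l1 := l + _; have ul1 : u <= l1 by rewrite /l1; lia.
have d2 n : foldl tu (Some (u, l1)) (nseq n (k.+1, false)) = if (n == 0) || (u < l1) then Some (u, l1) else None.
  elim: n => [|n IH] //; rewrite [foldl _ _ _]/= -/(tu (Some (u, l1)) (k.+1, false)) tu_step /= eqxx (ltn_eqF (ltnSn _)).
  by case: ltngtP ul1 => //= hh _; [rewrite IH hh orbT|rewrite tu_none].
rewrite d2; case: ifP => h2; last by rewrite !tu_none.
have d1 n u0 : u0 <= l1 -> foldl tu (Some (u0, l1)) (nseq n (k.+2, true)) = if u0 + n <= l1 then Some (u0 + n, l1) else None.
  elim: n u0 => [|n IH] u0 ul0; first by rewrite addn0 ul0.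
  rewrite [foldl _ _ _]/= -/(tu (Some (u0, l1)) (k.+2, true)) tu_step /= eqxx.
  case: ltnP => h1; first by rewrite tu_none; case: leqP => //; lia.
  by rewrite IH // addSnnS.
rewrite d1 //; case: ifP => h1; last by rewrite !tu_none.
elim: (count_mem r U) => //= n IH.
by rewrite -/(tu (Some (u + count_mem r V, l1)) (k.+2, false)) tu_step /= eqxx /= [l1 < _]ltnNge h1 /= IH.
Qed.

Lemma clt_S j S : clt j.+1 S = clt j S + count_mem j S.
Proof.
rewrite /clt; elim: S => //= x S ->; rewrite ltnS leq_eqVlt; case: eqP => [->|_] /=; rewrite ?ltnn; lia.
Qed.
Lemma cge_S j S : cge j S = cge j.+1 S + count_mem j S.
Proof.
rewrite /cge; elim: S => //= x S ->; rewrite [j <= x]leq_eqVlt eq_sym; case: eqP => [->|_] /=; rewrite ?ltnn; lia.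
Qed.

Lemma td_rows j : foldl td (Some (0, 0)) (flatten [seq rev (rowX X r) | r <- iota 0 j]) =
  if all (fun r => (cle r U <= clt r U') && ((count_mem r V == 0) || (cle r U < clt r U'))) (iota 0 j)
  then Some (clt j U, clt j U') else None.
Proof.
elim: j => [|j IH].
  by rewrite /= /clt !(eq_count (a2 := pred0)) ?count_pred0.
have io : iota 0 j.+1 = rcons (iota 0 j) j by rewrite -cats1 -[j.+1]addn1 iotaD.
rewrite io map_rcons flatten_rcons foldl_cat IH all_rcons.
have cleE : cle j U = clt j.+1 U by [].
case: ifP => H; last by rewrite td_none andbF.
have le : clt j U <= clt j U'.
  clear io; case: j H {IH cleE} => [|j] H; first by rewrite /clt !(eq_count (a2 := pred0)) ?count_pred0.
  have := allP H j; rewrite mem_iota leq0n add0n ltnSn => /(_ isT) /= /andP[hh _].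
  apply: leq_trans hh _; exact: c_lt_mono.
by rewrite td_row // cleE !clt_S andbT /=.
Qed.

Lemma tu_rows n j : j + n = h -> size U <= size U' -> all (fun r => r < h) V -> all (fun r => r < h) V' ->
  foldl tu (Some (size U, size U')) (flatten (rev [seq rowX X r | r <- iota j n])) =
  if all (fun r => ((count_mem r U' == 0) || (size U + cgt r V < size U' + cge r V')) &&
     (size U + cge r V <= size U' + cge r V')) (iota j n)
  then Some (size U + cge j V, size U' + cge j V') else None.
Proof.
move=> + sU aV aV'; elim: n j => [|n IH] j jh.
  have z S : all (fun r => r < h) S -> cge j S = 0.
    move=> aS; apply/eqP; rewrite -leqn0 leqNgt -has_count; apply/hasPn => x /(allP aS) /=; lia.
  by rewrite /= !z ?addn0.
rewrite /= rev_cons flatten_rcons foldl_cat IH; last by lia.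
case: ifP => H; last by rewrite tu_none andbF.
have le : size U + cge j.+1 V <= size U' + cge j.+1 V'.
  case: n jh IH H => [|n] jh IH H; last by have /andP[/andP[]] := H.
  have z S : all (fun r => r < h) S -> cge j.+1 S = 0.
    move=> aS; apply/eqP; rewrite -leqn0 leqNgt -has_count; apply/hasPn => x /(allP aS) /=; lia.
  by rewrite !z ?addn0.
by rewrite tu_row // andbT -!addnA -!cge_S.
Qed.

(** At the end of each row the tallies are the counts in [td_rows] and [tu_rows]. The downward pass
    thus checks the first two conditions of [G] row by row, the upward pass the last two. *)
Lemma latticeE : all (fun r => r < h) (wd (rev X)) -> lattice k.+2 (tabX h X) <-> G U' V' U V.
Proof.
move=> lX; have /andP[aU' aV'] := part_letters k lX; have /andP[aU aV] := part_letters k.+1 lX.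
rewrite -/U' -/V' -/U -/V in aU' aV' aU aV.
have ch S : all (fun r => r < h) S -> clt h S = size S by move=> aS; apply/eqP; rewrite -all_count.
have ch2 S r : all (fun r => r < h) S -> h <= r -> (clt r S = size S) * (cle r S = size S) * (cge r S = 0) * (cgt r S = 0).
  move=> aS hr; split; [split; [split|]|].
  - by apply/eqP; rewrite -all_count; apply: sub_all aS => x /=; lia.
  - by apply/eqP; rewrite -all_count; apply: sub_all aS => x /=; lia.
  - by apply/eqP; rewrite -leqn0 leqNgt -has_count; apply/hasPn => x /(allP aS) /=; lia.
  - by apply/eqP; rewrite -leqn0 leqNgt -has_count; apply/hasPn => x /(allP aS) /=; lia.
have c0 r (S : seq nat) : (count_mem r S == 0) = (r \notin S) by rewrite -has_pred1 has_count -eqn0Ngt.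
rewrite /lattice /reading_down /reading_up /tabX -map_comp td_rows !ch //.
case: ifP => /= H; last first.
  rewrite tu_none; split=> // -[g1 g2 _ _]; move/negP: H; case; apply/allP => r _.
  rewrite g1 /= c0; case rV: (r \in V) => //=; exact: g2.
have sU : size U <= size U'.
  case: h aU aU' H ch {ch2 aV aV' lX} => [|h'] aU aU' H ch; first by case: (U) aU.
  have := allP H h'; rewrite mem_iota leq0n add0n ltnSn => /(_ isT) /= /andP[le _].
  by rewrite -(ch U) // (leq_trans le) // -(ch U') // c_lt_mono.
rewrite (@tu_rows h 0) ?add0n //; split=> [|g].
  case: ifP => // H2 _; split.
  - move=> r; case: (ltnP r h) => rh; last by rewrite !(ch2 _ r).
    by have := allP H r; rewrite mem_iota leq0n add0n rh => /(_ isT) /= /andP[].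
  - move=> r rV; have := allP H r; rewrite mem_iota leq0n add0n (allP aV r rV) => /(_ isT) /= /andP[_].
    by rewrite c0 rV.
  - move=> r; case: (ltnP r h) => rh; last by rewrite !(ch2 _ r) ?addn0.
    by have := allP H2 r; rewrite mem_iota leq0n add0n rh => /(_ isT) /= /andP[].
  - move=> r rU; have := allP H2 r; rewrite mem_iota leq0n add0n (allP aU' r rU) => /(_ isT) /= /andP[+ _].
    by rewrite c0 rU.
have [_ _ g3 g4] := g; rewrite ifT //; apply/allP => r _; rewrite g3 andbT c0.
by case rU: (r \in U') => //=; exact: g4.
Qed.
End Tally.

(** * The starting property *)

(** Says that the cut of the hook word is the canonical one, with the peak in the increasing
    part. *)
Definition peakU (x : hookf) : bool := if x.2 is d :: _ then (x.1 != [::]) && (d < last 0 x.1) else true.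

(** Primed boxes come first within a row, so the lowest row containing the letter starts with a
    primed box exactly when the head of [V] is at least every element of [U]. *)
Lemma start_rows h (c : nat) (U V : seq nat) : sorted leq U -> sorted gtn V -> all (fun r => r < h) U -> all (fun r => r < h) V ->
  (if (flatten (rev [seq nseq (count_mem r V) (c, true) ++ nseq (count_mem r U) (c, false) | r <- iota 0 h]) : seq pletter)
     is a :: _ then ~~ a.2 else true) = peakU (U, V).
Proof.
elim: h => [|h IH] sU sV aU aV; first by case: V U aV aU {sV sU} => // -[].
have io : iota 0 h.+1 = rcons (iota 0 h) h by rewrite -cats1 -[h.+1]addn1 iotaD.
rewrite io map_rcons rev_rcons /=.
case vh: (count_mem h V) => [|n] /=; last first.
  have hV : h \in V by rewrite -has_pred1 has_count vh.
  case: V sV aV hV {vh IH} => // d V sV /andP[dh _]; rewrite inE => hd.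
  have -> : d = h.
    by case/orP: hd => [/eqP//|hV]; have := allP (order_path_min gtn_trans sV) h hV => /=; lia.
  rewrite /peakU /=; symmetry; apply/negbTE; rewrite negb_and; apply/orP; right; rewrite -leqNgt.
  case/lastP: U aU {sU} => // U u; rewrite all_rcons last_rcons => /andP[]; by rewrite ltnS.
have aV' : all (fun r => r < h) V.
  apply/allP => x xV; have := allP aV x xV; rewrite /= ltnS leq_eqVlt => /orP[/eqP E|//].
  by move/count_memPn: vh; rewrite -E xV.
case uh: (count_mem h U) => [|n] /=.
  rewrite IH //; apply/allP => x xV; have := allP aU x xV; rewrite /= ltnS leq_eqVlt => /orP[/eqP E|//].
  by move/count_memPn: uh; rewrite -E xV.
have hU : h \in U by rewrite -has_pred1 has_count uh.
rewrite /peakU; case: V aV' {sV aV vh IH} => // d V /= /andP[dh _].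
case/lastP: U hU sU {aU uh} => // U u hU; rewrite last_rcons -cats1 => /sorted_cat_leq[_ _ aU _ _].
symmetry; apply/andP; split; first by case: (U).
move: hU; rewrite mem_rcons inE => /orP[/eqP <- //|/(allP aU) /= h1]; exact: leq_trans h1.
Qed.

Lemma startingE h k X : okX X -> all (fun r => r < h) (wd (rev X)) ->
  starting k.+1 (tabX h X) = peakU (nthX X k).
Proof.
move=> oX lX; have /andP[aU aV] := part_letters k lX; have /andP[sU sV] := nth_okX k oX.
rewrite [nthX X k]surjective_pairing -(start_rows k.+1 sU sV aU aV) /starting /reading_up filter_flatten map_rev.
rewrite /tabX -map_comp; congr (if flatten (rev _) is a :: _ then ~~ a.2 else true).
apply: eq_map => r /=.
have -> : nseq (count_mem r (nthX X k).2) (k.+1, true) ++ nseq (count_mem r (nthX X k).1) (k.+1, false) =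
  flatten [seq nseq p.1 p.2 | p <- [:: (count_mem r (nthX X k).2, (k.+1, true)); (count_mem r (nthX X k).1, (k.+1, false))]].
  by rewrite /= cats0.
apply: (sorted_eq ple_trans ple_anti).
- by apply: sorted_filter (sorted_rowX _ _); exact: ple_trans.
- by apply: sorted_blocks; rewrite /= !pletter_leE /pcode /= andbT -!muln2; lia.
apply/allP => -[i b] _; apply/eqP.
rewrite /= cats0 !count_cat !count_nseq count_filter.
case: (eqVneq i k.+1) => [->|n1]; last first.
  rewrite (eq_count (a2 := pred0)) ?count_pred0; last first.
    by move=> [j c] /=; rewrite xpair_eqE; case: eqP => //= ->; rewrite (negbTE n1) andbF.
  by rewrite /= !xpair_eqE ![_ == i]eq_sym (negbTE n1) !mul0n.
rewrite (eq_count (a2 := pred1 (k.+1, b))); last first.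
  by move=> [j c] /=; rewrite xpair_eqE; case: (j == k.+1); rewrite /= ?andbT.
by rewrite count_rowX /= !xpair_eqE eqxx /=; case: b; rewrite /= ?mul1n ?mul0n ?addn0.
Qed.

(** * Antisymmetrised binomials count chains of horizontal strips *)

Lemma cp_small m k : m < k -> cp m k = 0.
Proof.
elim: m k => [|m IH] [|k] //; rewrite ltnS => mk; rewrite cpSS !IH //; exact: ltnW.
Qed.

Lemma cp_diag k : cp k k = 1.
Proof. by elim: k => // k IH; rewrite cpSS IH cp_small. Qed.

Lemma cp_hockey d k : \sum_(y < d.+1) cp (y + k) k = cp (d + k.+1) k.+1.
Proof.
elim: d => [|d IH]; first by rewrite big_ord1 !add0n !cp_diag.
have -> : d.+1 + k.+1 = (d + k.+1).+1 by [].
by rewrite cpSS big_ord_recr IH; congr (_ + cp _ _) => /=; lia.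
Qed.

Section KostkaAlternant.
Variable (l' M : nat).
Notation l := l'.+1.
Local Open Scope ring_scope.
Notation C := int.
Implicit Types (b c : 'I_l -> nat) (ts : seq nat) (F : ('I_l -> nat) -> C).
Local Notation vec := {ffun 'I_l -> 'I_M}.

Lemma int_tf (x : int) : x + x = 0 -> x = 0.
Proof. by move=> h; lia. Qed.

(* Each t in ts adds a multiset of rows below t. *)
Fixpoint TT ts F b : C :=
  if ts is t :: ts' then \sum_(g : vec | domr t b g) TT ts' F (nv g) else F b.

Definition dl c b : C := \prod_i (b i == c i)%:R.

(** The number of ways to write [c - b] as a sum of [k] nonnegative integers. *)
Definition cnum (c b k : nat) : nat := if (b <= c)%N then cp (c - b + k) k else 0%N.

Lemma domr_sum t b (g : vec) : domr t b g -> (\sum_i b i <= \sum_i g i)%N.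
Proof.
move/forallP => d; apply: leq_sum => i _; have := d i; case: ifP => // _ /eqP ->.
exact: leqnn.
Qed.

Lemma TT_zero N ts F b : (forall c, (\sum_i c i)%N != N -> F c = 0) -> (N < \sum_i b i)%N -> TT ts F b = 0.
Proof.
move=> F0; elim: ts b => [|t ts IH] b Nb /=; first by rewrite F0 // gtn_eqF.
by rewrite big1 // => g /domr_sum dg; apply: IH; apply: leq_trans Nb dg.
Qed.

Lemma TT_linear (I : finType) (a : I -> C) (Fs : I -> ('I_l -> nat) -> C) ts b :
  TT ts (fun c => \sum_i a i * Fs i c) b = \sum_i a i * TT ts (Fs i) b.
Proof.
elim: ts b => [|t ts IH] b //=.
under eq_bigr do rewrite IH.
by rewrite exchange_big; apply: eq_bigr => i _; rewrite mulr_sumr.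
Qed.

Lemma TT_swap ts F b (i j : 'I_l) : all (fun t => (i < t) && (j < t))%N ts -> i != j ->
  (forall c, F (c \o tperm i j) = - F c) -> TT ts F (b \o tperm i j) = - TT ts F b.
Proof.
move=> + ij Fs; elim: ts b => [|t ts IH] b //= /andP[/andP[it jt] ats].
pose tau (g : vec) : vec := [ffun x => g (tperm i j x)].
have tauK : involutive tau by move=> g; apply/ffunP => x; rewrite !ffunE tpermK.
rewrite (reindex_inj (inv_inj tauK)) -sumrN; apply: eq_big => g; last first.
  move=> _; rewrite -IH //; congr TT; apply/funext => x; rewrite /nv /= ffunE //.
have tt (x : 'I_l) : ((tperm i j x : nat) < t)%N = (x < t)%N.
  by case: tpermP => [->|->|//]; rewrite it jt.
apply/forallP/forallP => H x.
  by have := H (tperm i j x); rewrite tt /= ffunE tpermK.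
by have := H (tperm i j x); rewrite tt /= ffunE.
Qed.

(** Without strip conditions the rows grow independently, row [i] having one step for every [t]
    exceeding [i]. *)
Lemma TT_dl ts c b : (forall i, c i < M)%N ->
  TT ts (dl c) b = (\prod_i cnum (c i) (b i) (count (fun t => (i < t)%N) ts))%N%:R.
Proof.
move=> cM; elim: ts b => [|t ts IH] b /=.
  rewrite /dl natr_prod; apply: eq_bigr => i _; rewrite /cnum addn0.
  have -> : cp (c i - b i) 0 = (c i - b i == 0)%N by case: (c i - b i)%N.
  by case: ltngtP => //= h; congr (_%:R); lia.
under eq_bigr do rewrite IH.
rewrite -natr_sum; congr (_%:R).
pose fi (i : 'I_l) (x : 'I_M) : nat := if (if (i < t)%N then (b i <= x)%N else x == b i :> nat)
  then cnum (c i) x (count (fun t => (i < t)%N) ts) else 0%N.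
transitivity (\sum_(g : vec) \prod_i fi i (g i))%N.
  rewrite big_mkcond; apply: eq_bigr => g _; case: ifP => [/forallP dg|/forallPn[i ng]].
    by apply: eq_bigr => i _; rewrite /fi dg.
  by rewrite (bigD1 i) //= /fi (negbTE ng).
rewrite -bigA_distr_bigA; apply: eq_bigr => i _; rewrite /fi -big_mkcond /=.
set k := count (fun t => (i < t)%N) ts; have ciM := cM i; case it: (i < t)%N => /=; last first.
  case: (ltnP (b i) M) => bM.
    by rewrite (big_pred1 (Ordinal bM)) // => x; apply/eqP/eqP => [h|->//]; apply: val_inj.
  rewrite big_pred0 => [|x]; last by apply/negbTE/eqP => h; have := ltn_ord x; lia.
  by rewrite /cnum leqNgt (leq_trans ciM bM).
rewrite add1n /cnum.
transitivity (\sum_(0 <= x < M | (b i <= x) && (x <= c i)) cp (c i - x + k) k)%N.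
  by rewrite big_mkord big_mkcondr.
case: leqP => bc; last first.
  by rewrite big_nat_cond big_pred0 // => x; apply/negbTE; lia.
have -> : (\sum_(0 <= x < M | (b i <= x) && (x <= c i)) cp (c i - x + k) k =
   \sum_(b i <= x < (c i).+1) cp (c i - x + k) k)%N.
  rewrite (@big_cat_nat _ _ _ (b i)) //=; last by lia.
  rewrite [X in (X + _)%N]big_nat_cond big_pred0 ?add0n; last by move=> x; apply/negbTE; lia.
  rewrite (@big_cat_nat _ _ _ (c i).+1) //=; last by lia.
  rewrite [X in (_ + X)%N]big_nat_cond [X in (_ + X)%N]big_pred0 ?addn0; last by move=> x; apply/negbTE; lia.
  by rewrite big_nat_cond [RHS]big_nat_cond; apply: eq_bigl => x; lia.
rewrite -cp_hockey -(big_mkord xpredT (fun y => cp (y + k) k)) big_nat_rev /=.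
rewrite -{1}(add0n (b i)) big_addn.
have -> : ((c i).+1 - b i = (c i - b i).+1)%N by lia.
by rewrite big_nat [RHS]big_nat; apply: eq_bigr => x hx; congr (cp (_ + _) _); lia.
Qed.

(** Lengths are cut off at [M] to keep the list finite. *)
Definition Us (t : nat) : seq (seq nat) := flatten [seq incw (iota 0 t) r | r <- iota 0 M].

Lemma big_Us (F : seq nat -> C) t (P : pred (seq nat)) :
  \sum_(U <- Us t | P U) F U = \sum_(r < M) \sum_(U <- incw (iota 0 t) r | P U) F U.
Proof.
rewrite /Us; elim: M => [|m IH]; first by rewrite big_nil big_ord0.
by rewrite -addn1 iotaD map_cat flatten_cat big_cat IH /= cats0 addn1 big_ord_recr.
Qed.

Lemma bw_sum U w : all (fun i => (i < l)%N) U -> (\sum_i @bw l' (U ++ w) i = \sum_i @bw l' w i + size U)%N.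
Proof. by move=> aU; rewrite -(sum_count aU) -big_split; apply: eq_bigr => i _; rewrite bw_cat. Qed.

Lemma bw_mono w : okw 0 w -> forall i j : 'I_l, (i < j)%N -> (@bw l' w j < @bw l' w i)%N.
Proof.
move=> ok i j ij; rewrite /bw; suff : (count_mem (j : nat) w <= count_mem (i : nat) w)%N by have := ltn_ord j; lia.
case: i j ij => i il [j jl] /= {il jl}; elim: j => // j IH.
by rewrite ltnS leq_eqVlt => /orP[/eqP->|/IH]; [exact: okw0_count|apply: leq_trans; exact: okw0_count].
Qed.

(** The cancellation of [hPieri], for growth in the first [t] rows and any function antisymmetric in
    these rows. *)
Lemma level_cancel (H : ('I_l -> nat) -> C) t w r : (t <= l)%N -> okw 0 w -> (\sum_i @bw l' w i + r < M)%N ->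
  (forall b (i j : 'I_l), i != j -> (i < t)%N -> (j < t)%N -> H (b \o tperm i j) = - H b) ->
  \sum_(U <- incw (iota 0 t) r | okw 0 (U ++ w)) H (@bw l' (U ++ w)) =
  \sum_(g : vec | domr t (@bw l' w) g && (\sum_i g i == \sum_i @bw l' w i + r)%N) H (nv g).
Proof.
move=> tl ok bM Hs.
pose Q (c : 'I_l -> nat) := [forall i : 'I_l, forall j : 'I_l,
    (j == i.+1 :> nat) && (j < t)%N ==> (c j < @bw l' w i)%N].
transitivity (\sum_(U <- incw (iota 0 t) r)
   (fun c => if Q c then H c else 0) (fun i => (@bw l' w i + count_mem (i : nat) U)%N)).
  rewrite big_mkcond big_seq [RHS]big_seq; apply: eq_bigr => U.
  rewrite mem_incw ?sorted_iota // all_iota0 => /and3P[_ sU aU].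
  have aU' : all (fun i => (i < l)%N) U by apply: sub_all aU => i h; apply: leq_trans tl.
  rewrite (@okw0_bw l') //; have <- : @bw l' (U ++ w) = (fun i : 'I_l => (@bw l' w i + count_mem (i : nat) U)%N) by exact: bw_cat.
  congr (if _ then _ else _).
  apply/forallP/forallP => h i; apply/forallP => j; apply/implyP => /andP[ji jt].
    by have /forallP/(_ j)/implyP := h i; apply; rewrite ji ltn_ord.
  case: (ltnP j t) => jt'; first by have /forallP/(_ j)/implyP := h i; apply; rewrite ji.
  rewrite bw_cat (count_memPn _) ?addn0; last by apply/negP => /(allP aU); rewrite ltnNge jt'.
  by apply: bw_mono => //; rewrite (eqP ji).
rewrite (sum_incw (fun c => if Q c then H c else 0) tl bM) -big_mkcondr /=.
rewrite (@strip_cancel _ _ int_tf _ H t Hs _ _ tl) //.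
  by apply: eq_bigl => g; rewrite -andbA.
by move=> i j; rewrite leq_eqVlt => /orP[/eqP/val_inj->//|/(bw_mono ok)/ltnW].
Qed.

(** The variant of [TT] in which every step adds a horizontal strip. *)
Fixpoint RES ts F w : C :=
  if ts is t :: ts' then \sum_(U <- Us t | okw 0 (U ++ w)) RES ts' F (U ++ w) else F (@bw l' w).

(* The largest bounds are treated last, so that the remaining sum is antisymmetric in the rows
   concerned. *)
Lemma RES_TT N ts F w : (N < M)%N -> (forall c, (\sum_i c i)%N != N -> F c = 0) ->
  (forall b (i j : 'I_l), i != j -> F (b \o tperm i j) = - F b) ->
  sorted leq ts -> all (fun t => (t <= l)%N) ts -> okw 0 w -> RES ts F w = TT ts F (@bw l' w).
Proof.
move=> NM F0 Fs; elim: ts w => [|t ts IH] w //= sts /andP[tl ats] ok.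
have tts : all (leq t) ts by exact: order_path_min leq_trans sts.
have {}IH := IH _ (path_sorted sts) ats.
rewrite big_Us.
transitivity (\sum_(r < M) \sum_(g : vec | domr t (@bw l' w) g && (\sum_i g i == \sum_i @bw l' w i + r)%N) TT ts F (nv g)).
  (* Growths whose total exceeds [N] contribute zero on both sides. *)
  apply: eq_bigr => r _; case: (leqP (\sum_i @bw l' w i + r) N)%N => h.
    rewrite -level_cancel //; first by apply: eq_bigr => U; exact: IH.
      exact: leq_ltn_trans h NM.
    move=> b i j ij it jt; apply: TT_swap => //; last by move=> c; exact: Fs.
    by apply: sub_all tts => t' tt'; rewrite (leq_trans it tt') (leq_trans jt tt').
  rewrite big_seq_cond big1 => [|U /andP[]]; last first.
    rewrite mem_incw ?sorted_iota // all_iota0 => /and3P[/eqP sU _ aU] okU; rewrite IH //.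
    apply: (TT_zero (N := N)) => //; rewrite bw_sum ?sU //.
    by apply: sub_all aU => i h'; apply: leq_trans tl.
  by rewrite big1 // => g /andP[_ /eqP sg]; apply: (TT_zero (N := N)) => //; rewrite /nv sg.
transitivity (\sum_(r < M) \sum_(g : vec | domr t (@bw l' w) g)
    if (\sum_i g i == \sum_i @bw l' w i + r)%N then TT ts F (nv g) else 0).
  by apply: eq_bigr => r _; rewrite big_mkcondr.
rewrite exchange_big; apply: eq_bigr => g dg; rewrite -big_mkcond /=.
case: (leqP (\sum_i g i) N)%N => h; last first.
  by rewrite (TT_zero (N := N)) // big1.
have bg := domr_sum dg; have rM : (\sum_i g i - \sum_i @bw l' w i < M)%N by lia.
have pr (r : 'I_M) : ((\sum_i g i)%N == (\sum_i @bw l' w i + r)%N) = (r == Ordinal rM).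
  rewrite -(inj_eq val_inj) /=; clear -bg; move: (\sum_i g i)%N (\sum_i @bw l' w i)%N bg => p q; lia.
by rewrite (eq_bigl _ _ pr) big_pred1_eq.
Qed.

Lemma perm_incr_id (s : 'S_l) : (forall i j : 'I_l, (i < j)%N -> (s i < s j)%N) -> s = 1%g.
Proof.
move=> inc; have le (t : 'S_l) : (forall i j : 'I_l, (i < j)%N -> (t i < t j)%N) -> forall i : 'I_l, (i <= t i)%N.
  move=> ti [i il]; elim: i il => [|i IH] il //=.
  exact: leq_ltn_trans (IH (ltnW il)) (ti (Ordinal (ltnW il)) (Ordinal il) (ltnSn i)).
have incV (i j : 'I_l) : (i < j)%N -> (s^-1%g i < s^-1%g j)%N.
  move=> ij; rewrite ltnNge leq_eqVlt; apply/negP => /orP[/eqP/val_inj/perm_inj E|/inc].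
    by rewrite E ltnn in ij.
  by rewrite !permKV ltnNge (ltnW ij).
apply/permP => i; rewrite perm1; apply: val_inj; apply/eqP; rewrite eqn_leq le // andbT.
by have := le _ incV (s i); rewrite permK.
Qed.

(** Both shifted contents are strictly decreasing, so only the identity permutation can match
    them. *)
Lemma altn_dl w w0 : okw 0 w -> okw 0 w0 ->
  altn (dl (@bw l' w0)) (@bw l' w) = [forall i : 'I_l, @bw l' w i == @bw l' w0 i]%:R.
Proof.
move=> ok ok0; rewrite /altn (bigD1 1%g) //= odd_perm1 mul1r [X in _ + X]big1 => [|s s1].
  rewrite addr0 /dl; case: forallP => [h|h]; first by rewrite big1 // => i _ /=; rewrite perm1 h.
  have /forallPn[i ni] : ~~ [forall i : 'I_l, @bw l' w i == @bw l' w0 i] by apply/forallP.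
  by rewrite (bigD1 i) //= perm1 (negbTE ni) mul0r.
suff [i ni] : exists i, @bw l' w (s i) != @bw l' w0 i.
  by rewrite /dl (bigD1 i) //= (negbTE ni) mul0r mulr0.
apply/existsP; rewrite -negb_forall; apply: contraNN s1 => /forallP h.
apply/eqP/perm_incr_id => i j ij; have := bw_mono ok0 ij; rewrite -(eqP (h i)) -(eqP (h j)).
move=> lt; rewrite ltnNge leq_eqVlt; apply/negP => /orP[/eqP/val_inj E|/(bw_mono ok)].
  by rewrite E ltnn in lt.
by rewrite ltnNge (ltnW lt).
Qed.

(** Counts chains from the content of [w] to that of [w0], each [t] adding a horizontal strip in the
    first [t] rows. *)
Fixpoint NK (w0 : seq nat) ts w : nat :=
  if ts is t :: ts' then (\sum_(U <- Us t | okw 0 (U ++ w)) NK w0 ts' (U ++ w))%N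
  else [forall i : 'I_l, @bw l' w i == @bw l' w0 i].

(** Antisymmetrising the number of unrestricted growths leaves the chains of horizontal strips: a
    determinant of binomials counts flagged tableaux. *)
Lemma altn_cnum w0 w ts : okw 0 w0 -> okw 0 w -> sorted leq ts -> all (fun t => (t <= l)%N) ts ->
  (\sum_i @bw l' w0 i < M)%N ->
  altn (fun c => (\prod_i cnum (c i) (@bw l' w i) (count (fun t => (i < t)%N) ts))%N%:R) (@bw l' w0) =
  (NK w0 ts w)%:R :> int.
Proof.
move=> ok0 ok sts ats sM; set b0 := @bw l' w0.
have b0M i : (b0 i < M)%N by apply: leq_ltn_trans sM; rewrite (bigD1 i) //= leq_addr.
have -> : (NK w0 ts w)%:R = RES ts (altn (dl b0)) w.
  elim: ts w ok {sts ats} => [|t ts IH] w ok /=; first by rewrite altn_dl.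
  rewrite natr_sum; apply: eq_bigr => U okU; exact: IH.
rewrite (@RES_TT (\sum_i b0 i)%N) //; last first.
- by move=> b i j ij; rewrite altn_swap.
- move=> c nc; rewrite /altn big1 // => s _; rewrite /dl.
  suff /existsP[i ni] : [exists i, c (s i) != b0 i] by rewrite (bigD1 i) //= (negbTE ni) mul0r mulr0.
  rewrite -negb_forall; apply: contraNN nc => /forallP h.
  rewrite -(sum_perm c s); apply/eqP; apply: eq_bigr => i _; exact/eqP.
(* The permutation moves from the argument of [dl b0] to the target [b0], so that [TT_dl] applies to
   each term. *)
rewrite (TT_linear (fun s : 'S_l => (-1) ^+ s) (fun s c => dl b0 (c \o s))).
rewrite /altn (reindex_inj invg_inj) /=; apply: eq_bigr => s _; rewrite odd_permV; congr (_ * _).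
rewrite -TT_dl => [|i]; last exact: b0M.
congr (TT ts _ _); apply/funext => c; rewrite /dl (reindex_inj (@perm_inj _ s)).
by apply: eq_bigr => i _ /=; rewrite permK.
Qed.
End KostkaAlternant.

(** * Insertion tableaux as the tableaux counted by F *)

Definition Xof (R : seq (seq nat)) : seq hookf := [seq (up W, dn W) | W <- R].

Lemma wd_Xof R : wd (rev (Xof R)) = reading_up R.
Proof.
rewrite /wd /Xof -map_rev -map_comp (eq_map (g := id)) ?map_id // => W /=; exact: up_dn.
Qed.

Lemma Xof_inj : injective Xof.
Proof. by apply: inj_map => u v [e1 e2]; rewrite -(up_dn u) -(up_dn v) e1 e2. Qed.

Lemma nth_Xof R k : nthX (Xof R) k = (up (nth [::] R k), dn (nth [::] R k)).
Proof.
case: (ltnP k (size R)) => kR; first by rewrite (nth_map [::]).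
by rewrite !nth_default // size_map.
Qed.

Lemma goodR_nth R : goodR R <-> [/\ all hook R, [::] \notin R &
  forall i, i.+1 < size R -> good (nth [::] R i) (nth [::] R i.+1)].
Proof.
elim: R => [|W R IH]; first by split=> // _; split.
split.
  case=> hW W0 /IH[h1 h2 h3] gW; split.
  - by rewrite /= hW.
  - by rewrite inE negb_or h2 andbT eq_sym; apply/eqP.
  - case=> [|i] iR; last exact: h3.
    by case: (R) gW iR.
case=> /= /andP[hW hR]; rewrite inE negb_or eq_sym => /andP[/eqP W0 R0] g; split=> //.
  by apply/IH; split=> // i iR; exact: (g i.+1).
by case: R g {IH hR R0} => // W2 R g; exact: (g 0).
Qed.

Lemma peakU_up x : sorted leq x.1 -> peakU x -> up (x.1 ++ x.2) = x.1 /\ dn (x.1 ++ x.2) = x.2.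
Proof. by move=> s p; apply: up_dnE. Qed.

Lemma peakU_can W : peakU (up W, dn W).
Proof.
rewrite /peakU /=; case E: (dn W) => [|d D] //; have [U eU ->] := head_dn E.
by rewrite andbT eU; case: (U).
Qed.

Lemma G_nil U V : G U V [::] [::].
Proof.
split=> // a aU; rewrite !cE; by case: U aU.
Qed.

(** Row [k] of [R] lists the rows of the primed tableau occupied by the letter [k.+1], unprimed in
    [up] and primed in [dn]. The lattice property of the reading word becomes column strictness,
    [good] the lattice property, and the canonical cut the starting property. *)
Lemma FA_Fcoef mu la : is_part mu -> is_strict_part la -> ncard (FA mu la) = Fcoef mu la.
Proof.
move=> /andP[smu mu0] /andP[sla la0].
have offE : (fun=> 0) = (fun r => 0 * r) by [].
have ends r : r.+1 < size mu -> 0 + nth 0 mu r.+1 <= nth 0 mu r by move=> rh; exact: (sortedP 0 smu).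
apply: (ncard_rel (f := fun R => tabX (size mu) (Xof R)) (@FA_fin mu la)).
- move=> R [gR sh ok c]; have [hR R0 gd] := (goodR_nth R).1 gR.
  have oX : okX (Xof R).
    by apply/allP => x /mapP[W WR ->] /=; rewrite sorted_up; exact: (allP hR).
  have cX r : count_mem r (wd (rev (Xof R))) = nth 0 mu r by rewrite wd_Xof.
  have lX := content_letters cX.
  split.
  + by rewrite offE; apply/(tabX_primed oX cX ends); rewrite wd_Xof.
  + by case=> // k _; rewrite startingE // nth_Xof peakU_can.
  + case=> [|[|k]] // _; apply/latticeE => //; rewrite !nth_Xof /=.
    case: (ltnP k.+1 (size R)) => kR; first exact: gd.
    rewrite [nth _ _ k.+1]nth_default //; exact: G_nil.
  + move=> i; rewrite /xwt /ywt !count_tabX // nth_Xof /= -size_cat up_dn -sh.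
    case: (ltnP i (size R)) => iR; first by rewrite (nth_map [::]).
    by rewrite !nth_default // size_map.
- move=> R S [gR shR okR cR] [gS shS okS cS] e; apply: Xof_inj.
  have oX Q : goodR Q -> okX (Xof Q).
    move=> /goodR_hook hQ; by apply/allP => x /mapP[W WR ->] /=; rewrite sorted_up; exact: (allP hQ).
  apply: (tabX_inj (oX R gR) (oX S gS) _ _ _ e); rewrite ?wd_Xof.
  + exact: content_letters cR.
  + exact: content_letters cS.
  + by rewrite !size_map -(size_map size R) -(size_map size S) -!/(shape _) shR shS.
move=> T [pT st lt wt].
have le := tableau_letters (let: And5 _ p _ _ _ := pT in p) wt (fun i h => nth_default 0 h).
have [eT cT] := toX_primed pT le; set N := size la in le eT cT; set X := toX (size mu) N T in eT cT *.
have oX : okX X := toX_ok _ _ _.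
have lX := content_letters cT.
have sX : size X = N by rewrite size_map size_iota.
have pk k : peakU (nthX X k) by rewrite -(startingE k oX lX) eT st.
pose R := [seq x.1 ++ x.2 | x <- X].
have nR k : nth [::] R k = (nthX X k).1 ++ (nthX X k).2.
  case: (ltnP k N) => kN; first by rewrite (nth_map ([::], [::])) ?sX.
  have e1 : nth [::] R k = [::] by apply: nth_default; rewrite size_map sX.
  have e2 : nthX X k = ([::], [::]) by apply: nth_default; rewrite sX.
  by rewrite e1 e2.
have ud k : up (nth [::] R k) = (nthX X k).1 /\ dn (nth [::] R k) = (nthX X k).2.
  by rewrite nR; apply: peakU_up; rewrite ?pk //; case/andP: (nth_okX k oX).
have eX : Xof R = X.
  apply: (@eq_from_nth _ ([::], [::])); first by rewrite !size_map.
  by move=> k _; rewrite nth_Xof; have [-> ->] := ud k; case: (nthX X k).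
have szR k : size (nth [::] R k) = nth 0 la k.
  by rewrite nR size_cat -wt /xwt /ywt -eT !count_tabX.
have sR : size R = N by rewrite size_map sX.
have shR : shape R = la.
  apply: (@eq_from_nth _ 0); first by rewrite size_map sR.
  by move=> k; rewrite size_map => kR; rewrite (nth_map [::]).
exists R; last by rewrite eX.
have rdR : reading_up R = wd (rev X) by rewrite -eX wd_Xof.
split=> //; last 1 first.
- by move=> j; rewrite rdR cT.
- apply/goodR_nth; split.
  + apply/allP => W /(nthP [::])[k _ <-]; rewrite nR; have /andP[h1 h2] := nth_okX k oX; exact: hook_cat.
  + apply/negP => /(nthP [::])[k kR e]; have := szR k; rewrite e /= => z.
    by move/negP: la0; apply; rewrite z; apply: mem_nth; move: kR; rewrite sR.
  + move=> i _; rewrite /good; have [-> ->] := ud i; have [-> ->] := ud i.+1.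
    by apply/(latticeE i lX); rewrite eT lt.
- by rewrite rdR; apply/(tabX_primed oX cT ends); rewrite eT -offE.
Qed.

(** * Over flagged tableaux as chains of horizontal strips *)

(** For each value [e], from the largest part of [rho] down to 1, the number of rows whose flag
    admits [e]. This order makes the list increase, as [altn_cnum] requires. *)
Definition flags (rho : seq nat) : seq nat := [seq count (leq e) rho | e <- rev (iota 1 (head 0 rho))].

Lemma part_head rho i : sorted geq rho -> nth 0 rho i <= head 0 rho.
Proof.
case: rho => [|a rho]; first by rewrite nth_nil.
move=> s; case: i => //= i; case: (ltnP i (size rho)) => ir; last by rewrite nth_default.
have tr : transitive geq by move=> y x z /= h1 h2; apply: leq_trans h1.
exact: (allP (order_path_min tr s) _ (mem_nth 0 ir)).
Qed.

Lemma part_count rho e i : sorted geq rho -> 0 < e -> (i < count (leq e) rho) = (e <= nth 0 rho i).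
Proof.
move=> + e0; elim: rho i => [|a rho IH] i s; first by rewrite nth_nil /=; lia.
have s' := path_sorted s; case: (leqP e a) => ea; last first.
  have z : count (leq e) (a :: rho) = 0.
    apply/eqP; rewrite -leqn0 leqNgt -has_count; apply/hasPn => x xr; rewrite -ltnNge.
    have [k kr <-] := nthP 0 xr; have := part_head k s => /= h; exact: leq_ltn_trans h ea.
  have := part_head i s; rewrite z /=; lia.
by case: i => [|i] /=; rewrite ea // ltnS IH.
Qed.

Lemma count_flags rho i : sorted geq rho -> count (fun t => i < t) (flags rho) = nth 0 rho i.
Proof.
move=> s; rewrite /flags count_map count_rev.
rewrite (eq_in_count (a2 := leq^~ (nth 0 rho i))); last first.
  by move=> e; rewrite mem_iota => /andP[e0 _] /=; rewrite part_count.
have := part_head i s; move: (nth 0 rho i) (head 0 rho) => a E aE.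
rewrite -(subnKC aE) iotaD count_cat.
rewrite (eq_in_count (a2 := predT)) ?count_predT ?size_iota; last by move=> e; rewrite mem_iota /=; lia.
rewrite (eq_in_count (a2 := pred0)) ?count_pred0 ?addn0 //; move=> e; rewrite mem_iota /=; lia.
Qed.

Lemma sorted_flags rho : sorted leq (flags rho).
Proof.
rewrite /flags map_rev rev_sorted; move: (iota 1 _) (sorted_iota 1 (head 0 rho)) => s.
rewrite (sorted_pairwise ltn_trans) (@sorted_pairwise _ (fun x y => y <= x)); last first.
  by move=> y x z h1 h2; apply: leq_trans h1.
rewrite pairwise_map; apply: sub_pairwise => x y /= xy; apply: sub_count => z /=.
by apply: leq_trans; exact: ltnW.
Qed.

Fixpoint prodl (M : nat) (ts : seq nat) : seq (seq (seq nat)) :=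
  if ts is t :: ts' then [seq U :: X | U <- Us M t, X <- prodl M ts'] else [:: [::]].

Lemma mem_Us M t U : (U \in Us M t) = [&& size U < M, sorted leq U & all (fun i => i < t) U].
Proof.
apply/flatten_mapP/idP => [[r]|/and3P[h1 h2 h3]].
  by rewrite mem_iota mem_incw ?sorted_iota // all_iota0 => /= h /and3P[/eqP-> -> ->]; rewrite h.
by exists (size U); rewrite ?mem_iota // mem_incw ?sorted_iota // all_iota0 h2 h3 eqxx.
Qed.

Lemma uniq_Us M t : uniq (Us M t).
Proof.
apply: (@uniq_flat _ _ (fun U : seq nat => size U)); rewrite ?iota_uniq // => r.
  by move=> _; apply: uniq_incw; exact: sorted_iota.
by move=> U _; rewrite mem_incw ?sorted_iota // => /and3P[/eqP].
Qed.

Lemma mem_prodl M ts X : (X \in prodl M ts) = (size X == size ts) && all (fun p => p.1 \in Us M p.2) (zip X ts).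
Proof.
elim: ts X => [|t ts IH] [|U X] //.
  by apply/negbTE/negP => /allpairsP[[y z] [_ _]].
rewrite /= eqSS; apply/allpairsP/idP => [[[y z] /= [yS zS [-> ->]]]|/and3P[sk xS aS]].
  by move: zS; rewrite IH yS.
by exists (U, X); rewrite IH sk aS.
Qed.

Lemma uniq_prodl M ts : uniq (prodl M ts).
Proof.
elim: ts => // t ts IH; apply: allpairs_uniq; rewrite ?uniq_Us // => -[? ?] [? ?] _ _ /= [-> ->] //.
Qed.

Lemma count_allpairs_dep_sum (T : Type) (p : pred (seq T)) (s : seq T) (t : seq (seq T)) :
  count p [seq x :: X | x <- s, X <- t] = \sum_(x <- s) count (fun X => p (x :: X)) t.
Proof.
elim: s => [|x s IH]; first by rewrite big_nil.
by rewrite big_cons -IH /= count_cat count_map.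
Qed.

Lemma NK_count l' M w0 ts w : okw 0 w -> NK l' M w0 ts w =
  count (fun X => okw 0 (flatten (rev X) ++ w) && [forall i : 'I_l'.+1, bw (flatten (rev X) ++ w) i == bw w0 i]) (prodl M ts).
Proof.
elim: ts w => [|t ts IH] w ok /=; first by rewrite ok /= addn0.
rewrite count_allpairs_dep_sum big_mkcond; apply: eq_bigr => U _.
case: ifP => okU.
  rewrite IH //; apply: eq_count => X /=; by rewrite rev_cons flatten_rcons -catA.
symmetry; apply/eqP; rewrite -leqn0 leqNgt -has_count; apply/hasPn => X _.
by rewrite rev_cons flatten_rcons -catA; apply/negP => /andP[/okw_catr]; rewrite okU.
Qed.

Lemma column_map (A B : Type) (g : A -> B) off (T : seq (seq A)) c :
  column off (map (map g) T) c = map g (column off T c).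
Proof.
rewrite /column size_map; elim: (iota 0 (size T)) (mem_iota 0 (size T)) => //= r s IH H.
have onthm (s' : seq A) i : onth (map g s') i = omap g (onth s' i) by elim: s' i => [|x s' IHs] [|i] /=.
have -> : nth [::] (map (map g) T) r = map g (nth [::] T r).
  case: (ltnP r (size T)) => rT; first by rewrite (nth_map [::]).
  by rewrite !nth_default // size_map.
have IH' : pmap (fun r => if off r <= c then onth (nth [::] (map (map g) T) r) (c - off r) else None) s =
    map g (pmap (fun r => if off r <= c then onth (nth [::] T r) (c - off r) else None) s).
  elim: s {IH H} => //= q s IHs.
  have -> : nth [::] (map (map g) T) q = map g (nth [::] T q).
    case: (ltnP q (size T)) => rT; first by rewrite (nth_map [::]).
    by rewrite !nth_default // size_map.
  by rewrite onthm IHs; case: ifP => // _; case: (onth _ _).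
by rewrite onthm IH'; case: ifP => // _; case: (onth _ _).
Qed.

Lemma column_mem (T : seq (seq pletter)) off c a : a \in column off T c -> exists r, a \in nth [::] T r.
Proof.
rewrite /column mem_pmap => /mapP[r _]; case: ifP => // _ /esym /(onthP (0, false))[h <-].
by exists r; apply: mem_nth.
Qed.

Lemma nth_shape_size (T : Type) (Z : seq (seq T)) r : nth 0 (shape Z) r = size (nth [::] Z r).
Proof.
case: (ltnP r (size Z)) => h; first by rewrite /shape (nth_map [::]).
by rewrite !nth_default // size_map.
Qed.

Section FlaggedTableaux.
Variables (l' M : nat) (rho mu w0 wr : seq nat).
Hypotheses (prho : is_part rho) (pmu : is_part mu).
Hypotheses (c0 : forall j, count_mem j w0 = nth 0 mu j) (cr : forall j, count_mem j wr = nth 0 rho j).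
Hypotheses (okr : okw 0 wr) (sl : size rho <= l'.+1) (sl0 : size mu <= l'.+1) (wM : size w0 < M).
Let h := size mu.
Let E := head 0 rho.
Let srho : sorted geq rho. Proof. by case/andP: prho. Qed.
Let smu : sorted geq mu. Proof. by case/andP: pmu. Qed.

Definition KA : set (seq (seq nat)) := [set X | [/\ X \in prodl M (flags rho), okw 0 (flatten (rev X) ++ wr)
  & forall j, count_mem j (flatten (rev X) ++ wr) = nth 0 mu j]]%classic.

Lemma size_flags : size (flags rho) = E.
Proof. by rewrite size_map size_rev size_iota. Qed.

Lemma nth_flags k : k < E -> nth 0 (flags rho) k = count (leq (E - k)) rho.
Proof.
move=> kE; rewrite (nth_map 0) ?size_rev ?size_iota // nth_rev ?size_iota // nth_iota; last by lia.
by congr (count (leq _) _); lia.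
Qed.

Lemma prodl_letters X U r : X \in prodl M (flags rho) -> U \in X -> r \in U -> r < size rho.
Proof.
rewrite mem_prodl => /andP[/eqP sX /allP H] /(nthP [::])[k kX <-] rU.
have /H : (nth [::] X k, nth 0 (flags rho) k) \in zip X (flags rho).
  by rewrite -nth_zip //; apply: mem_nth; rewrite size_zip -sX minnn.
rewrite mem_Us => /and3P[_ _ /allP /(_ r rU) /= rt]; apply: leq_trans rt _.
by rewrite nth_flags ?count_size // -size_flags -sX.
Qed.

Lemma NK_KA : NK l' M w0 (flags rho) wr = ncard KA.
Proof.
rewrite NK_count // -size_filter; symmetry; apply: ncard_seq; first by rewrite filter_uniq ?uniq_prodl.
move=> X; rewrite mem_filter; split.
  case=> -> -> c; rewrite andbT /=; apply/forallP => i; by rewrite /bw c c0.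
case/andP => /andP[h1 /forallP h2] h3; split=> // j.
case: (ltnP j l'.+1) => jl; first by have := h2 (Ordinal jl); rewrite /bw eqn_add2r c0 => /eqP.
rewrite nth_default ?(leq_trans sl0) // count_cat cr nth_default ?(leq_trans sl) // addn0.
apply/count_memPn/negP => /flattenP[U]; rewrite mem_rev => UX jU.
by have := prodl_letters h3 UX jU; rewrite ltnNge (leq_trans sl).
Qed.

(** Every flag is at most the number of rows of [rho], so a chain can neither create a row nor
    remove one. *)
Lemma KA_sub X : KA X -> part_sub rho mu /\ size rho = size mu.
Proof.
case=> Xi _ c; have sub : part_sub rho mu by move=> i; rewrite -c -cr count_cat leq_addl.
have nz (s : seq nat) i : 0 \notin s -> i < size s -> 0 < nth 0 s i.
  by move=> s0 h'; rewrite lt0n; apply: contraNneq s0 => <-; apply: mem_nth.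
split=> //; apply/eqP; rewrite eqn_leq; apply/andP; split; rewrite leqNgt; apply/negP => lt.
  have /andP[_ r0] := prho; have := nz _ _ r0 lt; have := sub (size mu); rewrite [nth 0 mu _]nth_default //; lia.
have /andP[_ m0] := pmu; have := nz _ _ m0 lt; rewrite -c count_cat cr [nth 0 rho _]nth_default // addn0.
rewrite -has_count => /hasP[x /flattenP[U]]; rewrite mem_rev => UX xU /eqP xr.
by have := prodl_letters Xi UX xU; rewrite xr ltnn.
Qed.

Lemma NK_not_sub : ~ part_sub rho mu -> NK l' M w0 (flags rho) wr = 0.
Proof. by move=> ns; rewrite NK_KA ncard_le0 // => X /KA_sub[]. Qed.

(** Over flagged tableaux decrease along rows and columns. Complementing entries turns them into
    increasing fillings by unprimed letters, to which the coding [tabX] applies. *)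
Let ent (a : pletter) : nat := E.+1 - a.1.
Let P (a : pletter) : bool := ~~ a.2 && (0 < a.1 <= E).
Let X2 (X : seq (seq nat)) : seq hookf := [seq (U, [::]) | U <- X].

Lemma wd_X2 X : wd (rev (X2 X)) = flatten (rev X).
Proof.
by rewrite /wd /X2 -map_rev -map_comp (eq_map (g := id)) ?map_id // => U /=; rewrite cats0.
Qed.

Lemma ent_row s : all P s -> sorted geq (map ent s) = sorted pletter_le s.
Proof.
apply: mono_sorted_in => -[i b] [j d]; rewrite -!topredE /P /ent /= => /andP[/negbTE -> hi] /andP[/negbTE -> hj].
by rewrite pletter_leE /pcode /= -!muln2; lia.
Qed.

Lemma ent_col s : all P s -> sorted gtn (map ent s) = sorted pltR s.
Proof.
apply: mono_sorted_in => -[i b] [j d]; rewrite -!topredE /P /ent /= => /andP[/negbTE -> hi] /andP[/negbTE -> hj].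
by rewrite /pltR /pcode /= -!muln2; lia.
Qed.

Lemma rowX2_letters X r a : X \in prodl M (flags rho) -> a \in rowX (X2 X) r ->
  P a /\ E.+1 - a.1 <= nth 0 rho r.
Proof.
move=> Xi ar; have sX : size X = E by move: Xi; rewrite mem_prodl size_flags => /andP[/eqP].
have := rowX_letters ar; rewrite size_map sX; case: a ar => -[|k] b ar //= kE.
have := ar; rewrite -has_pred1 has_count count_rowX (nth_map [::]) ?sX //=.
case: b ar => // ar; rewrite -has_count has_pred1 => rU; split; first by rewrite /P /=.
move: Xi; rewrite mem_prodl => /andP[/eqP sXf /allP H].
have /H : (nth [::] X k, nth 0 (flags rho) k) \in zip X (flags rho).
  by rewrite -nth_zip //; apply: mem_nth; rewrite size_zip -sXf minnn sX.
rewrite mem_Us => /and3P[_ _ /allP /(_ r rU)] /=; rewrite nth_flags // part_count ?subSS //; lia.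
Qed.

Lemma KA_columns X : okX X -> (forall j, count_mem j (wd (rev X)) + nth 0 rho j = nth 0 mu j) -> size rho = size mu ->
  (forall c, sorted pltR (column (nth 0 rho) (tabX h X) c)) <-> okw 0 (wd (rev X) ++ wr).
Proof.
move=> oX cX srm.
have lX : all (fun i => i < h) (wd (rev X)).
  apply/allP => x xw; rewrite ltnNge; apply/negP => hx; have := cX x; rewrite nth_default ?srm //.
  rewrite nth_default // addn0 => /count_memPn; by rewrite xw.
have dec (s : seq nat) i j : sorted geq s -> i <= j -> nth 0 s j <= nth 0 s i.
  move=> ss ij; case: (ltnP j (size s)) => js; last by rewrite (nth_default _ js).
  have tr : transitive geq by move=> y x z /= h1 h2; apply: leq_trans h1.
  by apply: (sorted_leq_nth tr _ 0 ss) => //; rewrite ?inE ?(leq_ltn_trans ij) // => x /=.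
apply: tabX_columns => //.
- by move=> r _; rewrite cr mul0n addn0.
- by move=> i j k ij jk _; rewrite leq_max (dec rho i j).
- by move=> r rh; rewrite !size_rowX ![nth 0 rho _ + _]addnC !cX; apply: dec.
Qed.

Lemma K_bijection : size rho = size mu -> part_sub rho mu -> ncard KA = ncard [set T | over_flagged rho mu T]%classic.
Proof.
move=> srm sub.
have rE r : nth 0 rho r <= E by apply: part_head.
have okX2 X : X \in prodl M (flags rho) -> okX (X2 X).
  move=> Xi; apply/allP => x /mapP[U UX ->] /=; rewrite andbT.
  move: Xi; rewrite mem_prodl => /andP[/eqP sX /allP H]; have [k kX <-] := nthP [::] UX.
  have /H : (nth [::] X k, nth 0 (flags rho) k) \in zip X (flags rho).
    by rewrite -nth_zip //; apply: mem_nth; rewrite size_zip -sX minnn.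
  by rewrite mem_Us => /and3P[].
have cX2 X : (forall j, count_mem j (flatten (rev X) ++ wr) = nth 0 mu j) ->
    forall j, count_mem j (wd (rev (X2 X))) + nth 0 rho j = nth 0 mu j.
  by move=> c j; rewrite wd_X2 -cr -count_cat.
have PT X r : X \in prodl M (flags rho) -> all P (nth [::] (tabX h (X2 X)) r).
  by move=> Xi; apply/allP => a; rewrite nth_tabX; case: ifP => // _ /(rowX2_letters Xi)[].
apply: (ncard_rel (f := fun X => map (map ent) (tabX h (X2 X))) (s := prodl M (flags rho))).
- by move=> X [].
- move=> X [Xi ok c]; have cX := cX2 X c; split.
  + apply: (@eq_from_nth _ 0); first by rewrite !size_map !size_iota.
    move=> r; rewrite !size_map size_iota => rh.
    rewrite [nth 0 (shape _) r]nth_shape_size (nth_map [::]) ?size_map ?size_iota // nth_tabX rh.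
    by rewrite (nth_map 0) ?size_iota // nth_iota // size_rowX -(cX r) addnK.
  + move=> r x; case: (ltnP r h) => rh; last by rewrite nth_default ?size_map ?size_iota.
    rewrite (nth_map [::]) ?size_map ?size_iota // nth_tabX rh => /mapP[a /(rowX2_letters Xi)[/andP[_ pa] le] ->].
    by rewrite /ent le andbT; lia.
  + apply/allP => s /mapP[s' /(nthP [::])[r _ <-] ->]; rewrite ent_row ?PT // nth_tabX.
    by case: ifP => // _; exact: sorted_rowX.
  + move=> cc; rewrite column_map ent_col; last first.
      by apply/allP => a /column_mem[r ar]; exact: (allP (PT X r Xi)).
    by apply: (KA_columns (okX2 X Xi) cX srm).2; rewrite wd_X2.
- move=> X Y [Xi _ cX] [Yi _ cY] e.
  have i2 : injective X2 by apply: inj_map => U V [].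
  have lt Z : Z \in prodl M (flags rho) -> all (fun i => i < h) (wd (rev (X2 Z))).
    move=> Zi; rewrite wd_X2; apply/allP => x /flattenP[U]; rewrite mem_rev => UZ xU.
    by have := prodl_letters Zi UZ xU; rewrite srm.
  have sz Z : Z \in prodl M (flags rho) -> size (X2 Z) = E by rewrite mem_prodl size_flags size_map => /andP[/eqP].
  apply/i2/(tabX_inj (okX2 X Xi) (okX2 Y Yi) (lt X Xi) (lt Y Yi)); first by rewrite !sz.
  apply: (@eq_from_nth _ [::]); first by rewrite !size_map.
  move=> r; rewrite size_map size_iota => rh.
  have := congr1 (fun T => nth [::] T r) e; rewrite !(nth_map [::]) ?size_map ?size_iota //.
  apply: (inj_in_map (A := P)); [|exact: (PT X r Xi)|exact: (PT Y r Yi)].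
  move=> [i b] [j d]; rewrite -!topredE /P /ent /= => /andP[/negbTE -> hi] /andP[/negbTE -> hj] e'.
  by congr (_, _); lia.
move=> T [sh fl rows cols].
have sT : size T = h by rewrite -(size_map size T) -/(shape T) sh size_map size_iota.
pose T2 : seq (seq pletter) := map (map (fun e => (E.+1 - e, false))) T.
have flE r x : x \in nth [::] T r -> 0 < x <= E.
  by move/fl => /andP[-> h2]; apply: leq_trans h2 (rE r).
have eT2 : map (map ent) T2 = T.
  rewrite /T2 -map_comp -[RHS]map_id; apply/eq_in_map => s /(nthP [::])[r _ <-] /=.
  rewrite -map_comp -[RHS]map_id; apply/eq_in_map => x /flE; rewrite /= /ent /=; lia.
have nT2 r : nth [::] T2 r = map (fun e => (E.+1 - e, false)) (nth [::] T r).
  case: (ltnP r (size T)) => rT; first by rewrite (nth_map [::]).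
  by rewrite !nth_default // size_map.
have PT2 r : all P (nth [::] T2 r).
  by rewrite nT2; apply/allP => a /mapP[x /flE hx ->]; rewrite /P /=; lia.
have eX : tabX h (toX h E T2) = T2.
  apply: tabX_toX; first by rewrite size_map.
  - apply/allP => s /(nthP [::])[r _ <-]; apply: sub_all (PT2 r) => a /andP[_ /andP[]] //.
  - apply/allP => s /(nthP [::])[r rT <-]; rewrite -ent_row // nT2 -map_comp.
    rewrite size_map in rT; have -> : map (ent \o (fun e => (E.+1 - e, false))) (nth [::] T r) = nth [::] T r.
      by rewrite -[RHS]map_id; apply/eq_in_map => x /flE; rewrite /= /ent /=; lia.
    by apply: (allP rows); exact: mem_nth.
  - move=> r i; rewrite (count_memPn _) //; apply/negP => /(allP (PT2 r)); by rewrite /P.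
  - by move=> r a /(allP (PT2 r)) /andP[_ /andP[]].
pose X := map fst (toX h E T2).
have eX2 : X2 X = toX h E T2.
  rewrite /X2 /X -map_comp /toX -map_comp; apply: eq_map => k /=; congr (_, _).
  rewrite (eq_filter (a2 := pred0)) ?filter_pred0 // => r; apply/negP => /(allP (PT2 r)).
  by rewrite /P.
have cX j : count_mem j (wd (rev (X2 X))) + nth 0 rho j = nth 0 mu j.
  rewrite -size_rowX eX2; case: (ltnP j h) => jh.
    have := congr1 (fun S => size (nth [::] S j)) eX; rewrite nth_tabX jh nT2 size_map => ->.
    have -> : size (nth [::] T j) = nth 0 (shape T) j by rewrite (nth_map [::]) ?sT.
    by rewrite sh (nth_map 0) ?size_iota // nth_iota // subnK.
  rewrite !nth_default // ?srm // addn0 size_rowX; apply/count_memPn/negP.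
  by case/flatten_mapP => x; rewrite mem_rev => /toX_letters /allP a /a; rewrite ltnNge jh.
have cXw j : count_mem j (flatten (rev X) ++ wr) = nth 0 mu j by rewrite count_cat cr -wd_X2.
have pe : perm_eq (flatten (rev X) ++ wr) w0 by apply/allP => j _; rewrite /= cXw c0.
exists X; last by rewrite eX2 eX.
split=> //; last first.
  rewrite -wd_X2; apply: (KA_columns _ cX srm).1; first by rewrite eX2; exact: toX_ok.
  move=> c; rewrite eX2 eX -ent_col; first by rewrite -column_map eT2.
  by apply/allP => a /column_mem[r ar]; exact: (allP (PT2 r)).
rewrite mem_prodl size_flags !size_map size_iota eqxx /=.
apply/allP => p /(nthP ([::], 0))[k]; rewrite size_zip size_flags !size_map size_iota minnn => kE <-.
rewrite nth_zip ?size_flags ?size_map ?size_iota // mem_Us /=.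
have nX : nth [::] X k = wofc h (fun r => count_mem (k.+1, false) (nth [::] T2 r)).
  by rewrite (nth_map ([::], [::])) ?size_map ?size_iota // (nth_map 0) ?size_iota // nth_iota.
have kX : nth [::] X k \in X by rewrite mem_nth // !size_map size_iota.
apply/and3P; split.
- apply: leq_ltn_trans wM; rewrite -(perm_size pe) size_cat; apply: leq_trans (leq_addr _ _).
  have : nth [::] X k \in rev X by rewrite mem_rev.
  by elim: (rev X) => //= U Z IH; rewrite inE size_cat => /orP[/eqP->|/IH]; lia.
- by rewrite nX sorted_wofc.
- rewrite nX; apply/allP => r; rewrite -has_pred1 has_count count_wofc; case: ifP => // rh.
  rewrite -has_count has_pred1 nT2 => /mapP[e eT [ek]].
  have := fl r e eT => /andP[e1 e2]; have := rE r.
  rewrite nth_flags // part_count //; lia.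
Qed.

Lemma NK_Kcoef : part_sub rho mu -> NK l' M w0 (flags rho) wr = Kcoef rho mu.
Proof.
move=> sub; rewrite NK_KA /Kcoef; case: eqP => srm; first exact: K_bijection.
by apply: ncard_le0 => X /KA_sub[].
Qed.
End FlaggedTableaux.

(** * Partitions as contents of lattice words *)

Definition nonz (s : seq nat) : seq nat := [seq x <- s | x != 0].

Lemma geq_trans : transitive geq.
Proof. by move=> y x z /= h1 h2; apply: leq_trans h1. Qed.

Lemma nth_nonz s j : sorted geq s -> nth 0 (nonz s) j = nth 0 s j.
Proof.
elim: s j => // a s IH j sas; have as' := order_path_min geq_trans sas; have ss := path_sorted sas.
rewrite /nonz /=; case: eqP => [a0|_] /=; last by case: j => //= j; exact: IH.
have z x : x \in a :: s -> x = 0 by rewrite inE => /orP[/eqP->//|/(allP as')]; rewrite a0 /= leqn0 => /eqP.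
have -> : [seq x <- s | x != 0] = [::].
  rewrite -(filter_pred0 s); apply: eq_in_filter => x xs; by rewrite (z x) // inE xs orbT.
rewrite nth_nil; case: (ltnP j (size (a :: s))) => js; last by rewrite nth_default.
by rewrite (z (nth 0 (a :: s) j)) // mem_nth.
Qed.

Lemma nonz_part s : sorted geq s -> is_part (nonz s).
Proof.
move=> ss; rewrite /is_part (sorted_filter geq_trans) //=; by rewrite mem_filter.
Qed.

Lemma size_content w mu : (forall j, count_mem j w = nth 0 mu j) -> size w = sumn mu.
Proof.
move=> c; rewrite -(sum_count (content_letters c)) sumnE (big_nth 0) big_mkord.
by apply: eq_bigr => i _; rewrite c.
Qed.

Definition cont (w : seq nat) : seq nat := nonz [seq count_mem j w | j <- iota 0 (size w)].

Lemma cont_part w : okw 0 w -> is_part (cont w) /\ forall j, count_mem j w = nth 0 (cont w) j.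
Proof.
move=> ok; have dec i j : i <= j -> count_mem j w <= count_mem i w.
  elim: j => [|j IH]; first by rewrite leqn0 => /eqP->.
  by rewrite leq_eqVlt ltnS => /orP[/eqP->//|/IH]; apply: leq_trans; exact: okw0_count.
have ss : sorted geq [seq count_mem j w | j <- iota 0 (size w)].
  have := sorted_iota 0 (size w); rewrite (sorted_pairwise ltn_trans) (sorted_pairwise geq_trans) pairwise_map.
  by apply: sub_pairwise => i j /= /ltnW /dec.
split; first exact: nonz_part.
move=> j; rewrite nth_nonz //; case: (ltnP j (size w)) => jw.
  by rewrite (nth_map 0) ?size_iota // nth_iota.
rewrite nth_default ?size_map ?size_iota //; apply/count_memPn/negP => /(allP (okw0_small ok)) /=.
by rewrite ltnNge jw.
Qed.

(** A particular lattice word of content [rho], standing for the inner shape. *)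
Definition wpart (rho : seq nat) : seq nat := rev (wofc (size rho) (nth 0 rho)).

Lemma count_wpart rho j : count_mem j (wpart rho) = nth 0 rho j.
Proof. by rewrite count_rev count_wofc; case: ltnP => // h; rewrite nth_default. Qed.

Lemma okw_wpart rho : sorted geq rho -> okw 0 (wpart rho).
Proof.
move=> s; have dec i : nth 0 rho i.+1 <= nth 0 rho i.
  case: (ltnP i.+1 (size rho)) => h; last by rewrite [nth 0 rho i.+1]nth_default.
  exact: (sortedP 0 s).
rewrite /wpart; elim: (size rho) => // t IH; rewrite wofcS rev_cat rev_nseq.
have : nth 0 rho t <= nth 0 rho t by [].
elim: {1 3}(nth 0 rho t) => //= k IHk kt; rewrite IHk ?(ltnW kt) //=; case: t IH kt {IHk} => //= t IH kt.
rewrite !count_cat !count_nseq !count_rev !count_wofc ltnn ltnSn /= eqxx (gtn_eqF (ltnSn t)) mul1n mul0n.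
by have := dec t; lia.
Qed.

Lemma part_sub_box S rho mu : is_part rho -> is_part mu -> part_sub rho mu -> sumn mu = S -> rho \in box S.
Proof.
move=> /andP[_ r0] /andP[_ m0] sub <-; have := part_box m0; rewrite !mem_box => /andP[h1 /allP h2].
have sz : size rho <= size mu.
  rewrite leqNgt; apply/negP => lt; have := sub (size mu); rewrite [nth 0 mu _]nth_default // leqn0 => /eqP z.
  by move/negP: r0; apply; rewrite -z mem_nth.
rewrite (leq_trans sz h1) /=; apply/allP => x /(nthP 0)[i ir <-]; apply: leq_trans (sub i) _.
by apply: h2; rewrite mem_nth // (leq_trans ir).
Qed.

(** * Arrays without violation are Hecke tableaux *)

Lemma goodA_nth T : goodA T <-> forall i b, b \in nth [::] T i.+1 ->
  count (ltn^~ b) (nth [::] T i.+1) < count (ltn^~ b) (nth [::] T i).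
Proof.
split.
  move=> /allP g i b bi; case: (ltnP i (size T).-1) => iT; last first.
    by rewrite nth_default in bi; first by []; lia.
  have /g/allP/(_ b bi) : i \in iota 0 (size T).-1 by rewrite mem_iota.
  by rewrite /vio bi /= -ltnNge.
move=> g; apply/allP => i _; apply/allP => b bi; rewrite /vio bi /= -ltnNge; exact: g.
Qed.

Lemma sorted_ltn_count s i b : sorted ltn s -> i < size s -> (nth 0 s i < b) = (i < count (ltn^~ b) s).
Proof.
elim: s i => // x s IH i ss; have sx := order_path_min ltn_trans ss; have ss' := path_sorted ss.
have z : (x < b) = false -> count (ltn^~ b) s = 0.
  move=> xb; apply/eqP; rewrite -leqn0 leqNgt -has_count; apply/hasPn => y /(allP sx) /= xy; lia.
case: i => [_|i] /=; first by case xb: (x < b) => //=; rewrite z.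
rewrite ltnS => il; rewrite IH //; case xb: (x < b) => //=; by rewrite z.
Qed.

Lemma count_ltn_self s i : sorted ltn s -> i < size s -> count (ltn^~ (nth 0 s i)) s = i.
Proof.
move=> ss il; apply/eqP; rewrite eqn_leq; apply/andP; split.
  by rewrite leqNgt -sorted_ltn_count // ltnn.
case: i il => // i il; rewrite -sorted_ltn_count //; last exact: ltnW.
by apply: (sorted_ltn_nth ltn_trans 0 ss) => //; rewrite inE ltnW.
Qed.

(** In a strictly increasing row exactly [c] letters are smaller than the entry of column [c].
    Absence of a violation there says that the row above has more than [c] smaller letters, hence a
    smaller entry in column [c]. *)
Lemma goodA_columns T : all (sorted ltn) T ->
  goodA T <-> (sorted geq (shape T) /\ forall c, sorted ltn (column (fun=> 0) T c)).
Proof.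
move=> aT; have sT i : sorted ltn (nth [::] T i).
  by case: (ltnP i (size T)) => h; [exact: (allP aT _ (mem_nth [::] h))|rewrite nth_default].
pose f c r := if 0 <= c then onth (nth [::] T r) (c - 0) else None.
have fE c r : isSome (f c r) = (c < size (nth [::] T r)) by rewrite /f /= onth_isSome subn0.
have nsz r : size (nth [::] T r) = nth 0 (shape T) r.
  by case: (ltnP r (size T)) => h; [rewrite /shape (nth_map [::])|rewrite !nth_default // size_map].
have key : sorted geq (shape T) -> (forall c, sorted ltn (column (fun=> 0) T c)) <->
   forall r c, c < size (nth [::] T r.+1) -> nth 0 (nth [::] T r) c < nth 0 (nth [::] T r.+1) c.
  move=> sh; have ct c i j : i < j -> j < size T -> isSome (f c i) -> isSome (f c j) -> isSome (f c j.-1).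
    rewrite !fE !nsz => ij jT _ h; case: j ij jT h => // j _ jT h; apply: leq_trans h _.
    by apply: (sortedP 0 sh); rewrite size_map.
  split=> H.
    move=> r c cr; case: (ltnP r.+1 (size T)) => rT; last by rewrite nth_default in cr.
    have cr' : c < size (nth [::] T r).
      by apply: leq_trans cr _; rewrite !nsz; apply: (sortedP 0 sh); rewrite size_map.
    have /(sorted_pmap_iota ltn_trans (ct c)) h := H c; apply: (h r) => //.
      by rewrite /f /= subn0; apply/(onthP 0).
    by rewrite /f /= subn0; apply/(onthP 0).
  move=> c; apply/(sorted_pmap_iota ltn_trans (ct c)) => r a b rT.
  rewrite /f /= subn0 => /(onthP 0)[h1 <-] /(onthP 0)[h2 <-]; exact: H.
split.
  move/goodA_nth => g.
  have sh : sorted geq (shape T).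
    apply/(sortedP 0) => i; rewrite size_map => iT; rewrite -!nsz /=.
    case E: (size (nth [::] T i.+1)) => [|k] //.
    have kl : k < size (nth [::] T i.+1) by rewrite E.
    have := g i _ (mem_nth 0 kl); rewrite count_ltn_self // => h; apply: leq_trans h (count_size _ _).
  split=> //; apply/(key sh) => r c cr; have h := g r _ (mem_nth 0 cr).
  rewrite count_ltn_self // in h; rewrite sorted_ltn_count //; apply: leq_trans h (count_size _ _).
case=> sh /(key sh) H; apply/goodA_nth => i b /(nthP 0)[c cr <-].
rewrite count_ltn_self // -sorted_ltn_count //; first exact: H.
apply: leq_trans cr _; rewrite !nsz; case: (ltnP i.+1 (size T)) => iT.
  by apply: (sortedP 0 sh); rewrite size_map.
by rewrite [nth 0 _ i.+1]nth_default // size_map.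
Qed.

Definition trim (R : seq (seq nat)) : seq (seq nat) := [seq W <- R | W != [::]].

Lemma shape_trim R : shape (trim R) = nonz (shape R).
Proof.
rewrite /shape /nonz filter_map; congr map; apply: eq_filter => W /=; by rewrite size_eq0.
Qed.

Lemma reading_trim R : reading_up (trim R) = reading_up R.
Proof.
rewrite /reading_up /trim -filter_rev; elim: (rev R) => //= W s <-.
by case: eqP => [->|].
Qed.

Lemma trim_pad R : sorted geq (shape R) -> R = trim R ++ nseq (size R - size (trim R)) [::].
Proof.
elim: R => // W R IH s; have s' := path_sorted s; rewrite /trim /=; case: eqP => [W0|_] /=; last by rewrite -IH.
have z V : V \in W :: R -> V = [::].
  rewrite inE => /orP[/eqP-> //|VR]; have := allP (order_path_min geq_trans s) (size V).
  by rewrite map_f // W0 => /(_ isT) /=; case: V {VR}.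
have -> : [seq W0 <- R | W0 != [::]] = [::].
  by rewrite -(filter_pred0 R); apply: eq_in_filter => V VR; rewrite (z V) // inE VR orbT.
rewrite subn0 /= W0; congr (_ :: _); apply/all_pred1P/allP => V VR; by rewrite /= (z V) // inE VR orbT.
Qed.

Lemma nth_shape_trim R j : sorted geq (shape R) -> nth 0 (shape (trim R)) j = size (nth [::] R j).
Proof.
move=> s; rewrite shape_trim nth_nonz //; case: (ltnP j (size R)) => h; first by rewrite /shape (nth_map [::]).
by rewrite !nth_default // size_map.
Qed.

(** Arrays with exactly [l] rows are tableaux padded by empty rows at the bottom. *)
Lemma Hcoef_count n (w : 'S_n) l rho : is_part rho -> size rho <= l ->
  count (fun R => [&& goodA R, shape (trim R) == rho & hecke_word w (reading_up R)]) (lsts (subs (iota 1 n.-1)) l) =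
  Hcoef w rho.
Proof.
move=> /andP[sr r0] rl; set S := lsts _ _.
have inL i : (i \in iota 1 n.-1) = (0 < i < n) by rewrite mem_iota; lia.
pose A := [set R : seq (seq nat) | R \in S /\ [&& goodA R, shape (trim R) == rho & hecke_word w (reading_up R)]]%classic.
have RS R : R \in S = (size R == l) && all (fun U => sorted ltn U && all (fun i => 0 < i < n) U) R.
  rewrite mem_lsts; congr (_ && _); apply: eq_all => U /=; rewrite mem_subs ?sorted_iota //; congr (_ && _).
  by apply: eq_all => i; rewrite inL.
have uS : uniq S by rewrite uniq_lsts // uniq_subs // sorted_iota.
have -> : count (fun R => [&& goodA R, shape (trim R) == rho & hecke_word w (reading_up R)]) S = ncard A.
  rewrite -size_filter; symmetry; apply: ncard_seq; first by rewrite filter_uniq.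
  by move=> R; rewrite mem_filter andbC; split=> [[-> ->]|/andP[]].
have srt R : R \in S -> all (sorted ltn) R by rewrite RS => /andP[_]; apply: sub_all => U /andP[].
apply: (ncard_rel (f := trim) (s := S)).
- by move=> R [].
- move=> R [RiS /and3P[g /eqP sh hw]]; split=> //.
  + by rewrite /trim all_filter; apply: sub_all (srt R RiS) => U /= ->; rewrite implybT.
  + have [sR cR] := (goodA_columns (srt R RiS)).1 g.
    have : goodA (trim R).
      apply/goodA_nth => i b; have ne j : nth [::] (trim R) j = nth [::] R j.
        rewrite [in RHS](trim_pad sR) nth_cat; case: ltnP => // h; rewrite nth_default // nth_nseq.
        by case: ifP.
      rewrite !ne; exact: (goodA_nth R).1.
    case/goodA_columns => //; rewrite /trim all_filter; apply: sub_all (srt R RiS) => U /= ->; by rewrite implybT.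
  + by rewrite reading_trim.
- move=> R Q [RiS /and3P[gR _ _]] [QiS /and3P[gQ _ _]] e.
  have [sR _] := (goodA_columns (srt R RiS)).1 gR; have [sQ _] := (goodA_columns (srt Q QiS)).1 gQ.
  rewrite (trim_pad sR) (trim_pad sQ) e; congr (_ ++ nseq (_ - _) _).
  by move: RiS QiS; rewrite !RS => /andP[/eqP-> _] /andP[/eqP->].
move=> T [sh rows cols hw]; pose R := T ++ nseq (l - size T) [::].
have sT : size T = size rho by rewrite -sh size_map.
have tR : trim R = T.
  rewrite /trim filter_cat [X in _ ++ X](_ : _ = [::]) ?cats0; last by elim: (l - _).
  apply/all_filterP/allP => W WT; apply: contraNneq r0 => W0.
  by rewrite -sh; apply/mapP; exists W => //; rewrite W0.
have nR j : nth [::] R j = nth [::] T j.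
  rewrite nth_cat; case: ltnP => // h; rewrite [RHS]nth_default // nth_nseq; by case: ifP.
exists R => //; split.
  rewrite RS size_cat size_nseq sT subnKC // eqxx all_cat all_nseq orbT andbT /=.
  apply/allP => U UT; rewrite (allP rows) //=; case/andP: hw => hw _.
  by apply/allP => i iU; apply: (allP hw); apply/flattenP; exists U; rewrite // mem_rev.
apply/and3P; split; last by rewrite -reading_trim tR.
  have gT : goodA T by apply/(goodA_columns rows); split=> //; rewrite sh.
  by apply/goodA_nth => i b; rewrite !nR; exact: (goodA_nth T).1.
by rewrite tR sh.
Qed.

(** * Hook Hecke factorizations and the coefficients at x = y *)

Definition facC (L : seq nat) (m : nat) : seq hook_factor :=
  flatten [seq [seq (V, U) | V <- decw L a, U <- incw L (m - a)] | a <- iota 0 m.+1].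

Fixpoint facs (L ms : seq nat) : seq (seq hook_factor) :=
  if ms is m :: ms' then [seq y :: Y | y <- facC L m, Y <- facs L ms'] else [:: [::]].

Lemma mem_facC L m y : path.sorted ltn L -> (y \in facC L m) =
  [&& size y.1 + size y.2 == m, is_hook_factor y & all [in L] (y.1 ++ y.2)].
Proof.
move=> sL; case: y => V U; rewrite /is_hook_factor all_cat /=; apply/flatten_mapP/idP => [[a]|].
  rewrite mem_iota add0n ltnS => am /allpairsP[[V' U'] /= [Vi Ui [-> ->]]].
  move: Ui Vi; rewrite mem_incw ?mem_decw // => /and3P[/eqP -> -> ->] /and3P[/eqP -> -> ->].
  by rewrite subnKC // eqxx.
case/and3P => /eqP s /andP[h1 h2] /andP[h3 h4]; exists (size V); first by rewrite mem_iota leq0n add0n ltnS -s; exact: leq_addr.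
apply/allpairsP; exists (V, U); rewrite mem_incw ?mem_decw // h1 h2 h3 h4 eqxx -s addKn eqxx.
by split.
Qed.

Lemma uniq_facC L m : path.sorted ltn L -> uniq (facC L m).
Proof.
move=> sL; apply: (@uniq_flat _ _ (fun x : hook_factor => size x.1)); rewrite ?iota_uniq // => a.
  by move=> _; apply: allpairs_uniq; rewrite ?uniq_incw ?uniq_decw // => -[? ?] [? ?].
by move=> x _ /allpairsP[p [Vi _ ->]]; move: Vi; rewrite mem_decw // => /and3P[/eqP].
Qed.

Lemma mem_facs L ms Y : (Y \in facs L ms) =
  (size Y == size ms) && all (fun p => p.1 \in facC L p.2) (zip Y ms).
Proof.
elim: ms Y => [|m ms IH] [|x X] //.
  by apply/negbTE/negP => /allpairsP[[y t] [_ _]].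
rewrite -[facs _ (m :: ms)]/([seq x :: X | x <- facC L m, X <- facs L ms]) /= eqSS.
apply/allpairsP/idP => [[[y t] /= [yS tS [-> ->]]]|/and3P[sk xS aS]].
  by move: tS; rewrite IH yS.
by exists (x, X); rewrite IH sk aS.
Qed.

Lemma uniq_facs L ms : path.sorted ltn L -> uniq (facs L ms).
Proof.
move=> sL; elim: ms => // m ms IH; apply: allpairs_uniq; rewrite ?uniq_facC // => -[? ?] [? ?] _ _ /= [-> ->] //.
Qed.

Lemma nth_facs L ms Y i : Y \in facs L ms -> i < size ms -> nth ([::], [::]) Y i \in facC L (nth 0 ms i).
Proof.
rewrite mem_facs => /andP[/eqP s /allP H] im.
apply: (H (nth ([::], [::]) Y i, nth 0 ms i)).
by rewrite -nth_zip //; apply: mem_nth; rewrite size_zip s minnn.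
Qed.

Lemma prod_facs (A : pzRingType) (u : nat -> A) L ms :
  (\prod_(m <- ms) \sum_(a < m.+1) eL u L a * hL u L (m - a) = \sum_(Y <- facs L ms) Wd u (wd Y))%R.
Proof.
elim: ms => [|m ms IH]; first by rewrite big_nil big_seq1 /Wd big_nil.
rewrite big_cons IH -[facs _ (m :: ms)]/([seq x :: X | x <- facC L m, X <- facs L ms]) big_allpairs_dep /=.
have -> : (\sum_(a < m.+1) eL u L a * hL u L (m - a) = \sum_(y <- facC L m) Wd u (y.1 ++ y.2))%R.
  rewrite /facC big_flatten big_map.
  rewrite -(big_mkord xpredT (fun a => eL u L a * hL u L (m - a))%R) /index_iota subn0.
  apply: eq_bigr => a _; rewrite big_allpairs /= /eL /hL mulr_suml; apply: eq_bigr => V _.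
  by rewrite mulr_sumr; apply: eq_bigr => U _; rewrite Wd_cat.
rewrite mulr_suml; apply: eq_bigr => y _; rewrite mulr_sumr; apply: eq_bigr => Y _.
by rewrite -Wd_cat.
Qed.

Lemma flatten_filter (I T : Type) (p : pred I) (F : I -> seq T) s : (forall i, ~~ p i -> F i = [::]) ->
  flatten (map F (seq.filter p s)) = flatten (map F s).
Proof. by move=> H; elim: s => //= i s IH; case pi: (p i) => /=; rewrite IH // H ?pi. Qed.

Lemma erase_iota (f : factorization) N : (forall i, N <= i -> f i = ([::], [::])) ->
  erase f = wd [seq f i | i <- iota 0 N].
Proof.
move=> fN; rewrite /erase /wd -map_comp.
have -> : sort leq (enum_fset (finsupp f)) = [seq i <- iota 0 N | i \in finsupp f].
  apply: (sorted_eq leq_trans anti_leq); first exact: sort_sorted leq_total _.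
    by apply: sorted_filter; [exact: leq_trans|exact: iota_sorted].
  apply: uniq_perm; rewrite ?sort_uniq ?filter_uniq ?iota_uniq ?fset_uniq // => i.
  rewrite mem_sort mem_filter mem_iota /= add0n -[i \in enum_fset _]/(i \in finsupp f).
  case E: (i \in finsupp f) => //=; symmetry; rewrite ltnNge; apply/negP => /fN fi.
  by move: E; rewrite mem_finsupp fi eqxx.
apply: (flatten_filter (F := fun i => (f i).1 ++ (f i).2)) => i; rewrite mem_finsupp negbK => /eqP -> //.
Qed.

Section Coefficients.
Variables (n : nat) (w : 'S_n) (m : monom) (N : nat).
Hypothesis mN : forall i, N <= i -> m i = 0.
Notation L := (iota 1 n.-1).
Let ms := [seq m i | i <- iota 0 N].
Let sms : size ms = N. Proof. by rewrite size_map size_iota. Qed.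
Let nms i : i < N -> nth 0 ms i = m i.
Proof. by move=> iN; rewrite (nth_map 0) ?size_iota // nth_iota. Qed.

Definition fof (Y : seq hook_factor) : factorization :=
  [fsfun i in seq_fset tt (iota 0 N) => nth ([::], [::]) Y i | ([::], [::])].

Lemma fofE Y i : size Y = N -> fof Y i = nth ([::], [::]) Y i.
Proof.
move=> sY; rewrite /fof fsfunE seq_fsetE mem_iota /= add0n; case: ltnP => // h; by rewrite nth_default ?sY.
Qed.

Definition facset : set factorization :=
  [set f | hook_hecke w f /\ forall i, size (f i).1 + size (f i).2 = m i]%classic.

Lemma inL i : (i \in L) = (0 < i < n).
Proof. by rewrite mem_iota; lia. Qed.

Lemma facset_count : ncard facset = count (fun Y => hecke_word w (wd Y)) (facs L ms) /\
  exists s : seq factorization, forall f, facset f -> f \in s.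
Proof.
pose A := [set Y | Y \in facs L ms /\ hecke_word w (wd Y)]%classic.
have sL := sorted_iota 1 n.-1.
have szY Y : Y \in facs L ms -> size Y = N by rewrite mem_facs sms => /andP[/eqP].
have fA Y : A Y -> facset (fof Y).
  case=> Yi hw; have sY := szY Y Yi.
  have nY i : [&& size (nth ([::], [::]) Y i).1 + size (nth ([::], [::]) Y i).2 == m i & is_hook_factor (nth ([::], [::]) Y i)].
    case: (ltnP i N) => iN; last by rewrite nth_default ?sY // mN.
    have := nth_facs Yi (eq_ind_r (fun k => i < k) iN sms).
    by rewrite mem_facC // nms // => /and3P[-> ->].
  split; last by move=> i; rewrite fofE //; have /andP[/eqP] := nY i.
  split; first by move=> i; rewrite fofE //; have /andP[] := nY i.
  rewrite (erase_iota (N := N)) => [|i Ni]; last by rewrite fofE // nth_default ?sY.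
  have -> : [seq fof Y i | i <- iota 0 N] = Y; last by [].
  apply: (@eq_from_nth _ ([::], [::])); first by rewrite size_map size_iota.
  by move=> i; rewrite size_map size_iota => iN; rewrite (nth_map 0) ?size_iota // nth_iota // fofE.
have surj f : facset f -> exists2 Y, A Y & fof Y = f.
  case=> -[hk hw] sz; pose Y := [seq f i | i <- iota 0 N].
  have f0 i : N <= i -> f i = ([::], [::]).
    by move=> Ni; have := sz i; rewrite mN //; case: (f i) => [[|a V] [|b U]].
  have hY : hecke_word w (wd Y) by rewrite -erase_iota.
  exists Y.
    split=> //; rewrite mem_facs sms size_map size_iota eqxx /=; apply/allP => p /(nthP (([::], [::]), 0))[k].
    rewrite size_zip sms size_map size_iota minnn => kN <-; rewrite nth_zip ?sms ?size_map ?size_iota //=.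
    rewrite mem_facC // nms // (nth_map 0) ?size_iota // nth_iota // add0n sz eqxx hk /=.
    case/andP: hY => hY _; apply/allP => x xf; rewrite inL; apply: (allP hY); apply/flattenP.
    exists ((f k).1 ++ (f k).2) => //; apply/mapP; exists (f k) => //; apply/mapP; exists k => //.
    by rewrite mem_iota.
  apply/fsfunP => i; rewrite fofE ?size_map ?size_iota //; case: (ltnP i N) => iN.
    by rewrite (nth_map 0) ?size_iota // nth_iota.
  by rewrite nth_default ?size_map ?size_iota // f0.
split; last first.
  by exists (map fof (facs L ms)) => f /surj[Y [Yi _] <-]; apply: map_f.
have -> : count (fun Y => hecke_word w (wd Y)) (facs L ms) = ncard A.
  rewrite -size_filter; symmetry; apply: ncard_seq; first by rewrite filter_uniq ?uniq_facs.
  by move=> Y; rewrite mem_filter andbC; split=> [[-> ->]|/andP[]].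
symmetry; apply: (ncard_rel (f := fof) (s := facs L ms)) => //.
- by move=> Y [].
- move=> X Y [/szY sX _] [/szY sY _] e; apply: (@eq_from_nth _ ([::], [::])); first by rewrite sX sY.
  by move=> i _; rewrite -!fofE // e.
Qed.

(** On the diagonal the pairs of weights with total [m] merge: only the size of each factor remains
    prescribed. *)
Lemma eval_diag_count : eval_diag (hook_gen w) m = Posz (count (fun Y => hecke_word w (wd Y)) (facs L ms)).
Proof.
have [<- [s fs]] := facset_count.
pose k (f : factorization) : monom * monom :=
  ([fsfun i in finsupp f => size (f i).2 | 0], [fsfun i in finsupp f => size (f i).1 | 0]).
have kE f i : ((k f).1 i = size (f i).2) * ((k f).2 i = size (f i).1).
  rewrite /k /= !fsfunE; case: ifP => // /negbT; rewrite mem_finsupp negbK => /eqP -> //.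
have [t [ut tA]] := finite_seqP fs.
(* The pairs of weights that occur; on the rest of the summation range [hook_gen] vanishes. *)
pose r := undup (map k t).
have rP p : p \in r -> exists2 f, facset f & k f = p.
  by rewrite mem_undup => /mapP[f ft ->]; exists f => //; apply/tA.
rewrite /eval_diag.
transitivity (\sum_(p <- r) hook_gen w p.1 p.2)%R.
  transitivity (\sum_(p \in ([set` r])%classic) hook_gen w p.1 p.2)%R; last first.
    by symmetry; apply: fsbig_seq; exact: undup_uniq.
  symmetry; apply: fsbig_widen.
    move=> p /= /rP[f [_ sz] <-] i; rewrite !kE -(sz i); exact: addnC.
  move=> p [/= S1 nr]; rewrite /hook_gen ncard_le0 // => f [hh h1 h2]; apply: nr.
  rewrite mem_undup; apply/mapP; exists f.
    by apply/tA; split=> // i; rewrite h1 h2 addnC; exact: (S1 i).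
  by case: p S1 h1 h2 => p q /= _ h1 h2; congr (_, _); apply/fsfunP => i; rewrite (kE f i) ?h1 ?h2.
rewrite (ncard_sum (k := k) (js := r) fs (undup_uniq _)).
  elim: r rP => [|p r' IH] rP; first by rewrite !big_nil.
  rewrite !big_cons PoszD IH => [|q qr]; last by apply: rP; rewrite inE qr orbT.
  congr (_ + _)%R; rewrite /hook_gen; congr (Posz (ncard _)).
  have [g [_ sg] gp] := rP p (mem_head _ _).
  apply/predeqP => f /=; split.
    case=> hh h1 h2; split; last by case: p gp h1 h2 {rP} => p q /= _ h1 h2; congr (_, _); apply/fsfunP => i; rewrite (kE f i) ?h1 ?h2.
    by apply: (conj hh) => i; rewrite h1 h2 -gp !kE; exact: sg.
  by case=> -[hh h1] <-; split=> // i; rewrite kE.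
by move=> f /tA ft; rewrite mem_undup map_f.
Qed.
End Coefficients.

(** * The 0-Hecke expansion and its matrix entries *)

Lemma int_mx_tf p q (x : 'M[int]_(p, q)) : (x + x = 0 -> x = 0)%R.
Proof.
move=> h; apply/matrixP => i j; rewrite [RHS]mxE.
have e : (x i j + x i j = 0)%R by have /matrixP/(_ i j) := h; rewrite !mxE.
by move/eqP: e; rewrite -mulr2n mulrn_eq0 => /orP[//|/eqP].
Qed.

Section Expand.
Variables (A : pzRingType) (u : nat -> A).
Local Open Scope ring_scope.
Hypothesis uu : forall i, u i * u i = u i.
Hypothesis ufar : forall i j, (i.+1 < j)%N -> u i * u j = u j * u i.
Hypothesis ubraid : forall i, u i * u i.+1 * u i = u i.+1 * u i * u i.+1.
Hypothesis tf : forall x : A, x + x = 0 -> x = 0.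
Variables (b0 k l' : nat).
Notation L := (iota b0 k).
Notation l := l'.+1.

Let hC := hL_comm uu ufar ubraid b0 k.
Let C := bicomT hC.
Let h' (r : nat) : C := bic hC r.

Lemma hL0 : hL u L 0 = 1.
Proof. by rewrite /hL incw0 big_seq1 /Wd big_nil. Qed.

(** The alternating relation [he_alt] expresses [eL u L a] recursively as a polynomial in the
    complete elements. *)
Lemma mem_e a : eL u L a \in bicom (hL u L).
Proof.
elim/ltn_ind: a => a IH; have := he_alt u L a; rewrite big_ord_recr /= subnn hL0 mul1r => H.
have -> : eL u L a = (-1) ^+ a * ((a == 0%N)%:R - \sum_(i < a) (-1) ^+ i * (hL u L (a - i) * eL u L i)).
  by rewrite -H addrAC subrr add0r signrMK.
rewrite rpredMsign rpredB ?rpred_nat // rpred_sum // => i _.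
by rewrite rpredMsign rpredM ?IH // mem_bicom.
Qed.

Let e' (a : nat) : C := Bicom hC (mem_e a).

Lemma he_bic r : \sum_(a < r.+1) (-1) ^+ a * (h' (r - a) * e' a) = (r == 0%N)%:R.
Proof.
apply: val_inj; rewrite rmorph_sum rmorph_nat -(he_alt u L r); apply: eq_bigr => a _.
by rewrite rmorphM rmorph_sign rmorphM.
Qed.

Lemma tf_bic (x : C) : x + x = 0 -> x = 0.
Proof. by move=> h; apply: val_inj; rewrite rmorph0; apply: tf; rewrite -rmorphD h rmorph0. Qed.

Lemma h0_bic : h' 0 = 1.
Proof. by apply: val_inj; rewrite rmorph1 /= hL0. Qed.

Lemma val_qq ms : val (\prod_(m <- ms) qq h' e' m) = \prod_(m <- ms) \sum_(a < m.+1) eL u L a * hL u L (m - a).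
Proof.
rewrite rmorph_prod; apply: eq_bigr => m _; rewrite /qq rmorph_sum; apply: eq_bigr => a _.
by rewrite rmorphM.
Qed.

(** The factors of the commutative determinant may be ordered from the last row to the first, which
    is the order of the row reading word in [phase_one]. *)
Lemma val_Dw w : val (Dw h' l' w) =
  altn (fun c => \sum_(R <- lsts (subs L) l | goodA R) Wd u (flatten (rev R)) *+ co l' (nats c) 0 R) (@bw l' w).
Proof.
rewrite -(phase_one uu ufar ubraid b0 k tf) /Dw /jt /altn rmorph_sum; apply: eq_bigr => s _.
rewrite rmorphM rmorph_sign; congr (_ * _); set c := _ \o _.
have -> : mono h' c = \prod_(j <- rev (iota 0 l)) hh h' (nats c j) (l' - j).
  rewrite (perm_big (iota 0 l)); last by rewrite perm_rev.
  have -> : iota 0 l = index_iota 0 l by rewrite /index_iota subn0.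
  by rewrite big_mkord /mono; apply: eq_bigr => i _; rewrite natsE.
rewrite rmorph_prod; apply: eq_bigr => j _; rewrite /hh /hA; case: ifP => //; by rewrite rmorph0.
Qed.

Lemma facs_expand ms : (sumn ms < l)%N -> \sum_(Y <- facs L ms) Wd u (wd Y) =
  \sum_(X <- arrs (iota 0 l) ms | okw 0 (wd X))
  altn (fun c => \sum_(R <- lsts (subs L) l | goodA R) Wd u (flatten (rev R)) *+ co l' (nats c) 0 R) (@bw l' (wd X)).
Proof.
move=> sl; rewrite -prod_facs -val_qq -(prod_qq tf_bic h0_bic he_bic sl) rmorph_sum.
by apply: eq_bigr => X _; exact: val_Dw.
Qed.
End Expand.

Lemma co_prod l' (c : nat -> nat) i R :
  co l' c i R = \prod_(0 <= j < size R) cpd (l' - (i + j)) (c (i + j)) (size (nth [::] R j)).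
Proof.
elim: R i => [|a R IH] i /=; first by rewrite big_geq.
rewrite big_nat_recl //= addn0 IH; congr (_ * _); apply: eq_bigr => j _; by rewrite addSnnS.
Qed.

Section HeckeCoefficients.
Variables (n : nat) (w : 'S_n) (l' : nat).
Notation l := l'.+1.
Notation L := (iota 1 n.-1).
Notation S := (lsts (subs L) l).

(** A row of size rho_i is blown up by distributing the extra length over its rho_i letters. So its
    weight is [cnum] with rho_i steps, and rho_i is also the number of flags exceeding [i]
    ([count_flags]). *)
Lemma altn_co M x R : R \in S -> goodA R -> okw 0 x -> (\sum_i @bw l' x i < M)%N ->
  altn (fun c => (co l' (nats c) 0 R)%:R%R : int) (@bw l' x) =
  (NK l' M x (flags (shape (trim R))) (wpart (shape (trim R))))%:R%R.
Proof.
move=> RS g ok sM; set rho := shape (trim R).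
have aR : all (sorted ltn) R.
  move: RS; rewrite mem_lsts => /andP[_]; apply: sub_all => U /=; by rewrite mem_subs ?sorted_iota // => /andP[].
have [sR _] := (goodA_columns aR).1 g.
have sz : size R = l by move: RS => /size_lsts.
have srho : sorted geq rho by rewrite /rho shape_trim; have /andP[] := nonz_part sR.
have szr : size rho <= l by rewrite size_map -sz /trim size_filter count_size.
rewrite -altn_cnum //; last 1 first.
- by apply/allP => t /mapP[e _ ->]; apply: leq_trans szr; exact: count_size.
- congr altn; apply/funext => c; congr (_%:R)%R; rewrite co_prod sz big_mkord; apply: eq_bigr => i _.
  rewrite add0n natsE count_flags // /bw count_wpart /rho nth_shape_trim //; set a := size _.
  rewrite /cpd /cnum; case: leqP => h1; case: leqP => h2 //.
  + by congr (cp _ _); lia.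
  + by rewrite cp_small //; lia.
  + by exfalso; lia.
- exact: okw_wpart.
- exact: sorted_flags.
Qed.

Lemma facs_count M ms : sumn ms < l -> (forall x, size x = sumn ms -> all (fun i => i < l) x -> \sum_i @bw l' x i < M) ->
  count (fun Y => hecke_word w (wd Y)) (facs L ms) =
  \sum_(X <- arrs (iota 0 l) ms | okw 0 (wd X)) \sum_(R <- S | goodA R)
    hecke_word w (reading_up R) * NK l' M (wd X) (flags (shape (trim R))) (wpart (shape (trim R))).
Proof.
move=> sl bM; have [t et] := iota_St n; have [s es] := one_line_St w.
have inLn i : (i \in L) = (0 < i < n) by rewrite mem_iota; lia.
have hw v : all (fun i => 0 < i < n) v -> (Wd (hmx n) v (enum_rank s) (enum_rank t) = (hecke_word w v)%:R)%R.
  by move=> av; rewrite hmx_word // /hecke_word av et es eq_sym.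
apply/eqP; rewrite -(eqr_nat int); apply/eqP.
(* Both sides of [facs_expand] are compared at the entry indexed by the one-line word of [w] and the
   identity. *)
have := congr1 (fun B : 'M_ _ => B (enum_rank s) (enum_rank t))
  (facs_expand (@hmx_idem n) (@hmx_far n) (@hmx_braid n) (@int_mx_tf _ _) 1 n.-1 sl).
rewrite !summxE => H.
have {1}-> : ((count (fun Y => hecke_word w (wd Y)) (facs L ms))%:R =
    \sum_(Y <- facs L ms) Wd (hmx n) (wd Y) (enum_rank s) (enum_rank t) :> int)%R.
  rewrite big_seq (eq_bigr (fun Y => (hecke_word w (wd Y))%:R%R)); last first.
    move=> Y Yi; rewrite hw //; apply/allP => x /flatten_mapP[y yY xy].
    have [i iY ey] := nthP ([::], [::]) yY; have sY : size Y = size ms by move: Yi; rewrite mem_facs => /andP[/eqP].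
    have := nth_facs Yi (eq_ind _ (fun p => i < p) iY _ sY); rewrite ey mem_facC ?sorted_iota //.
    by case/and3P => _ _ /allP /(_ x xy); rewrite inLn.
  rewrite -big_seq -natr_sum; congr (_%:R)%R.
  by elim: (facs L ms) => [|Y F IH]; rewrite ?big_nil ?big_cons //= IH.
rewrite H natr_sum [LHS]big_seq_cond [RHS]big_seq_cond; apply: eq_bigr => X /andP[Xi ok].
have sX := size_arrs Xi; have aX : all (fun i => i < l) (wd X).
  by apply: sub_all (okw0_small ok) => i hi; apply: ltn_trans hi _; rewrite sX.
have bX := bM (wd X) sX aX.
rewrite {1}/altn summxE.
transitivity (\sum_(R <- S | goodA R) (hecke_word w (reading_up R))%:R *
   altn (fun c => (co l' (nats c) 0 R)%:R : int) (@bw l' (wd X)))%R.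
  rewrite /altn; under [RHS]eq_bigr do rewrite mulr_sumr.
  rewrite [RHS]exchange_big; apply: eq_bigr => p _ /=.
  have -> (B : 'M[int]_#|{: n.-tuple 'I_n.+1}|) : ((-1) ^+ p * B)%R (enum_rank s) (enum_rank t) =
      ((-1) ^+ p * B (enum_rank s) (enum_rank t))%R.
    by rewrite !mulr_sign; case: ifP => // _; rewrite mxE.
  rewrite summxE mulr_sumr [LHS]big_seq_cond [RHS]big_seq_cond; apply: eq_bigr => R /andP[RS _].
  rewrite mulmxnE -[flatten (rev R)]/(reading_up R) hw; first by rewrite [RHS]mulrCA mulr_natr.
  move: RS; rewrite mem_lsts => /andP[_ /allP aR]; apply/allP => x /flattenP[U]; rewrite mem_rev => /aR /=.
  by rewrite mem_subs ?sorted_iota // => /andP[_ /allP aU] /aU; rewrite inLn.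
rewrite natr_sum [LHS]big_seq_cond [RHS]big_seq_cond; apply: eq_bigr => R /andP[RS g].
by rewrite (altn_co RS g ok bX) natrM.
Qed.
End HeckeCoefficients.

(** * Assembling the coefficient of a monomial *)

Lemma regroup (T J : eqType) (s : seq T) (p : pred T) (k : T -> J) (F : J -> nat) (r : seq J) : uniq r ->
  (forall x, x \in s -> p x -> k x \notin r -> F (k x) = 0) ->
  \sum_(x <- s | p x) F (k x) = \sum_(y <- r) count (fun x => p x && (k x == y)) s * F y.
Proof.
move=> ur H.
have cE y : count (fun x => p x && (k x == y)) s = \sum_(x <- s | p x) (k x == y).
  elim: s {H} => [|x s IH]; first by rewrite big_nil.
  by rewrite big_cons /= IH; case: (p x).
under [RHS]eq_bigr do rewrite cE big_distrl.
rewrite exchange_big [LHS]big_seq_cond [RHS]big_seq_cond; apply: eq_bigr => x /andP[xs px].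
case: (boolP (k x \in r)) => kr; last first.
  transitivity 0; first exact: H.
  symmetry; apply: big1_seq => y /andP[_ yr]; case: (eqVneq (k x) y) => [E|_]; last exact: mul0n.
  by rewrite E yr in kr.
rewrite (bigD1_seq (k x)) //= eqxx big1 => [|y ne]; last by rewrite eq_sym (negbTE ne); exact: mul0n.
by rewrite addn0; symmetry; exact: mul1n.
Qed.

Definition PB N := [seq x <- box N | is_part x].

Lemma uniq_PB N : uniq (PB N). Proof. by rewrite filter_uniq // uniq_box. Qed.

(** The guard matters: when [rho] is not contained in [mu], truncated subtraction gives [Kcoef] a
    meaningless shape and possibly a nonzero value. *)
Definition KK (rho mu : seq nat) : nat := if `[< part_sub rho mu >] then Kcoef rho mu else 0.

Section Coefficient.
Variables (n : nat) (w : 'S_n) (m : monom) (N : nat).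
Hypothesis mN : forall i, N <= i -> m i = 0.
Let ms := [seq m i | i <- iota 0 N].
Let S := sumn ms.

Lemma hook_gen_coef : eval_diag (hook_gen w) m =
  (\sum_(mu <- PB S) \sum_(rho <- PB S) \sum_(la <- lams S)
     Posz (Hcoef w rho * KK rho mu * Fcoef mu la) * schurQ la m)%R.
Proof.
(* There are more rows than the [S] boxes, and [M] exceeds the total of any content of size [S] plus
   the staircase. *)
pose l' := S; pose M := (S + \sum_(i < l'.+1) (l' - i)).+1.
have bM x : size x = sumn ms -> all (fun i => i < l'.+1) x -> \sum_i @bw l' x i < M.
  by move=> sx ax; rewrite /bw big_split /= sum_count // sx /M.
rewrite (eval_diag_count w mN) -/ms (facs_count w (ltnSn S) bM).
have cX X : X \in arrs (iota 0 l'.+1) ms -> okw 0 (wd X) ->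
    \sum_(R <- lsts (subs (iota 1 n.-1)) l'.+1 | goodA R)
      hecke_word w (reading_up R) * NK l' M (wd X) (flags (shape (trim R))) (wpart (shape (trim R))) =
    \sum_(rho <- PB S) Hcoef w rho * KK rho (cont (wd X)).
  move=> Xi ok; have sX : size (wd X) = S := size_arrs Xi; have [pm cm] := cont_part ok.
  have sc : sumn (cont (wd X)) = S by rewrite -(size_content cm).
  have szc : size (cont (wd X)) <= l'.+1.
    have /andP[_ c0] := pm; have := part_box c0; rewrite mem_box sc => /andP[h _]; exact: leqW.
  have rhoR R : R \in lsts (subs (iota 1 n.-1)) l'.+1 -> goodA R ->
      is_part (shape (trim R)) /\ size (shape (trim R)) <= l'.+1.
    move=> RS g; have aR : all (sorted ltn) R.
      move: RS; rewrite mem_lsts => /andP[_]; apply: sub_all => U /=; by rewrite mem_subs ?sorted_iota // => /andP[].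
    have [sR _] := (goodA_columns aR).1 g; rewrite shape_trim; split; first exact: nonz_part.
    by rewrite -shape_trim size_map -(size_lsts RS) /trim size_filter count_size.
  transitivity (\sum_(R <- lsts (subs (iota 1 n.-1)) l'.+1 | goodA R && hecke_word w (reading_up R))
      KK (shape (trim R)) (cont (wd X))).
    rewrite big_mkcondr [LHS]big_seq_cond [RHS]big_seq_cond; apply: eq_bigr => R /andP[RS g].
    case: ifP => _; last by rewrite mul0n.
    have [pr sr] := rhoR R RS g; have /andP[sr' _] := pr.
    rewrite mul1n /KK; case: asboolP => sub.
      apply: NK_Kcoef => //; [exact: count_wpart|exact: okw_wpart|].
      by rewrite sX /M ltnS leq_addr.
    apply: (@NK_not_sub _ _ _ (cont (wd X))) => //; try exact: count_wpart; try exact: okw_wpart; by rewrite sX /M ltnS leq_addr.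
  rewrite (@regroup _ _ _ _ (fun R => shape (trim R)) (fun rho => KK rho (cont (wd X))) (PB S) (uniq_PB S)).
    rewrite big_seq [RHS]big_seq; apply: eq_bigr => rho; rewrite mem_filter mem_box => /and3P[pr sr _].
    congr (_ * _); rewrite -(@Hcoef_count n w l'.+1) ?(leqW sr) //; apply: eq_count => R.
    by rewrite -andbA [hecke_word _ _ && _]andbC.
  move=> R RS /andP[g _] nr; rewrite /KK; case: asboolP => // sub.
  have [pr _] := rhoR R RS g.
  by move: nr; rewrite mem_filter pr (part_sub_box pr pm sub sc).
rewrite big_seq_cond (eq_bigr (fun X => \sum_(rho <- PB S) Hcoef w rho * KK rho (cont (wd X)))); last first.
  by move=> X /andP[]; exact: cX.
rewrite -big_seq_cond.
rewrite (@regroup _ _ _ (fun X => okw 0 (wd X)) (fun X => cont (wd X)) (fun mu => \sum_(rho <- PB S) Hcoef w rho * KK rho mu) (PB S) (uniq_PB S)); last first.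
  move=> X Xi ok; have [pm cm] := cont_part ok.
  rewrite mem_filter pm /=; have /andP[_ c0] := pm; have := part_box c0.
  by rewrite -(size_content cm) (size_arrs Xi) => ->.
have big_Posz (I : Type) (s : seq I) (F : I -> nat) : Posz (\sum_(i <- s) F i) = (\sum_(i <- s) Posz (F i))%R.
  by elim: s => [|i s IH]; rewrite ?big_nil // !big_cons PoszD IH.
rewrite big_Posz big_seq [RHS]big_seq; apply: eq_bigr => mu; rewrite mem_filter => /andP[pm _].
have -> : count (fun X => okw 0 (wd X) && (cont (wd X) == mu)) (arrs (iota 0 l'.+1) ms) = VA l'.+1 0 ms mu.
  apply: eq_count => X; case ok: (okw 0 (wd X)) => //=; have [pc cc] := cont_part ok.
  apply/eqP/asboolP => [<-|e] //; have /andP[_ m0] := pm; have /andP[_ c0] := pc.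
  by apply: nth_parts => // i; rewrite -cc e.
rewrite (VA_identity _ (leqnSn S)) big_distrlr /= big_Posz.
transitivity (\sum_(la <- lams S) \sum_(j <- PB S) Posz (ncard (FA mu la) * VA S.+1 1 (rev ms) la * (Hcoef w j * KK j mu)))%R.
  by apply: eq_bigr => la _; exact: big_Posz.
rewrite exchange_big; apply: eq_bigr => rho _; rewrite big_seq [RHS]big_seq; apply: eq_bigr => la.
rewrite mem_filter mem_box => /and3P[pl sl _].
rewrite (@schurQ_VA l'.+1 N) ?(leqW sl) // -/ms -FA_Fcoef // -!PoszM; congr Posz.
by rewrite mulnC -!mulnA; congr (_ * (_ * _)); rewrite mulnC.
Qed.

Lemma schurQ_size la : is_strict_part la -> schurQ la m != 0%R -> sumn la = S.
Proof.
move=> pl; rewrite (@schurQ_VA (size la).+1 N) // => h.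
have : 0 < VA (size la).+1 1 (rev [seq m i | i <- iota 0 N]) la by rewrite lt0n; apply: contraNneq h => ->.
rewrite -has_count => /hasP[X Xi /andP[_ /asboolP c]].
by rewrite -(size_content c) (size_arrs Xi) sumn_rev.
Qed.
End Coefficient.

(** * Finite support of the formal sums *)

Lemma Fcoef_size mu la : is_part mu -> is_strict_part la -> Fcoef mu la != 0 -> sumn mu = sumn la.
Proof.
move=> pm pl; rewrite -FA_Fcoef // => h; apply/eqP; apply: contraNT h => ne; apply/eqP.
apply: ncard_le0 => R [_ sh _ c]; move/eqP: ne; apply.
by rewrite -sh -size_reading (size_content c).
Qed.

Lemma monom_bound (m : monom) : exists N, forall i, N <= i -> m i = 0.
Proof.
exists (sumn (enum_fset (finsupp m))).+1 => i; case: (finsuppP m i) => // im lt.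
have {}im : i \in enum_fset (finsupp m) by [].
have : i <= sumn (enum_fset (finsupp m)) by elim: (enum_fset _) im => //= a s IH; rewrite inE => /orP[/eqP ->|/IH]; lia.
by rewrite leqNgt lt.
Qed.

(* A finitely supported formal sum computed over a list containing the support. *)
Lemma formal_sum_seq (I : choiceType) (A : set I) (c : I -> int) (F : I -> series) (Q : series) :
  (forall m, exists s : seq I, [/\ uniq s, forall t, t \in s -> A t,
     forall t, A t -> (c t * F t m != 0)%R -> t \in s & Q m = (\sum_(t <- s) c t * F t m)%R]) ->
  formal_sum A c F Q.
Proof.
move=> H m; have [s [us sA As ->]] := H m; split.
  apply: (@sub_finite_set _ _ [set` s]%classic); last exact: finite_seq.
  by move=> t [At nz] /=; exact: As.
transitivity (\sum_(t \in ([set` s])%classic) c t * F t m)%R; first exact: fsbig_seq.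
apply: fsbig_widen => [t /= /sA //|t [/= At nt]].
by apply/eqP; apply: contra_notT nt => nz; exact: As.
Qed.

Local Open Scope classical_set_scope.

Theorem theorem5p20 (n : nat) (w : 'S_n) :
  Q_Schur_positive (eval_diag (hook_gen w)) /\
  formal_sum
    [set t : seq nat * seq nat * seq nat |
      let: (rho, mu, la) := t in
      [/\ is_part rho, is_part mu, part_sub rho mu & is_strict_part la]]
    (fun t => let: (rho, mu, la) := t in
      Posz (Hcoef w rho * Kcoef rho mu * Fcoef mu la))
    (fun t => let: (rho, mu, la) := t in schurQ la)
    (eval_diag (hook_gen w)).
Proof.
split.
  (* By homogeneity and containment, every [mu] and [rho] with a nonzero contribution fits in a
     square of side [sumn la], so this finite sum is the full coefficient of Q_la. *)
  exists (fun la => \sum_(mu <- PB (sumn la)) \sum_(rho <- PB (sumn la))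
     Posz (Hcoef w rho * KK rho mu * Fcoef mu la))%R.
  split; first by move=> la _; apply: sumr_ge0 => mu _; apply: sumr_ge0.
  apply: formal_sum_seq => m; have [N mN] := monom_bound m.
  set S := sumn [seq m i | i <- iota 0 N].
  exists [seq la <- lams S | sumn la == S]; split.
  - by rewrite !filter_uniq // uniq_box.
  - by move=> la; rewrite !mem_filter => /and3P[].
  - move=> la pl nz; have Q0 : schurQ la m != 0%R by apply: contraNneq nz => ->; rewrite mulr0.
    have sla := schurQ_size mN pl Q0; rewrite !mem_filter pl sla eqxx /= -[S]sla.
    by apply: part_box; case/andP: pl.
  rewrite (hook_gen_coef w mN) -/S [RHS]big_filter [RHS]big_mkcond.
  under [LHS]eq_bigr do rewrite exchange_big.
  rewrite exchange_big [LHS]big_seq [RHS]big_seq; apply: eq_bigr => la.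
  rewrite mem_filter => /andP[pl _]; case: eqP => [->|ne].
    rewrite mulr_suml; apply: eq_bigr => mu _; by rewrite mulr_suml.
  rewrite big1 // => mu _; rewrite big1 // => rho _.
  (* A strict partition of the wrong size contributes nothing to this monomial. *)
  case: (eqVneq (schurQ la m) 0%R) => [->|/(schurQ_size mN pl)//]; by rewrite mulr0.
apply: formal_sum_seq => m; have [N mN] := monom_bound m.
set S := sumn [seq m i | i <- iota 0 N].
(* Candidate triples in the boxes of side [S]; the filter on containment corresponds to the guard in
   [KK]. *)
pose all3 := [seq (x, la) | x <- [seq (rho, mu) | rho <- PB S, mu <- PB S], la <- lams S].
exists [seq t <- all3 | `[< part_sub t.1.1 t.1.2 >]]; split.
- rewrite filter_uniq //; apply: allpairs_uniq; last by move=> [? ?] [? ?].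
    by apply: allpairs_uniq; rewrite ?uniq_PB // => -[? ?] [? ?].
  by rewrite filter_uniq // uniq_box.
- move=> [[rho mu] la]; rewrite mem_filter => /andP[/asboolP sub] /allpairsPdep[[rho0 mu0] [la0 [xi li [er em el]]]]; subst rho0 mu0 la0.
  case/allpairsPdep: xi => rho0 [mu0 [ri mi [er em]]]; subst rho0 mu0.
  by move: ri mi li; rewrite !mem_filter => /andP[pr _] /andP[pm _] /andP[pl _]; exact: (And4 pr pm sub pl).
- move=> [[rho mu] la] [pr pm sub pl] nz.
  have Q0 : schurQ la m != 0%R by apply: contraNneq nz => ->; rewrite mulr0.
  have F0 : Fcoef mu la != 0 by apply: contraNneq nz => ->; rewrite muln0 mul0r.
  have sla := schurQ_size mN pl Q0; have smu := Fcoef_size pm pl F0.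
  rewrite mem_filter; apply/andP; split; first exact/asboolP.
  have lab : la \in lams S.
    by rewrite mem_filter pl /= -[S]sla; apply: part_box; case/andP: pl.
  have mub : mu \in PB S.
    by rewrite mem_filter pm /= -[S]sla -smu; apply: part_box; case/andP: pm.
  have rhob : rho \in PB S.
    by rewrite mem_filter pr /=; apply: (part_sub_box pr pm sub); rewrite smu sla.
  by apply/allpairsP; exists ((rho, mu), la); split=> //; apply/allpairsP; exists (rho, mu).
rewrite (hook_gen_coef w mN) -/S [RHS]big_filter [RHS]big_mkcond big_allpairs big_allpairs [LHS]exchange_big.
apply: eq_bigr => rho _; apply: eq_bigr => mu _; apply: eq_bigr => la _ /=.
by rewrite /KK; case: asboolP => // _; rewrite muln0 mul0n mul0r.
Qed.
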